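(* Let $G\leq\operatorname{E}(2)$ be a wallpaper group. (a) If $G$ is of type ${\ast}333$, ${\ast}442$, ${\ast}632$, or ${\ast}2222$, then $c_2(\mathbb R^2/G)=1$. (b) If $G$ is of type ${\ast}{\ast}$, then $c_2(\mathbb R^2/G)=\frac{\pi}{2}$. (c) If $G$ is of type $2{\ast}22$, then $c_2(\mathbb R^2/G)=\sqrt2$. (d) If $G$ is of type $4{\ast}2$, then $c_2(\mathbb R^2/G)=2\sqrt{2-\sqrt2}$. (e) If $G$ is of type ${\times}{\times}$ (that is, if $\mathbb R^2/G$ is a flat Klein bottle), then $\frac{\pi}{2}\leq c_2(\mathbb R^2/G)\leq\frac{\pi}{\sqrt2}$. (f) If $G$ is of type $22{\times}$, then $\frac{\pi}{2}\leq c_2(\mathbb R^2/G)\leq\pi$. (g) If $G$ is of type $2222$, then $\sqrt2\leq c_2(\mathbb R^2/G)\leq\sqrt2\cdot c_2(\mathbb R^2/T_G)<8\sqrt2$, where $T_G$ is the translation lattice of $G$. (h) If $G$ is of type ${\ast}{\times}$ (that is, if $\mathbb R^2/G$ is a Möbius strip), then $\frac{\pi}{2}\leq c_2(\mathbb R^2/G)\leq\frac{\pi}{\sqrt2}$. (i) If $G$ is of type $22{\ast}$, then $\sqrt2\leq c_2(\mathbb R^2/G)\leq2$. (j) If $G$ is of type $333$ or $3{\ast}3$, then $\frac32\leq c_2(\mathbb R^2/G)\leq2$. (k) If $G$ is of type $442$, then $2\sqrt{2-\sqrt2}\leq c_2(\mathbb R^2/G)\leq2$. (l) If $G$ is of type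 $632$, then $3\sqrt{2-\sqrt3}\leq c_2(\mathbb R^2/G)\leq2$.
   Context: A wallpaper group is a discrete subgroup $G\leq\operatorname{E}(2)$ of the isometry group of the Euclidean plane such that $\mathbb R^2/G$ is compact. Its set $T_G:=G\cap\mathbb R^2$ of translation vectors is a rank-$2$ lattice in $\mathbb R^2$. Types are given in Conway's orbifold signature notation, describing the orbifold $\mathbb R^2/G$: digits before any ${\ast}$ are the orders of rotation centers (up to $G$-equivalence) not on a mirror line (cone points); each ${\ast}$ denotes a mirror boundary component, and the digits after it are its corner orders (a digit $k$ means $k$ mirror lines meet, adjacent ones at angle $\pi/k$); each ${\times}$ denotes a crosscap. The correspondence with crystallographic names is: ${\ast}333$ = p3m1, ${\ast}442$ = p4m, ${\ast}632$ = p6m, ${\ast}2222$ = pmm, ${\ast}{\ast}$ = pm, $2{\ast}22$ = cmm, $4{\ast}2$ = p4g, ${\times}{\times}$ = pg, $22{\times}$ = pgg, $2222$ = p2, ${\ast}{\times}$ = cm, $22{\ast}$ = pmg, $333$ = p3, $3{\ast}3$ = p31m, $442$ = p4, $632$ = p6. The orbit space $\mathbb R^2/G$ carries the quotient metric $d([x],[y])=\inf_{p\in[x],\,q\in[y]}\|p-q\|$, where $[x]=G\cdot x$; likewise for $\mathbb R^2/T_G$. For a map $f\colon X\to Y$ of metric spaces, let $\alpha,\beta\in[0,\infty]$ be the largest and smallest constants (respectively) with $\alpha\, d_X(x,x')\le d_Y(f(x),f(x'))\le\beta\, d_X(x,x')$ for all $x,x'\in X$; the distortion of $f$ is $\kappa(f):=\beta/\alpha$,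 with $\kappa(f)=\infty$ if $\alpha=0$ or $\beta=\infty$. The Euclidean distortion $c_2(X)\in[1,\infty]$ is the infimum of all $c$ for which there exist a Hilbert space $H$ and a map $f\colon X\to H$ with $\kappa(f)=c$. *)

(* Defs.v *)
From HB Require Import structures.
From mathcomp Require Import all_boot all_order all_algebra generic_quotient.
From mathcomp Require Import all_classical all_reals all_analysis.

Set Implicit Arguments.
Unset Strict Implicit.
Unset Printing Implicit Defensive.

Import Order.TTheory GRing.Theory Num.Theory.
Import numFieldNormedType.Exports.

Local Open Scope classical_set_scope.
Local Open Scope card_scope.
Local Open Scope quotient_scope.
Local Open Scope ring_scope.

Notation plane R := 'cV[R]_2.

(* The library norm on matrices is the sup norm. *)
Definition enorm (R : realType) (x : plane R) : R :=
  Num.sqrt (\sum_(i < 2) x i 0 ^+ 2).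

(* The pair (A, v) stands for the map x |-> A x + v; it is an isometry of the
   Euclidean plane when A is orthogonal, and every isometry has this form. *)
Notation affine R := ('M[R]_2 * 'cV[R]_2)%type.

Definition act (R : realType) (g : affine R) (x : plane R) : plane R :=
  g.1 *m x + g.2.

Definition aff1 (R : realType) : affine R := (1%:M, 0).

Definition affM (R : realType) (g h : affine R) : affine R :=
  (g.1 *m h.1, g.1 *m h.2 + g.2).

(* The inverse of g when g.1 is orthogonal. *)
Definition affV (R : realType) (g : affine R) : affine R :=
  (g.1^T, - (g.1^T *m g.2)).

Record subgroupE2 (R : realType) := SubgroupE2 {
  elems :> set (affine R);
  elems_orthogonal : forall g, elems g -> g.1^T *m g.1 = 1%:M;
  elems1 : elems (aff1 R);
  elemsM : forall g h, elems g -> elems h -> elems (affM g h);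
  elemsV : forall g, elems g -> elems (affV g)
}.

Section OrbitSpace.
Variables (R : realType) (G : subgroupE2 R).

Definition orbit_rel : rel (plane R) :=
  fun x y => `[< exists2 g, elems G g & y = act g x >].

Lemma orbit_rel_refl : reflexive orbit_rel.
Proof.
move=> x; apply/asboolP; exists (aff1 R); first exact: elems1.
by rewrite /act mul1mx addr0.
Qed.

Lemma orbit_rel_trans : transitive orbit_rel.
Proof.
move=> y x z /asboolP[g Gg ->] /asboolP[h Gh ->]; apply/asboolP.
exists (affM h g); first exact: elemsM.
by rewrite /act /affM /= mulmxDr mulmxA addrA.
Qed.

Lemma orbit_rel_sym : symmetric orbit_rel.
Proof.
suff sub x y : orbit_rel x y -> orbit_rel y x by move=> x y; apply/idP/idP => /sub.
move=> /asboolP[g Gg ->]; apply/asboolP; exists (affV g); first exact: elemsV.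
by rewrite /act /affV /= mulmxDr mulmxA (elems_orthogonal Gg) mul1mx addrK.
Qed.

Canonical orbit_equiv :=
  EquivRel orbit_rel orbit_rel_refl orbit_rel_sym orbit_rel_trans.

End OrbitSpace.

Notation orbit_space G := (quotient_topology {eq_quot (orbit_equiv G)}).

Definition orbit (R : realType) (G : subgroupE2 R) (x : plane R) :
  orbit_space G := \pi_(orbit_space G) x.

Definition orbit_dist (R : realType) (G : subgroupE2 R)
    (a b : orbit_space G) : R :=
  inf [set r | exists p q, [/\ orbit G p = a, orbit G q = b &
                               r = enorm (p - q)]].

Definition is_wallpaper (R : realType) (G : subgroupE2 R) : Prop :=
  (elems G `<=` isolated (elems G)) /\ compact [set: orbit_space G].

Section TranslationLattice.
Variables (R : realType) (G : subgroupE2 R).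

Definition translations : set (affine R) :=
  [set g | elems G g /\ g.1 = 1%:M].

Let translations_orthogonal g : translations g -> g.1^T *m g.1 = 1%:M.
Proof. by case=> Gg _; exact: elems_orthogonal Gg. Qed.

Let translations1 : translations (aff1 R).
Proof. by split=> //; exact: elems1. Qed.

Let translationsM g h :
  translations g -> translations h -> translations (affM g h).
Proof.
by case=> Gg g1 [Gh h1]; split; [exact: elemsM | rewrite /= g1 h1 mul1mx].
Qed.

Let translationsV g : translations g -> translations (affV g).
Proof.
by case=> Gg g1; split; [exact: elemsV | rewrite /= g1 trmx1].
Qed.

Definition translation_lattice : subgroupE2 R :=
  SubgroupE2 translations_orthogonal translations1 translationsM translationsV.

End TranslationLattice.

Section Signature.
Variables (R : realType) (G : subgroupE2 R).

Definition rotations_at (p : plane R) : set (affine R) :=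
  [set g | [/\ elems G g, \det g.1 = 1 & act g p = p]].

(* An orientation-reversing isometry with a fixed point is a reflection. *)
Definition reflections_at (p : plane R) : set (affine R) :=
  [set g | [/\ elems G g, \det g.1 = -1 & act g p = p]].

Definition on_mirror (p : plane R) : Prop := reflections_at p !=set0.

Definition cone_point (n : nat) (p : plane R) : Prop :=
  [/\ (2 <= n)%N, rotations_at p #= `I_n & ~ on_mirror p].

(* k mirror lines meet at p. *)
Definition corner_point (k : nat) (p : plane R) : Prop :=
  (2 <= k)%N /\ reflections_at p #= `I_k.

(* ks lists, in some order and once per orbit, the orders k of the orbits of
   points p with P k p. *)
Definition lists_orders (P : nat -> plane R -> Prop) (ks : seq nat) : Prop :=
  exists s : seq (orbit_space G * nat),
    [/\ uniq s, [seq x.2 | x <- s] = ks &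
        forall a k, (a, k) \in s <-> exists2 p, orbit G p = a & P k p].

Definition mirror_locus : set (orbit_space G) := orbit G @` on_mirror.

Definition boundary_component (C : set (orbit_space G)) : Prop :=
  exists2 a, mirror_locus a & C = connected_component mirror_locus a.

(* Corner orders are recorded as a multiset: in a wallpaper group a boundary
   component has at most three corners, or four of order 2, so that their
   cyclic order (up to reversal) carries no information. *)
Definition lists_boundaries (bs : seq (seq nat)) : Prop :=
  exists Cs : seq (set (orbit_space G)),
    [/\ uniq Cs, size Cs = size bs,
        forall C, C \in Cs <-> boundary_component C &
        forall i, (i < size bs)%N ->
          lists_orders
            (fun k p => nth set0 Cs i (orbit G p) /\ corner_point k p)
            (nth [::] bs i)].

(* A lift gamma of a simple closed one-sided curve in the surface R^2/G, away
   from mirrors and cone points: the endpoints of gamma are related by an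
   orientation-reversing element of G. *)
Definition one_sided_loop (gamma : R -> plane R) : Prop :=
  [/\ {within `[0%R, 1%R], continuous gamma},
      forall t, t \in `[0%R, 1%R] ->
        forall g, elems G g -> act g (gamma t) = gamma t -> g = aff1 R,
      exists2 g, elems G g & \det g.1 = -1 /\ gamma 1 = act g (gamma 0) &
      forall s t, s \in `[0%R, 1%R] -> t \in `[0%R, 1%R] -> s < t ->
        orbit G (gamma s) = orbit G (gamma t) -> s = 0 /\ t = 1].

Definition disjoint_one_sided_loops (k : nat) : Prop :=
  exists gamma : 'I_k -> R -> plane R,
    (forall i, one_sided_loop (gamma i)) /\
    (forall i j, i != j -> forall s t, s \in `[0%R, 1%R] ->
       t \in `[0%R, 1%R] -> orbit G (gamma i s) <> orbit G (gamma j t)).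

(* A crosscap is an embedded Moebius band, i.e. a neighbourhood of a one-sided
   simple closed curve; a sphere with holes and k crosscaps contains k, but not
   k + 1, pairwise disjoint such curves. *)
Definition crosscap_number (k : nat) : Prop :=
  disjoint_one_sided_loops k /\ ~ disjoint_one_sided_loops k.+1.

End Signature.

(* Conway's signature: cone point orders, the list of mirror boundary
   components each with its corner orders, and the number of crosscaps.  For
   instance 2*22 is Signature [:: 2] [:: [:: 2; 2]] 0 and ** is
   Signature [::] [:: [::]; [::]] 0.  There is no field for handles: for
   wallpaper groups the only signature with a handle is that of the torus, which
   has no cone points, mirrors or crosscaps. *)
Record signature := Signature {
  cone_orders : seq nat;
  boundary_corners : seq (seq nat);
  crosscaps : nat
}.

Definition has_type (R : realType) (G : subgroupE2 R) (s : signature) : Prop :=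
  [/\ lists_orders G (cone_point G) (cone_orders s),
      lists_boundaries G (boundary_corners s) &
      crosscap_number G (crosscaps s)].

Record hilbertSpace (R : realType) := HilbertSpace {
  hilbert_sort :> completeNormedModType R;
  inner : hilbert_sort -> hilbert_sort -> R;
  innerC : forall x y, inner x y = inner y x;
  innerDl : forall x y z, inner (x + y) z = inner x z + inner y z;
  innerZl : forall (a : R) x y, inner (a *: x) y = a * inner x y;
  inner_norm : forall x, inner x x = `|x| ^+ 2
}.

Section Distortion.
Local Open Scope ereal_scope.
Variables (R : realType) (X : Type) (dX : X -> X -> R).

Definition lower_const (Y : Type) (dY : Y -> Y -> R) (f : X -> Y) : \bar R :=
  ereal_sup [set a | 0 <= a /\
    forall x x', a * (dX x x')%:E <= (dY (f x) (f x'))%:E].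

Definition upper_const (Y : Type) (dY : Y -> Y -> R) (f : X -> Y) : \bar R :=
  ereal_inf [set b | 0 <= b /\
    forall x x', (dY (f x) (f x'))%:E <= b * (dX x x')%:E].

Definition distortion (Y : Type) (dY : Y -> Y -> R) (f : X -> Y) : \bar R :=
  let alpha := lower_const dY f in
  let beta := upper_const dY f in
  if (alpha == 0) || (beta == +oo) then +oo else beta / alpha.

Definition euclidean_distortion : \bar R :=
  ereal_inf [set c | exists (H : hilbertSpace R) (f : X -> H),
    distortion (fun u v : H => `|u - v|%R) f = c].

End Distortion.

Definition c2 (R : realType) (G : subgroupE2 R) : \bar R :=
  euclidean_distortion (@orbit_dist R G).

(* Main.v *)
Require Import Defs.
From HB Require Import structures.
From mathcomp Require Import all_boot all_order all_algebra generic_quotient.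
From mathcomp Require Import all_classical all_reals all_analysis.
From mathcomp Require Import ring lra zify.

(** Pulled back to the plane, an embedding of R^2/G is a G-invariant map F with
    min_g |x - g y| <= |F x - F y| <= k min_g |x - g y|, and c_2 is the infimum of
    the possible k.

    Upper bounds.  If G is generated by reflections up to a finite cyclic stabiliser of a
    chamber, moving points into the chamber identifies R^2/G with a convex set divided by
    rotations about a point, which lies in a Euclidean cone; the cone of angle 2 pi / n
    is mapped to a round cone in R^3.  If G has index two in a reflection group W, then
    R^2/G is a double of a chamber of W, and (position in the chamber, signed distance to
    the glued walls) has distortion 2.  If N has index two in G, an embedding of R^2/N is
    split into even and odd parts under the swap, and the odd part m is replaced by
    m (x) m / |m|, at the cost of a factor sqrt 2.  Rectangular tori and annuli are
    products of circles and segments.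

    Lower bounds.  On a closed curve of length l in R^2/G along which antipodal points
    are at distance at least a, the autocorrelations c of the antiperiodic part of F at
    2^j equidistant points satisfy c(2h) c(0) >= 2 c(h)^2 - c(0)^2; halving h down to one
    step gives k >= pi a / l.  Circles around a cone point of order n give
    k >= n sin (pi / 2n), lines invariant under a translation or a glide reflection give
    k >= pi / 2. *)

Set Implicit Arguments.
Unset Strict Implicit.
Unset Printing Implicit Defensive.

Import Order.TTheory GRing.Theory Num.Theory.
Import numFieldNormedType.Exports.

Local Open Scope classical_set_scope.
Local Open Scope card_scope.
Local Open Scope quotient_scope.
Local Open Scope ring_scope.

Local Notation orb := Defs.orbit.

(** * Hilbert spaces from positive kernels *)

(** No classification of wallpaper groups is assumed. A signature enters only through what it
    forces: presence or absence of mirrors, orders of cone and corner points, an element of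
    determinant -1. Explicit coordinates for the group are derived from these facts. Types that
    agree in them are told apart by counts: two boundary components exclude cm, a crosscap excludes
    pm, four orbits of cone points exclude pgg. For 333, 442 and 632 the absence of mirrors alone
    rules out orientation-reversing elements.

    The constants: in the sharp cases the round cone has phi = pi / 2n, the angle at which its
    chords just dominate the cone metric at the opposite angle pi / n; its largest stretch n sin phi
    is then the lower bound given by circles around the cone point. The factor pi / 2 is arc over
    chord on a circle. The 2 for doubles is sqrt 2 for adding a second coordinate times sqrt 2 for
    the rescaling that keeps the map noncontracting.

    The target of an embedding is an abstract Hilbert space, so it is never built by hand: an
    embedding is given by its Gram kernel on the plane, and one general construction turns kernels
    into Hilbert spaces. *)

Record psd_kernel (R : realType) (S : Type) := PsdKernel {
  kfun :> S -> S -> R;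
  kfunC : forall s t, kfun s t = kfun t s;
  kfun_psd : forall u : seq (R * S),
    0 <= \sum_(p <- u) \sum_(q <- u) p.1 * q.1 * kfun p.2 q.2
}.

Section KernelSpace.
Variables (R : realType) (S : Type) (K : psd_kernel R S).

(** A list of weighted points stands for a finite formal linear combination; this is the
    semidefinite form that the kernel induces on such combinations. *)
Definition kform (u v : seq (R * S)) : R :=
  \sum_(p <- u) \sum_(q <- v) p.1 * q.1 * K p.2 q.2.

Definition keval (phi : S -> R) (u : seq (R * S)) : R :=
  \sum_(p <- u) p.1 * phi p.2.

Definition kscale (a : R) (u : seq (R * S)) := [seq (a * p.1, p.2) | p <- u].

Lemma kformC u v : kform u v = kform v u.
Proof.
rewrite /kform exchange_big; apply: eq_bigr => q _; apply: eq_bigr => p _.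
by rewrite kfunC mulrAC; ring.
Qed.

Lemma kform_ge0 u : 0 <= kform u u.
Proof. exact: kfun_psd. Qed.

Lemma kform_cat u v w : kform (u ++ v) w = kform u w + kform v w.
Proof. by rewrite /kform big_cat. Qed.

Lemma kform_scale a u v : kform (kscale a u) v = a * kform u v.
Proof.
rewrite /kform big_map mulr_sumr; apply: eq_bigr => p _ /=.
by rewrite mulr_sumr; apply: eq_bigr => q _; rewrite !mulrA.
Qed.

Lemma keval_cat phi u v : keval phi (u ++ v) = keval phi u + keval phi v.
Proof. by rewrite /keval big_cat. Qed.

Lemma keval_scale phi a u : keval phi (kscale a u) = a * keval phi u.
Proof.
by rewrite /keval big_map mulr_sumr; apply: eq_bigr => p _; rewrite /= mulrA.
Qed.

Lemma kevalD phi psi u : keval (phi + psi) u = keval phi u + keval psi u.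
Proof. by rewrite /keval -big_split; apply: eq_bigr => p _; rewrite /= -mulrDr. Qed.

Lemma kevalZ a phi u : keval (a *: phi) u = a * keval phi u.
Proof. by rewrite /keval mulr_sumr; apply: eq_bigr => p _; rewrite mulrCA. Qed.

Definition knorm_comb u := Num.sqrt (kform u u).

Lemma kevalN phi u : keval (- phi) u = - keval phi u.
Proof. by rewrite -scaleN1r kevalZ mulN1r. Qed.

(** The Hilbert space will be the dual of the space of finite combinations: functions on [S] whose
    linear extension is bounded for the seminorm [knorm_comb]. A dual is complete and its norm
    separates points, which spares a completion and a quotient by null vectors. *)
Definition kbounded_by (phi : S -> R) (C : R) : Prop :=
  0 <= C /\ forall u, `|keval phi u| <= C * knorm_comb u.

Definition kbounded : pred (S -> R) :=
  fun phi => `[< exists C, kbounded_by phi C >].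

Lemma kbounded_byD phi psi C D : kbounded_by phi C -> kbounded_by psi D ->
  kbounded_by (phi + psi) (C + D).
Proof.
move=> [C0 HC] [D0 HD]; split=> [|u]; first exact: addr_ge0.
by rewrite kevalD mulrDl (le_trans (ler_normD _ _))// lerD.
Qed.

Lemma kbounded_byZ a phi C : kbounded_by phi C -> kbounded_by (a *: phi) (`|a| * C).
Proof.
move=> [C0 HC]; split=> [|u]; first exact: mulr_ge0.
by rewrite kevalZ normrM -mulrA ler_wpM2l.
Qed.

Lemma kbounded_by0 : kbounded_by 0 0.
Proof.
split=> // u; rewrite mul0r /keval big1 ?normr0// => p _.
by rewrite [X in _ * X](_ : _ = 0)// mulr0.
Qed.

Lemma kbounded_closed : submod_closed kbounded.
Proof.
split=> [|a f g /asboolP[C HC] /asboolP[D HD]]; apply/asboolP.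
  by exists 0; exact: kbounded_by0.
by exists (`|a| * C + D); apply: kbounded_byD => //; exact: kbounded_byZ.
Qed.

HB.instance Definition _ := GRing.isSubmodClosed.Build _ _ kbounded kbounded_closed.

Record kspace := KSpace { kspace_fun :> S -> R; _ : kspace_fun \in kbounded }.
HB.instance Definition _ := [isSub for kspace_fun].
HB.instance Definition _ := [Choice of kspace by <:].
HB.instance Definition _ := [SubChoice_isSubLmodule of kspace by <:].

Lemma kspace_bounded (f : kspace) : exists C, kbounded_by f C.
Proof. by case: f => f /= /asboolP. Qed.

Lemma kspaceD (f g : kspace) : (f + g : kspace) = (f : S -> R) + g :> (S -> R).
Proof. by []. Qed.

Lemma kspaceZ a (f : kspace) : (a *: f : kspace) = a *: (f : S -> R) :> (S -> R).
Proof. by []. Qed.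

Lemma kspaceN (f : kspace) : (- f : kspace) = - (f : S -> R) :> (S -> R).
Proof. by []. Qed.

Definition knorm (f : kspace) : R := inf [set C | kbounded_by f C].

Lemma knorm_has_inf (f : kspace) : has_inf [set C | kbounded_by f C].
Proof.
split; first by have [C HC] := kspace_bounded f; exists C.
by exists 0 => C [].
Qed.

Lemma knorm_ge0 f : 0 <= knorm f.
Proof. by apply: lb_le_inf; [case: (knorm_has_inf f) | move=> C []]. Qed.

Lemma knorm_le (f : kspace) C : kbounded_by f C -> knorm f <= C.
Proof. by move=> HC; apply: ge_inf => //; case: (knorm_has_inf f). Qed.

Lemma knormP (f : kspace) : kbounded_by f (knorm f).
Proof.
split; first exact: knorm_ge0.
move=> u; have := sqrtr_ge0 (kform u u); rewrite -/(knorm_comb u).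
(* On a null combination any bound [C] forces the value 0; elsewhere one may divide by
   [knorm_comb u] and pass to the infimum. *)
rewrite le_eqVlt => /orP[/eqP u0|u0].
  have [C [_ /(_ u)]] := kspace_bounded f.
  by rewrite -u0 !mulr0.
rewrite -ler_pdivrMr//; apply: lb_le_inf; first by case: (knorm_has_inf f).
by move=> C [_ /(_ u)]; rewrite ler_pdivrMr.
Qed.

Lemma knormD f g : knorm (f + g) <= knorm f + knorm g.
Proof. by apply: knorm_le; rewrite kspaceD; apply: kbounded_byD; exact: knormP. Qed.

Lemma knormZ a f : knorm (a *: f) = `|a| * knorm f.
Proof.
have le b h : knorm (b *: h) <= `|b| * knorm h.
  by apply: knorm_le; rewrite kspaceZ; apply: kbounded_byZ; exact: knormP.
apply/eqP; rewrite eq_le le/=.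
have [->|a0] := eqVneq a 0; first by rewrite normr0 mul0r knorm_ge0.
rewrite -ler_pdivlMl ?normr_gt0// -normfV.
by apply: le_trans (le _ _); rewrite scalerA mulVf// scale1r.
Qed.

Lemma keval1 phi s : keval phi [:: (1, s)] = phi s.
Proof. by rewrite /keval big_seq1 mul1r. Qed.

Lemma knorm0_eq0 f : knorm f = 0 -> f = 0.
Proof.
move=> f0; apply/val_inj/funext => s /=.
have [_ /(_ [:: (1, s)])] := knormP f.
by rewrite f0 mul0r keval1 normr_le0 => /eqP.
Qed.

HB.instance Definition _ :=
  Lmodule_isNormed.Build R kspace knormD knormZ knorm0_eq0.

Lemma keval_le f u : `|keval (f : kspace) u| <= `|f| * knorm_comb u.
Proof. by have [_ ] := knormP f. Qed.

(** The usual argument for duals: evaluations are bounded, so pointwise limits exist, and the Cauchy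
    estimate, being uniform in [u], survives the limit. *)
Lemma kspace_complete (F : set_system kspace) :
  ProperFilter F -> cauchy F -> cvg F.
Proof.
move=> FF /cauchyP/= Fc.
have FcE e : 0 < e -> exists f : kspace, \forall g \near F, `|f - g| < e.
  by move=> e0; have [f Hf] := Fc _ e0; exists f.
have pt s : cvg (((fun f : kspace => f s) : kspace -> R^o) @ F).
  apply: cauchy_cvg; apply/cauchyP => e e0.
  have c0 : 0 <= knorm_comb [:: (1, s)] by exact: sqrtr_ge0.
  set c := knorm_comb _ in c0.
  have e1 : 0 < e / (c + 1) by rewrite divr_gt0// ltr_wpDl.
  have [f Hf] := FcE _ e1; exists (f s).
  suff : \forall g \near F, ball (f s : R^o) e ((g : kspace) s) by [].
  near=> g.
  have fg : `|f - g| < e / (c + 1) by near: g.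
  have := keval_le (f - g) [:: (1, s)]; rewrite keval1 -/c /ball/= => h.
  apply: le_lt_trans h _; apply: (@le_lt_trans _ _ (`|f - g| * (c + 1))).
    by rewrite ler_wpM2l// lerDl.
  by rewrite -ltr_pdivlMr// ltr_wpDl.
pose phi s : R := lim (((fun f : kspace => f s) : kspace -> R^o) @ F).
have phi_lim s : ((fun f : kspace => f s) : kspace -> R^o) @ F --> phi s by exact: pt.
have ev_lim u : ((fun f : kspace => keval f u) : kspace -> R^o) @ F --> keval phi u.
  elim: u => [|p u IH].
    rewrite (_ : (fun f : kspace => _) = cst 0) ?/keval ?big_nil; first exact: cvg_cst.
    by apply/funext => f; rewrite big_nil.
  rewrite (_ : (fun f : kspace => _) = (fun f : kspace => p.1 * f p.2 + keval f u)).
    rewrite /keval big_cons; apply: cvgD => //.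
    by apply: cvgM; [exact: cvg_cst | exact: phi_lim].
  by apply/funext => f; rewrite /keval big_cons.
(* Elements near the end of [F] are within [e] of the pointwise limit in norm; this gives both the
   boundedness of [phi] and the convergence. *)
have close e : 0 < e -> \forall f \near F, kbounded_by (((f : kspace) : S -> R) - phi) e.
  move=> e0; have [h Hh] := FcE _ (divr_gt0 e0 (ltr0n _ 2)).
  near=> f; split; first exact: ltW.
  have hf : `|h - f| < e / 2 by near: f.
  move=> u; have -> : keval ((f : S -> R) - phi) u = keval f u - keval phi u.
    by rewrite kevalD kevalN.
  have lim2 : ((fun g : kspace => `|keval f u - keval g u|) : kspace -> R^o) @ F --> `|keval f u - keval phi u|.
    by apply: cvg_norm; apply: cvgB; [exact: cvg_cst | exact: ev_lim].
  apply: (cvgr_to_le lim2); near=> g.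
  have hg : `|h - g| < e / 2 by near: g.
  have -> : keval f u - keval g u = keval (f - g : kspace) u.
    by rewrite kspaceD kspaceN kevalD kevalN.
  apply: le_trans (keval_le _ _) _; rewrite ler_wpM2r ?sqrtr_ge0//.
  have -> : f - g = (h - g) - (h - f) by rewrite opprB [RHS]addrC addrA subrK.
  by rewrite (le_trans (ler_normB _ _))// ltW// [ltRHS](splitr e) ltrD.
have phiB : phi \in kbounded.
  have [f Hf] := filter_ex (close 1 ltr01).
  have -> : phi = (-1) *: ((f : S -> R) - phi) + f.
    by rewrite scaleN1r opprB subrK.
  have [C HC] := kspace_bounded f.
  apply/asboolP; eexists; apply: kbounded_byD HC.
  exact: kbounded_byZ Hf.
apply/cvg_ex; exists (KSpace phiB); apply/cvgrPdist_le => e e0.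
near=> f; rewrite distrC; apply: knorm_le.
have : kbounded_by ((f : S -> R) - phi) e by near: f; exact: close.
by rewrite kspaceD kspaceN.
Unshelve. all: by end_near. Qed.

HB.instance Definition _ := Uniform_isComplete.Build kspace kspace_complete.

Lemma knorm_comb_sqr u : knorm_comb u ^+ 2 = kform u u.
Proof. by rewrite sqr_sqrtr// kform_ge0. Qed.

Lemma kform_catC u v w : kform w (u ++ v) = kform w u + kform w v.
Proof. by rewrite !(kformC w) kform_cat. Qed.

Lemma kform_scaler a u v : kform u (kscale a v) = a * kform u v.
Proof. by rewrite !(kformC u) kform_scale. Qed.

(** The norm is the least bound, so [|f| - e] fails to be one, and a combination violating it can be
    normalised. *)
Lemma kspace_attain (f : kspace) e : 0 < e -> exists u,
  `|f| - e <= keval f u /\ kform u u <= 1.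
Proof.
move=> e0; have [fe|fe] := ltP (`|f| - e) 0.
  exists [::]; rewrite /keval /kform !big_nil ltW//.
have : ~ kbounded_by f (`|f| - e).
  by move/knorm_le; rewrite -[knorm f]/`|f| => h; lra.
apply: contra_notP => /forallNP H; split=> // u.
have := sqrtr_ge0 (kform u u); rewrite -/(knorm_comb u) le_eqVlt => /orP[/eqP u0|u0].
  by have := keval_le f u; rewrite -u0 !mulr0.
(* Scaling by [c] makes [u] a unit combination on which [f] is nonnegative. *)
pose c := (if 0 <= keval f u then 1 else -1) / knorm_comb u.
have := H (kscale c u); rewrite keval_scale kform_scale kform_scaler -knorm_comb_sqr.
move/not_andP => [/negP|/negP].
  rewrite -ltNge => /ltW; rewrite /c; case: ifPn => [f0|].
    by rewrite mulrAC ler_pdivrMr// mul1r => h; rewrite ger0_norm.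
  by rewrite -ltNge => f0; rewrite mulrAC ler_pdivrMr// mulN1r => h; rewrite ltr0_norm.
have -> : c * (c * knorm_comb u ^+ 2) = 1; last by rewrite lexx.
by rewrite /c; case: ifP => _; field; rewrite gt_eqF.
Qed.

(** Take almost maximising unit combinations [u], [v] for [f + g] and [f - g], with values [a] and
    [b]. For [w1 = a u + b v] and [w2 = a u - b v] one has [f w1 + g w2 = a^2 + b^2], while the
    parallelogram law of the form gives [|w1|^2 + |w2|^2 <= 2 (a^2 + b^2)]; Cauchy-Schwarz
    concludes. *)
Lemma kspace_parallelogram_le (f g : kspace) :
  `|f + g| ^+ 2 + `|f - g| ^+ 2 <= 2 * (`|f| ^+ 2 + `|g| ^+ 2).
Proof.
set P := (X in 2 * X).
have P0 : 0 <= P by rewrite addr_ge0// sqr_ge0.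
apply/ler_addgt0Pr => e e0.
set A := `|f + g|; set B := `|f - g|.
have A0 : 0 <= A by exact: normr_ge0.
have B0 : 0 <= B by exact: normr_ge0.
(* Replacing [A], [B] by [a], [b] costs at most [2 (A + B) d], which this choice keeps below [e]. *)
pose d := e / (2 * (A + B + 1)).
have AB : 0 < A + B + 1 by rewrite ltr_wpDl// addr_ge0.
have d0 : 0 < d by rewrite divr_gt0// mulr_gt0.
have [u [Hu Nu]] := kspace_attain (f + g) d0.
have [v [Hv Nv]] := kspace_attain (f - g) d0.
rewrite -/A -/B in Hu Hv.
set a := keval (f + g) u in Hu; set b := keval (f - g) v in Hv.
have ab : a ^+ 2 + b ^+ 2 <= 2 * P.
  pose w1 := kscale a u ++ kscale b v; pose w2 := kscale a u ++ kscale (- b) v.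
  have E1 : a ^+ 2 + b ^+ 2 = keval f w1 + keval g w2.
    rewrite /w1 /w2 !keval_cat !keval_scale !expr2 {2}/a {2}/b.
    by rewrite !kspaceD kspaceN !kevalD kevalN; ring.
  have E2 : kform w1 w1 + kform w2 w2 = 2 * (a ^+ 2 * kform u u + b ^+ 2 * kform v v).
    rewrite /w1 /w2 !(kform_cat, kform_catC, kform_scale, kform_scaler).
    by rewrite (kformC v u); ring.
  have H1 := le_trans (ler_norm _) (keval_le f w1).
  have H2 := le_trans (ler_norm _) (keval_le g w2).
  have : kform w1 w1 + kform w2 w2 <= 2 * (a ^+ 2 + b ^+ 2).
    rewrite E2 ler_pM2l// lerD// ler_piMr// ?sqr_ge0//.
  rewrite -!knorm_comb_sqr; move: H1 H2; rewrite E1 /P.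
  have := sqrtr_ge0 (kform w1 w1); have := sqrtr_ge0 (kform w2 w2).
  rewrite -/(knorm_comb _) -/(knorm_comb _).
  move: (keval f w1) (keval g w2) (knorm_comb w1) (knorm_comb w2) `|f| `|g|.
  move=> x y n1 n2 F G n20 n10 xF yG h.
  have h2 : (x + y) ^+ 2 <= (F ^+ 2 + G ^+ 2) * (n1 ^+ 2 + n2 ^+ 2) \/ x + y <= 0.
    have [xy|xy] := leP (x + y) 0; first by right.
    left; have : (x + y) ^+ 2 <= (F * n1 + G * n2) ^+ 2.
      by rewrite ler_sqr ?nnegrE; lra.
    by move=> /le_trans; apply; have := sqr_ge0 (F * n2 - G * n1); nra.
  have P1 : 0 <= F ^+ 2 + G ^+ 2 by rewrite addr_ge0// sqr_ge0.
  case: h2 => [h2|]; last lra.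
  have [xy|xy] := leP (x + y) 0; first lra.
  rewrite -(@ler_pM2r _ (x + y))// -expr2 (le_trans h2)//.
  by rewrite -mulrA (mulrC 2) -mulrA ler_wpM2l//; lra.
have e1 : (A + B) * d <= e / 2.
  rewrite /d mulrA ler_pdivrMr ?mulr_gt0//.
  by rewrite [leRHS](_ : _ = e * (A + B + 1)); [rewrite mulrC ler_wpM2l; lra | field].
have Aa : A ^+ 2 <= a ^+ 2 + 2 * A * d.
  have [h|h] := leP d A; last by have := sqr_ge0 a; nra.
  by have : (A - d) ^+ 2 <= a ^+ 2; [rewrite ler_sqr ?nnegrE; lra | nra].
have Bb : B ^+ 2 <= b ^+ 2 + 2 * B * d.
  have [h|h] := leP d B; last by have := sqr_ge0 b; nra.
  by have : (B - d) ^+ 2 <= b ^+ 2; [rewrite ler_sqr ?nnegrE; lra | nra].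
nra.
Qed.

(** The reverse inequality is the same one for [f + g] and [f - g], whose sum and difference are
    [2 f] and [2 g]. *)
Lemma kspace_parallelogram (f g : kspace) :
  `|f + g| ^+ 2 + `|f - g| ^+ 2 = 2 * (`|f| ^+ 2 + `|g| ^+ 2).
Proof.
apply/eqP; rewrite eq_le kspace_parallelogram_le/=.
have := kspace_parallelogram_le (f + g) (f - g).
have -> : f + g + (f - g) = 2%:R *: f by rewrite addrACA subrr addr0 scaler_nat mulr2n.
have -> : f + g - (f - g) = 2%:R *: g.
  by rewrite opprB (addrC f g) addrACA subrr addr0 scaler_nat mulr2n.
rewrite !normrZ !normr_nat; nra.
Qed.

End KernelSpace.

(** * Jordan-von Neumann: from the parallelogram law to an inner product *)

Section JordanVonNeumann.
Variables (R : realType) (V : normedModType R).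
Hypothesis par : forall f g : V,
  `|f + g| ^+ 2 + `|f - g| ^+ 2 = 2 * (`|f| ^+ 2 + `|g| ^+ 2).

Definition polar_form (f g : V) : R := (`|f + g| ^+ 2 - `|f - g| ^+ 2) / 4.

Lemma polar_formC f g : polar_form f g = polar_form g f.
Proof. by rewrite /polar_form (addrC f g) (distrC f g). Qed.

Lemma polar_form_norm f : polar_form f f = `|f| ^+ 2.
Proof.
have := par f f; rewrite /polar_form subrr normr0 => h.
rewrite expr0n/= subr0 addr0 in h *; lra.
Qed.

Lemma polar_formDl f g h : polar_form (f + g) h = polar_form f h + polar_form g h.
Proof.
have H1 := par (f + h) g; have H2 := par (f - h) g.
have H3 := par (f + g) h.
have H4 := par (g + h) f; have H5 := par (g - h) f.
have E1 : g + h + f = f + g + h by rewrite addrAC (addrC g).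
have E2 : g - h + f = f + g - h by rewrite addrAC (addrC g).
have E3 : f + h + g = f + g + h by rewrite addrAC.
have E4 : f - h + g = f + g - h by rewrite addrAC.
have E5 : `|g - h - f| = `|f + h - g| by rewrite distrC opprB addrA (addrC f).
have E6 : `|g + h - f| = `|f - h - g| by rewrite distrC opprD addrA addrAC.
rewrite E1 E2 E3 E4 E5 E6 in H1 H2 H4 H5 *.
rewrite /polar_form; lra.
Qed.

Lemma polar_form0l g : polar_form 0 g = 0.
Proof. by rewrite /polar_form add0r sub0r normrN subrr mul0r. Qed.

Lemma polar_formNl f g : polar_form (- f) g = - polar_form f g.
Proof.
by apply/eqP; rewrite -subr_eq0 opprK -polar_formDl addNr polar_form0l.
Qed.

Lemma polar_formMn n f g : polar_form (f *+ n) g = n%:R * polar_form f g.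
Proof.
elim: n => [|n IH]; first by rewrite mulr0n polar_form0l mul0r.
by rewrite mulrS polar_formDl IH -addn1 natrD; ring.
Qed.

Lemma polar_formMz (n : int) f g : polar_form (f *~ n) g = n%:~R * polar_form f g.
Proof.
case: n => n; first by rewrite -pmulrn polar_formMn.
by rewrite NegzE mulrNz polar_formNl -pmulrn polar_formMn mulrNz mulNr.
Qed.

Lemma polar_form_bound f g : `|polar_form f g| <= (`|f| + `|g|) ^+ 2.
Proof.
rewrite /polar_form normrM normfV normr_nat ler_pdivrMr//.
have a0 : `|f + g| ^+ 2 <= (`|f| + `|g|) ^+ 2 by rewrite ler_sqr ?nnegrE ?addr_ge0 ?ler_normD.
have b0 : `|f - g| ^+ 2 <= (`|f| + `|g|) ^+ 2 by rewrite ler_sqr ?nnegrE ?addr_ge0 ?ler_normB.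
have := sqr_ge0 `|f + g|; have := sqr_ge0 `|f - g|.
by rewrite ler_norml => h1 h2; apply/andP; split; nra.
Qed.

(** Let [d] be the defect of homogeneity and write [n a = k + r] with [k] an integer and
    [0 <= r < 1]. Additivity removes [k], so [n d] equals the defect at [r], which is bounded
    independently of [n]; by Archimedes [d = 0]. *)
Lemma polar_formZl a f g : polar_form (a *: f) g = a * polar_form f g.
Proof.
apply/eqP; rewrite -subr_eq0; apply/eqP.
set d := _ - _.
pose M := (`|f| + `|g|) ^+ 2 + `|polar_form f g|.
have dM (n : nat) : n%:R * `|d| <= M.
  pose k := Num.floor (n%:R * a).
  pose r := n%:R * a - k%:~R.
  have rb : 0 <= r < 1.
    by have := floor_itv (n%:R * a); rewrite /r -/k intrD1 => /andP[? ?]; apply/andP; split; lra.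
  have : n%:R * d = polar_form (r *: f) g - r * polar_form f g.
    rewrite /d mulrBr -polar_formMn -scaler_nat scalerA.
    have -> : n%:R * a = k%:~R + r by rewrite /r; ring.
    rewrite scalerDl polar_formDl scaler_int polar_formMz.
    by move: (polar_form (r *: f) g) => q; rewrite /r; ring.
  move/(congr1 Num.norm); rewrite normrM normr_nat => ->.
  case/andP: rb => r0 r1.
  apply: le_trans (ler_normB _ _) _; apply: lerD.
    apply: le_trans (polar_form_bound _ _) _.
    rewrite ler_sqr ?nnegrE ?addr_ge0// lerD2r normrZ ger0_norm// ler_piMl//.
    exact: ltW.
  by rewrite normrM ger0_norm// ler_piMl// ltW.
apply/eqP/normr0P/eqP/negPn/negP; rewrite -normr_gt0 normr_id => d0.
have := dM (Num.bound (M / `|d|)).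
have := archi_boundP (divr_ge0 _ (ltW d0) : 0 <= M / `|d|).
rewrite ltr_pdivrMr// => /(_ (addr_ge0 (sqr_ge0 _) (normr_ge0 _))).
lra.
Qed.
End JordanVonNeumann.

Definition kspace_hilbert (R : realType) (S : Type) (K : psd_kernel R S) : hilbertSpace R :=
  @HilbertSpace R (kspace K) (@polar_form R (kspace K)) (@polar_formC R (kspace K))
   (polar_formDl (@kspace_parallelogram R S K))
   (polar_formZl (@kspace_parallelogram R S K))
   (polar_form_norm (@kspace_parallelogram R S K)).

Lemma quadratic_ge0_discr (R : realFieldType) (a b c : R) : 0 <= c ->
  (forall t, 0 <= a + 2 * t * b + t ^+ 2 * c) -> b ^+ 2 <= a * c.
Proof.
rewrite le_eqVlt => /orP[/eqP<- H|c0 H].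
  have [->|b0] := eqVneq b 0; first by rewrite expr0n/= mulr0.
  have := H (- (a + 1) / (2 * b)); rewrite mulr0 addr0.
  have -> : a + 2 * (- (a + 1) / (2 * b)) * b = -1 by field.
  by rewrite ler0N1.
have := H (- b / c).
have -> : a + 2 * (- b / c) * b + (- b / c) ^+ 2 * c = (a * c - b ^+ 2) / c.
  by field; rewrite gt_eqF.
by rewrite pmulr_lge0 ?invr_gt0// subr_ge0.
Qed.

Lemma kform_Cauchy_Schwarz (R : realType) (S : Type) (K : psd_kernel R S) u v :
  `|kform K u v| <= knorm_comb K u * knorm_comb K v.
Proof.
rewrite -ler_sqr ?nnegrE// ?mulr_ge0 ?sqrtr_ge0//.
rewrite exprMn !knorm_comb_sqr -normrX ger0_norm ?sqr_ge0//.
apply: quadratic_ge0_discr => [|t]; first exact: kform_ge0.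
have := kform_ge0 K (u ++ kscale t v).
rewrite !(kform_cat, kform_catC, kform_scale, kform_scaler) (kformC K v u).
by congr (_ <= _); ring.
Qed.

(** The point [s] is sent to the functional [K s]. By Cauchy-Schwarz the functional of a combination
    [u] has norm at most [knorm_comb u], and evaluation at [u] itself shows equality. *)
Lemma psd_kernel_embedding (R : realType) (S : Type) (K : psd_kernel R S) :
  exists (H : hilbertSpace R) (F : S -> H), forall s t,
    `|F s - F t| ^+ 2 = K s s + K t t - 2 * K s t.
Proof.
pose Kc (u : seq (R * S)) : S -> R := fun t => kform K u [:: (1, t)].
have evK u v : keval (Kc u) v = kform K u v.
  rewrite kformC /keval /Kc [kform K v u]/kform; apply: eq_bigr => p _.
  rewrite kformC /kform big_seq1 mulr_sumr; apply: eq_bigr => q _ /=.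
  by rewrite mul1r mulrA.
have KcB u : kbounded_by K (Kc u) (knorm_comb K u).
  by split; [exact: sqrtr_ge0 | move=> v; rewrite evK; exact: kform_Cauchy_Schwarz].
have KcP u : Kc u \in kbounded K by apply/asboolP; eexists; exact: KcB.
have normKc u : knorm (KSpace (KcP u)) ^+ 2 = kform K u u.
  have N0 := sqrtr_ge0 (kform K u u).
  rewrite -knorm_comb_sqr; congr (_ ^+ 2); apply/eqP; rewrite eq_le.
  rewrite (knorm_le (f := KSpace (KcP u)) (KcB u))/=.
  have [->|N1] := eqVneq (knorm_comb K u) 0; first exact: knorm_ge0.
  have {N1} N0 : 0 < knorm_comb K u by rewrite lt_neqAle eq_sym N1.
  have [_ /(_ u)] := knormP (KSpace (KcP u)).
  rewrite evK ger0_norm ?kform_ge0// -knorm_comb_sqr expr2.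
  by rewrite ler_pM2r.
exists (kspace_hilbert K), (fun s => KSpace (KcP [:: (1, s)])) => s t.
have -> : KSpace (KcP [:: (1, s)]) - KSpace (KcP [:: (1, t)]) =
          KSpace (KcP [:: (1, s); (-1, t)]) :> kspace K.
  apply/val_inj/funext => x /=.
  rewrite [LHS]/(Kc _ x - Kc _ x) /Kc /kform !big_cons !big_nil /=.
  change (1 * 1 * K s x + 0 + 0 - (1 * 1 * K t x + 0 + 0) = 1 * 1 * K s x + 0 + (-1 * 1 * K t x + 0 + 0)).
  by ring.
rewrite [LHS]normKc /kform !big_cons !big_nil /= (kfunC K t s); ring.
Qed.

(** * Isometries of the plane *)

Section Plane.
Variable R : realType.
Implicit Types (x y z p : plane R) (g h : affine R) (A B : 'M[R]_2).

Lemma I2P (i : 'I_2) : i = 0 \/ i = 1.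
Proof. by case: i => [[|[|//]] lti]; [left|right]; apply: val_inj. Qed.

Lemma planeP x y : x 0 0 = y 0 0 -> x 1 0 = y 1 0 -> x = y.
Proof. by move=> h0 h1; apply/matrixP => i j; rewrite !ord1; case: (I2P i) => ->. Qed.

Lemma mx2P A B : A 0 0 = B 0 0 -> A 0 1 = B 0 1 -> A 1 0 = B 1 0 -> A 1 1 = B 1 1 -> A = B.
Proof.
by move=> *; apply/matrixP => i j; case: (I2P i) => ->; case: (I2P j) => ->.
Qed.

Lemma sum2 (F : 'I_2 -> R) : \sum_i F i = F 0 + F 1.
Proof. by rewrite !big_ord_recl big_ord0 addr0; congr (_ + F _); apply: val_inj. Qed.

Lemma mulmx2E (n : nat) A (B : 'M[R]_(2, n)) i j :
  (A *m B) i j = A i 0 * B 0 j + A i 1 * B 1 j.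
Proof. by rewrite mxE sum2. Qed.

Lemma det2 A : \det A = A 0 0 * A 1 1 - A 0 1 * A 1 0.
Proof.
rewrite (expand_det_row _ 0) sum2 /cofactor !det_mx11 !mxE /= expr0 expr1.
rewrite (_ : lift 0 0 = 1); last exact: val_inj.
rewrite (_ : lift 1 0 = 0); last exact: val_inj.
by rewrite !mul1r mulN1r mulrN.
Qed.

Definition pt (a b : R) : plane R := \col_i (if i == 0 then a else b).
Lemma pt0 a b : pt a b 0 0 = a. Proof. by rewrite mxE. Qed.

Lemma pt1 a b : pt a b 1 0 = b. Proof. by rewrite mxE. Qed.

Definition ptE := (pt0, pt1).

Definition mx2 (a b c d : R) : 'M[R]_2 :=
  \matrix_(i, j) (if i == 0 then if j == 0 then a else b else if j == 0 then c else d).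
Lemma mx2_00 a b c d : mx2 a b c d 0 0 = a. Proof. by rewrite mxE. Qed.

Lemma mx2_01 a b c d : mx2 a b c d 0 1 = b. Proof. by rewrite mxE. Qed.

Lemma mx2_10 a b c d : mx2 a b c d 1 0 = c. Proof. by rewrite mxE. Qed.

Lemma mx2_11 a b c d : mx2 a b c d 1 1 = d. Proof. by rewrite mxE. Qed.

Definition mx2E := (mx2_00, mx2_01, mx2_10, mx2_11).

Lemma plane0 i : (0 : plane R) i 0 = 0. Proof. by rewrite mxE. Qed.

Lemma planeD x y i : (x + y) i 0 = x i 0 + y i 0. Proof. by rewrite mxE. Qed.

Lemma planeN x i : (- x) i 0 = - x i 0. Proof. by rewrite mxE. Qed.

Lemma planeZ (a : R) x i : (a *: x) i 0 = a * x i 0. Proof. by rewrite mxE. Qed.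

Lemma act_coord g x i : act g x i 0 = g.1 i 0 * x 0 0 + g.1 i 1 * x 1 0 + g.2 i 0.
Proof. by rewrite /act planeD mulmx2E. Qed.

Definition planeE := (plane0, planeD, planeN, planeZ, act_coord, ptE).

Definition dotp x y : R := x 0 0 * y 0 0 + x 1 0 * y 1 0.

Lemma dotpC x y : dotp x y = dotp y x.
Proof. by rewrite /dotp; ring. Qed.

Lemma dotpDl x y z : dotp (x + y) z = dotp x z + dotp y z.
Proof. by rewrite /dotp !planeE; ring. Qed.

Lemma dotpDr x y z : dotp z (x + y) = dotp z x + dotp z y.
Proof. by rewrite /dotp !planeE; ring. Qed.

Lemma dotpNl x y : dotp (- x) y = - dotp x y.
Proof. by rewrite /dotp !planeE; ring. Qed.

Lemma dotpNr x y : dotp x (- y) = - dotp x y.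
Proof. by rewrite /dotp !planeE; ring. Qed.

Lemma dotpZl a x y : dotp (a *: x) y = a * dotp x y.
Proof. by rewrite /dotp !planeE; ring. Qed.

Lemma dotpZr a x y : dotp x (a *: y) = a * dotp x y.
Proof. by rewrite /dotp !planeE; ring. Qed.

Lemma dotp_ge0 x : 0 <= dotp x x.
Proof. by rewrite /dotp -!expr2 addr_ge0// sqr_ge0. Qed.

Lemma dotp_eq0 x : dotp x x = 0 -> x = 0.
Proof.
rewrite /dotp -!expr2 => /eqP; rewrite paddr_eq0 ?sqr_ge0// !sqrf_eq0.
by move=> /andP[/eqP x0 /eqP x1]; apply: planeP; rewrite ?x0 ?x1 !plane0.
Qed.

Lemma enormE x : enorm x = Num.sqrt (dotp x x).
Proof. by rewrite /enorm sum2 /dotp !expr2. Qed.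

Lemma enorm_ge0 x : 0 <= enorm x. Proof. exact: sqrtr_ge0. Qed.

Lemma enorm_sqr x : enorm x ^+ 2 = dotp x x.
Proof. by rewrite enormE sqr_sqrtr// dotp_ge0. Qed.

Lemma enorm0 : enorm (0 : plane R) = 0.
Proof. by rewrite enormE /dotp !plane0 mulr0 addr0 sqrtr0. Qed.

Lemma enorm0_eq0 x : enorm x = 0 -> x = 0.
Proof. by move=> h; apply: dotp_eq0; rewrite -enorm_sqr h expr0n. Qed.

Lemma enorm_gt0 x : (0 < enorm x) = (x != 0).
Proof.
rewrite lt_neqAle enorm_ge0 andbT eq_sym; congr (~~ _).
by apply/eqP/eqP => [/enorm0_eq0|->]//; rewrite enorm0.
Qed.

Lemma enormN x : enorm (- x) = enorm x.
Proof. by rewrite !enormE dotpNl dotpNr opprK. Qed.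

Lemma enormB x y : enorm (x - y) = enorm (y - x).
Proof. by rewrite -enormN opprB. Qed.

Lemma enormZ a x : enorm (a *: x) = `|a| * enorm x.
Proof. by rewrite !enormE dotpZl dotpZr mulrA sqrtrM -?expr2 ?sqr_ge0// sqrtr_sqr. Qed.

Lemma dotp_le x y : dotp x y <= enorm x * enorm y.
Proof.
have [h|h] := leP (dotp x y) 0; first by rewrite (le_trans h)// mulr_ge0 ?enorm_ge0.
rewrite -ler_sqr ?nnegrE ?mulr_ge0 ?enorm_ge0 ?(ltW h)// exprMn !enorm_sqr.
by rewrite /dotp; have := sqr_ge0 (x 0 0 * y 1 0 - x 1 0 * y 0 0); lra.
Qed.

Lemma dotp_norm_le x y : `|dotp x y| <= enorm x * enorm y.
Proof.
by rewrite ler_norml dotp_le andbT lerNl -dotpNl (le_trans (dotp_le _ _))// enormN.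
Qed.

Lemma enormD x y : enorm (x + y) <= enorm x + enorm y.
Proof.
rewrite -ler_sqr ?nnegrE ?addr_ge0 ?enorm_ge0// sqrrD !enorm_sqr.
by rewrite dotpDl !dotpDr (dotpC y x); have := dotp_le x y; lra.
Qed.

Lemma enorm_triangle x y z : enorm (x - z) <= enorm (x - y) + enorm (y - z).
Proof. by apply: le_trans (enormD _ _); rewrite addrA subrK. Qed.

Lemma coord0_le x : `|x 0 0| <= enorm x.
Proof.
by rewrite -ler_sqr ?nnegrE ?enorm_ge0// enorm_sqr real_normK ?num_real// /dotp -!expr2 lerDl sqr_ge0.
Qed.

Lemma coord1_le x : `|x 1 0| <= enorm x.
Proof.
by rewrite -ler_sqr ?nnegrE ?enorm_ge0// enorm_sqr real_normK ?num_real// /dotp -!expr2 lerDr sqr_ge0.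
Qed.

Lemma enorm_le_coord x : enorm x <= `|x 0 0| + `|x 1 0|.
Proof.
rewrite -ler_sqr ?nnegrE ?enorm_ge0 ?addr_ge0// enorm_sqr /dotp -!expr2 sqrrD.
by rewrite !real_normK ?num_real// addrAC lerDl mulrn_wge0// mulr_ge0.
Qed.

Definition orth g := g.1^T *m g.1 = 1%:M.

Lemma orthP g : orth g ->
  [/\ g.1 0 0 ^+ 2 + g.1 1 0 ^+ 2 = 1, g.1 0 0 * g.1 0 1 + g.1 1 0 * g.1 1 1 = 0 &
      g.1 0 1 ^+ 2 + g.1 1 1 ^+ 2 = 1].
Proof.
move=> gO; split; rewrite ?expr2.
- by have /matrixP/(_ 0 0) := gO; rewrite mulmx2E !mxE.
- by have /matrixP/(_ 0 1) := gO; rewrite mulmx2E !mxE.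
- by have /matrixP/(_ 1 1) := gO; rewrite mulmx2E !mxE.
Qed.

Lemma orth_det1 g : orth g -> \det g.1 = 1 ->
  [/\ g.1 1 1 = g.1 0 0, g.1 0 1 = - g.1 1 0 & g.1 0 0 ^+ 2 + g.1 1 0 ^+ 2 = 1].
Proof.
move=> /orthP[h1 h2 h3]; rewrite det2 => h4.
split=> //; last first.
  move: h1 h2 h3 h4; move: (g.1 0 0) (g.1 0 1) (g.1 1 0) (g.1 1 1) => a b c d h1 h2 h3 h4.
  have : b * (a ^+ 2 + c ^+ 2) = a * (a * b + c * d) - c * (a * d - b * c) by ring.
  by rewrite h1 h2 h4; lra.
move: h1 h2 h3 h4; move: (g.1 0 0) (g.1 0 1) (g.1 1 0) (g.1 1 1) => a b c d h1 h2 h3 h4.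
have : d * (a ^+ 2 + c ^+ 2) = a * (a * d - b * c) + c * (a * b + c * d) by ring.
by rewrite h1 h4 h2; lra.
Qed.

Lemma orth_detN1 g : orth g -> \det g.1 = -1 ->
  [/\ g.1 1 1 = - g.1 0 0, g.1 0 1 = g.1 1 0 & g.1 0 0 ^+ 2 + g.1 1 0 ^+ 2 = 1].
Proof.
move=> /orthP[h1 h2 h3]; rewrite det2 => h4.
move: h1 h2 h3 h4; move: (g.1 0 0) (g.1 0 1) (g.1 1 0) (g.1 1 1) => a b c d h1 h2 h3 h4.
split=> //.
  have : d * (a ^+ 2 + c ^+ 2) = a * (a * d - b * c) + c * (a * b + c * d) by ring.
  by rewrite h1 h4 h2; lra.
have : b * (a ^+ 2 + c ^+ 2) = a * (a * b + c * d) - c * (a * d - b * c) by ring.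
by rewrite h1 h2 h4; lra.
Qed.

Lemma orth_det g : orth g -> \det g.1 = 1 \/ \det g.1 = -1.
Proof.
move=> gO; have := congr1 determinant gO; rewrite det_mulmx det_tr det1 -expr2.
by move/eqP; rewrite sqrf_eq1 => /orP[] /eqP; [left|right].
Qed.

Lemma orth_mulV g : orth g -> g.1 *m g.1^T = 1%:M.
Proof. exact: mulmx1C. Qed.

Lemma act1 x : act (aff1 R) x = x.
Proof. by rewrite /act mul1mx addr0. Qed.

Lemma actM g h x : act (affM g h) x = act g (act h x).
Proof. by rewrite /act /affM /= mulmxDr mulmxA addrA. Qed.

Lemma actV g x : orth g -> act (affV g) (act g x) = x.
Proof. by move=> gO; rewrite /act /affV /= mulmxDr mulmxA gO mul1mx addrK. Qed.

Lemma actVK g x : orth g -> act g (act (affV g) x) = x.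
Proof.
by move=> gO; rewrite /act /affV /= mulmxDr mulmxN !mulmxA orth_mulV// !mul1mx subrK.
Qed.

Lemma actB g x y : act g x - act g y = g.1 *m (x - y).
Proof. by rewrite /act opprD addrACA subrr addr0 mulmxBr. Qed.

Lemma dotp_orth g x y : orth g -> dotp (g.1 *m x) (g.1 *m y) = dotp x y.
Proof.
move=> /orthP[h1 h2 h3]; rewrite /dotp !mulmx2E.
move: h1 h2 h3; move: (g.1 0 0) (g.1 0 1) (g.1 1 0) (g.1 1 1) => a b c d h1 h2 h3.
transitivity ((a ^+ 2 + c ^+ 2) * (x 0 0 * y 0 0) + (b ^+ 2 + d ^+ 2) * (x 1 0 * y 1 0) +
  (a * b + c * d) * (x 0 0 * y 1 0 + x 1 0 * y 0 0)); first by ring.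
by rewrite h1 h2 h3; ring.
Qed.

Lemma enorm_orth g x : orth g -> enorm (g.1 *m x) = enorm x.
Proof. by move=> gO; rewrite !enormE dotp_orth. Qed.

Lemma enorm_act g x y : orth g -> enorm (act g x - act g y) = enorm (x - y).
Proof. by move=> gO; rewrite actB enorm_orth. Qed.

Lemma affM_orth g h : orth g -> orth h -> orth (affM g h).
Proof.
by move=> gO hO; rewrite /orth /affM /= trmx_mul mulmxA -(mulmxA h.1^T) gO mulmx1 hO.
Qed.

Lemma affV_orth g : orth g -> orth (affV g).
Proof. by move=> gO; rewrite /orth /affV /= trmxK orth_mulV. Qed.

Lemma aff_eq g h : (forall x, act g x = act h x) -> g = h.
Proof.
move=> H; have H0 := H 0; rewrite /act !mulmx0 !add0r in H0.
case: g h H H0 => [A v] [B w] /= H vw; congr (_, _) => //.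
apply/matrixP => i j.
have := H (\col_k (k == j)%:R); rewrite /act /= vw => /addIr/matrixP/(_ i 0).
rewrite !mulmx2E !mxE.
by case: (I2P j) => ->; rewrite /= ?mulr1 ?mulr0 ?addr0 ?add0r.
Qed.

Lemma affMA g h k : affM g (affM h k) = affM (affM g h) k.
Proof. by apply: aff_eq => x; rewrite !actM. Qed.

Lemma affM1 g : affM g (aff1 R) = g.
Proof. by apply: aff_eq => x; rewrite actM act1. Qed.

Lemma aff1M g : affM (aff1 R) g = g.
Proof. by apply: aff_eq => x; rewrite actM act1. Qed.

Lemma affVM g : orth g -> affM (affV g) g = aff1 R.
Proof. by move=> gO; apply: aff_eq => x; rewrite actM act1 actV. Qed.

Lemma affMV g : orth g -> affM g (affV g) = aff1 R.
Proof. by move=> gO; apply: aff_eq => x; rewrite actM act1 actVK. Qed.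

Lemma affVK g : orth g -> affV (affV g) = g.
Proof.
move=> gO; apply: aff_eq => x; rewrite -{1}(actV x gO) actV//; exact: affV_orth.
Qed.

Lemma act_conv g x y (t : R) : act g ((1 - t) *: x + t *: y) = (1 - t) *: act g x + t *: act g y.
Proof.
rewrite /act mulmxDr -!scalemxAr !scalerDr addrACA -scalerDl subrK scale1r.
by [].
Qed.

End Plane.

Section EmbedsP.
Variable R : realType.
Implicit Types (G N : subgroupE2 R) (x y : plane R).

Lemma elems_orth G g : elems G g -> orth g.
Proof. exact: elems_orthogonal. Qed.

(* An embedding of the orbit space, pulled back to the plane. *)
Definition embeds G (k : R) : Prop :=
  exists (H : hilbertSpace R) (F : plane R -> H),
    (forall g x y, elems G g -> `|F x - F y| <= k * enorm (x - act g y)) /\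
    (forall x y, exists2 g, elems G g & enorm (x - act g y) <= `|F x - F y|).

Lemma embeds_kernel G k (K : psd_kernel R (plane R)) : 0 <= k ->
  (forall g x y, elems G g ->
    K x x + K y y - 2 * K x y <= k ^+ 2 * enorm (x - act g y) ^+ 2) ->
  (forall x y, exists2 g, elems G g &
    enorm (x - act g y) ^+ 2 <= K x x + K y y - 2 * K x y) ->
  embeds G k.
Proof.
move=> k0 up low; have [H [F HF]] := psd_kernel_embedding K.
exists H, F; split=> [g x y Gg|x y].
  by rewrite -ler_sqr ?nnegrE ?mulr_ge0 ?enorm_ge0// HF exprMn up.
by have [g Gg h] := low x y; exists g => //; rewrite -ler_sqr ?nnegrE ?enorm_ge0// HF.
Qed.

Definition func_kernel (n : nat) (f : 'I_n -> plane R -> R) : psd_kernel R (plane R).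
Proof.
refine (@PsdKernel R (plane R) (fun x y => \sum_i f i x * f i y) _ _).
  by move=> s t; apply: eq_bigr => i _; rewrite mulrC.
move=> u.
have -> : \sum_(p <- u) \sum_(q <- u) p.1 * q.1 * (\sum_i f i p.2 * f i q.2) =
          \sum_i (\sum_(p <- u) p.1 * f i p.2) ^+ 2.
  transitivity (\sum_(p <- u) \sum_(q <- u) \sum_i (p.1 * f i p.2) * (q.1 * f i q.2)).
    apply: eq_bigr => p _; apply: eq_bigr => q _; rewrite mulr_sumr.
    by apply: eq_bigr => i _; ring.
  rewrite (eq_bigr (fun p => \sum_i \sum_(q <- u) (p.1 * f i p.2) * (q.1 * f i q.2))); last first.
    by move=> p _; rewrite exchange_big.
  rewrite exchange_big; apply: eq_bigr => i _; rewrite expr2 mulr_suml.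
  by apply: eq_bigr => p _; rewrite mulr_sumr.
by apply: sumr_ge0 => i _; exact: sqr_ge0.
Defined.

Lemma embeds_funcs G k (n : nat) (f : 'I_n -> plane R -> R) : 0 <= k ->
  (forall g x y, elems G g ->
    \sum_i (f i x - f i y) ^+ 2 <= k ^+ 2 * enorm (x - act g y) ^+ 2) ->
  (forall x y, exists2 g, elems G g &
    enorm (x - act g y) ^+ 2 <= \sum_i (f i x - f i y) ^+ 2) ->
  embeds G k.
Proof.
have E x y : func_kernel f x x + func_kernel f y y - 2 * func_kernel f x y =
    \sum_i (f i x - f i y) ^+ 2.
  rewrite /= mulr_sumr -big_split -sumrB; apply: eq_bigr => i _ /=; ring.
move=> k0 up low; apply: (embeds_kernel (K := func_kernel f)) => //.
  by move=> g x y Gg; rewrite E; exact: up.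
by move=> x y; rewrite E; exact: low.
Qed.

End EmbedsP.

(** * Embeddings of orbit spaces *)

Section LocallyFinite.
Variable R : realType.
Implicit Types (G N : subgroupE2 R) (x y : plane R).

(** The form in which discreteness is used: it makes infima of distances over orbits into minima. *)
Definition locally_finite G : Prop :=
  forall r, finite_set [set g | elems G g /\ enorm (act g 0) <= r].

Lemma finite_argmin (T : choiceType) (A : set T) (phi : T -> R) :
  finite_set A -> A !=set0 -> exists2 a, A a & forall b, A b -> phi a <= phi b.
Proof.
move=> /finite_seqP[s ->] {A} [a0].
elim: s a0 => [//|a s IH] a0 _.
case: s IH => [_|b s IH].
  by exists a => [|b]; rewrite /= ?inE ?eqxx// => /eqP ->.
have [c /= cs Hc] := IH b (mem_head _ _).
have [ac|ca] := leP (phi a) (phi c).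
  exists a; first by rewrite /= inE eqxx.
  move=> d; rewrite /= inE => /predU1P[->//|ds]; exact: le_trans ac (Hc _ ds).
exists c; first by rewrite /= inE cs orbT.
by move=> d; rewrite /= inE => /predU1P[->|ds]; [exact: ltW | exact: Hc].
Qed.

(** If [phi] grows at least as the displacement of the origin, only finitely many elements compete
    with a given one. *)
Lemma locally_finite_argmin G (A : set (affine R)) (phi : affine R -> R) (C : R) :
  locally_finite G -> (forall g, A g -> elems G g) -> A !=set0 ->
  (forall g, A g -> enorm (act g 0) <= phi g + C) ->
  exists2 g, A g & forall h, A h -> phi g <= phi h.
Proof.
move=> GF AG [a Aa] Hphi.
have [b [Ab b1] Hb] : exists2 b, (A b /\ enorm (act b 0) <= phi a + C) &
    forall c, (A c /\ enorm (act c 0) <= phi a + C) -> phi b <= phi c.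
  apply: finite_argmin; last by exists a; split=> //; exact: Hphi.
  by apply: sub_finite_set (GF (phi a + C)) => g [Ag ?]; split=> //; exact: AG.
exists b => // h Ah; have [ha|ha] := leP (phi h) (phi a).
  by apply: Hb; split=> //; apply: le_trans (Hphi _ Ah) _; rewrite lerD2r.
apply: le_trans (ltW ha); apply: Hb; split=> //; exact: Hphi.
Qed.

Lemma closest_orbit_point G x y (A : set (affine R)) :
  locally_finite G -> (forall g, A g -> elems G g) -> A !=set0 ->
  exists2 g, A g & forall h, A h -> enorm (x - act g y) <= enorm (x - act h y).
Proof.
move=> GF AG A0.
apply: (@locally_finite_argmin G A (fun g => enorm (x - act g y)) (enorm x + enorm y)) => //.
move=> g Ag.
have -> : act g 0 = - (x - act g y) + (x + (act g 0 - act g y)).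
  by rewrite opprB addrA subrK addrCA subrr addr0.
apply: le_trans (enormD _ _) _; rewrite enormN lerD2l.
apply: le_trans (enormD _ _) _; rewrite lerD2l enorm_act ?sub0r ?enormN//.
by apply: (@elems_orth _ G); exact: AG.
Qed.

Lemma closest_in_orbit G x y : locally_finite G ->
  exists2 g, elems G g & forall h, elems G h -> enorm (x - act g y) <= enorm (x - act h y).
Proof.
move=> GF; apply: (@closest_orbit_point G) => //; exists (aff1 R); exact: elems1.
Qed.

Lemma orbitP G x y : orb G x = orb G y <-> exists2 g, elems G g & y = act g x.
Proof.
split=> [/eqmodP/asboolP//|H]; apply/eqmodP; exact/asboolP.
Qed.

Lemma orbit_act G g x : elems G g -> orb G (act g x) = orb G x.
Proof. by move=> Gg; apply/esym/orbitP; exists g. Qed.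

Lemma orbit_repr G (a : orbit_space G) : exists x, orb G x = a.
Proof. by exists (repr (a : {eq_quot orbit_equiv G})); rewrite /orb reprK. Qed.

Lemma orbit_dist_le G g x y : elems G g ->
  orbit_dist (orb G x) (orb G y) <= enorm (x - act g y).
Proof.
move=> Gg; apply: ge_inf; first by exists 0 => r [p [q [_ _ ->]]]; exact: enorm_ge0.
by exists x, (act g y); split=> //; exact: orbit_act.
Qed.

Lemma orbit_dist_ge G x y r :
  (forall g, elems G g -> r <= enorm (x - act g y)) ->
  r <= orbit_dist (orb G x) (orb G y).
Proof.
move=> H; apply: lb_le_inf.
  by exists (enorm (x - y)), x, y.
move=> _ [p [q [/orbitP[g Gg xE] /esym/orbitP[h Gh qE] ->]]].
rewrite -(enorm_act p q (elems_orth Gg)) -xE qE -actM; apply: H.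
exact: elemsM.
Qed.

Lemma orbit_dist_min G x y : locally_finite G ->
  exists2 g, elems G g & orbit_dist (orb G x) (orb G y) = enorm (x - act g y).
Proof.
move=> GF; have [g Gg Hg] := closest_in_orbit x y GF; exists g => //.
by apply/eqP; rewrite eq_le orbit_dist_le// orbit_dist_ge.
Qed.

Lemma orbit_dist_ge0 G x y : 0 <= orbit_dist (orb G x) (orb G y).
Proof. by apply: orbit_dist_ge => *; exact: enorm_ge0. Qed.

Lemma c2_le G k : 0 < k -> embeds G k -> (c2 G <= k%:E)%E.
Proof.
move=> k0 [H [F [up low]]].
pose rp (a : orbit_space G) : plane R := sval (cid (orbit_repr a)).
have rpK a : orb G (rp a) = a by rewrite /rp; case: cid.
pose f a := F (rp a).
apply: ereal_inf_le; exists (distortion (@orbit_dist R G) (fun u v : H => `|u - v|) f).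
  by exists H, f.
rewrite /distortion.
set al := lower_const _ _ _; set be := upper_const _ _ _.
have al1 : (1%:E <= al)%E.
  apply: ereal_sup_ubound; split; first by rewrite lee_fin.
  move=> a b; rewrite mul1e lee_fin.
  have [g Gg h] := low (rp a) (rp b); apply: le_trans h.
  by have := orbit_dist_le (rp a) (rp b) Gg; rewrite !rpK.
have bek : (be <= k%:E)%E.
  apply: ereal_inf_lbound; split; first by rewrite lee_fin ltW.
  move=> a b; rewrite -EFinM lee_fin -ler_pdivrMl//.
  have : k^-1 * `|f a - f b| <= orbit_dist (orb G (rp a)) (orb G (rp b)).
    by apply: orbit_dist_ge => g Gg; rewrite ler_pdivrMl//; exact: up.
  by rewrite !rpK.
have be0 : (0 <= be)%E by apply: le_ereal_inf_tmp => b [].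
have -> : (al == 0) || (be == +oo)%E = false.
  apply/negbTE; rewrite negb_or; apply/andP; split; apply/negP => /eqP h.
    by move: al1; rewrite h lee_fin ler10.
  by move: bek; rewrite h leye_eq.
apply: le_trans bek.
case: al al1 => [a| |]; rewrite ?lee_fin// => a1.
  rewrite -[X in (_ <= X)%E]mule1; apply: lee_wpmul2l => //.
  have a0 : 0 < a by exact: lt_le_trans ltr01 a1.
  by rewrite inver gt_eqF// lee_fin invf_le1.
(* If [al] is infinite, its inverse is 0 and so is the quotient. *)
by rewrite invey mule0.
Qed.

Lemma embeds_of_bounds G (H : hilbertSpace R) (f : orbit_space G -> H) (a b : R) :
  locally_finite G -> 0 < a ->
  (forall u v, a * orbit_dist u v <= `|f u - f v|) ->
  (forall u v, `|f u - f v| <= b * orbit_dist u v) ->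
  0 <= b -> embeds G (b / a).
Proof.
move=> GF a0 low up b0.
exists H, (fun x => a^-1 *: f (orb G x)); split=> [g x y Gg|x y].
  rewrite -scalerBr normrZ gtr0_norm ?invr_gt0// mulrC -mulrA [_ * enorm _]mulrC mulrA.
  rewrite ler_pM2r ?invr_gt0//; apply: le_trans (up _ _) _.
  by rewrite ler_wpM2l// orbit_dist_le.
have [g Gg hg] := orbit_dist_min x y GF; exists g => //.
by rewrite -scalerBr normrZ gtr0_norm ?invr_gt0// ler_pdivlMl// -hg.
Qed.

(** For every admissible pair [0 < a], [0 <= b] of constants of [f], the map [f / a] is an embedding
    with constant [b / a], so [C <= b / a]. The rest passes to the supremum over [a] and the infimum
    over [b] in the extended reals. *)
Lemma c2_ge G (C : \bar R) : locally_finite G ->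
  (forall k, 0 <= k -> embeds G k -> (C <= k%:E)%E) -> (C <= c2 G)%E.
Proof.
move=> GF HC; apply: le_ereal_inf_tmp => _ [H [f <-]].
rewrite /distortion.
set al := lower_const _ _ _; set be := upper_const _ _ _.
case: ifPn => [_|]; first exact: leey.
rewrite negb_or => /andP[al0 be_fin].
pose lowP a := forall u v, a * orbit_dist u v <= `|f u - f v|.
pose upP b := forall u v, `|f u - f v| <= b * orbit_dist u v.
have HCab a b : 0 < a -> 0 <= b -> lowP a -> upP b -> (C <= (b / a)%:E)%E.
  move=> a0 b0 la ub; apply: HC; first by rewrite divr_ge0// ltW.
  exact: embeds_of_bounds la ub b0.
have dist0 (x y : orbit_space G) : 0 <= orbit_dist x y.
  by have [u <-] := orbit_repr x; have [v <-] := orbit_repr y; exact: orbit_dist_ge0.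
have al_sup (c : R) : (forall a : R, 0 < a -> lowP a -> a <= c) -> 0 <= c -> (al <= c%:E)%E.
  move=> Hc c0; apply: ge_ereal_sup => -[a| |] [a0 Ha]//.
    move: a0; rewrite !lee_fin le_eqVlt => /orP[/eqP<-//|a0]; exact: Hc.
  (* The constant [+oo] is admissible only if all distances vanish, and then every real number is,
     [c + 1] among them. *)
  suff : c + 1 <= c by move=> ?; exfalso; lra.
  apply: Hc; first lra.
  move=> x y; have [d0|d0] := ltP 0 (orbit_dist x y).
    by have := Ha x y; rewrite gt0_mulye ?lte_fin// leye_eq.
  by rewrite (_ : orbit_dist x y = 0) ?mulr0//; apply/eqP; rewrite eq_le d0 dist0.
have [a a0 la] : exists2 a, 0 < a & lowP a.
  apply: contrapT => h; case/negP: al0; rewrite eq_le; apply/andP; split.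
    by apply: al_sup => // a a0 la; case: h; exists a.
  apply: ereal_sup_ubound; split=> // u v; by rewrite mul0e lee_fin.
have be_inf (c : \bar R) : (forall b : R, 0 <= b -> upP b -> (c <= b%:E)%E) -> (c <= be)%E.
  move=> Hc; apply: le_ereal_inf_tmp => -[b| |] [b0 Hb]//; last exact: leey.
  exact: Hc.
have [b b0 ub] : exists2 b, 0 <= b & upP b.
  apply: contrapT => h; case/negP: be_fin; rewrite -leye_eq; apply: be_inf => b b0 ub.
  by case: h; exists b.
have := HCab _ _ a0 b0 la ub.
case: C HC HCab => [c| |] HC HCab hc //; last exact: leNye.
have be0 : (0 <= be)%E by apply: be_inf => *; rewrite lee_fin.
have al_ge0 : (0 <= al)%E.
  by apply: ereal_sup_ubound; split=> // u v; rewrite mul0e lee_fin.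
have [c0|c0] := leP c 0.
  apply: (@le_trans _ _ 0%E); first by rewrite lee_fin.
  by rewrite mule_ge0// inve_ge0.
have alB (B : R) : 0 <= B -> upP B -> (al <= (B / c)%:E)%E.
  move=> B0 uB; apply: al_sup; last by rewrite divr_ge0// ltW.
  move=> a' a'0 la'; have := HCab _ _ a'0 B0 la' uB.
  by rewrite lee_fin !ler_pdivlMr// mulrC.
have [r rE] : exists r, al = r%:E.
  have := alB _ b0 ub; case: al al_ge0 {al0 al_sup alB} => [r| |]//.
  by exists r.
have r0 : 0 < r by move: al0 al_ge0; rewrite rE lee_fin eqe lt_neqAle eq_sym => -> ->.
rewrite rE inver gt_eqF// lee_pdivlMr// -EFinM; apply: be_inf => B B0 uB.
have := alB _ B0 uB.
by rewrite rE !lee_fin ler_pdivlMr// mulrC.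
Qed.

Lemma embeds_mono G k k' : k <= k' -> embeds G k -> embeds G k'.
Proof.
move=> kk [H [F [up low]]]; exists H, F; split=> // g x y Gg.
by apply: le_trans (up _ _ _ Gg) _; rewrite ler_wpM2r// enorm_ge0.
Qed.

(** Enlarging [k] by [e] covers the value 0, which [c2_le] excludes. *)
Lemma embeds_c2_le G k : 0 <= k -> embeds G k -> (c2 G <= k%:E)%E.
Proof.
move=> k0 Gk; apply/lee_addgt0Pr => e e0; rewrite -EFinD; apply: c2_le; first by rewrite ltr_wpDl.
by apply: embeds_mono Gk; rewrite lerDl ltW.
Qed.

Lemma c2_scale G N s : locally_finite N -> 0 < s ->
  (forall k, 0 <= k -> embeds N k -> embeds G (s * k)) ->
  (c2 G <= s%:E * c2 N)%E.
Proof.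
move=> NF s0 H; rewrite -lee_pdivrMl//; apply: c2_ge => // k k0 Nk.
rewrite lee_pdivrMl// -EFinM; apply: embeds_c2_le; first by rewrite mulr_ge0// ltW.
exact: H.
Qed.

End LocallyFinite.

(** * Extensions of index two *)

Section HilbertFacts.
Variables (R : realType) (H : hilbertSpace R).
Implicit Types (x y z : H).

Lemma innerDr x y z : inner z (x + y) = inner z x + inner z y.
Proof. by rewrite innerC innerDl !(innerC _ z). Qed.

Lemma innerZr (a : R) x y : inner x (a *: y) = a * inner x y.
Proof. by rewrite innerC innerZl innerC. Qed.

Lemma innerNl x y : inner (- x) y = - inner x y.
Proof. by rewrite -scaleN1r innerZl mulN1r. Qed.

Lemma innerNr x y : inner x (- y) = - inner x y.
Proof. by rewrite innerC innerNl innerC. Qed.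

Lemma inner0l y : inner (0 : H) y = 0.
Proof. by rewrite -(scale0r (0 : H)) innerZl mul0r. Qed.

Lemma inner_ge0 x : 0 <= inner x x.
Proof. by rewrite inner_norm sqr_ge0. Qed.

Lemma inner_sumr (I : Type) (r : seq I) (F : I -> H) x :
  inner x (\sum_(i <- r) F i) = \sum_(i <- r) inner x (F i).
Proof.
elim: r => [|i r IH]; first by rewrite !big_nil innerC inner0l.
by rewrite !big_cons innerDr IH.
Qed.

Lemma inner_suml (I : Type) (r : seq I) (F : I -> H) x :
  inner (\sum_(i <- r) F i) x = \sum_(i <- r) inner (F i) x.
Proof. by rewrite innerC inner_sumr; apply: eq_bigr => i _; rewrite innerC. Qed.

Lemma normB_sqr x y : `|x - y| ^+ 2 = `|x| ^+ 2 + `|y| ^+ 2 - 2 * inner x y.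
Proof.
by rewrite -!inner_norm innerDl !innerDr !innerNl !innerNr (innerC y x); ring.
Qed.

Lemma normD_sqr x y : `|x + y| ^+ 2 = `|x| ^+ 2 + `|y| ^+ 2 + 2 * inner x y.
Proof. by rewrite -!inner_norm innerDl !innerDr (innerC y x); ring. Qed.

Lemma inner_le x y : `|inner x y| <= `|x| * `|y|.
Proof.
rewrite -ler_sqr ?nnegrE ?mulr_ge0// -normrX ger0_norm ?sqr_ge0// exprMn.
apply: quadratic_ge0_discr => [|t]; first exact: sqr_ge0.
have := inner_ge0 (x + t *: y); congr (_ <= _).
by rewrite -!inner_norm innerDl !innerDr !innerZl !innerZr (innerC y x); ring.
Qed.

(* The Schur product theorem for the square of a Gram matrix: splitting off
   the component along one of the vectors shortens the list. *)
Lemma inner_sqr_psd (u : seq (R * H)) :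
  0 <= \sum_(p <- u) \sum_(q <- u) p.1 * q.1 * inner p.2 q.2 ^+ 2.
Proof.
have [n] := ubnP (size u); elim: n u => [//|n IH] [|[c v] u] szu; first by rewrite big_nil.
rewrite ltnS in szu.
have [e eE] : exists e, e = `|v|^-1 *: v by eexists.
pose a (w : H) := inner w e.
pose pr (w : H) := w - a w *: e.
have [v0|v0] := eqVneq v 0.
  have E (w : R * H) : inner v w.2 = 0 by rewrite v0 inner0l.
  rewrite big_cons big1; last by move=> q _; rewrite E expr0n mulr0.
  rewrite add0r (eq_bigr (fun p => \sum_(q <- u) p.1 * q.1 * inner p.2 q.2 ^+ 2)).
    exact: IH.
  by move=> p _; rewrite big_cons innerC E expr0n mulr0 add0r.
have e1 : inner e e = 1.
  rewrite eE innerZl innerZr inner_norm; field.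
  by rewrite normr_eq0.
have prE w z : inner w z = inner (pr w) (pr z) + a w * a z.
  rewrite /pr innerDl !innerDr !innerNl !innerNr !innerZl !innerZr e1.
  by rewrite (innerC e z) /a; ring.
have prv : pr v = 0.
  rewrite /pr /a eE innerZr inner_norm scalerA.
  rewrite (_ : _ * _ * _ = 1) ?scale1r ?subrr//; field.
  by rewrite normr_eq0.
set u' := (c, v) :: u.
pose u2 := [seq (p.1, pr p.2) | p <- u].
pose B := \sum_(p <- u') (p.1 * a p.2) *: pr p.2.
(* Squaring [prE] yields three semidefinite sums. In the first one the head [(c, v)] drops out since
   [pr v = 0], so it is a sum over a shorter list. *)
have -> : \sum_(p <- u') \sum_(q <- u') p.1 * q.1 * inner p.2 q.2 ^+ 2 =
  \sum_(p <- u2) \sum_(q <- u2) p.1 * q.1 * inner p.2 q.2 ^+ 2 +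
  2 * inner B B + (\sum_(p <- u') p.1 * a p.2 ^+ 2) ^+ 2.
  have -> : inner B B = \sum_(p <- u') \sum_(q <- u') p.1 * q.1 * (a p.2 * a q.2 * inner (pr p.2) (pr q.2)).
    rewrite inner_suml; apply: eq_bigr => p _; rewrite inner_sumr.
    by apply: eq_bigr => q _; rewrite innerZl innerZr; ring.
  have -> : (\sum_(p <- u') p.1 * a p.2 ^+ 2) ^+ 2 =
      \sum_(p <- u') \sum_(q <- u') p.1 * q.1 * (a p.2 * a q.2) ^+ 2.
    rewrite expr2 mulr_suml; apply: eq_bigr => p _; rewrite mulr_sumr.
    by apply: eq_bigr => q _; ring.
  have -> : \sum_(p <- u2) \sum_(q <- u2) p.1 * q.1 * inner p.2 q.2 ^+ 2 =
      \sum_(p <- u') \sum_(q <- u') p.1 * q.1 * inner (pr p.2) (pr q.2) ^+ 2.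
    rewrite /u2 !big_map [in RHS]big_cons [X in _ = X + _]big1 ?add0r; last first.
      by move=> q _; rewrite /= prv inner0l expr0n mulr0.
    apply: eq_bigr => p _; rewrite big_cons /= prv (innerC _ 0) inner0l expr0n mulr0 add0r.
    by rewrite big_map.
  rewrite mulr_sumr -!big_split; apply: eq_bigr => p _ /=.
  rewrite mulr_sumr -!big_split; apply: eq_bigr => q _ /=.
  by rewrite prE; ring.
rewrite !addr_ge0 ?sqr_ge0 ?mulr_ge0 ?inner_ge0//.
by apply: IH; rewrite size_map.
Qed.

(** As the inverse of 0 is 0, the second summand vanishes when [m x] or [m y] does, which is the
    value that the limit would give. *)
Definition quotient_kernel (S : Type) (p m : S -> H) : psd_kernel R S.
Proof.
refine (@PsdKernel R S (fun (x y : S) => inner (p x) (p y) +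
   `|m x|^-1 * `|m y|^-1 * inner (m x) (m y) ^+ 2) _ _).
  by move=> s t; rewrite innerC (innerC (m s)) (mulrC `|m s|^-1).
move=> u; under eq_bigr do under eq_bigr do rewrite mulrDr.
under eq_bigr do rewrite big_split; rewrite big_split /=; apply: addr_ge0.
  rewrite (_ : bigop _ _ _ = inner (\sum_(q <- u) q.1 *: p q.2) (\sum_(q <- u) q.1 *: p q.2)).
    exact: inner_ge0.
  rewrite inner_suml; apply: eq_bigr => q _; rewrite inner_sumr.
  by apply: eq_bigr => r _; rewrite innerZl innerZr; ring.
have := inner_sqr_psd [seq (q.1 / `|m q.2|, m q.2) | q <- u].
congr (_ <= _); rewrite big_map; apply: eq_bigr => q _; rewrite big_map.
by apply: eq_bigr => r _ /=; ring.
Defined.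

(* The kernel embeds H+ x (H-/{1,-1}), with the quotient metric, up to a factor sqrt 2,
   through v |-> v (x) v / |v| on H-. *)
Lemma quotient_kernel_bounds (S : Type) (p m : S -> H) (x y : S) :
  let K := quotient_kernel p m in
  let D := K x x + K y y - 2 * K x y in
  let Ep := `|p x - p y| ^+ 2 + `|m x - m y| ^+ 2 in
  let En := `|p x - p y| ^+ 2 + `|m x + m y| ^+ 2 in
  [/\ D <= 2 * Ep, D <= 2 * En & Ep <= D \/ En <= D].
Proof.
move=> K D Ep En.
set a := `|m x|; set b := `|m y|; set t := inner (m x) (m y).
have a0 : 0 <= a by exact: normr_ge0.
have b0 : 0 <= b by exact: normr_ge0.
have tab : `|t| <= a * b by exact: inner_le.
set P := `|p x - p y| ^+ 2 in Ep En *.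
have P0 : 0 <= P by exact: sqr_ge0.
(* The bounds rest on [q <= |t| <= a b] and on [q + a b - 2 t = (t - a b)^2 / (a b)], together with
   its analogue for [- t]. *)
pose q := a^-1 * b^-1 * t ^+ 2.
have sq (c : R) : c^-1 * c^-1 * (c ^+ 2) ^+ 2 = c ^+ 2.
  have [->|c0] := eqVneq c 0; first by rewrite invr0 !mul0r expr0n.
  by field.
have DE : D = P + a ^+ 2 + b ^+ 2 - 2 * q.
  rewrite /D /K /= /q /t !inner_norm -/a -/b !sq /P normB_sqr; ring.
have EpE : Ep = P + a ^+ 2 + b ^+ 2 - 2 * t by rewrite /Ep normB_sqr -/a -/b -/t; ring.
have EnE : En = P + a ^+ 2 + b ^+ 2 + 2 * t by rewrite /En normD_sqr -/a -/b -/t; ring.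
rewrite DE EpE EnE.
have [ab0|ab0] := eqVneq (a * b) 0.
  have t0 : t = 0 by apply/eqP; rewrite -normr_le0 -ab0.
  rewrite /q t0 expr0n /= !mulr0; split; [| |left] => //;
    by rewrite ?subr0 ?addr0; have := sqr_ge0 a; have := sqr_ge0 b; lra.
have ab : 0 < a * b by rewrite lt_neqAle eq_sym ab0 mulr_ge0.
have qE : q * (a * b) = t ^+ 2.
  have := ab0; rewrite mulf_eq0 negb_or => /andP[a00 b00]; rewrite /q. field; rewrite ?a00 ?b00 //.
have := sqr_ge0 (a - b); rewrite sqrrB => hab.
have up s : 0 <= (q + a * b + s * 2 * t) -> s = 1 \/ s = -1 -> 0 <= q + a * b + s * 2 * t by [].
have hp : 0 <= q + a * b - 2 * t.
  rewrite -(pmulr_lge0 _ ab) !mulrDl qE mulNr; have := sqr_ge0 (t - a * b); lra.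
have hn : 0 <= q + a * b + 2 * t.
  rewrite -(pmulr_lge0 _ ab) !mulrDl qE; have := sqr_ge0 (t + a * b); lra.
have qt : q <= `|t|.
  rewrite -(ler_pM2r ab) qE -real_normK ?num_real// expr2.
  by rewrite ler_wpM2l.
split.
- lra.
- lra.
- by have [t0|t0] := leP 0 t; [left; rewrite ger0_norm// in qt; lra | right; rewrite ltr0_norm// in qt; lra].
Qed.

End HilbertFacts.

Section IndexTwo.
Variable R : realType.
Implicit Types (G N : subgroupE2 R).

(** By the parallelogram law [Ep] is the mean of [|f x - f y|^2] and [|f (s x) - f (s y)|^2], and
    [En] the mean of the two mixed terms. Since [s] normalises [N], all of them obey the upper
    bound; for the lower bound one of two terms is at most their mean, and it supplies an element of
    [G]. *)
Lemma embeds_index2 G N (s : affine R) k :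
  elems N `<=` elems G -> elems G s ->
  (forall n, elems N n -> elems N (affM s (affM n (affV s)))) ->
  elems N (affM s s) ->
  (forall g, elems G g -> elems N g \/ exists2 n, elems N n & g = affM n s) ->
  0 <= k -> embeds N k -> embeds G (Num.sqrt 2 * k).
Proof.
move=> NG Gs Ns Nss Gcase k0 [H [f [up low]]].
have sO := elems_orth Gs.
pose sg x := act s x.
pose p x : H := 2^-1 *: (f x + f (sg x)).
pose m x : H := 2^-1 *: (f x - f (sg x)).
have f_inv n x : elems N n -> f (act n x) = f x.
  move=> Nn; apply/eqP; rewrite -subr_eq0 -normr_le0.
  by have := up n (act n x) x Nn; rewrite subrr enorm0 mulr0.
have par (x y : H) : `|2^-1 *: (x + y)| ^+ 2 + `|2^-1 *: (x - y)| ^+ 2 = (`|x| ^+ 2 + `|y| ^+ 2) / 2.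
  rewrite !normrZ normfV normr_nat !exprMn normB_sqr normD_sqr; lra.
have EpE x y : `|p x - p y| ^+ 2 + `|m x - m y| ^+ 2 =
    (`|f x - f y| ^+ 2 + `|f (sg x) - f (sg y)| ^+ 2) / 2.
  rewrite -par /p /m -!scalerBr; congr (_ ^+ 2 + _ ^+ 2); congr (`|_|); congr (_ *: _).
    by rewrite opprD addrACA.
  by rewrite !opprB addrACA [RHS]addrACA; congr (_ + _); rewrite addrC.
have ssf x : f (sg (sg x)) = f x by rewrite /sg -actM f_inv.
have EnE x y : `|p x - p y| ^+ 2 + `|m x + m y| ^+ 2 =
    (`|f x - f (sg y)| ^+ 2 + `|f (sg x) - f y| ^+ 2) / 2.
  have -> : p y = p (sg y) by rewrite /p ssf addrC.
  have -> : m y = - m (sg y) by rewrite /m ssf -scalerN opprB.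
  by rewrite EpE ssf.
apply: (embeds_kernel (K := quotient_kernel p m)); first by rewrite mulr_ge0.
  move=> g x y Gg; have [Dp Dn _] := quotient_kernel_bounds p m x y.
  rewrite exprMn sqr_sqrtr// -mulrA -exprMn.
  have [Ng|[n Nn gE]] := Gcase g Gg.
    apply: le_trans Dp _; rewrite ler_pM2l// EpE ler_pdivrMr//.
    have e1 := up g x y Ng.
    have e2 : `|f (sg x) - f (sg y)| <= k * enorm (x - act g y).
      have := up _ (sg x) (sg y) (Ns _ Ng).
      by rewrite !actM /sg actV// enorm_act.
    by rewrite mulr_natr mulr2n lerD// ler_sqr ?nnegrE ?mulr_ge0 ?enorm_ge0.
  apply: le_trans Dn _; rewrite ler_pM2l// EnE ler_pdivrMr//.
  have e1 : `|f x - f (sg y)| <= k * enorm (x - act g y).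
    by rewrite gE actM; exact: up.
  have e2 : `|f (sg x) - f y| <= k * enorm (x - act g y).
    have := up _ (sg x) y (elemsM (Ns _ Nn) Nss).
    by rewrite !actM /sg actV// gE actM enorm_act.
  by rewrite mulr_natr mulr2n lerD// ler_sqr ?nnegrE ?mulr_ge0 ?enorm_ge0.
move=> x y; have [_ _ Dc] := quotient_kernel_bounds p m x y.
have half (a b c : R) : a <= (b ^+ 2 + c ^+ 2) / 2 \/ True by right.
have mid (b c d : R) : (b ^+ 2 + c ^+ 2) / 2 <= d -> b ^+ 2 <= d \/ c ^+ 2 <= d.
  by move=> h; have [?|?] := leP (b ^+ 2) d; [left|right; lra].
have conj_low g u v : elems N g -> enorm (sg u - act g v) = enorm (u - act (affM (affV s) g) v).
  by move=> Ng; rewrite -(enorm_act _ _ (affV_orth sO)) /sg actV// actM.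
have GsV := elemsV Gs.
case: Dc; rewrite ?EpE ?EnE => /mid[] h.
- have [g Ng hg] := low x y; exists g; first exact: NG.
  by apply: le_trans h; rewrite ler_sqr ?nnegrE ?enorm_ge0.
- have [g Ng hg] := low (sg x) (sg y); exists (affM (affV s) (affM g s)).
    by apply: elemsM => //; apply: elemsM => //; exact: NG.
  apply: le_trans h; rewrite ler_sqr ?nnegrE ?enorm_ge0//.
  by rewrite affMA actM -conj_low.
- have [g Ng hg] := low x (sg y); exists (affM g s).
    by apply: elemsM => //; exact: NG.
  by apply: le_trans h; rewrite ler_sqr ?nnegrE ?enorm_ge0// actM.
- have [g Ng hg] := low (sg x) y; exists (affM (affV s) g).
    by apply: elemsM => //; exact: NG.
  by apply: le_trans h; rewrite ler_sqr ?nnegrE ?enorm_ge0// -conj_low.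
Qed.

End IndexTwo.

(** * Lower bounds from closed curves *)

Section Trig.
Variable R : realType.
Implicit Types x y : R.

Lemma sin_MVT x y : x < y -> exists2 c, x < c < y & sin y - sin x = cos c * (y - x).
Proof.
move=> xy; have [|c cxy ->] := @MVT R sin cos x y xy (fun z _ => is_derive_sin z).
  by apply: continuous_subspaceT => z; exact: continuous_sin.
by exists c => //; move: cxy; rewrite in_itv.
Qed.

Lemma ler_cos_pi x y : 0 <= x -> x <= y -> y <= pi -> cos y <= cos x.
Proof.
rewrite le_eqVlt => /predU1P[<-{x}|x0] xy ypi; first by rewrite cos0 cos_le1.
move: xy; rewrite le_eqVlt => /predU1P[->//|xy].
by apply: ltW; rewrite ltr_cos// in_itv/= ?ypi ?(ltW x0) ?(ltW (lt_trans x0 xy))// (le_trans (ltW xy)).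
Qed.

Lemma sin_ge_mul_cos y : 0 <= y <= pi -> y * cos y <= sin y.
Proof.
move=> /andP[]; rewrite le_eqVlt => /predU1P[<-|y0 ypi]; first by rewrite mul0r sin0.
have [c /andP[c0 cy]] := sin_MVT y0.
rewrite sin0 !subr0 => ->; rewrite mulrC ler_pM2r//.
by apply: ler_cos_pi => //; exact: ltW.
Qed.

Lemma sin_le_id y : 0 <= y -> sin y <= y.
Proof.
rewrite le_eqVlt => /predU1P[<-|y0]; first by rewrite sin0.
have [c _] := sin_MVT y0.
by rewrite sin0 !subr0 => ->; rewrite ler_piMl ?cos_le1// ltW.
Qed.

Lemma normr_sin_le x : `|sin x| <= `|x|.
Proof.
have [x0|x0] := leP 0 x; last first.
  rewrite -normrN -sinN -(normrN x).
  have : 0 <= - x by lra.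
  move: (- x) => z z0; rewrite [leRHS]ger0_norm// ler_norml sin_le_id// andbT.
  have [zp|zp] := leP z pi; last by have := sin_geN1 z; have := @pi_ge2 R; lra.
  by have := @sin_ge0_pi R z; rewrite z0 zp => /(_ isT); lra.
rewrite [leRHS]ger0_norm// ler_norml sin_le_id// andbT.
have [zp|zp] := leP x pi; last by have := sin_geN1 x; have := @pi_ge2 R; lra.
by have := @sin_ge0_pi R x; rewrite x0 zp => /(_ isT); lra.
Qed.

Lemma cos_ge_1B y : 0 <= y <= pi / 2 -> 1 - y <= cos y.
Proof.
move=> /andP[y0 y2].
have c0 : 0 <= cos y by apply: cos_ge0_pihalf; rewrite y2 andbT; have := @pi_gt0 R; lra.
have := sin_le_id y0; have := cos2Dsin2 y; have := cos_le1 y; have := sin_le1 y.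
have s0 : 0 <= sin y by apply: sin_ge0_pi; rewrite y0/=; have := @pi_gt0 R; lra.
by move: (cos y) (sin y) c0 s0 => c s *; nra.
Qed.

(** Were the graph of sine below the chord at [y], its mean slope would be less than [2 / pi] before
    [y] and greater after, while the slope [cos] decreases. *)
Lemma Jordan_inequality y : 0 <= y <= pi / 2 -> 2 / pi * y <= sin y.
Proof.
have p0 := @pi_gt0 R.
have E1 : 2 / pi * (pi / 2) = 1 :> R.
  by move: pi p0 => p p0; field; rewrite gt_eqF.
move=> /andP[]; rewrite le_eqVlt => /predU1P[<-|y0]; first by rewrite mulr0 sin0.
rewrite le_eqVlt => /predU1P[->|y2].
  by rewrite sin_pihalf E1.
rewrite leNgt; apply/negP => h.
have [c /andP[c0 cy]] := sin_MVT y0; rewrite sin0 !subr0 => Ec.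
have [d /andP[d0 dy]] := sin_MVT y2; rewrite sin_pihalf => Ed.
have cd : cos d <= cos c by apply: ler_cos_pi; lra.
have hc : cos c < 2 / pi by rewrite -(ltr_pM2r y0) -Ec.
have : 2 / pi < cos d.
  rewrite -(@ltr_pM2r _ (pi / 2 - y)) ?subr_gt0// -Ed mulrBr E1; lra.
lra.
Qed.
End Trig.

(** * Autocorrelations of antiperiodic sequences *)

Section CyclicSums.
Variables (R : realType) (H : hilbertSpace R).

Lemma sum_shift (N h : nat) (phi : nat -> R) : (forall i, phi (i + N)%N = phi i) ->
  \sum_(i < N) phi (i + h)%N = \sum_(i < N) phi i.
Proof.
move=> per; elim: h => [|h IH]; first by under eq_bigr do rewrite addn0.
rewrite -IH; case: N per {IH} => [|N] per; first by rewrite !big_ord0.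
rewrite big_ord_recr [RHS]big_ord_recl /= addrC; congr (_ + _).
  by rewrite add0n addnS -addSn addnC per.
by apply: eq_bigr => i _; rewrite /bump /= add1n addnS addSn.
Qed.

Variables (g : nat -> H) (j : nat).
Let m := (2 ^ j)%N.
Hypothesis anti : forall i, g (i + m)%N = - g i.
Let N := m.*2.
Let c (h : nat) := \sum_(i < N) inner (g i) (g (i + h)%N).
Let S := \sum_(i < N) `|g i| ^+ 2.

Lemma antiperiodic_period i : g (i + N)%N = g i.
Proof. by rewrite /N -addnn addnA !anti opprK. Qed.

(** Expand the sum of the squares of [S (g (i + 2h) + g i) - 2 c g (i + h)]. If [c h] is written as
    [S cos x], the result says that the angle at most doubles: [cos 2x] is bounded below by
    [2 cos^2 x - 1]. *)
Lemma corr_doubling h : 0 < S -> 2 * c h ^+ 2 - S ^+ 2 <= c h.*2 * S.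
Proof.
move=> S0.
have : 0 <= \sum_(i < N) `|S *: (g (i + h.*2)%N + g i) - (2 * c h) *: g (i + h)%N| ^+ 2.
  by apply: sumr_ge0 => i _; exact: sqr_ge0.
have gen s t : \sum_(i < N) `|s *: (g (i + h.*2)%N + g i) - t *: g (i + h)%N| ^+ 2 =
  s ^+ 2 * (\sum_(i < N) `|g (i + h.*2)%N| ^+ 2 + \sum_(i < N) `|g i| ^+ 2 +
     2 * \sum_(i < N) inner (g i) (g (i + h.*2)%N)) +
  t ^+ 2 * (\sum_(i < N) `|g (i + h)%N| ^+ 2) -
  2 * s * t * (\sum_(i < N) inner (g (i + h)%N) (g (i + h + h)%N) +
     \sum_(i < N) inner (g i) (g (i + h)%N)).
  rewrite !mulrDr !mulr_sumr -!big_split /= -sumrB; apply: eq_bigr => i _ /=.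
  rewrite normB_sqr !normrZ !exprMn !real_normK ?num_real// normD_sqr.
  rewrite innerZl innerZr innerDl (innerC (g (i + h.*2)%N) (g i)).
  by rewrite (innerC (g (i + h.*2)%N) (g (i + h)%N)) -addnA addnn; ring.
rewrite gen -/S -/(c h) -/(c h.*2).
have P1 k i : `|g (i + N + k)%N| ^+ 2 = `|g (i + k)%N| ^+ 2 by rewrite addnAC antiperiodic_period.
rewrite (@sum_shift N h.*2 (fun i => `|g i| ^+ 2)); last by move=> i; rewrite antiperiodic_period.
rewrite (@sum_shift N h (fun i => `|g i| ^+ 2)); last by move=> i; rewrite antiperiodic_period.
rewrite (@sum_shift N h (fun i => inner (g i) (g (i + h)%N))); last first.
  by move=> i; rewrite antiperiodic_period addnAC antiperiodic_period.
rewrite -/S -/(c h).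
have -> : S ^+ 2 * (S + S + 2 * c h.*2) + (2 * c h) ^+ 2 * S - 2 * S * (2 * c h) * (c h + c h) =
  2 * S * (c h.*2 * S - (2 * c h ^+ 2 - S ^+ 2)) by ring.
by rewrite pmulr_rge0 ?mulr_gt0// subr_ge0.
Qed.

(** At the antipodal shift [2 ^ j] antiperiodicity gives [c = - S = cos pi * S]; each halving of the
    shift halves the angle by [corr_doubling]. *)
Lemma corr_le i : 0 < S -> (i <= j)%N -> c (2 ^ (j - i)) <= cos (pi / (2 ^ i)%:R) * S.
Proof.
move=> S0; elim: i => [_|i IH ij].
  rewrite subn0 expn0 divr1 cospi mulN1r /S /c -sumrN.
  by apply: ler_sum => k _; rewrite anti innerNr inner_norm.
have {}IH := IH (ltnW ij).
have E : (2 ^ (j - i))%N = (2 ^ (j - i.+1)).*2 by rewrite -mul2n -expnS subnSK.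
rewrite E in IH.
have := corr_doubling (2 ^ (j - i.+1)) S0.
set C := c _; set th := pi / (2 ^ i.+1)%:R.
have thE : pi / (2 ^ i)%:R = th *+ 2 :> R.
  rewrite /th expnS natrM mulr2n; field.
  by rewrite pnatr_eq0 expn_eq0.
rewrite thE cos_mulr2n in IH => hC.
have th0 : 0 <= th <= pi / 2.
  have p2 : 1 <= (2 ^ i)%:R :> R by rewrite ler1n expn_gt0.
  rewrite divr_ge0 ?pi_ge0//= /th expnS natrM invfM mulrA ler_piMr ?divr_ge0 ?pi_ge0//.
  by rewrite invf_le1// (lt_le_trans ltr01).
have c0 : 0 <= cos th.
  by case/andP: th0 => ? ?; apply: cos_ge0_pihalf; apply/andP; split=> //; have := @pi_gt0 R; lra.
(* The right-hand side is nonnegative as [th <= pi / 2], so only a positive correlation has to be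
   compared by squares. *)
have [Cn|Cp] := leP C 0; first by rewrite (le_trans Cn)// mulr_ge0// ltW.
rewrite -ler_sqr ?nnegrE ?(ltW Cp) ?mulr_ge0 ?(ltW S0)// exprMn.
have : c (2 ^ (j - i.+1)).*2 * S <= (cos th ^+ 2 *+ 2 - 1) * S * S by rewrite ler_wpM2r// ltW.
rewrite -mulrA -expr2; move: (cos th ^+ 2) (S ^+ 2) (C ^+ 2) hC => u v w; lra.
Qed.

(** A discrete Wirtinger inequality; the constant is the one of a uniformly traversed half circle of
    [m] steps. *)
Lemma antiperiodic_energy : 0 < S ->
  2 * (1 - cos (pi / m%:R)) * S <= \sum_(i < N) `|g i.+1 - g i| ^+ 2.
Proof.
move=> S0; have := corr_le S0 (leqnn j); rewrite subnn expn0 => h.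
have -> : \sum_(i < N) `|g i.+1 - g i| ^+ 2 = S + S - 2 * c 1.
  have Es : \sum_(i < N) `|g i.+1| ^+ 2 = S.
    transitivity (\sum_(i < N) `|g (i + 1)%N| ^+ 2).
      by apply: eq_bigr => i _; rewrite addn1.
    by apply: (@sum_shift N 1 (fun i => `|g i| ^+ 2)) => i; rewrite antiperiodic_period.
  rewrite -{1}Es /S /c mulr_sumr -big_split -sumrB; apply: eq_bigr => i _ /=.
  by rewrite normB_sqr addn1 (innerC (g i)).
by rewrite -/m in h; lra.
Qed.
End CyclicSums.

Section CurveBound.
Variable R : realType.

(** The differences [f i - f (i + m)] of antipodal images form an antiperiodic sequence of norm at
    least [a] and with steps at most [2 k l / N]; the Wirtinger constant is rewritten by
    [1 - cos 2x = 2 sin^2 x]. *)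
Lemma curve_bound_dyadic (G : subgroupE2 R) k (p : R -> plane R) a l (j : nat) :
  embeds G k -> 0 <= k -> 0 < a -> 0 <= l ->
  (forall s t, enorm (p s - p t) <= l * `|s - t|) ->
  (forall s, exists2 g, elems G g & p (s + 1) = act g (p s)) ->
  (forall s g, elems G g -> a <= enorm (p s - act g (p (s + 2^-1)))) ->
  a * (2 ^ j.+1)%:R * sin (pi / (2 ^ j.+1)%:R) <= l * k.
Proof.
move=> [H [F [up low]]] k0 a0 l0 plip pper pfar.
pose m := (2 ^ j)%N; pose N := m.*2.
have N0 : 0 < N%:R :> R by rewrite ltr0n double_gt0 expn_gt0.
pose f (i : nat) := F (p (i%:R / N%:R)).
pose g i := f i - f (i + m)%N.
have Finv h x : elems G h -> F (act h x) = F x.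
  move=> Gh; apply/eqP; rewrite -subr_eq0 -normr_le0.
  by have := up h (act h x) x Gh; rewrite subrr enorm0 mulr0.
have fper i : f (i + m + m)%N = f i.
  rewrite /f -addnA addnn -/N natrD mulrDl divff ?gt_eqF//.
  by have [h Gh ->] := pper (i%:R / N%:R); exact: Finv.
have anti i : g (i + m)%N = - g i by rewrite /g fper opprB.
have fstep i : `|f i.+1 - f i| <= k * l / N%:R.
  have := up (aff1 R) (p (i.+1%:R / N%:R)) (p (i%:R / N%:R)) (elems1 G).
  rewrite act1 => /le_trans; apply; rewrite -mulrA ler_wpM2l//.
  apply: le_trans (plip _ _) _; rewrite -mulrBl -natr1 addrAC subrr add0r mul1r.
  by rewrite ger0_norm// invr_ge0 ltW.
have ffar i : a <= `|g i|.
  have [h Gh hh] := low (p (i%:R / N%:R)) (p ((i + m)%:R / N%:R)).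
  apply: le_trans hh; have := pfar (i%:R / N%:R) h Gh.
  rewrite natrD mulrDl (_ : m%:R / N%:R = 2^-1)//.
  rewrite /N -muln2 natrM invfM mulrA divff ?mul1r// pnatr_eq0 expn_eq0//.
pose S := \sum_(i < N) `|g i| ^+ 2.
have SN : N%:R * a ^+ 2 <= S.
  rewrite mulr_natl -[X in _ *+ X]card_ord -sumr_const; apply: ler_sum => i _.
  by rewrite ler_sqr ?nnegrE// ltW.
have S0 : 0 < S by apply: lt_le_trans SN; rewrite mulr_gt0// exprn_gt0.
have E := antiperiodic_energy anti S0.
have U : \sum_(i < N) `|g i.+1 - g i| ^+ 2 <= N%:R * (2 * (k * l / N%:R)) ^+ 2.
  rewrite mulr_natl -[X in _ *+ X]card_ord -sumr_const; apply: ler_sum => i _.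
  rewrite ler_sqr ?nnegrE ?mulr_ge0 ?invr_ge0 ?(ltW N0)//.
  have -> : g i.+1 - g i = (f i.+1 - f i) - (f (i + m).+1 - f (i + m)%N).
    by rewrite /g !opprB addrACA [RHS]addrACA addSn; congr (_ + _); rewrite addrC.
  by rewrite (le_trans (ler_normB _ _))// mulr2n mulrDl mul1r lerD.
set x := pi / (2 ^ j.+1)%:R.
have mN : (2 ^ j.+1)%N = N by rewrite expnS mul2n.
have xE : pi / m%:R = x *+ 2.
  by rewrite -[RHS]mulr_natr /x mN /N -muln2 natrM invfM mulrA mulfVK.
have c2 : 2 * (1 - cos (pi / m%:R)) = 4 * sin x ^+ 2.
  by rewrite xE cos_mulr2n cos2sin2; lra.
have x0 : 0 <= x by rewrite divr_ge0 ?pi_ge0.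
have xp : x <= pi by rewrite ler_pdivrMr ?mN// ler_peMr ?pi_ge0// ler1n double_gt0 expn_gt0.
have s0 : 0 <= sin x by apply: sin_ge0_pi; rewrite x0.
have K : 4 * sin x ^+ 2 * (N%:R * a ^+ 2) <= N%:R * (2 * (k * l / N%:R)) ^+ 2.
  apply: le_trans U; apply: le_trans E; rewrite -/m c2 ler_wpM2l//.
  by rewrite mulr_ge0// sqr_ge0.
rewrite mN -ler_sqr ?nnegrE ?mulr_ge0 ?(ltW a0) ?(ltW N0)//.
have -> : (a * N%:R * sin x) ^+ 2 = 4 * sin x ^+ 2 * (N%:R * a ^+ 2) * (N%:R / 4).
  by move: (sin x) => y; field.
have -> : (l * k) ^+ 2 = N%:R * (2 * (k * l / N%:R)) ^+ 2 * (N%:R / 4).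
  by field; rewrite gt_eqF.
by rewrite ler_wpM2r// divr_ge0// ltW.
Qed.

(* The polygons inscribed in a closed curve of length [l] at [2^j] equidistant
   parameters. *)
Lemma curve_bound (G : subgroupE2 R) k (p : R -> plane R) a l :
  embeds G k -> 0 <= k -> 0 < a -> 0 <= l ->
  (forall s t, enorm (p s - p t) <= l * `|s - t|) ->
  (forall s, exists2 g, elems G g & p (s + 1) = act g (p s)) ->
  (forall s g, elems G g -> a <= enorm (p s - act g (p (s + 2^-1)))) ->
  pi * a <= l * k.
Proof.
move=> Gk k0 a0 l0 plip pper pfar.
have p0 := @pi_gt0 R.
rewrite leNgt; apply/negP => h.
pose e := pi * a - l * k.
have e0 : 0 < e by rewrite subr_gt0.
(* With [x = pi / N] the estimate [x (1 - x) <= sin x] loses [pi a x] against the limit; [j] is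
   chosen so that this is less than the gap [e]. *)
pose j := Num.bound (pi * a * pi / e).
have hj : pi * a * pi / e < j%:R.
  by apply: archi_boundP; rewrite divr_ge0 ?mulr_ge0// ltW.
have jN : j%:R < (2 ^ j.+1)%:R :> R.
  by rewrite ltr_nat (ltn_trans (ltn_expl j (isT : 1 < 2)%N))// ltn_exp2l.
have := curve_bound_dyadic j Gk k0 a0 l0 plip pper pfar.
set N := (2 ^ j.+1)%N.
have N0 : 0 < N%:R :> R by rewrite ltr0n expn_gt0.
have N2 : 2 <= N%:R :> R by rewrite (ler_nat _ 2 N) /N expnS leq_pmulr// expn_gt0.
set x := pi / N%:R.
have x2 : 0 <= x <= pi / 2.
  rewrite divr_ge0 ?pi_ge0//= ler_pdivrMr// -mulrA ler_peMr ?pi_ge0//.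
  by rewrite ler_pdivlMl// mulr1.
have h1 : x * cos x <= sin x.
  by apply: sin_ge_mul_cos; move: x2 => /andP[-> ?] /=; lra.
have h2 := cos_ge_1B x2.
have h3 : x * (1 - x) <= sin x.
  by apply: le_trans h1; rewrite ler_wpM2l//; case/andP: x2.
move=> H.
have h4 : a * N%:R * (x * (1 - x)) <= l * k.
  by apply: le_trans H; apply: ler_wpM2l => //; apply: mulr_ge0 => //; exact: ltW.
have : pi * a - pi * a * x <= l * k.
  apply: le_trans h4; rewrite le_eqVlt; apply/orP; left; apply/eqP.
  by rewrite /x; move: pi p0 => q q0; field; rewrite gt_eqF.
have : pi * a * x < e.
  rewrite /x mulrA ltr_pdivrMr// [ltRHS]mulrC -ltr_pdivrMr//.
  exact: lt_trans jN.
rewrite /e; lra.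
Qed.
End CurveBound.

(** * Discreteness *)

Section Discrete.
Variable R : realType.
Implicit Types (G : subgroupE2 R) (x y : plane R).

Lemma isolated_separation G : elems G `<=` isolated (elems G) ->
  exists2 e : R, 0 < e & forall g, elems G g ->
    (forall i j, `|(1%:M : 'M[R]_2) i j - g.1 i j| < e) ->
    (forall i, `|g.2 i 0| < e) -> g = aff1 R.
Proof.
move=> /(_ _ (elems1 G))[_ [V /nbhs_ballP[e /= e0 eV] VG]].
exists e => // g Gg h1 h2.
suff : (V `&` elems G) g by rewrite VG.
split=> //; apply: eV; split; split=> // i j.
by rewrite ord1 /ball/= mxE sub0r normrN; exact: h2.
Qed.

Lemma orth_entry (g : affine R) i j : orth g -> `|g.1 i j| <= 1.
Proof.
move=> /orthP[h1 _ h3].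
rewrite -(@ler_sqr R) ?nnegrE// expr1n real_normK ?num_real//.
have := sqr_ge0 (g.1 0 0); have := sqr_ge0 (g.1 1 0).
have := sqr_ge0 (g.1 0 1); have := sqr_ge0 (g.1 1 1).
by case: (I2P i) => ->; case: (I2P j) => ->; lra.
Qed.

Lemma truncn_eq_dist (N a b : R) : 0 < N -> 0 <= a -> 0 <= b ->
  Num.truncn (N * a) = Num.truncn (N * b) -> `|a - b| < N^-1.
Proof.
move=> N0 a0 b0 E.
have := truncn_itv (mulr_ge0 (ltW N0) a0); have := truncn_itv (mulr_ge0 (ltW N0) b0).
rewrite E -natr1 => /andP[h1 h2] /andP[h3 h4].
have : `|N * (a - b)| < 1 by rewrite mulrBr ltr_norml; apply/andP; split; lra.
by rewrite normrM gtr0_norm// mulrC -ltr_pdivlMr// div1r.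
Qed.

(** Pigeonhole on the six entries, cut into cells of width [e / 4]: if [g] and [h] share all cells,
    each entry of [h^-1 g] differs from that of the identity by a sum of two products below [e / 4],
    so [h^-1 g] is the identity. *)
Lemma locally_finite_of_isolated G : elems G `<=` isolated (elems G) -> locally_finite G.
Proof.
move=> /isolated_separation[e e0 He] r.
pose N := 4 / e.
have N0 : 0 < N by rewrite divr_gt0.
have NE : N^-1 = e / 4 by rewrite /N invf_div.
pose c := `|r| + 1.
pose ent (g : affine R) (k : 'I_2 * 'I_3) : R :=
  if (k.2 < 2)%N then g.1 k.1 (inord k.2) else g.2 k.1 0.
pose K := Num.truncn (N * (c + c)).
pose phi (g : affine R) : {ffun 'I_2 * 'I_3 -> 'I_K.+1} :=
  [ffun k => inord (Num.truncn (N * (ent g k + c)))].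
have entB g k : elems G g -> enorm (act g 0) <= r -> `|ent g k| <= c.
  move=> Gg gr; rewrite /ent /c; case: ifP => _.
    by rewrite (le_trans (orth_entry _ _ (elems_orth Gg)))// lerDr.
  have -> : g.2 = act g 0 by rewrite /act mulmx0 add0r.
  have gr' : enorm (act g 0) <= `|r| + 1 by rewrite (le_trans gr)// ler_wpDr// ler_norm.
  by apply: le_trans gr'; case: (I2P k.1) => ->; [exact: coord0_le|exact: coord1_le].
set A := [set g | _]; rewrite -/A.
have phi_inj g h : A g -> A h -> phi g = phi h -> g = h.
  move=> [Gg gr] [Gh hr] E.
  have gO := elems_orth Gg; have hO := elems_orth Gh.
  have clos k : `|ent g k - ent h k| < e / 4.
    have := entB g k Gg gr; have := entB h k Gh hr.
    rewrite !ler_norml => /andP[h1 h2] /andP[h3 h4].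
    have -> : ent g k - ent h k = (ent g k + c) - (ent h k + c) by ring.
    rewrite -NE; apply: truncn_eq_dist => //; [lra|lra|].
    have /ffunP/(_ k) := E; rewrite !ffunE => /(congr1 val) /=.
    rewrite !inordK// ltnS /K le_truncn// ler_pM2l//; lra.
  have c1 i j : `|g.1 i j - h.1 i j| < e / 4.
    have jE : (inord j : 'I_3) = j :> nat by rewrite inordK// (ltn_trans (ltn_ord j)).
    by have := clos (i, inord j); rewrite /ent (_ : (i, inord j).2 = inord j)// jE ltn_ord inord_val.
  have c2 i : `|g.2 i 0 - h.2 i 0| < e / 4.
    by have := clos (i, inord 2); rewrite /ent (_ : (i, inord 2).2 = inord 2)// inordK.
  suff E1 : affM (affV h) g = aff1 R by rewrite -[g]aff1M -(affMV hO) -affMA E1 affM1.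
  have prod (a b a' b' : R) : `|a| <= 1 -> `|b| < e / 4 -> `|a'| <= 1 -> `|b'| < e / 4 -> `|a * b + a' * b'| < e.
    move=> a1 b1 a2 b2; apply: le_lt_trans (ler_normD _ _) _; rewrite !normrM.
    have : `|a| * `|b| <= `|b| by rewrite ler_piMl.
    have : `|a'| * `|b'| <= `|b'| by rewrite ler_piMl.
    lra.
  have En i j : `|h.1^T i j| <= 1 by rewrite mxE orth_entry.
  apply: He; first by apply: elemsM => //; exact: elemsV.
    move=> i j; rewrite distrC.
    have -> : (affM (affV h) g).1 i j - (1%:M : 'M[R]_2) i j = (h.1^T *m (g.1 - h.1)) i j.
      by rewrite mulmxBr hO /affM /affV /= !mxE.
    by rewrite mulmx2E; apply: prod => //; rewrite !mxE; exact: c1.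
  move=> i; have -> : (affM (affV h) g).2 = h.1^T *m (g.2 - h.2) by rewrite /affM /affV /= mulmxBr.
  by rewrite mulmx2E; apply: prod => //; rewrite planeD planeN; exact: c2.
pose psi (z : {ffun _}) := if pselect (exists2 g, A g & phi g = z) is left H then s2val (cid2 H) else aff1 R.
apply: (@sub_finite_set _ _ (psi @` setT)); last exact/finite_image/finite_finset.
move=> g Ag; exists (phi g) => //; rewrite /psi.
case: pselect => [H|]; last by case; exists g.
by case: cid2 => h /= Ah; exact: phi_inj.
Qed.

Lemma locally_finite_sub G G' : elems G' `<=` elems G -> locally_finite G -> locally_finite G'.
Proof. by move=> sub GF r; apply: sub_finite_set (GF r) => g [/sub]. Qed.

Lemma lip_continuous (h : plane R -> R) : (forall x y, h x <= h y + enorm (x - y)) -> continuous h.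
Proof.
move=> lip x; apply/(@cvgrPdist_lt R R (plane R) (nbhs x) (nbhs_filter x) h (h x)) => e e0; near=> y.
rewrite ltr_norml.
have xy : enorm (x - y) < e.
  apply: le_lt_trans (enorm_le_coord _) _; rewrite !planeE.
  have : ball x (e / 2) y by near: y; apply: nbhsx_ballx; rewrite divr_gt0.
  case=> _ H; have := H 0 0; have := H 1 0; rewrite /ball/= => h1 h2.
  by rewrite [ltRHS](splitr e) ltrD.
have := lip x y; have := lip y x; rewrite (enormB y x); move=> ? ?.
by apply/andP; split; lra.
Unshelve. all: by end_near. Qed.

Definition cobounded G : Prop := exists r, forall x, exists2 g, elems G g & enorm (x - act g 0) <= r.

(** The distance to the orbit of the origin is a continuous function on the compact orbit space,
    hence bounded. *)
Lemma cobounded_of_compact G : locally_finite G -> compact [set: orbit_space G] -> cobounded G.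
Proof.
move=> GF Gc.
pose f (a : orbit_space G) : R := orbit_dist a (orb G 0).
have fE x : f (\pi_(orbit_space G) x) = orbit_dist (orb G x) (orb G 0) by [].
have lip x y : orbit_dist (orb G x) (orb G 0) <= orbit_dist (orb G y) (orb G 0) + enorm (x - y).
  have [g Gg ->] := orbit_dist_min y 0 GF.
  rewrite addrC; apply: le_trans (enorm_triangle _ _ _).
  exact: orbit_dist_le.
have hc : continuous (fun x => orbit_dist (orb G x) (orb G 0)) by exact: lip_continuous.
have fc : continuous f by apply/quotient_continuous.
have : compact (f @` [set: orbit_space G]).
  by apply: continuous_compact => //; apply: continuous_subspaceT.
move=> /compact_bounded[r [_ Hr]].
exists (r + 1) => x.
have [g Gg hg] := orbit_dist_min x 0 GF; exists g => //.
rewrite -hg; apply: le_trans (ler_norm _) _.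
by apply: (Hr (r + 1)); [rewrite ltrDl|exists (orb G x)].
Qed.

End Discrete.

(** * Rotations *)

Section DiscreteSubgroup.
Variable R : realType.

(** Division with remainder by the least positive element. *)
Lemma discrete_subgroup (S : set R) (x0 : R) :
  S x0 -> x0 != 0 -> (forall x y, S x -> S y -> S (x - y)) ->
  finite_set [set x | S x /\ 0 < x <= `|x0|] ->
  exists a, [/\ 0 < a, S a & forall x, S x -> exists k : int, x = k%:~R * a].
Proof.
move=> S0 x00 SB SF.
have S00 : S 0 by rewrite -(subrr x0); exact: SB.
have SN x : S x -> S (- x) by move=> Sx; rewrite -sub0r; exact: SB.
have Sabs : S `|x0| by case: (ger0P x0) => // _; exact: SN.
have [|a [Sa /andP[a0 ax]] Hmin] := @finite_argmin R R [set x | S x /\ 0 < x <= `|x0|] id SF.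
  by exists `|x0|; split=> //; rewrite normr_gt0 x00/=.
exists a; split=> // x Sx; exists (Num.floor (x / a)).
have SM (k : nat) : S (k%:R * a).
  elim: k => [|k IH]; first by rewrite mul0r.
  by rewrite -natr1 mulrDl mul1r -[a in X in S (_ + X)]opprK; apply: SB => //; exact: SN.
have SZ (k : int) : S (k%:~R * a).
  by case: k => k; rewrite ?NegzE ?mulrNz ?mulNr -?pmulrn; [exact: SM|apply: SN; exact: SM].
have := floor_itv (x / a); set k := Num.floor _.
rewrite ler_pdivlMr// ltr_pdivrMr// intrD1 mulrDl mul1r => /andP[h1 h2].
have Sd : S (x - k%:~R * a) by exact: SB.
apply/eqP; rewrite -subr_eq0; apply/negPn/negP => d0.
have d1 : 0 < x - k%:~R * a by rewrite lt_neqAle eq_sym d0 subr_ge0.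
have : a <= x - k%:~R * a by apply: Hmin; split=> //; rewrite d1/=; lra.
lra.
Qed.
End DiscreteSubgroup.

Section Rotations.
Variable R : realType.
Implicit Types (G : subgroupE2 R) (x y p : plane R) (t : R).

Definition rotmx t : 'M[R]_2 := mx2 (cos t) (- sin t) (sin t) (cos t).

Lemma rotmxD s t : rotmx (s + t) = rotmx s *m rotmx t.
Proof. by apply: mx2P; rewrite mulmx2E !mx2E ?cosD ?sinD; ring. Qed.

Lemma rotmx0 : rotmx 0 = 1%:M.
Proof. by apply: mx2P; rewrite !mx2E !mxE ?cos0 ?sin0 ?oppr0. Qed.

Lemma rotmxN t : (rotmx t)^T = rotmx (- t).
Proof. by apply: mx2P; rewrite mxE !mx2E ?cosN ?sinN ?opprK. Qed.

Lemma det_rotmx t : \det (rotmx t) = 1.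
Proof. by rewrite det2 !mx2E mulNr opprK -!expr2 cos2Dsin2. Qed.

Lemma rotmx_2pi : rotmx (2 * pi) = 1%:M.
Proof. by rewrite mulr_natl -rotmx0; apply: mx2P; rewrite !mx2E ?cos2pi ?sin2pi ?cos0 ?sin0. Qed.

Lemma angle_exists (a c : R) : a ^+ 2 + c ^+ 2 = 1 ->
  exists2 t, 0 <= t < 2 * pi & a = cos t /\ c = sin t.
Proof.
move=> h; have p0 := @pi_gt0 R.
have a1 : -1 <= a <= 1.
  by have c2 := sqr_ge0 c; apply/andP; split; nra.
have ain : a \in `[-1, 1] by rewrite in_itv.
have := acos_ge0 a1; have := acos_lepi a1 => tp t0.
have sE : sin (acos a) = `|c|.
  by rewrite sin_acos// -[X in Num.sqrt X](_ : c ^+ 2 = _) ?sqrtr_sqr//; lra.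
have [c0|c0] := leP 0 c.
  by exists (acos a); [apply/andP; split; lra|rewrite acosK// sE ger0_norm].
have t1 : 0 < acos a.
  rewrite lt_neqAle t0 andbT eq_sym; apply/eqP => E.
  by move: sE; rewrite E sin0 => /esym/normr0_eq0; lra.
exists (2 * pi - acos a); first by apply/andP; split; lra.
have -> : cos (2 * pi - acos a) = cos (- acos a).
  by rewrite addrC mulr_natl cosD2pi.
have -> : sin (2 * pi - acos a) = sin (- acos a).
  by rewrite addrC mulr_natl sinD2pi.
by rewrite cosN sinN acosK// sE ltr0_norm// opprK.
Qed.

Lemma orth_rotmx (g : affine R) : orth g -> \det g.1 = 1 ->
  exists2 t, 0 <= t < 2 * pi & g.1 = rotmx t.
Proof.
move=> gO gd; have [h1 h2 h3] := orth_det1 gO gd.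
have [t tb [ct st]] := angle_exists h3.
by exists t => //; apply: mx2P; rewrite !mx2E ?h1 ?h2 ?ct ?st.
Qed.

Lemma rotmx_eq1 t : -(2 * pi) < t < 2 * pi -> rotmx t = 1%:M -> t = 0.
Proof.
move=> /andP[t1 t2] /matrixP/(_ 0 0); rewrite mx2E mxE /= => c1.
have s0 : sin (t / 2) = 0.
  apply/eqP; rewrite -sqrf_eq0; apply/eqP.
  have := cos_mulr2n (t / 2).
  by rewrite -[(t / 2) *+ 2]mulr_natr mulfVK// c1 cos2sin2 mulr2n; lra.
have [t0|t0|//] := ltgtP t 0.
  have : 0 < sin (- (t / 2)) by apply: sin_gt0_pi; apply/andP; split; lra.
  by rewrite sinN s0 oppr0 ltxx.
have : 0 < sin (t / 2) by apply: sin_gt0_pi; apply/andP; split; lra.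
by rewrite s0 ltxx.
Qed.

Definition rotp p t : affine R := (rotmx t, p - rotmx t *m p).

Lemma act_rotp p t x : act (rotp p t) x = rotmx t *m (x - p) + p.
Proof. by rewrite /act /rotp /= mulmxBr addrA addrAC. Qed.

Lemma rotp_fix p t : act (rotp p t) p = p.
Proof. by rewrite act_rotp subrr mulmx0 add0r. Qed.

Lemma rotpD p s t : rotp p (s + t) = affM (rotp p s) (rotp p t).
Proof. by apply: aff_eq => x; rewrite actM !act_rotp addrK rotmxD mulmxA. Qed.

Lemma rotp0 p : rotp p 0 = aff1 R.
Proof. by apply: aff_eq => x; rewrite act_rotp rotmx0 mul1mx subrK act1. Qed.

Lemma rotp_orth p t : orth (rotp p t).
Proof. by rewrite /orth /= rotmxN -rotmxD addNr rotmx0. Qed.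

Lemma rotpN p t : rotp p (- t) = affV (rotp p t).
Proof.
rewrite -[LHS]affM1 -(affMV (rotp_orth p t)) affMA -rotpD addNr rotp0.
by rewrite aff1M.
Qed.

Lemma rotpP p (g : affine R) : orth g -> \det g.1 = 1 -> act g p = p ->
  exists2 t, 0 <= t < 2 * pi & g = rotp p t.
Proof.
move=> gO gd gp; have [t tb gt] := orth_rotmx gO gd; exists t => //.
apply: aff_eq => x; rewrite act_rotp -gt -actB.
by rewrite -{2}gp addrAC addrK.
Qed.

(** The angles of all rotations of [G] about [p], taken in the real line, form a discrete subgroup
    containing [2 pi]. If [a] generates it and [2 pi = m a], counting the rotations gives
    [m = n]. *)
Lemma rotations_card G p n : rotations_at G p #= `I_n ->
  [/\ (0 < n)%N, elems G (rotp p (2 * pi / n%:R)) &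
   forall g, rotations_at G p g -> exists2 k, (k < n)%N & g = rotp p (2 * pi / n%:R * k%:R)].
Proof.
move=> card_n; have p0 := @pi_gt0 R.
have fin : finite_set (rotations_at G p) by apply/finite_setP; exists n.
pose S : set R := [set t | elems G (rotp p t)].
have S2 : S (2 * pi) by rewrite /S /= /rotp rotmx_2pi mul1mx subrr; exact: elems1.
have SD (x y : R) : S x -> S y -> S (x - y).
  by move=> Sx Sy; rewrite /S /= rotpD rotpN; apply: elemsM => //; exact: elemsV.
have inS t : S t -> rotations_at G p (rotp p t).
  by move=> St; split=> //; [rewrite det_rotmx|rewrite rotp_fix].
have inj s t : 0 <= s < 2 * pi -> 0 <= t < 2 * pi -> rotp p s = rotp p t -> s = t.
  move=> /andP[s0 s2] /andP[t0 t2] [E _]; apply/eqP; rewrite -subr_eq0; apply/eqP.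
  apply: rotmx_eq1; first by apply/andP; split; lra.
  by rewrite rotmxD E -rotmxD subrr rotmx0.
pose ang (g : affine R) := if pselect (exists2 t, 0 <= t < 2 * pi & g = rotp p t) is left H
  then s2val (cid2 H) else 0.
have angK t : 0 <= t < 2 * pi -> ang (rotp p t) = t.
  move=> tb; rewrite /ang; case: pselect => [H|]; last by case; exists t.
  by case: cid2 => s /= sb /esym; exact: inj.
have SF : finite_set [set x | S x /\ 0 < x <= `|2 * pi|].
  apply: (@sub_finite_set _ _ ((ang @` rotations_at G p) `|` [set 2 * pi])).
    move=> x [Sx /andP[x0]]; rewrite ger0_norm; last by lra.
    rewrite le_eqVlt => /orP[/eqP->|x2]; [by right|left].
    by exists (rotp p x); [exact: inS|apply: angK; rewrite x2 ltW].
  by rewrite finite_setU; split; [exact: finite_image|exact: finite_set1].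
have p20 : 2 * pi != 0 :> R by rewrite mulf_neq0// gt_eqF.
have [a [a0 Sa Ha]] := discrete_subgroup S2 p20 SD SF.
have [m mE] := Ha _ S2.
have m0 : 0 < m by rewrite -(ltr_int R) -(pmulr_lgt0 _ a0) -mE; lra.
case: m m0 mE => // m m0 mE; rewrite -pmulrn in mE.
have Sk (k : nat) : S (a * k%:R).
  elim: k => [|k IH]; first by rewrite mulr0 /S /= rotp0; exact: elems1.
  rewrite -natr1 mulrDr mulr1 -[X in S (_ + X)]opprK; apply: SD => //.
  by rewrite /S /= rotpN; apply: elemsV.
have kb (k : nat) : (k < m)%N -> 0 <= a * k%:R < 2 * pi.
  by move=> km; rewrite mulr_ge0 ?(ltW a0)//= mE mulrC ltr_pM2r// ltr_nat.
have SE g : rotations_at G p g -> exists2 k, (k < m)%N & g = rotp p (a * k%:R).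
  move=> [Gg gd gp]; have [t /andP[t0 t2] gE] := rotpP (elems_orth Gg) gd gp.
  have [k kE] : exists k : int, t = k%:~R * a by apply: Ha; rewrite /S /= -gE.
  have k0 : 0 <= k by rewrite -(ler_int R) -(pmulr_lge0 _ a0) -kE.
  case: k k0 kE => // k _; rewrite -pmulrn => kE; exists k; last by rewrite gE kE mulrC.
  by move: t2; rewrite kE mE ltr_pM2r// ltr_nat.
have nm : n = m.
  apply/card_eq_II; apply: card_eq_trans (card_esym card_n) _.
  have <- : (fun k => rotp p (a * k%:R)) @` `I_m = rotations_at G p.
    apply/seteqP; split=> [g [k km <-]|g /SE[k km ->]]; first exact/inS/Sk.
    by exists k.
  apply: inj_card_eq => k l; rewrite !inE => km lm /inj.
  move=> /(_ (kb _ km) (kb _ lm)) /(mulfI (lt0r_neq0 a0)) /eqP.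
  by rewrite eqr_nat => /eqP.
have aE : 2 * pi / n%:R = a.
  by rewrite mE nm mulrAC divff ?mul1r// pnatr_eq0 -lt0n.
rewrite aE nm; split=> //.
Qed.

End Rotations.

(** * Cone points and signatures *)

Section ConePoints.
Variable R : realType.
Implicit Types (G : subgroupE2 R) (x y p : plane R) (t : R).

Definition dir t : plane R := pt (cos t) (sin t).

Lemma rotmx_dir s t : rotmx s *m dir t = dir (s + t).
Proof. by apply: planeP; rewrite mulmx2E !mx2E !ptE ?cosD ?sinD; ring. Qed.

Lemma enorm_dirB s t : enorm (dir s - dir t) = 2 * `|sin ((s - t) / 2)|.
Proof.
apply/eqP; rewrite -(@eqrXn2 _ 2%N) ?enorm_ge0 ?mulr_ge0//; apply/eqP.
rewrite enorm_sqr exprMn real_normK ?num_real// /dotp !planeE.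
have -> : (cos s - cos t) * (cos s - cos t) + (sin s - sin t) * (sin s - sin t) =
  (cos s ^+ 2 + sin s ^+ 2) + (cos t ^+ 2 + sin t ^+ 2) - 2 * (cos s * cos t + sin s * sin t) by ring.
rewrite !cos2Dsin2 -cosB.
have := cos_mulr2n ((s - t) / 2).
by rewrite -[((s - t) / 2) *+ 2]mulr_natr mulfVK// cos2sin2 => ->; rewrite mulr2n; lra.
Qed.

Lemma enorm_dirB_le s t : enorm (dir s - dir t) <= `|s - t|.
Proof.
rewrite enorm_dirB -ler_pdivlMl// (le_trans (normr_sin_le _))//.
by rewrite normrM normfV normr_nat mulrC.
Qed.

(* The bound is realised by small circles around the cone point. *)
Lemma cone_point_bound G n p k : locally_finite G -> cone_point G n p ->
  0 <= k -> embeds G k -> n%:R * sin (pi / (2 * n%:R)) <= k.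
Proof.
move=> GF [n2 card_n nomirror] k0 Gk.
have p0 := @pi_gt0 R.
have [n0 Grot Hrot] := rotations_card card_n.
have nn : 2 <= n%:R :> R by rewrite (ler_nat _ 2 n).
have nz : n%:R != 0 :> R by rewrite gt_eqF//; lra.
have fixE g : elems G g -> act g p = p -> exists2 k, (k < n)%N & g = rotp p (2 * pi / n%:R * k%:R).
  move=> Gg gp; have [gd|gd] := orth_det (elems_orth Gg); first exact: Hrot.
  by case: nomirror; exists g.
(* The radius is a quarter of the least positive displacement of [p], so that an element moving [p]
   keeps points of the circle at least [2 r] apart. *)
have [r r0 Hr] : exists2 r : R, 0 < r & forall g, elems G g -> act g p != p -> 4 * r <= enorm (p - act g p).
  have [[g0 Gg0 g0p]|none] := pselect (exists2 g, elems G g & act g p != p); last first.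
    by exists 1 => // g Gg gp; case: none; exists g.
  have [g [Gg gp] Hg] := @closest_orbit_point _ G p p [set g | elems G g /\ act g p != p] GF
    (fun g H => proj1 H) (ex_intro _ g0 (conj Gg0 g0p)).
  exists (enorm (p - act g p) / 4).
    by rewrite divr_gt0// enorm_gt0 subr_eq0 eq_sym.
  by move=> h Gh hp; rewrite mulrC mulfVK//; apply: Hg.
pose c s := p + r *: dir (2 * pi / n%:R * s).
have cp s : enorm (c s - p) = r.
  rewrite /c [p + _]addrC addrK enormZ gtr0_norm// enormE /dotp !ptE -!expr2.
  by rewrite cos2Dsin2 sqrtr1 mulr1.
have w0 : 0 < 2 * pi / n%:R :> R by rewrite divr_gt0 ?mulr_gt0//; lra.
have rc t s : act (rotp p t) (c s) = p + r *: dir (t + 2 * pi / n%:R * s).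
  by rewrite act_rotp /c [p + _ *: _]addrC addrK -scalemxAr rotmx_dir addrC.
set y := pi / (2 * n%:R).
have y0 : 0 < y by apply: divr_gt0 => //; lra.
have yhalf : y <= pi / 4.
  by rewrite ler_pdivrMr; [nra | lra].
have s0 : 0 < sin y by apply: sin_gt0_pi; apply/andP; split; lra.
have s1 : sin y <= 1 by exact: sin_le1.
suff : pi * (2 * r * sin y) <= 2 * pi * r / n%:R * k.
  have -> : pi * (2 * r * sin y) = (n%:R * sin y) * (2 * pi * r / n%:R).
    by move: (sin y) => z; move: pi => q; field.
  have X0 : 0 < 2 * pi * r / n%:R by apply: divr_gt0; [rewrite !mulr_gt0|lra].
  by rewrite [leRHS]mulrC (ler_pM2r X0).
apply: (@curve_bound _ G k c (2 * r * sin y) (2 * pi * r / n%:R) Gk k0).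
- by rewrite !mulr_gt0.
- by rewrite divr_ge0 ?mulr_ge0 ?(ltW p0) ?(ltW r0)//; lra.
- move=> s t; rewrite /c opprD addrACA subrr add0r -scalerBr enormZ gtr0_norm//.
  have -> : 2 * pi * r / n%:R * `|s - t| = r * (2 * pi / n%:R * `|s - t|).
    by move: pi => q; field.
  rewrite ler_pM2l//; apply: le_trans (enorm_dirB_le _ _) _.
  by rewrite -mulrBr normrM gtr0_norm.
- move=> s; exists (rotp p (2 * pi / n%:R)) => //.
  by rewrite rc /c mulrDr mulr1 [_ * s + _]addrC.
- move=> s g Gg; have [gp|gp] := eqVneq (act g p) p; last first.
    have := Hr g Gg gp; have := enorm_triangle p (c s) (act g p).
    have := enorm_triangle (c s) (act g (c (s + 2^-1))) (act g p).
    rewrite (enorm_act _ _ (elems_orth Gg)) (enormB p (c s)) !cp.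
    have h : 2 * r * sin y <= 2 * r by rewrite ler_piMr ?mulr_ge0 ?(ltW r0).
    lra.
  have [j jn ->] := fixE g Gg gp.
  (* Half a period is the angle [pi / n]; after [j] further turns the two points subtend
     [(2j + 1) pi / n], and the chord is [2 r sin ((2j + 1) y)] with [(2j + 1) y] between [y] and
     [pi - y]. *)
  rewrite rc /c opprD addrACA subrr add0r -scalerBr enormZ gtr0_norm// enorm_dirB.
  rewrite (mulrC 2 r) -(mulrA r 2) ler_pM2l// ler_pM2l//.
  rewrite -normrN -sinN.
  have -> : - ((2 * pi / n%:R * s - (2 * pi / n%:R * j%:R + 2 * pi / n%:R * (s + 2^-1))) / 2) =
     y * (j.*2.+1)%:R.
    have -> : (j.*2.+1)%:R = 2 * j%:R + 1 :> R by rewrite -natr1 -mul2n natrM.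
    by rewrite /y; move: pi => q; field.
  apply: le_trans (ler_norm _).
  have yn : y * (n.*2)%:R = pi by rewrite /y -muln2 natrM; move: pi => q; field.
  have z1 : y <= y * (j.*2.+1)%:R by rewrite ler_pMr// ler1n.
  have z2 : y * (j.*2.+1)%:R <= pi - y.
    rewrite -yn -{3}[y]mulr1 -mulrBr ler_pM2l// lerBrDr natr1 ler_nat.
    by rewrite -doubleS leq_double.
  move: (y * _) z1 z2 => z z1 z2.
  rewrite -[sin y]cosBpihalf -[sin z]cosBpihalf -cosN opprB.
  have [zh|zh] := leP z (pi / 2).
    by rewrite -[X in _ <= X]cosN opprB; apply: ler_cos_pi; lra.
  by apply: ler_cos_pi; lra.
Qed.

Lemma no_mirror_det1 G p g : ~ on_mirror G p -> elems G g -> act g p = p -> \det g.1 = 1.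
Proof.
by move=> nm Gg gp; have [//|gd] := orth_det (elems_orth Gg); case: nm; exists g.
Qed.

Lemma det_affM (g h : affine R) : \det (affM g h).1 = \det g.1 * \det h.1.
Proof. exact: det_mulmx. Qed.

Lemma det_affV (g : affine R) : \det (affV g).1 = \det g.1.
Proof. exact: det_tr. Qed.

Lemma det_aff1 : \det (aff1 R).1 = 1.
Proof. exact: det1. Qed.

(** Composition with one reflection at [p] exchanges rotations and reflections. *)
Lemma reflections_card G n p : on_mirror G p -> rotations_at G p #= `I_n ->
  reflections_at G p #= `I_n.
Proof.
move=> [s [Gs sd sp]] /card_eqPle card_n.
have sO := elems_orth Gs.
have <- : (affM s) @` rotations_at G p = reflections_at G p.
  apply/seteqP; split=> [_ [g [Gg gd gp] <-]|g [Gg gd gp]].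
    split; [exact: elemsM|by rewrite det_affM sd gd mulr1|by rewrite actM gp].
  exists (affM (affV s) g); last by rewrite affMA affMV// aff1M.
  split; first by apply: elemsM => //; exact: elemsV.
    by rewrite det_affM det_affV sd gd mulrNN mulr1.
  by rewrite actM gp -{1}sp actV.
apply: card_eq_trans (inj_card_eq _) (iffRL (card_eqPle _ _) card_n) => g h _ _ E.
by rewrite -[g]aff1M -(affVM sO) -affMA E affMA affVM// aff1M.
Qed.

(** The link between the group and its signature: the centre of a rotation in [G] must show up as a
    cone point or as a corner, with the order of its rotation group. *)
Lemma rotation_center G p g : locally_finite G -> elems G g -> \det g.1 = 1 ->
  act g p = p -> g <> aff1 R ->
  exists n, [/\ (2 <= n)%N, rotations_at G p #= `I_n &
    cone_point G n p \/ corner_point G n p].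
Proof.
move=> GF Gg gd gp g1.
have : finite_set (rotations_at G p).
  apply: sub_finite_set (GF (enorm p + enorm p)) => h [Gh hd hp]; split=> //.
  have -> : act h 0 = p + (act h 0 - act h p) by rewrite hp addrC subrK.
  apply: le_trans (enormD _ _) _; rewrite lerD2l enorm_act ?sub0r ?enormN//.
  exact: elems_orth Gh.
move=> /finite_setP[n card_n]; exists n.
have [n0 _ H] := rotations_card card_n.
have n2 : (2 <= n)%N.
  case: n n0 H card_n => [//|[|//]] _ H _.
  have [[|//] _ gE] := H g (And3 Gg gd gp).
  by move: g1; rewrite gE mulr0 rotp0.
split=> //; have [m|nm] := pselect (on_mirror G p).
  by right; split=> //; exact: reflections_card.
by left.
Qed.

Lemma rotation_fixpoint (g : affine R) : orth g -> \det g.1 = 1 -> g.1 <> 1%:M ->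
  exists p, act g p = p.
Proof.
move=> gO gd g1; have [h1 h2 h3] := orth_det1 gO gd.
set a := g.1 0 0 in h1 h3; set c := g.1 1 0 in h2 h3.
set v := g.2 0 0; set w := g.2 1 0.
have D0 : 1 - a != 0.
  apply/eqP => a1; have a1' : a = 1 by lra.
  have c0 : c = 0 by apply/eqP; rewrite -sqrf_eq0; apply/eqP; move: h3; rewrite a1' expr1n; lra.
  apply: g1; apply: mx2P; rewrite ?h1 ?h2 -?/a -?/c ?a1' ?c0 !mxE//= ?oppr0//.
(* Cramer's rule for [(1 - A) p = t], whose determinant is [(1 - a)^2 + c^2 = 2 (1 - a)]. *)
exists (pt (((1 - a) * v - c * w) / (2 * (1 - a))) ((c * v + (1 - a) * w) / (2 * (1 - a)))).
have h3' : c ^+ 2 = 1 - a ^+ 2 by lra.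
have E q z : (c * (c * q) : R) = (1 - a ^+ 2) * q by rewrite mulrA -expr2 h3'.
apply: planeP; rewrite act_coord !ptE ?h1 ?h2 -/a -/c -/v -/w.
  apply/eqP; rewrite -subr_eq0; apply/eqP.
  transitivity ((1 - a ^+ 2 - c ^+ 2) * v / (2 * (1 - a))); first by field.
  by rewrite h3'; field.
apply/eqP; rewrite -subr_eq0; apply/eqP.
transitivity ((1 - a ^+ 2 - c ^+ 2) * w / (2 * (1 - a))); first by field.
by rewrite h3'; field.
Qed.

End ConePoints.

Section Signatures.
Variable R : realType.
Implicit Types (G : subgroupE2 R) (p : plane R).

Lemma lists_orders_mem G P ks k p : lists_orders G P ks -> P k p -> k \in ks.
Proof.
move=> [s [_ <- H]] Pk; apply/mapP; exists (orb G p, k) => //.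
by apply/H; exists p.
Qed.

Lemma lists_orders_ex G P ks k : lists_orders G P ks -> k \in ks -> exists p, P k p.
Proof.
by move=> [s [_ <- H]] /mapP[[a k'] /H[p _ Pk] ->]; exists p.
Qed.

Lemma boundaries_corner G bs k p : lists_boundaries G bs -> corner_point G k p ->
  exists2 b, b \in bs & k \in b.
Proof.
move=> [Cs [_ sz Ccomp Hb]] [k2 card_k].
have mp : on_mirror G p.
  apply: contrapT => /asboolP; rewrite asbool_neg => /negP nm.
  have : reflections_at G p = set0.
    by apply/seteqP; split=> // g Gg; case: nm; apply/asboolP; exists g.
  move=> E; move: card_k; rewrite E => /card_esym/card_eqPle[h _].
  by move: h; rewrite card_le0 => /eqP/seteqP[/(_ 0%N) h _]; apply: h; exact: leq_trans k2.
have lp : @mirror_locus R G (orb G p) by exists p.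
pose C := connected_component (@mirror_locus R G) (orb G p).
have CC : C \in Cs by apply/Ccomp; exists (orb G p).
have ib : (index C Cs < size bs)%N by rewrite -sz index_mem.
exists (nth [::] bs (index C Cs)); first exact: mem_nth.
apply: (lists_orders_mem (p := p) (Hb _ ib)); split; last by split.
by rewrite nth_index//; exact: connected_component_refl.
Qed.

Lemma boundaries_corner_ex G bs b k : lists_boundaries G bs -> b \in bs -> k \in b ->
  exists p, corner_point G k p.
Proof.
move=> [Cs [_ sz Ccomp Hb]] bbs kb; have ib : (index b bs < size bs)%N by rewrite index_mem.
have [|p [_ ?]] := lists_orders_ex (Hb _ ib) (k := k); first by rewrite nth_index.
by exists p.
Qed.

Lemma boundaries_mirror_ex G b bs : lists_boundaries G (b :: bs) -> exists p, on_mirror G p.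
Proof.
move=> [[|C Cs] [_ //= sz Ccomp _]].
by have /Ccomp[a [p mp _] _] := mem_head C Cs; exists p.
Qed.

Lemma boundaries_nil_mirror G p : lists_boundaries G [::] -> ~ on_mirror G p.
Proof.
move=> [[|C Cs] [_ //= sz Ccomp _]] mp.
suff : connected_component (@mirror_locus R G) (orb G p) \in (@nil (set (orbit_space G))) by [].
by apply/Ccomp; exists (orb G p) => //; exists p.
Qed.

Lemma crosscap_det G k : crosscap_number G k.+1 -> exists2 g, elems G g & \det g.1 = -1.
Proof. by move=> [[gam [/(_ ord0)[_ _ [g Gg [gd _]]]]] _ _]; exists g. Qed.

End Signatures.

(** * Reflections and chambers *)

Section Reflections.
Variable R : realType.
Implicit Types (G : subgroupE2 R) (x y p n : plane R) (c : R).

(** The linear part is the Householder matrix [1 - 2 n n^T]; for a unit vector [n] this is the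
    reflection in the line [dotp n x = c], and [sdist] is the signed distance to it. *)
Definition refl n c : affine R :=
  (mx2 (1 - 2 * n 0 0 ^+ 2) (- 2 * n 0 0 * n 1 0) (- 2 * n 0 0 * n 1 0) (1 - 2 * n 1 0 ^+ 2),
   (2 * c) *: n).

Definition sdist n c x : R := dotp n x - c.

Lemma act_refl n c x : act (refl n c) x = x - (2 * sdist n c x) *: n.
Proof.
by apply: planeP; rewrite !planeE /= !mx2E /sdist /dotp; ring.
Qed.

Lemma sdist_refl n c x : dotp n n = 1 -> sdist n c (act (refl n c) x) = - sdist n c x.
Proof. by move=> n1; rewrite /sdist act_refl dotpDr dotpNr dotpZr n1 /sdist; ring. Qed.

Lemma reflK n c x : dotp n n = 1 -> act (refl n c) (act (refl n c) x) = x.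
Proof.
by move=> n1; rewrite [LHS]act_refl sdist_refl// act_refl mulrN scaleNr opprK subrK.
Qed.

Lemma refl_orth n c : dotp n n = 1 -> orth (refl n c).
Proof.
rewrite /dotp => n1; rewrite /orth; apply: mx2P; rewrite mulmx2E ![_^T _ _]mxE !mx2E mxE /=.
- by transitivity (1 + 4 * n 0 0 ^+ 2 * (n 0 0 * n 0 0 + n 1 0 * n 1 0 - 1)); [ring|rewrite n1; ring].
- by transitivity (4 * n 0 0 * n 1 0 * (n 0 0 * n 0 0 + n 1 0 * n 1 0 - 1)); [ring|rewrite n1; ring].
- by transitivity (4 * n 0 0 * n 1 0 * (n 0 0 * n 0 0 + n 1 0 * n 1 0 - 1)); [ring|rewrite n1; ring].
- by transitivity (1 + 4 * n 1 0 ^+ 2 * (n 0 0 * n 0 0 + n 1 0 * n 1 0 - 1)); [ring|rewrite n1; ring].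
Qed.

Lemma det_refl n c : dotp n n = 1 -> \det (refl n c).1 = -1.
Proof.
rewrite det2 !mx2E /dotp => n1.
by transitivity (1 - 2 * (n 0 0 * n 0 0 + n 1 0 * n 1 0)); [ring|rewrite n1; ring].
Qed.

(** This identity turns a minimal distance over an orbit into a statement about sides: reflecting
    [y] does not bring it closer to [x] exactly when the mirror does not separate them. *)
Lemma refl_dist n c x y : dotp n n = 1 ->
  enorm (x - act (refl n c) y) ^+ 2 = enorm (x - y) ^+ 2 + 4 * sdist n c x * sdist n c y.
Proof.
move=> n1; rewrite !enorm_sqr act_refl opprB addrCA addrC.
rewrite !dotpDl !dotpDr !dotpZl !dotpZr n1 !dotpNl !dotpNr !(dotpC _ n) /sdist; ring.
Qed.

Lemma sdist_lip n c x y : dotp n n = 1 -> `|sdist n c x - sdist n c y| <= enorm (x - y).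
Proof.
move=> n1; have -> : sdist n c x - sdist n c y = dotp n (x - y).
  by rewrite /sdist dotpDr dotpNr; ring.
by rewrite (le_trans (dotp_norm_le _ _))// (enormE n) n1 sqrtr1 mul1r.
Qed.

Lemma reflP (g : affine R) p : orth g -> \det g.1 = -1 -> act g p = p ->
  exists n c, [/\ dotp n n = 1, g = refl n c & dotp n p = c].
Proof.
move=> gO gd gp; have [h1 h2 h3] := orth_detN1 gO gd.
have [n [n1 gE]] : exists n : plane R, dotp n n = 1 /\
    g.1 = mx2 (1 - 2 * n 0 0 ^+ 2) (- 2 * n 0 0 * n 1 0) (- 2 * n 0 0 * n 1 0) (1 - 2 * n 1 0 ^+ 2).
  move: h1 h2 h3; set a := g.1 0 0; set b := g.1 1 0 => h1 h2 h3.
  have [a1|a1] := eqVneq a 1.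
    have b0 : b = 0 by apply/eqP; rewrite -sqrf_eq0; apply/eqP; move: h3; rewrite a1 expr1n; lra.
    exists (pt 0 1); split; first by rewrite /dotp !ptE; ring.
    by apply: mx2P; rewrite !mx2E !ptE ?h1 ?h2 -?/a -?/b ?a1 ?b0; ring.
  have a2 : 0 < 2 * (1 - a).
    have b2 := sqr_ge0 b; have ale : a <= 1 by nra.
    by rewrite mulr_gt0// subr_gt0 lt_neqAle a1.
  (* The normal is the direction of [A e_1 - e_1 = (a - 1, b)], of squared length [2 (1 - a)]; the
     case [a = 1], where it vanishes, is the reflection with normal [e_2]. *)
  set s := Num.sqrt (2 * (1 - a)).
  have s2 : s ^+ 2 = 2 * (1 - a) by rewrite sqr_sqrtr// ltW.
  have s0 : s != 0 by rewrite gt_eqF// sqrtr_gt0.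
  have bE : b ^+ 2 = 1 - a ^+ 2 by lra.
  have a3 : 2 * (1 - a) != 0 by rewrite gt_eqF.
  have a4 : 1 - a != 0 by apply: contraNneq a3 => ->; rewrite mulr0.
  have E1 : ((a - 1) / s) ^+ 2 = (1 - a) / 2.
    by rewrite expr_div_n s2; field.
  have E2 : (b / s) ^+ 2 = (1 + a) / 2.
    by rewrite expr_div_n s2 bE; field.
  have E3 : (a - 1) / s * (b / s) = - b / 2.
    by rewrite mulrACA -invfM -expr2 s2; field.
  exists (pt ((a - 1) / s) (b / s)); split.
    by rewrite /dotp !ptE -!expr2 E1 E2; lra.
  by apply: mx2P; rewrite !mx2E !ptE ?E1 ?E2 -?(mulrA (-2)) ?E3 ?h1 ?h2 -/a -/b; lra.
exists n, (dotp n p); split=> //; apply: aff_eq => x.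
have -> : act g x = act g p + g.1 *m (x - p) by rewrite -actB addrC subrK.
rewrite gp act_refl gE /sdist; apply: planeP; rewrite !(planeE, mulmx2E, mx2E) /dotp; ring.
Qed.

Definition mirror G n c := dotp n n = 1 /\ elems G (refl n c).

Lemma mirror_conj G n c (g : affine R) : mirror G n c -> elems G g ->
  exists n' c', mirror G n' c' /\ (forall x, sdist n' c' (act g x) = sdist n c x) /\
    refl n' c' = affM g (affM (refl n c) (affV g)).
Proof.
move=> [n1 Gr] Gg; have gO := elems_orth Gg.
exists (g.1 *m n), (c + dotp (g.1 *m n) g.2).
have E x : sdist (g.1 *m n) (c + dotp (g.1 *m n) g.2) (act g x) = sdist n c x.
  by rewrite /sdist /act dotpDr dotp_orth//; ring.
have E2 : refl (g.1 *m n) (c + dotp (g.1 *m n) g.2) = affM g (affM (refl n c) (affV g)).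
  apply: aff_eq => x; rewrite !actM -{1}(actVK x gO); move: (act (affV g) x) => y.
  by rewrite act_refl E [in RHS]act_refl /act mulmxBr -scalemxAr addrAC.
split; [split|split] => //; first by rewrite dotp_orth.
by rewrite E2; apply: elemsM => //; apply: elemsM => //; exact: elemsV.
Qed.

Lemma mirror_conjV G n c (g : affine R) : mirror G n c -> elems G g ->
  exists n' c', mirror G n' c' /\ (forall x, sdist n' c' x = sdist n c (act g x)) /\
   refl n' c' = affM (affV g) (affM (refl n c) g).
Proof.
move=> m Gg; have gO := elems_orth Gg.
have [n' [c' [m' [E E2]]]] := mirror_conj m (elemsV Gg); exists n', c'; split=> //.
by split; [move=> x; rewrite -E actV|rewrite E2 affVK].
Qed.

Lemma on_mirrorP G p : on_mirror G p <-> exists n c, mirror G n c /\ sdist n c p = 0.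
Proof.
split=> [[g [Gg gd gp]]|[n [c [[n1 Gr] h]]]].
  have [n [c [n1 gE np]]] := reflP (elems_orth Gg) gd gp.
  by exists n, c; split; [split; rewrite -?gE|rewrite /sdist np subrr].
exists (refl n c); split=> //; first exact: det_refl.
by rewrite act_refl h mulr0 scale0r subr0.
Qed.

(** Elements are treated one at a time, and a ball free of fixed points of the previous ones is
    kept. If the next element fixes its centre, a small move towards a point that it does not fix
    leaves its fixed set, and the ball is shrunk. *)
Lemma generic_point_seq (s : seq (affine R)) x (r : R) : 0 < r ->
  exists y d, [/\ enorm (x - y) < r, 0 < d & forall g, g \in s -> orth g -> g <> aff1 R ->
    forall z, enorm (y - z) < d -> act g z <> z].
Proof.
elim: s r => [|g s IH] r r0.
  by exists x, 1; split=> //; rewrite subrr enorm0.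
have [y [d [xy d0 Hd]]] := IH (r / 2) (divr_gt0 r0 (ltr0n _ 2)).
have [[gO g1]|triv] := pselect (orth g /\ g <> aff1 R); last first.
  exists y, d; split=> //; first lra.
  by move=> h; rewrite inE => /predU1P[->|]; [move=> *; case: triv|exact: Hd].
have [z [zd gz]] : exists z, enorm (y - z) < Num.min (d / 2) (r / 2) /\ act g z <> z.
  have m0 : 0 < Num.min (d / 2) (r / 2) by rewrite lt_min !divr_gt0.
  have [gy|gy] := pselect (act g y = y); last first.
    by exists y; split=> //; rewrite subrr enorm0.
  have [w gw] : exists w, act g w <> w.
    by apply: contrapT => /forallNP H; apply: g1; apply: aff_eq => w; rewrite act1; apply: contrapT; exact: H.
  set m := Num.min _ _ in m0 *.
  pose t := m / (2 * (enorm (y - w) + 1)).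
  have e0 := enorm_ge0 (y - w).
  have t0 : 0 < t by rewrite divr_gt0//; lra.
  exists ((1 - t) *: y + t *: w); split.
    have -> : y - ((1 - t) *: y + t *: w) = t *: (y - w).
      by apply: planeP; rewrite !planeE; ring.
    rewrite enormZ gtr0_norm// /t mulrAC ltr_pdivrMr; last lra.
    by rewrite ltr_pM2l//; lra.
  rewrite act_conv gy => /addrI /eqP; rewrite -subr_eq0 -scalerBr scaler_eq0 (gt_eqF t0)/=.
  by rewrite subr_eq0 => /eqP.
rewrite lt_min in zd; case/andP: zd => zd zr.
pose e := enorm (act g z - z).
have e0 : 0 < e by rewrite enorm_gt0 subr_eq0; apply/eqP.
exists z, (Num.min (d / 2) (e / 2)); split.
- by apply: le_lt_trans (enorm_triangle _ y _) _; lra.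
- by rewrite lt_min !divr_gt0.
move=> h; rewrite inE => /predU1P[->|hs] hO h1 w; rewrite lt_min => /andP[wd we].
  move=> gw; have : e <= enorm (act g z - act g w) + enorm (w - z).
    by have := enorm_triangle (act g z) (act g w) z; rewrite {2}gw.
  by rewrite enorm_act// enormB (enormB w); lra.
by apply: Hd => //; apply: le_lt_trans (enorm_triangle _ z _) _; lra.
Qed.

(** An element fixing a point within distance 1 of the origin moves the origin by at most 2, so
    finitely many elements have to be avoided. *)
Lemma generic_point G : locally_finite G -> exists x0, forall g, elems G g -> act g x0 = x0 -> g = aff1 R.
Proof.
move=> GF; have /finite_seqP[s sE] := GF 2.
have [y [d [y1 d0 Hd]]] := generic_point_seq s 0 ltr01.
exists y => g Gg gy; apply: contrapT => g1.
have : g \in s.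
  suff : [set` s] g by [].
  rewrite -sE; split=> //; have -> : act g 0 = (act g 0 - act g y) + y by rewrite gy subrK.
  apply: le_trans (enormD _ _) _; rewrite enorm_act; last exact: elems_orth Gg.
  by move: y1; rewrite !sub0r !enormN; lra.
move=> gs; apply: (Hd g gs (elems_orth Gg) g1 y) => //.
by rewrite subrr enorm0.
Qed.

End Reflections.

Section Chamber.
Variables (R : realType) (G : subgroupE2 R) (x0 : plane R).
Hypothesis GF : locally_finite G.
Hypothesis x0_generic : forall g, elems G g -> act g x0 = x0 -> g = aff1 R.
Implicit Types (x y z p n : plane R) (c : R).

(** The product of signed distances is the same for [(n, c)] and [(- n, - c)], so that no
    orientation of the mirrors has to be chosen. *)
Definition chamber x := forall n c, mirror G n c -> 0 <= sdist n c x0 * sdist n c x.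
Definition ichamber x := forall n c, mirror G n c -> 0 < sdist n c x0 * sdist n c x.

Lemma sdist_x0 n c : mirror G n c -> sdist n c x0 != 0.
Proof.
move=> [n1 Gr]; apply/eqP => h.
have := x0_generic Gr; rewrite act_refl h mulr0 scale0r subr0 => /(_ erefl) E.
by have := det_refl c n1; rewrite E det_aff1; lra.
Qed.

Lemma ichamber_x0 : ichamber x0.
Proof. by move=> n c m; rewrite -expr2 exprn_even_gt0//= sdist_x0. Qed.

Lemma ichamberW x : ichamber x -> chamber x.
Proof. by move=> Hx n c m; apply/ltW/Hx. Qed.

Lemma same_sign (a b c : R) : 0 < a * b -> 0 <= b * c -> 0 <= a * c.
Proof.
move=> ab bc; have : 0 <= (a * b) * (b * c) by rewrite mulr_ge0// ltW.
have -> : (a * b) * (b * c) = b ^+ 2 * (a * c) by ring.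
by rewrite pmulr_rge0// exprn_even_gt0//=; apply: contraTneq ab => ->; rewrite mulr0 ltxx.
Qed.

Lemma same_sign_lt (a b c : R) : 0 < a * b -> 0 < b * c -> 0 < a * c.
Proof.
move=> ab bc; have : 0 < (a * b) * (b * c) by rewrite mulr_gt0.
have -> : (a * b) * (b * c) = b ^+ 2 * (a * c) by ring.
by rewrite pmulr_rgt0// exprn_even_gt0//=; apply: contraTneq ab => ->; rewrite mulr0 ltxx.
Qed.

Lemma closest_same_side x y :
  (forall h, elems G h -> enorm (x - y) <= enorm (x - act h y)) ->
  forall n c, mirror G n c -> 0 <= sdist n c x * sdist n c y.
Proof.
move=> Hy n c [n1 Gr]; have := Hy _ Gr.
rewrite -ler_sqr ?nnegrE ?enorm_ge0// refl_dist//; lra.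
Qed.

(** The point of the orbit closest to [x0] is separated from [x0] by no mirror. *)
Lemma chamber_repr x : exists2 g, elems G g & chamber (act g x).
Proof.
have [g Gg Hg] := closest_in_orbit x0 x GF; exists g => //.
apply: closest_same_side => h Gh; rewrite -actM; apply: Hg; exact: elemsM.
Qed.

Lemma ichamber_act y x g : elems G g -> ichamber y -> ichamber (act g y) ->
  ichamber x -> ichamber (act g x).
Proof.
move=> Gg iy igy ix n c m.
have [n' [c' [m' [E _]]]] := mirror_conjV m Gg.
apply: same_sign_lt (igy _ _ m) _; rewrite -!E.
by apply: same_sign_lt (ix _ _ m'); rewrite mulrC; exact: iy.
Qed.

Definition chamber_stab g := elems G g /\ ichamber (act g x0).

(** A closest point [h y] to [x] is separated from [x] by no mirror, and it lies on none because [y]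
    does not; hence [h] maps the open chamber to itself. *)
Lemma chamber_stab_closest x y g : ichamber x -> ichamber y -> elems G g ->
  exists2 h, chamber_stab h & enorm (x - act h y) <= enorm (x - act g y).
Proof.
move=> ix iy Gg; have [h Gh Hh] := closest_in_orbit x y GF; exists h; last exact: Hh.
split=> //; apply: (ichamber_act Gh iy _ ichamber_x0) => n c m.
have : 0 <= sdist n c x * sdist n c (act h y).
  apply: closest_same_side m => k Gk; rewrite -actM; apply: Hh; exact: elemsM.
move=> /(same_sign (ix _ _ m)); rewrite le_eqVlt => /orP[|//]; rewrite eq_sym mulf_eq0.
rewrite (negbTE (sdist_x0 m))/= => /eqP h0.
have [n' [c' [m' [E _]]]] := mirror_conjV m Gh.
by have := iy _ _ m'; rewrite !E h0 mulr0 ltxx.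
Qed.

Hypothesis chamber_bounded : exists B, forall x, chamber x -> enorm x <= B.

Lemma chamber_stab_finite : finite_set [set g | chamber_stab g].
Proof.
have [B HB] := chamber_bounded.
apply: sub_finite_set (GF (enorm x0 + B)) => g [Gg ig]; split=> //.
have -> : act g 0 = (act g 0 - act g x0) + act g x0 by rewrite subrK.
apply: le_trans (enormD _ _) _; rewrite enorm_act; last exact: elems_orth Gg.
by rewrite sub0r enormN lerD2l HB//; exact: ichamberW.
Qed.

Lemma chamber_stab1 : chamber_stab (aff1 R).
Proof. by split; [exact: elems1 | rewrite act1; exact: ichamber_x0]. Qed.

Lemma chamber_stabM g h : chamber_stab g -> chamber_stab h -> chamber_stab (affM g h).
Proof.
move=> [Gg ig] [Gh ih]; split; first exact: elemsM.
by rewrite actM; exact: (ichamber_act Gg ichamber_x0).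
Qed.

Lemma chamber_stabV g : chamber_stab g -> chamber_stab (affV g).
Proof.
move=> [Gg ig]; split; first exact: elemsV.
apply: (@ichamber_act (act g x0)) => //; first exact: elemsV.
  by rewrite actV; [exact: ichamber_x0|exact: elems_orth Gg].
exact: ichamber_x0.
Qed.

Lemma act_sum (I : Type) (s : seq I) (F : I -> plane R) (g : affine R) :
  \sum_(i <- s) act g (F i) = g.1 *m (\sum_(i <- s) F i) + (size s)%:R *: g.2.
Proof.
elim: s => [|i s IH]; first by rewrite !big_nil mulmx0 scale0r addr0.
rewrite !big_cons IH mulmxDr /= -natr1 scalerDl scale1r /act.
by rewrite [_ *: _ + g.2]addrC addrACA.
Qed.

(* The barycentre of the orbit of [x0] under the stabiliser. *)
Lemma chamber_stab_fix : exists2 p, ichamber p & forall g, chamber_stab g -> act g p = p.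
Proof.
have /finite_seqP[s0 sE0] := chamber_stab_finite.
pose s := undup s0.
have sE g : (g \in s) <-> chamber_stab g.
  rewrite mem_undup; suff : (g \in s0) = `[< chamber_stab g >] by move=> ->; split=> /asboolP.
  by apply/idP/asboolP => [gs|]; [|]; have /seteqP[h1 h2] := sE0; [exact: h2|exact: h1].
have s_gt0 : 0 < (size s)%:R :> R.
  rewrite ltr0n; have /sE := chamber_stab1; by case: (s).
pose p := (size s)%:R^-1 *: \sum_(g <- s) act g x0.
exists p => [n c m|g Sg].
  have -> : sdist n c p = (size s)%:R^-1 * \sum_(g <- s) sdist n c (act g x0).
    have E : forall t : seq (affine R), dotp n (\sum_(g <- t) act g x0) = \sum_(g <- t) sdist n c (act g x0) + (size t)%:R * c.
      elim=> [|g t IH]; first by rewrite !big_nil /dotp !plane0 /= !mulr0 mul0r !addr0.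
      by rewrite !big_cons dotpDr IH /= -natr1 /sdist; ring.
    by rewrite /sdist /p dotpZr E mulrDr mulrA mulVf ?gt_eqF// mul1r addrK.
  rewrite mulrCA pmulr_rgt0 ?invr_gt0// mulr_sumr.
  have : forall t : seq (affine R), (0 < size t)%N -> (forall g, g \in t -> chamber_stab g) ->
     0 < \sum_(g <- t) sdist n c x0 * sdist n c (act g x0).
    elim=> [//|g t IH] _ Ht; rewrite big_cons.
    have g0 : 0 < sdist n c x0 * sdist n c (act g x0).
      by have [_ ig] := Ht g (mem_head _ _); exact: ig.
    case: t IH Ht => [|h t] IH Ht; first by rewrite big_nil addr0.
    by rewrite addr_gt0// IH// => k kt; apply: Ht; rewrite inE kt orbT.
  by apply=> [|g /sE//]; rewrite -(ltr_nat R).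
have gO : orth g by case: Sg => /elems_orth.
have perm : perm_eq [seq affM g h | h <- s] s.
  apply: uniq_perm; rewrite ?undup_uniq//.
    rewrite map_inj_uniq ?undup_uniq// => h k E.
    by rewrite -[h]aff1M -(affVM gO) -affMA E affMA affVM// aff1M.
  move=> h; apply/mapP/idP => [[k /sE Sk ->]|/sE Sh]; first by apply/sE; exact: chamber_stabM.
  exists (affM (affV g) h); last by rewrite affMA affMV// aff1M.
  by apply/sE; apply: chamber_stabM => //; exact: chamber_stabV.
have E : \sum_(h <- s) act g (act h x0) = \sum_(h <- s) act h x0.
  rewrite -[RHS](perm_big _ perm) big_map; apply: eq_bigr => h _; by rewrite actM.
rewrite {1}/act {1}/p -scalemxAr.
have -> : g.2 = (size s)%:R^-1 *: ((size s)%:R *: g.2).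
  by rewrite scalerA mulVf ?gt_eqF// scale1r.
by rewrite -scalerDr -act_sum E.
Qed.

Lemma ichamber_conv x t : chamber x -> 0 < t -> t <= 1 -> ichamber ((1 - t) *: x + t *: x0).
Proof.
move=> cx t0 t1 n c m.
have -> : sdist n c ((1 - t) *: x + t *: x0) = (1 - t) * sdist n c x + t * sdist n c x0.
  by rewrite /sdist dotpDr !dotpZr; ring.
have h1 := cx _ _ m; have h2 := ichamber_x0 m.
have -> : sdist n c x0 * ((1 - t) * sdist n c x + t * sdist n c x0) =
  (1 - t) * (sdist n c x0 * sdist n c x) + t * (sdist n c x0 * sdist n c x0) by ring.
by apply: ltr_wpDl; [apply: mulr_ge0 => //; lra|exact: mulr_gt0].
Qed.

(* Density of the interior of the chamber. *)
Lemma chamber_stab_closest_closed x y g : chamber x -> chamber y -> elems G g ->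
  exists2 h, chamber_stab h & enorm (x - act h y) <= enorm (x - act g y).
Proof.
move=> cx cy Gg.
have [h Sh Hh] : exists2 h, chamber_stab h &
    forall k, chamber_stab k -> enorm (x - act h y) <= enorm (x - act k y).
  apply: (@closest_orbit_point _ G x y [set k | chamber_stab k]) => //.
    by move=> k [].
  by exists (aff1 R); exact: chamber_stab1.
exists h => //; apply/ler_addgt0Pr => e e0.
(* Both points move by the fraction [t] towards [x0], which changes the two distances by at most
   [2 M t <= e] in total. *)
pose M := enorm (x - x0) + enorm (y - x0) + 1.
have M0 : 0 < M by rewrite ltr_wpDl// addr_ge0 ?enorm_ge0.
pose t := Num.min 1 (e / (2 * M)).
have t0 : 0 < t by rewrite lt_min ltr01 divr_gt0// mulr_gt0.
have t1 : t <= 1 by rewrite ge_min lexx.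
have te : t * (2 * M) <= e.
  by rewrite -ler_pdivlMr ?mulr_gt0// ge_min lexx orbT.
pose xt := (1 - t) *: x + t *: x0; pose yt := (1 - t) *: y + t *: x0.
have [k Sk Hk] := chamber_stab_closest (ichamber_conv cx t0 t1) (ichamber_conv cy t0 t1) Gg.
rewrite -/xt -/yt in Hk.
have dx : enorm (x - xt) = t * enorm (x - x0).
  by rewrite (_ : x - xt = t *: (x - x0)) ?enormZ ?gtr0_norm//; apply: planeP; rewrite !planeE; ring.
have dy : enorm (y - yt) = t * enorm (y - x0).
  by rewrite (_ : y - yt = t *: (y - x0)) ?enormZ ?gtr0_norm//; apply: planeP; rewrite !planeE; ring.
apply: le_trans (Hh k Sk) _.
have [Gk _] := Sk.
have := enorm_triangle x xt (act k y); have := enorm_triangle xt (act k yt) (act k y).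
have := enorm_triangle xt x (act g yt); have := enorm_triangle x (act g y) (act g yt).
rewrite !enorm_act; [|exact: elems_orth Gk|exact: elems_orth Gg].
rewrite (enormB xt x) (enormB yt y) dx dy.
move: te Hk; rewrite /M.
have := enorm_ge0 (x - x0); have := enorm_ge0 (y - x0); nra.
Qed.

End Chamber.

(** * Chambers with a rotation centre *)

Section Corner.
Variable R : realType.
Implicit Types (G : subgroupE2 R) (x y z p n t : plane R) (c : R).

Definition trans t : affine R := (1%:M, t).

Lemma act_trans t x : act (trans t) x = x + t.
Proof. by rewrite /act /= mul1mx. Qed.

Lemma trans_orth t : orth (trans t).
Proof. by rewrite /orth /= trmx1 mul1mx. Qed.

Lemma transD s t : trans (s + t) = affM (trans s) (trans t).
Proof. by apply: aff_eq => x; rewrite actM !act_trans [s + t]addrC addrA. Qed.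

Lemma transN t : trans (- t) = affV (trans t).
Proof.
apply: aff_eq => x; rewrite -{2}(subrK t x) -(act_trans t (x - t)) actV ?act_trans//.
exact: trans_orth.
Qed.

Lemma elems_transD G s t : elems G (trans s) -> elems G (trans t) -> elems G (trans (s + t)).
Proof. by rewrite transD; exact: elemsM. Qed.

Lemma elems_transN G t : elems G (trans t) -> elems G (trans (- t)).
Proof. by rewrite transN; exact: elemsV. Qed.

Lemma elems_transB G s t : elems G (trans s) -> elems G (trans t) -> elems G (trans (s - t)).
Proof. by move=> Gs /elems_transN; exact: elems_transD. Qed.

Lemma elems_trans0 G : elems G (trans 0).
Proof. exact: elems1. Qed.

Lemma elems_transMz G t (k : int) : elems G (trans t) -> elems G (trans (k%:~R *: t)).
Proof.
move=> Gt; have H (m : nat) : elems G (trans (m%:R *: t)).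
  elim: m => [|m IH]; first by rewrite scale0r; exact: elems_trans0.
  by rewrite -natr1 scalerDl scale1r; exact: elems_transD.
case: k => m; first exact: H.
by rewrite NegzE mulrNz scaleNr; apply: elems_transN; exact: H.
Qed.

(** Rank 2 of the translation lattice, stated as: no nonzero linear functional kills all translation
    vectors. *)
Definition spans G : Prop := forall n, n != 0 -> exists2 t, elems G (trans t) & dotp n t != 0.

Lemma mirror_trans G n c t : mirror G n c -> elems G (trans t) -> mirror G n (c + dotp n t).
Proof.
move=> [n1 Gr] Gt; split=> //.
have -> : refl n (c + dotp n t) = affM (trans t) (affM (refl n c) (trans (- t))).
  apply: aff_eq => x; rewrite !actM !act_trans !act_refl /sdist dotpDr dotpNr.
  by apply: planeP; rewrite !planeE; ring.
by apply: elemsM => //; apply: elemsM => //; exact: elems_transN.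
Qed.

Definition cross x y : R := x 0 0 * y 1 0 - x 1 0 * y 0 0.

Lemma bounded_of_two_dotp (n1 n2 : plane R) (x0 : plane R) (b1 b2 : R) : cross n1 n2 != 0 ->
  exists B, forall x, `|dotp n1 x - dotp n1 x0| <= b1 -> `|dotp n2 x - dotp n2 x0| <= b2 -> enorm x <= B.
Proof.
move=> D0; set D := cross n1 n2 in D0.
exists (enorm x0 + (`|n2 1 0 / D| * b1 + `|n1 1 0 / D| * b2 + (`|n2 0 0 / D| * b1 + `|n1 0 0 / D| * b2))) => x h1 h2.
have -> : x = x0 + (x - x0) by rewrite addrC subrK.
apply: le_trans (enormD _ _) _; rewrite lerD2l.
apply: le_trans (enorm_le_coord _) _.
set u := dotp n1 x - dotp n1 x0 in h1; set v := dotp n2 x - dotp n2 x0 in h2.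
have E0 : (x - x0) 0 0 = n2 1 0 / D * u - n1 1 0 / D * v.
  by rewrite /u /v /dotp !planeE; rewrite /D /cross in D0 *; field.
have E1 : (x - x0) 1 0 = n1 0 0 / D * v - n2 0 0 / D * u.
  by rewrite /u /v /dotp !planeE; rewrite /D /cross in D0 *; field.
rewrite E0 E1; apply: lerD.
  by apply: le_trans (ler_normB _ _) _; rewrite !normrM lerD// ler_wpM2l.
by apply: le_trans (ler_normB _ _) _; rewrite !normrM addrC lerD// ler_wpM2l.
Qed.

(** The translates of the mirror by multiples of [t] are mirrors; [x0] lies strictly between two
    consecutive ones, and so does the chamber up to its boundary. *)
Lemma chamber_strip G x0 n c t : mirror G n c -> elems G (trans t) -> dotp n t != 0 ->
  (forall n c, mirror G n c -> sdist n c x0 != 0) ->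
  forall x, chamber G x0 x -> `|dotp n x - dotp n x0| <= `|dotp n t|.
Proof.
move=> m Gt nt0 off.
wlog nt : t Gt nt0 / 0 < dotp n t.
  move=> wl; have [h|h] := ltP 0 (dotp n t); first exact: wl.
  have -> : `|dotp n t| = `|dotp n (- t)| by rewrite dotpNr normrN.
  apply: (wl (- t)); rewrite ?dotpNr ?oppr_eq0//; first exact: elems_transN.
  by rewrite oppr_gt0 lt_neqAle nt0 h.
set tau := dotp n t in nt0 nt *; rewrite gtr0_norm//.
move=> x cx; pose k := Num.floor ((dotp n x0 - c) / tau).
have := floor_itv ((dotp n x0 - c) / tau); rewrite -/k ler_pdivlMr// ltr_pdivrMr// intrD1.
move=> /andP[h1 h2].
have mk (j : int) : mirror G n (c + j%:~R * tau).
  by have := mirror_trans m (elems_transMz j Gt); rewrite dotpZr.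
have m1 := cx _ _ (mk k); have m2 := cx _ _ (mk (k + 1)).
have o1 := off _ _ (mk k); have o2 := off _ _ (mk (k + 1)).
rewrite /sdist intrD1 in m1 m2 o1 o2 *.
have p1 : 0 < dotp n x0 - (c + k%:~R * tau) by rewrite lt_neqAle eq_sym o1; lra.
have p2 : 0 < (c + (k%:~R + 1) * tau) - dotp n x0.
  rewrite lt_neqAle subr_ge0; apply/andP; split; last by lra.
  by apply: contra o2 => /eqP h; apply/eqP; lra.
have m2' : 0 <= (c + (k%:~R + 1) * tau - dotp n x0) * (c + (k%:~R + 1) * tau - dotp n x).
  by move: m2; congr (_ <= _); ring.
rewrite (pmulr_rge0 _ p1) in m1; rewrite (pmulr_rge0 _ p2) in m2'.
by rewrite ler_norml; apply/andP; split; lra.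
Qed.

(** Two mirrors that are not parallel confine the chamber to two crossing strips. *)
Lemma chamber_bounded_of_mirrors G x0 n1 c1 n2 c2 : spans G ->
  mirror G n1 c1 -> mirror G n2 c2 -> cross n1 n2 != 0 ->
  (forall n c, mirror G n c -> sdist n c x0 != 0) ->
  exists B, forall x, chamber G x0 x -> enorm x <= B.
Proof.
move=> sp m1 m2 D0 off.
have nz n c : mirror G n c -> n != 0.
  by move=> [n1' _]; apply/eqP => n0; move: n1'; rewrite n0 /dotp !plane0 mulr0 addr0; lra.
have [t1 Gt1 nt1] := sp _ (nz _ _ m1); have [t2 Gt2 nt2] := sp _ (nz _ _ m2).
have [B HB] := bounded_of_two_dotp x0 `|dotp n1 t1| `|dotp n2 t2| D0.
by exists B => x cx; apply: HB; [apply: (chamber_strip m1 Gt1)|apply: (chamber_strip m2 Gt2)].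
Qed.

Lemma cross_reflections (n1 n2 p : plane R) : dotp n1 n1 = 1 -> dotp n2 n2 = 1 ->
  refl n1 (dotp n1 p) <> refl n2 (dotp n2 p) -> cross n1 n2 != 0.
Proof.
move=> u1 u2 ne; apply/eqP => D0; apply: ne; apply: aff_eq => x.
rewrite !act_refl /sdist; congr (_ - _).
have E (q : plane R) : dotp n1 q *: n1 = dotp n2 q *: n2.
  have d2 : dotp n1 n2 ^+ 2 = 1.
    have : dotp n1 n2 ^+ 2 + cross n1 n2 ^+ 2 = dotp n1 n1 * dotp n2 n2.
      by rewrite /dotp /cross; ring.
    by rewrite D0 u1 u2 expr0n addr0 mulr1.
  have n1E : n1 = dotp n1 n2 *: n2.
    apply: planeP; rewrite planeE.
      transitivity (n1 0 0 * dotp n2 n2); first by rewrite u2 mulr1.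
      transitivity (dotp n1 n2 * n2 0 0 + cross n1 n2 * n2 1 0); first by rewrite /dotp /cross; ring.
      by rewrite D0 mul0r addr0.
    transitivity (n1 1 0 * dotp n2 n2); first by rewrite u2 mulr1.
    transitivity (dotp n1 n2 * n2 1 0 - cross n1 n2 * n2 0 0); first by rewrite /dotp /cross; ring.
    by rewrite D0 mul0r subr0.
  rewrite {1 2}n1E dotpZl scalerA -mulrA [dotp n2 q * _]mulrC mulrA -expr2 d2.
  by rewrite mul1r.
by rewrite -!scalerA !scalerBl !E.
Qed.

Lemma corner_two_mirrors G k p : corner_point G k p ->
  exists n1 c1 n2 c2, [/\ mirror G n1 c1, mirror G n2 c2 & cross n1 n2 != 0].
Proof.
move=> [k2 card_k].
have [g [h [Hg Hh gh]]] : exists g h, [/\ reflections_at G p g, reflections_at G p h & g <> h].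
  apply: contrapT => H.
  have one g h : reflections_at G p g -> reflections_at G p h -> g = h.
    by move=> Hg Hh; apply: contrapT => gh; apply: H; exists g, h.
  have : `I_k #<= `I_1.
    have /card_eqPle[h1 _] := card_esym card_k; apply: (card_le_trans h1).
    have [[g Hg]|H0] := pselect (reflections_at G p !=set0).
      have -> : reflections_at G p = (fun=> g) @` `I_1.
        by apply/seteqP; split=> [h Hh|_ [_ _ <-]//]; exists 0%N => //; exact: one.
      exact: card_image_le.
    have -> : reflections_at G p = set0 by apply/seteqP; split=> // g Hg; case: H0; exists g.
    exact: card_ge0.
  by rewrite card_le_II leqNgt k2.
case: Hg => Gg gd gp; case: Hh => Gh hd hp.
have [n1 [c1 [u1 gE np1]]] := reflP (elems_orth Gg) gd gp.
have [n2 [c2 [u2 hE np2]]] := reflP (elems_orth Gh) hd hp.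
exists n1, c1, n2, c2; split; [by split; rewrite -?gE|by split; rewrite -?hE|].
apply: (cross_reflections (p := p)) => //; rewrite np1 np2 => E; apply: gh; congruence.
Qed.

End Corner.

(** * Polar coordinates and round cones *)

Section ConeMap.
Variable R : realType.
Implicit Types (G : subgroupE2 R) (x y z p : plane R) (t : R).

Lemma polar x : exists t, x = enorm x *: dir t.
Proof.
have [->|x0] := eqVneq x 0; first by exists 0; rewrite enorm0 scale0r.
have e0 : 0 < enorm x by rewrite enorm_gt0.
have : (x 0 0 / enorm x) ^+ 2 + (x 1 0 / enorm x) ^+ 2 = 1.
  rewrite !expr_div_n -mulrDl.
  have -> : x 0 0 ^+ 2 + x 1 0 ^+ 2 = enorm x ^+ 2 by rewrite enorm_sqr /dotp !expr2.
  by rewrite divff// gt_eqF// exprn_gt0.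
move=> /angle_exists[t _ [ct st]]; exists t.
by apply: planeP; rewrite planeE ptE -?ct -?st mulrC divfK// gt_eqF.
Qed.

Definition arg x : R := sval (cid (polar x)).
Lemma argP x : x = enorm x *: dir (arg x).
Proof. by rewrite /arg; case: cid. Qed.

Lemma dist_polar (r s t u : R) : enorm (r *: dir t - s *: dir u) ^+ 2 = r ^+ 2 + s ^+ 2 - 2 * r * s * cos (t - u).
Proof.
rewrite enorm_sqr /dotp !planeE cosB.
transitivity (r ^+ 2 * (cos t ^+ 2 + sin t ^+ 2) + s ^+ 2 * (cos u ^+ 2 + sin u ^+ 2) -
  2 * r * s * (cos t * cos u + sin t * sin u)); first by ring.
by rewrite !cos2Dsin2; ring.
Qed.

Lemma cos_periodZ t (k : int) : cos (t + 2 * pi * k%:~R) = cos t.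
Proof.
have H (m : nat) (s : R) : cos (s + 2 * pi * m%:R) = cos s.
  elim: m => [|m IH]; first by rewrite mulr0 addr0.
  by rewrite -[m.+1%:R]natr1 mulrDr mulr1 addrA [2 * pi]mulr_natl cosD2pi -[pi *+ 2]mulr_natl.
case: k => m; first exact: H.
by rewrite NegzE mulrNz mulrN -(H m.+1 (t - _)) subrK.
Qed.

(* Cone over the circle of length [2 pi / n], on the round cone
   (r cos phi, r sin phi e^{i n theta}) with [q = sin^2 phi]. *)
Definition cone_coord (n : nat) (q : R) (i : 'I_3) (x : plane R) : R :=
  if i == 0 then Num.sqrt (1 - q) * enorm x
  else if i == 1 then Num.sqrt q * (enorm x * cos (n%:R * arg x))
  else Num.sqrt q * (enorm x * sin (n%:R * arg x)).

Lemma cone_coord_dist n q x y : 0 <= q <= 1 ->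
  \sum_i (cone_coord n q i x - cone_coord n q i y) ^+ 2 =
  enorm x ^+ 2 + enorm y ^+ 2 -
  2 * enorm x * enorm y * (1 - q * (1 - cos (n%:R * (arg x - arg y)))).
Proof.
move=> /andP[q0 q1]; rewrite (mulrBr n%:R) cosB.
rewrite !big_ord_recl big_ord0 /cone_coord /=.
set r := enorm x; set s := enorm y.
set ca := cos _; set cb := cos _; set sa := sin _; set sb := sin _.
have q1' : 0 <= 1 - q by rewrite subr_ge0.
rewrite -!mulrBr !exprMn !(sqr_sqrtr q0) (sqr_sqrtr q1').
transitivity ((1 - q) * (r - s) ^+ 2 + q * (r ^+ 2 * (ca ^+ 2 + sa ^+ 2) + s ^+ 2 * (cb ^+ 2 + sb ^+ 2)
  - 2 * r * s * (ca * cb + sa * sb))); first by ring.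
by rewrite !cos2Dsin2; ring.
Qed.

Lemma nearest_turn n t : (0 < n)%N -> exists k : int, `|t - 2 * pi / n%:R * k%:~R| <= pi / n%:R.
Proof.
move=> n0; have nR : 0 < n%:R :> R by rewrite ltr0n.
have p0 := @pi_gt0 R.
set w := 2 * pi / n%:R; have w0 : 0 < w by rewrite divr_gt0// mulr_gt0.
have -> : pi / n%:R = w / 2 by rewrite /w; move: pi => q; field; rewrite gt_eqF.
exists (Num.floor (t / w + 2^-1)).
have := floor_itv (t / w + 2^-1); set k := Num.floor _; rewrite intrD1 => /andP[h1 h2].
have E : t = t / w * w by rewrite divfK// gt_eqF.
rewrite E [w * _]mulrC -mulrBl normrM (gtr0_norm w0) mulrC ler_pM2l// ler_norml.
by apply/andP; split; lra.
Qed.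

(** After [c], orbit distance is a minimum over the rotations about [p], that is, over shifts of the
    polar angle by [2 pi / n]. The cone coordinates do not see these shifts, so each bound may be
    checked at a convenient one. *)
Lemma embeds_of_cone_map G n (q kap : R) p (c : plane R -> plane R) :
  rotations_at G p #= `I_n -> ~ on_mirror G p ->
  (forall x, exists2 g, elems G g & c x = act g x) ->
  (forall x y g, elems G g -> exists h, [/\ elems G h, act h p = p &
     enorm (c x - act h (c y)) <= enorm (c x - act g (c y))]) ->
  0 <= q <= 1 -> 1 <= kap ->
  (forall t, `|t| <= pi / n%:R -> 1 - cos t <= q * (1 - cos (n%:R * t))) ->
  (forall t, q * (1 - cos (n%:R * t)) <= kap ^+ 2 * (1 - cos t)) ->
  embeds G kap.
Proof.
move=> card_n nom cG cmin qb kap1 low up.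
have [n0 Grot Hrot] := rotations_card card_n.
have nR : n%:R != 0 :> R by rewrite pnatr_eq0 -lt0n.
set w := 2 * pi / n%:R in Grot Hrot.
have nw : n%:R * w = 2 * pi by rewrite /w mulrC divfK.
(* Both [E], the squared distance on the round cone, and the law of cosines have the form
   [(r - s)^2] plus [2 r s] times a function of the angle. The comparison thus reduces to [low] and
   [up]. *)
pose E r s t : R := r ^+ 2 + s ^+ 2 - 2 * r * s * (1 - q * (1 - cos (n%:R * t))).
have mid r s t : 0 <= r -> 0 <= s -> E r s t <= kap ^+ 2 * (r ^+ 2 + s ^+ 2 - 2 * r * s * cos t).
  move=> r0 s0; rewrite /E; have := up t; have := sqr_ge0 (r - s).
  have k2 : 1 <= kap ^+ 2 by rewrite expr_ge1//; lra.
  have rs : 0 <= r * s by exact: mulr_ge0.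
  move: (cos _) (cos t) => a b h1 h2.
  have : 0 <= 2 * (r * s) * (kap ^+ 2 * (1 - b) - q * (1 - a)) by rewrite mulr_ge0; lra.
  have : 0 <= (kap ^+ 2 - 1) * (r - s) ^+ 2 by rewrite mulr_ge0//; lra.
  nra.
have lowE r s t : 0 <= r -> 0 <= s -> `|t| <= pi / n%:R -> r ^+ 2 + s ^+ 2 - 2 * r * s * cos t <= E r s t.
  move=> r0 s0 /low h; rewrite /E.
  have : 0 <= 2 * (r * s) * (q * (1 - cos (n%:R * t)) - (1 - cos t)) by rewrite mulr_ge0 ?mulr_ge0//; lra.
  by move: (cos _) (cos t) => a b; lra.
have EZ r s t (k : int) : E r s (t - w * k%:~R) = E r s t.
  by rewrite /E (mulrBr n%:R) (mulrA n%:R) nw -(mulrN (2 * pi)) -mulrNz cos_periodZ.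
have hE h : elems G h -> act h p = p -> exists k : int, h = rotp p (w * k%:~R).
  move=> Gh hp; have hd := no_mirror_det1 nom Gh hp.
  by have [k _ ->] := Hrot h (And3 Gh hd hp); exists k.
have Gk (k : int) : elems G (rotp p (w * k%:~R)).
  have H (m : nat) : elems G (rotp p (w * m%:R)).
    elim: m => [|m IH]; first by rewrite mulr0 rotp0; exact: elems1.
    by rewrite -natr1 mulrDr mulr1 rotpD; exact: elemsM.
  case: k => m; first exact: H.
  by rewrite NegzE mulrNz mulrN rotpN; apply: elemsV; exact: H.
have distE x y (k : int) : enorm (x - act (rotp p (w * k%:~R)) y) ^+ 2 =
   enorm (x - p) ^+ 2 + enorm (y - p) ^+ 2 - 2 * enorm (x - p) * enorm (y - p) *
     cos (arg (x - p) - arg (y - p) - w * k%:~R).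
  rewrite act_rotp opprD addrA addrAC {1}(argP (x - p)) {1}(argP (y - p)) -scalemxAr rotmx_dir.
  by rewrite dist_polar opprD addrA addrAC.
apply: (@embeds_funcs _ G kap 3 (fun i x => cone_coord n q i (c x - p))); first lra.
  move=> g x y Gg; rewrite cone_coord_dist// -/(E _ _ _).
  have [gx Ggx cx] := cG x; have [gy Ggy cy] := cG y.
  have [h [Gh hp hmin]] := cmin x y (affM gx (affM g (affV gy)))
    (elemsM Ggx (elemsM Gg (elemsV Ggy))).
  have e1 : enorm (c x - act h (c y)) <= enorm (x - act g y).
    apply: le_trans hmin _; rewrite !actM cy actV; last exact: elems_orth Ggy.
    by rewrite cx enorm_act//; exact: elems_orth Ggx.
  have [k hk] := hE h Gh hp.
  have := distE (c x) (c y) k; rewrite -hk => dE.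
  rewrite -(EZ _ _ _ k); apply: le_trans (mid _ _ _ _ _) _; rewrite ?enorm_ge0// -dE.
  by rewrite ler_wpM2l ?sqr_ge0// ler_sqr ?nnegrE ?enorm_ge0.
move=> x y; rewrite cone_coord_dist// -/(E _ _ _).
have [gx Ggx cx] := cG x; have [gy Ggy cy] := cG y.
have [k hk] := nearest_turn (arg (c x - p) - arg (c y - p)) n0.
exists (affM (affV gx) (affM (rotp p (w * k%:~R)) gy)).
  by apply: elemsM; [exact: elemsV|exact: elemsM].
rewrite !actM -cy -(enorm_act _ _ (elems_orth Ggx)) actVK; last exact: elems_orth Ggx.
by rewrite -cx distE -(EZ _ _ _ k); apply: lowE; rewrite ?enorm_ge0.
Qed.

End ConeMap.

(** * Cocompact groups contain translations in two directions *)

Section Spans.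
Variable R : realType.
Implicit Types (G : subgroupE2 R) (x y z p n t : plane R) (c : R).

Lemma trans_conj G g t : elems G g -> elems G (trans t) -> elems G (trans (g.1 *m t)).
Proof.
move=> Gg Gt; have gO := elems_orth Gg.
have -> : trans (g.1 *m t) = affM g (affM (trans t) (affV g)).
  apply: aff_eq => x; rewrite !actM !act_trans -{1}(actVK x gO).
  by move: (act (affV g) x) => w; rewrite /act mulmxDr addrAC.
by apply: elemsM => //; apply: elemsM => //; exact: elemsV.
Qed.

Lemma elems_trans_of_lin G g : elems G g -> g.1 = 1%:M -> elems G (trans g.2).
Proof. by case: g => A v /= Gg A1; rewrite /trans -A1. Qed.

Lemma elems_same_lin G g h : elems G g -> elems G h -> g.1 = h.1 ->
  elems G (trans (act g 0 - act h 0)).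
Proof.
move=> Gg Gh E; have gO := elems_orth Gg; have hO := elems_orth Gh.
have -> : trans (act g 0 - act h 0) = affM g (affV h).
  apply: aff_eq => x; rewrite actM act_trans -{1}(actVK x hO).
  move: (act (affV h) x) => w; rewrite /act !mulmx0 !add0r E -addrA.
  by congr (_ + _); rewrite addrC subrK.
by apply: elemsM => //; exact: elemsV.
Qed.

Lemma rotation_fix_unique (g : affine R) x p : orth g -> \det g.1 = 1 -> g.1 <> 1%:M ->
  act g p = p -> act g x = x -> x = p.
Proof.
move=> gO gd g1 gp gx; have [h1 h2 h3] := orth_det1 gO gd.
have D := actB g x p; rewrite gx gp in D.
apply/eqP; rewrite -subr_eq0; apply/eqP; move: D; set v := x - p => D.
have D0 : v 0 0 = (g.1 *m v) 0 0 by rewrite -D.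
have D1 : v 1 0 = (g.1 *m v) 1 0 by rewrite -D.
rewrite !mulmx2E h1 h2 in D0 D1.
have nz : (1 - g.1 0 0) ^+ 2 + g.1 1 0 ^+ 2 != 0.
  rewrite paddr_eq0 ?sqr_ge0// !sqrf_eq0 subr_eq0; apply/negP => /andP[/eqP a1 /eqP c0].
  by apply: g1; apply: mx2P; rewrite ?h1 ?h2 -?a1 ?c0 ?oppr0 !mxE.
apply: planeP; rewrite plane0; apply: (mulfI nz); rewrite mulr0.
  transitivity ((1 - g.1 0 0) * (v 0 0 - (g.1 0 0 * v 0 0 + - g.1 1 0 * v 1 0)) - g.1 1 0 * (v 1 0 - (g.1 1 0 * v 0 0 + g.1 0 0 * v 1 0))); first by ring.
  by rewrite -D0 -D1; ring.
transitivity ((1 - g.1 0 0) * (v 1 0 - (g.1 1 0 * v 0 0 + g.1 0 0 * v 1 0)) + g.1 1 0 * (v 0 0 - (g.1 0 0 * v 0 0 + - g.1 1 0 * v 1 0))); first by ring.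
by rewrite -D0 -D1; ring.
Qed.

Lemma cobounded_moves G p : cobounded G -> exists2 h, elems G h & act h p <> p.
Proof.
move=> [r Hr]; apply: contrapT => H.
have fixp h : elems G h -> act h p = p.
  by move=> Gh; apply: contrapT => hp; apply: H; exists h.
have [h Gh hh] := Hr (p + (`|r| + enorm p + 1) *: pt 1 0).
have e1 : enorm (pt 1 0 : plane R) = 1 by rewrite enormE /dotp !ptE mulr1 mulr0 addr0 sqrtr1.
have h0 : enorm (act h 0 - p) = enorm p.
  by rewrite -{1}(fixp _ Gh) enorm_act ?sub0r ?enormN//; exact: elems_orth Gh.
have : enorm ((`|r| + enorm p + 1) *: pt 1 0) <= r + enorm p.
  have -> : (`|r| + enorm p + 1) *: pt 1 0 = (p + (`|r| + enorm p + 1) *: pt 1 0 - act h 0) + (act h 0 - p).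
    by apply: planeP; rewrite !(planeD, planeN, planeZ); ring.
  by apply: le_trans (enormD _ _) _; rewrite h0 lerD2r.
rewrite enormZ e1 mulr1 ger0_norm; first by have := ler_norm r; lra.
by have := enorm_ge0 p; have := normr_ge0 r; lra.
Qed.

(** The commutator of [g] with a conjugate about another centre has trivial linear part. It is a
    nonzero translation, and [g], being neither trivial nor a half-turn, rotates it to a second
    direction. *)
Lemma spans_of_rotation G g : cobounded G -> elems G g -> \det g.1 = 1 ->
  g.1 <> 1%:M -> g.1 <> - 1%:M -> spans G.
Proof.
move=> Gc Gg gd g1 gN1; have gO := elems_orth Gg.
have [p gp] := rotation_fixpoint gO gd g1.
have [h Gh hp] := cobounded_moves p Gc.
have hO := elems_orth Gh.
have [g' g'E] : exists g', g' = affM h (affM g (affV h)) by eexists.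
have Gg' : elems G g' by rewrite g'E; apply: elemsM => //; apply: elemsM => //; exact: elemsV.
have gO' := elems_orth Gg'.
have gd' : \det g'.1 = 1.
  rewrite g'E !det_affM det_affV gd mul1r.
  by have [->|->] := orth_det hO; rewrite ?mulr1// mulrNN mulr1.
pose k := affM (affM g g') (affM (affV g) (affV g')).
have Gk : elems G k by apply: elemsM; apply: elemsM => //; exact: elemsV.
have k1 : k.1 = 1%:M.
  have [s _ gs] := orth_rotmx gO gd; have [s' _ gs'] := orth_rotmx gO' gd'.
  have -> : k.1 = (g.1 *m g'.1) *m (g.1^T *m g'.1^T) by [].
  rewrite gs gs' !rotmxN -!rotmxD.
  by rewrite (_ : _ + _ = 0) ?rotmx0//; ring.
set t := k.2.
have Gt : elems G (trans t) by exact: elems_trans_of_lin.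
have t0 : t <> 0.
  move=> t0; apply: hp.
  (* A trivial commutator would make the two rotations commute and share the fixed point [p], so
     that [h] would fix [p] as well. *)
  have kE : k = aff1 R by rewrite [k]surjective_pairing k1 -/t t0.
  have comm x : act g (act g' x) = act g' (act g x).
    have := congr1 (fun f => act f (act g' (act g x))) kE.
    by rewrite /= act1 /k !actM actV// actV.
  have g'p : act g' p = p.
    by apply: (rotation_fix_unique gO gd g1 gp); rewrite comm gp.
  have : act (affV h) p = p.
    apply: (rotation_fix_unique gO gd g1 gp).
    by have := congr1 (act (affV h)) g'p; rewrite {1}g'E !actM actV.
  by move=> hp; rewrite -{1}hp actVK.
move=> n n0.
have [nt|nt] := eqVneq (dotp n t) 0; last by exists t.
exists (g.1 *m t); first exact: trans_conj.
have [h1 h2 h3] := orth_det1 gO gd.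
apply/eqP => H; apply: t0.
have c0 : g.1 1 0 != 0.
  apply/eqP => c0; move: h3; rewrite c0 expr0n addr0 => /eqP.
  rewrite sqrf_eq1 => /orP[] /eqP a1.
    by apply: g1; apply: mx2P; rewrite ?h1 ?h2 ?a1 ?c0 ?oppr0 !mxE.
  by apply: gN1; apply: mx2P; rewrite ?h1 ?h2 ?a1 ?c0 ?oppr0 !mxE ?oppr0.
have cr : cross t n = 0.
  apply: (mulfI c0); rewrite mulr0.
  transitivity (dotp n (g.1 *m t) - g.1 0 0 * dotp n t).
    by rewrite /dotp !mulmx2E h1 h2 /cross; ring.
  by rewrite H nt; ring.
have nn : dotp n n != 0 by apply: contraNneq n0 => /dotp_eq0 ->.
rewrite /cross in cr; rewrite /dotp in nt.
apply: planeP; rewrite plane0; apply: (mulfI nn); rewrite mulr0 /dotp.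
  transitivity (n 0 0 * (n 0 0 * t 0 0 + n 1 0 * t 1 0) + n 1 0 * (t 0 0 * n 1 0 - t 1 0 * n 0 0)); first by ring.
  by rewrite nt cr; ring.
transitivity (n 1 0 * (n 0 0 * t 0 0 + n 1 0 * t 1 0) - n 0 0 * (t 0 0 * n 1 0 - t 1 0 * n 0 0)); first by ring.
by rewrite nt cr; ring.
Qed.

(** Otherwise the rotations have linear part 1 or -1, so at most four linear parts occur in [G]. If
    all translations were orthogonal to [n], the value [dotp n (act g 0)] would depend only on the
    linear part, and the orbit of the origin would stay in a strip. *)
Lemma spans_of_cobounded G : cobounded G -> spans G.
Proof.
move=> Gc.
have [[g [Gg gd g1 gN1]]|none] := pselect (exists g, [/\ elems G g, \det g.1 = 1, g.1 <> 1%:M & g.1 <> - 1%:M]).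
  exact: spans_of_rotation gN1.
have lin1 g : elems G g -> \det g.1 = 1 -> g.1 = 1%:M \/ g.1 = - 1%:M.
  move=> Gg gd; have [?|g1] := pselect (g.1 = 1%:M); first by left.
  by right; apply: contrapT => gN1; apply: none; exists g.
move=> n n0; apply: contrapT => H.
have tn t : elems G (trans t) -> dotp n t = 0.
  by move=> Gt; apply/eqP/negPn/negP => nt; apply: H; exists t.
have cls (A : 'M[R]_2) : exists2 M : R, 0 <= M & forall g, elems G g -> g.1 = A -> `|dotp n (act g 0)| <= M.
  have [[g Gg gA]|no] := pselect (exists2 g, elems G g & g.1 = A); last first.
    by exists 0 => // g Gg gA; case: no; exists g.
  exists `|dotp n (act g 0)| => // h Gh hA.
  have := tn _ (elems_same_lin Gg Gh (etrans gA (esym hA))).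
  by rewrite dotpDr dotpNr => /eqP; rewrite subr_eq0 => /eqP ->.
have [B HB] : exists B : 'M[R]_2, forall g, elems G g -> [\/ g.1 = 1%:M, g.1 = - 1%:M, g.1 = B | g.1 = - B].
  have [[g2 [Gg2 gd2]]|no] := pselect (exists g, elems G g /\ \det g.1 = -1); last first.
    exists 1%:M => g Gg; have [gd|gd] := orth_det (elems_orth Gg).
      by case: (lin1 g Gg gd); [constructor 1|constructor 2].
    by case: no; exists g.
  exists g2.1 => g Gg; have [gd|gd] := orth_det (elems_orth Gg).
    by case: (lin1 g Gg gd); [constructor 1|constructor 2].
  have := lin1 (affM g (affV g2)) (elemsM Gg (elemsV Gg2)).
  rewrite det_affM det_affV gd gd2 mulrNN mulr1 /= => /(_ erefl).
  have E : g.1 *m g2.1^T *m g2.1 = g.1 by rewrite -mulmxA (elems_orth Gg2) mulmx1.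
  by case=> h; rewrite h ?mulNmx mul1mx in E; [constructor 3|constructor 4].
have [M1 M10 HM1] := cls 1%:M; have [M2 M20 HM2] := cls (- 1%:M).
have [M3 M30 HM3] := cls B; have [M4 M40 HM4] := cls (- B).
have bound g : elems G g -> `|dotp n (act g 0)| <= M1 + M2 + M3 + M4.
  move=> Gg; case: (HB g Gg) => E; [have := HM1 g Gg E|have := HM2 g Gg E|have := HM3 g Gg E|have := HM4 g Gg E]; lra.
have [r Hr] := Gc.
have nn : 0 < dotp n n by rewrite lt_neqAle dotp_ge0 andbT eq_sym; apply: contraNneq n0 => /dotp_eq0 ->.
(* Chosen so that [L n] is further than [r] from the strip. *)
pose L := (M1 + M2 + M3 + M4 + enorm n * r + 1) / dotp n n.
have [g Gg hg] := Hr (L *: n).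
have := bound g Gg; have := dotp_norm_le n (L *: n - act g 0).
have : enorm n * enorm (L *: n - act g 0) <= enorm n * r by rewrite ler_wpM2l// enorm_ge0.
rewrite dotpDr dotpZr dotpNr /L divfK ?gt_eqF// ler_norml => h1 /andP[_ h2] h3.
have := ler_norm (dotp n (act g 0)); lra.
Qed.

End Spans.

(** * Cone constants for the orders that occur *)

Section ConeTable.
Variable R : realType.
Implicit Types (G : subgroupE2 R) (p : plane R) (t : R).

(** The numerical input of [embeds_of_cone_map]. For [n] from 2 to 4 the value below is
    [q = sin^2 (pi / 2n)], which makes the third condition an equality at [t = pi / n]; the ratio in
    the last condition tends to [q n^2] as [t] tends to 0, whence [kap = n sin (pi / 2n)]. *)
Definition cone_table (n : nat) (kap : R) : Prop := exists q : R,
  [/\ 0 <= q <= 1, 1 <= kap,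
   forall t, `|t| <= pi / n%:R -> 1 - cos t <= q * (1 - cos (n%:R * t)) &
   forall t, q * (1 - cos (n%:R * t)) <= kap ^+ 2 * (1 - cos t)].

(** A corner bounds the chamber by two crossing mirrors; [p] is the fixed point of the chamber's
    stabiliser and [c] moves a point into the chamber. *)
Lemma chamber_data G k q : locally_finite G -> spans G -> corner_point G k q ->
  exists p (c : plane R -> plane R), [/\ ~ on_mirror G p,
  (forall x, exists2 g, elems G g & c x = act g x) &
  (forall x y g, elems G g -> exists h, [/\ elems G h, act h p = p &
     enorm (c x - act h (c y)) <= enorm (c x - act g (c y))])].
Proof.
move=> GF sp crn; have [x0 gen] := generic_point GF.
have [n1 [c1 [n2 [c2 [m1 m2 cr]]]]] := corner_two_mirrors crn.
have bnd := chamber_bounded_of_mirrors sp m1 m2 cr (sdist_x0 gen).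
have [p ip pfix] := chamber_stab_fix GF gen bnd.
pose c x := act (s2val (cid2 (chamber_repr x0 GF x))) x.
exists p, c; split.
- move=> /on_mirrorP[n [d [m d0]]].
  by have := ip _ _ m; rewrite d0 mulr0 ltxx.
- by move=> x; rewrite /c; case: cid2 => g /= Gg _; exists g.
move=> x y g Gg.
have cc z : chamber G x0 (c z) by rewrite /c; case: cid2.
have [h Sh hh] := chamber_stab_closest_closed GF gen (cc x) (cc y) Gg.
by exists h; split=> //; [case: Sh|exact: pfix].
Qed.

Lemma rotations_card_ex G p : locally_finite G -> exists n, rotations_at G p #= `I_n.
Proof.
move=> GF; apply/finite_setP.
apply: sub_finite_set (GF (enorm p + enorm p)) => h [Gh hd hp]; split=> //.
have -> : act h 0 = p + (act h 0 - act h p) by rewrite hp addrC subrK.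
apply: le_trans (enormD _ _) _; rewrite lerD2l enorm_act ?sub0r ?enormN//.
exact: elems_orth Gh.
Qed.

Lemma cone_table1 (kap : R) : 1 <= kap -> cone_table 1 kap.
Proof.
move=> k1; exists 1; split=> // [|t _|t]; rewrite ?ler01 ?lexx// mul1r mul1r// ler_peMl.
  by [].
by rewrite subr_ge0 cos_le1.
by rewrite expr_ge1//; lra.
Qed.

Lemma embeds_corner G k q (kap : R) : locally_finite G -> spans G -> corner_point G k q ->
  1 <= kap -> (forall n p, cone_point G n p -> cone_table n kap) -> embeds G kap.
Proof.
move=> GF sp crn k1 tab.
have [p [c [nom cG cmin]]] := chamber_data GF sp crn.
have [n card_n] := rotations_card_ex p GF.
have [n0 _ _] := rotations_card card_n.
(* If the stabiliser contributes no rotation, [n = 1] and the cone is the plane; otherwise [p] is a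
   cone point. *)
have [t [tb _ low up]] : cone_table n kap.
  case: n n0 card_n => [//|[_ _|n _ card_n]]; first exact: cone_table1.
  by apply: (tab _ p).
exact: (embeds_of_cone_map card_n nom cG cmin tb k1 low up).
Qed.

Lemma cos_double t : cos (2 * t) = 2 * cos t ^+ 2 - 1.
Proof. by rewrite mulr_natl cos_mulr2n mulr_natl. Qed.

Lemma cos_triple t : cos (3 * t) = 4 * cos t ^+ 3 - 3 * cos t.
Proof.
have -> : 3 * t = 2 * t + t by ring.
rewrite cosD cos_double [2 * t]mulr_natl sin_mulr2n mulr2n.
transitivity ((2 * cos t ^+ 2 - 1) * cos t - 2 * cos t * sin t ^+ 2); first by ring.
by rewrite sin2cos2; ring.
Qed.

Lemma cos_quadruple t : cos (4 * t) = 8 * cos t ^+ 4 - 8 * cos t ^+ 2 + 1.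
Proof.
have -> : 4 * t = 2 * (2 * t) by ring.
by rewrite !cos_double; ring.
Qed.

Lemma cos_ge_of_abs_le t y : `|t| <= y -> y <= pi -> cos y <= cos t.
Proof. by move=> ty yp; rewrite -(cos_norm t); exact: ler_cos_pi. Qed.

Lemma cos_pi3 : cos (pi / 3) = 2^-1 :> R.
Proof.
have p0 := @pi_gt0 R.
have h : 0 < cos (pi / 3) :> R by apply: cos_gt0_pihalf; apply/andP; split; lra.
have := cos_triple (pi / 3); rewrite mulrC divfK// cospi => E.
move: (cos _) h E => c h E.
have : (2 * c - 1) ^+ 2 * (c + 1) = 0 by transitivity (4 * c ^+ 3 - 3 * c + 1); [ring|rewrite -E; ring].
by move/eqP; rewrite mulf_eq0 sqrf_eq0 => /orP[] /eqP; lra.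
Qed.

Lemma sin_half_sqr t : sin (t / 2) ^+ 2 = (1 - cos t) / 2.
Proof.
have -> : cos t = cos (2 * (t / 2)) by rewrite mulrC divfK.
by rewrite cos_double cos2sin2; lra.
Qed.

Lemma sin_halfE t : 0 <= t <= pi -> sin (t / 2) = Num.sqrt ((1 - cos t) / 2).
Proof.
move=> /andP[t0 tp]; rewrite -sin_half_sqr sqrtr_sqr ger0_norm//.
by apply: sin_ge0_pi; apply/andP; split; lra.
Qed.

Lemma cos_pi4 : cos (pi / 4) = Num.sqrt 2 / 2 :> R.
Proof.
have p0 := @pi_gt0 R.
have h : 0 < cos (pi / 4) :> R by apply: cos_gt0_pihalf; apply/andP; split; lra.
have E : cos (pi / 4) ^+ 2 = 2^-1 :> R.
  have := cos_double (pi / 4); rewrite (_ : 2 * (pi / 4) = pi / 2); last by lra.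
  by rewrite cos_pihalf; lra.
apply/eqP; rewrite -(@eqrXn2 _ 2)// ?divr_ge0 ?sqrtr_ge0 ?(ltW h)// E.
by rewrite expr_div_n sqr_sqrtr//; apply/eqP; field.
Qed.

Lemma cos_pi6 : cos (pi / 6) = Num.sqrt 3 / 2 :> R.
Proof.
have p0 := @pi_gt0 R.
have h : 0 < cos (pi / 6) :> R by apply: cos_gt0_pihalf; apply/andP; split; lra.
have E : cos (pi / 6) ^+ 2 = 3 / 4 :> R.
  have := cos_double (pi / 6); rewrite (_ : 2 * (pi / 6) = pi / 3); last by lra.
  by rewrite cos_pi3; lra.
apply/eqP; rewrite -(@eqrXn2 _ 2)// ?divr_ge0 ?sqrtr_ge0 ?(ltW h)// E.
by rewrite expr_div_n sqr_sqrtr//; apply/eqP; field.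
Qed.

Lemma sqrt2_sqr : Num.sqrt 2 ^+ 2 = 2 :> R. Proof. by rewrite sqr_sqrtr. Qed.

Lemma sqrt2_ge0 : 0 <= Num.sqrt 2 :> R. Proof. exact: sqrtr_ge0. Qed.

Lemma cone_const2 : 2%:R * sin (pi / (2 * 2%:R)) = Num.sqrt 2 :> R.
Proof.
have p0 := @pi_gt0 R.
have -> : pi / (2 * 2%:R) = (pi / 2) - (pi / 4) :> R by lra.
by rewrite sinB sin_pihalf cos_pihalf cos_pi4; lra.
Qed.

Lemma cone_const3 : 3%:R * sin (pi / (2 * 3%:R)) = 3 / 2 :> R.
Proof.
have p0 := @pi_gt0 R.
have -> : pi / (2 * 3%:R) = (pi / 2) - (pi / 3) :> R by lra.
by rewrite sinB sin_pihalf cos_pihalf cos_pi3; lra.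
Qed.

Lemma sqrt_quarter (a : R) : 0 <= a -> Num.sqrt (a / 2 ^+ 2) = Num.sqrt a / 2.
Proof. by move=> a0; rewrite sqrtrM// sqrtrV// sqrtr_sqr normr_nat. Qed.

Lemma cone_const4 : 4%:R * sin (pi / (2 * 4%:R)) = 2 * Num.sqrt (2 - Num.sqrt 2) :> R.
Proof.
have p0 := @pi_gt0 R.
have -> : pi / (2 * 4%:R) = (pi / 4) / 2 :> R by lra.
rewrite sin_halfE; last by apply/andP; split; lra.
rewrite cos_pi4 (_ : (1 - _) / 2 = (2 - Num.sqrt 2) / 2 ^+ 2); last by lra.
rewrite sqrt_quarter; first lra.
have := @sqr_sqrtr R 2 (ler0n _ _); have := sqrtr_ge0 (2 : R); nra.
Qed.

Lemma cone_const6 : 6%:R * sin (pi / (2 * 6%:R)) = 3 * Num.sqrt (2 - Num.sqrt 3) :> R.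
Proof.
have p0 := @pi_gt0 R.
have -> : pi / (2 * 6%:R) = (pi / 6) / 2 :> R by lra.
rewrite sin_halfE; last by apply/andP; split; lra.
rewrite cos_pi6 (_ : (1 - _) / 2 = (2 - Num.sqrt 3) / 2 ^+ 2); last by lra.
rewrite sqrt_quarter; first lra.
have := @sqr_sqrtr R 3 (ler0n _ _); have := sqrtr_ge0 (3 : R); nra.
Qed.

Lemma cone_table2 : cone_table 2 (Num.sqrt 2).
Proof.
have s2 := sqrt2_sqr; have s0 := sqrt2_ge0.
exists 2^-1; split=> [|| t ht|t].
- by apply/andP; split; lra.
- nra.
- have : 0 <= cos t by have := cos_ge_of_abs_le ht; rewrite cos_pihalf; apply; have := @pi_gt0 R; lra.
  by rewrite cos_double; have := cos_le1 t; move: (cos t) => c; nra.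
by rewrite s2 cos_double; have := cos_le1 t; have := cos_geN1 t; move: (cos t) => c; nra.
Qed.

Lemma cone_table3 : cone_table 3 (3 / 2).
Proof.
exists (1 / 4); split=> [|| t ht|t].
- by apply/andP; split; lra.
- lra.
- have : 2^-1 <= cos t by have := cos_ge_of_abs_le ht; rewrite cos_pi3; apply; have := @pi_gt0 R; lra.
  rewrite cos_triple; have := cos_le1 t; move: (cos t) => c c1 c2.
  have -> : 1 / 4 * (1 - (4 * c ^+ 3 - 3 * c)) = (1 - c) * ((1 + 2 * c) ^+ 2 / 4) by lra.
  by rewrite ler_peMr; [|lra|]; nra.
rewrite cos_triple; have := cos_le1 t; have := cos_geN1 t; move: (cos t) => c c1 c2.
have -> : 1 / 4 * (1 - (4 * c ^+ 3 - 3 * c)) = ((1 + 2 * c) ^+ 2 / 4) * (1 - c) by lra.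
by apply: ler_wpM2r; nra.
Qed.

Lemma cone_table4 : cone_table 4 (2 * Num.sqrt (2 - Num.sqrt 2)).
Proof.
set s := Num.sqrt 2; have s2 : s ^+ 2 = 2 := sqrt2_sqr; have s0 : 0 <= s := sqrt2_ge0.
have sb : 7 / 5 <= s <= 3 / 2 by apply/andP; split; nra.
have u0 : 0 <= 2 - s by lra.
have uE := sqr_sqrtr u0; have uu := sqrtr_ge0 (2 - s).
exists ((2 - s) / 4); split=> [|| t ht|t].
- by apply/andP; split; lra.
- nra.
- have : s / 2 <= cos t.
    by have := cos_ge_of_abs_le ht; rewrite cos_pi4; apply; have := @pi_gt0 R; lra.
  rewrite cos_quadruple; have := cos_le1 t; move: (cos t) => c c1 c2.
  have -> : (2 - s) / 4 * (1 - (8 * c ^+ 4 - 8 * c ^+ 2 + 1)) = (1 - c) * (2 * (2 - s) * (c ^+ 2 * (1 + c))) by lra.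
  have cc : 2^-1 <= c ^+ 2 by nra.
  have cd : 2^-1 * (1 + s / 2) <= c ^+ 2 * (1 + c) by apply: ler_pM; lra.
  have : 2 * (2 - s) * (2^-1 * (1 + s / 2)) = 1 by lra.
  move: (c ^+ 2 * (1 + c)) cd => z cd E.
  by rewrite ler_peMr; [|lra|]; nra.
rewrite exprMn uE cos_quadruple; have := cos_le1 t; have := cos_geN1 t; move: (cos t) => c c1 c2.
have -> : (2 - s) / 4 * (1 - (8 * c ^+ 4 - 8 * c ^+ 2 + 1)) = (2 * (2 - s) * (c ^+ 2 * (1 + c))) * (1 - c) by lra.
apply: ler_wpM2r; first lra.
have : c ^+ 2 * (1 + c) <= 2 by have : c ^+ 2 <= 1; nra.
move: (c ^+ 2 * (1 + c)) => z; nra.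
Qed.

End ConeTable.

(** * Doubles of chambers *)

Section IndexTwoReflection.
Variables (R : realType) (W G : subgroupE2 R) (x0 : plane R).
Hypothesis WF : locally_finite W.
Hypothesis gen : forall g, elems W g -> act g x0 = x0 -> g = aff1 R.
Hypothesis stab_triv : forall g, chamber_stab W x0 g -> g = aff1 R.
Hypothesis GW : elems G `<=` elems W.
Hypothesis index2 : forall v w, elems W v -> elems W w -> ~ elems G v -> ~ elems G w -> elems G (affM v w).
Implicit Types (x y z p n : plane R) (c : R).

Lemma index2_cancel v w : elems W w -> elems G v -> elems G (affM v w) -> elems G w.
Proof.
move=> Ww Gv Gvw; have vO := elems_orth Gv.
by rewrite -[w]aff1M -(affVM vO) -affMA; apply: elemsM => //; exact: elemsV.
Qed.

Lemma index2_cancelr v w : elems W w -> elems G v -> elems G (affM w v) -> elems G w.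
Proof.
move=> Ww Gv Gvw; have vO := elems_orth Gv.
by rewrite -[w]affM1 -(affMV vO) affMA; apply: elemsM => //; exact: elemsV.
Qed.

Lemma index2_V w : elems W w -> ~ elems G w -> ~ elems G (affV w).
Proof. by move=> Ww nw /elemsV; rewrite affVK//; exact: elems_orth Ww. Qed.

Lemma index2_normal w g : elems W w -> elems G g -> elems G (affM w (affM g (affV w))).
Proof.
move=> Ww Gg; have [Gw|nw] := pselect (elems G w).
  by apply: elemsM => //; apply: elemsM => //; exact: elemsV.
apply: index2 => //; first by apply: elemsM; [exact: GW|exact: elemsV].
by move/(index2_cancel (elemsV Ww) Gg); exact: index2_V.
Qed.

(* The mirrors along which two copies of the chamber are glued. *)
Definition glue_mirror n c := mirror W n c /\ ~ elems G (refl n c).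
Hypothesis glue_ex : exists n c, glue_mirror n c.

Lemma glue_conjV n c g : glue_mirror n c -> elems W g -> exists n' c',
  glue_mirror n' c' /\ (forall x, sdist n' c' x = sdist n c (act g x)).
Proof.
move=> [m nG] Wg; have [n' [c' [m' [E E2]]]] := mirror_conjV m Wg.
exists n', c'; split=> //; split=> // Gr; apply: nG.
have gO := elems_orth Wg.
have := index2_normal Wg Gr; rewrite E2.
by rewrite !affMA affMV// aff1M -affMA affMV// affM1.
Qed.

(** A reflection displaces [x] by twice its distance to the mirror, so the nearest glue mirror comes
    from a closest orbit point. *)
Lemma glue_dist_ex x : exists r, (exists n c, glue_mirror n c /\ r = `|sdist n c x|) /\
  forall n c, glue_mirror n c -> r <= `|sdist n c x|.
Proof.
have E n c : dotp n n = 1 -> enorm (x - act (refl n c) x) = 2 * `|sdist n c x|.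
  move=> n1; rewrite act_refl opprB addrCA subrr addr0 enormZ normrM normr_nat.
  by rewrite (enormE n) n1 sqrtr1 mulr1.
have [||g [n [c [gm ->]]] Hg] := @closest_orbit_point R W x x
  [set g | exists n c, glue_mirror n c /\ g = refl n c] WF.
- by move=> g [n [c [[[_ Wr] _] ->]]].
- by have [n [c gm]] := glue_ex; exists (refl n c), n, c.
exists `|sdist n c x|; split; first by exists n, c.
move=> n' c' gm'; have := Hg (refl n' c'); rewrite !E; [|by case: gm' => -[]|by case: gm => -[]].
by move=> /(_ (ex_intro _ _ (ex_intro _ _ (conj gm' erefl)))); rewrite ler_pM2l.
Qed.

Definition glue_dist x : R := sval (cid (glue_dist_ex x)).
Lemma glue_distP x : exists n c, glue_mirror n c /\ glue_dist x = `|sdist n c x|.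
Proof. by rewrite /glue_dist; case: cid => r []. Qed.

Lemma glue_dist_le x n c : glue_mirror n c -> glue_dist x <= `|sdist n c x|.
Proof. by rewrite /glue_dist; case: cid => r [] /= _; apply. Qed.

Lemma glue_dist_ge0 x : 0 <= glue_dist x.
Proof. by have [n [c [_ ->]]] := glue_distP x. Qed.

Lemma glue_dist_lip x y : glue_dist x <= glue_dist y + enorm (x - y).
Proof.
have [n [c [gm ->]]] := glue_distP y; apply: le_trans (glue_dist_le x gm) _.
have n1 : dotp n n = 1 by case: gm => -[].
have := sdist_lip c x y n1; have := ler_normD (sdist n c y) (sdist n c x - sdist n c y).
by rewrite addrC subrK; lra.
Qed.

Lemma glue_dist_act_le w x : elems W w -> glue_dist x <= glue_dist (act w x).
Proof.
move=> Ww; have [n [c [gm ->]]] := glue_distP (act w x).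
by have [n' [c' [gm' E]]] := glue_conjV gm Ww; rewrite -E; exact: glue_dist_le.
Qed.

Lemma glue_dist_act w x : elems W w -> glue_dist (act w x) = glue_dist x.
Proof.
move=> Ww; apply/eqP; rewrite eq_le glue_dist_act_le// andbT.
have := glue_dist_act_le (act w x) (elemsV Ww); rewrite actV//; exact: elems_orth Ww.
Qed.

Lemma sdist_conv n c x y t : sdist n c ((1 - t) *: x + t *: y) = (1 - t) * sdist n c x + t * sdist n c y.
Proof. by rewrite /sdist dotpDr !dotpZr; ring. Qed.

(** If a glue mirror separates [x] from [w y], the distances of both points to it add up. Otherwise
    reflections in [G] carry [w y] into the chamber of [x] without ever needing a glue mirror; the
    stabiliser being trivial, this puts [w] in [G]. *)
Lemma ichamber_glue_cross x y w : ichamber W x0 x -> ichamber W x0 y -> elems W w -> ~ elems G w ->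
  glue_dist x + glue_dist y <= enorm (x - act w y).
Proof.
move=> ix iy Ww nw; rewrite -(glue_dist_act y Ww).
have [[n [c [gm neg]]]|pos] := pselect (exists n c, glue_mirror n c /\ sdist n c x * sdist n c (act w y) < 0).
  have n1 : dotp n n = 1 by case: gm => -[].
  apply: le_trans (sdist_lip c x (act w y) n1).
  apply: le_trans (lerD (glue_dist_le _ gm) (glue_dist_le _ gm)) _.
  move: (sdist n c x) (sdist n c (act w y)) neg => a b ab.
  rewrite -ler_sqr ?nnegrE ?addr_ge0// real_normK ?num_real// sqrrD !real_normK ?num_real//.
  by rewrite -normrM ltr0_norm//; lra.
exfalso; apply: nw.
have offW z v n c : ichamber W x0 z -> elems W v -> mirror W n c -> sdist n c (act v z) != 0.
  move=> iz Wv m; have [n' [c' [m' [<- _]]]] := mirror_conjV m Wv.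
  by apply/eqP => h0; have := iz _ _ m'; rewrite h0 mulr0 ltxx.
have offx n c : mirror W n c -> sdist n c x != 0.
  by move=> m; apply/eqP => h0; have := ix _ _ m; rewrite h0 mulr0 ltxx.
(* The images of [w y] under [G] that no glue mirror separates from [x]. The one closest to [x] is
   shown to be in the chamber: a mirror of [G] in between would reflect it to a closer member of the
   same set. *)
pose A := [set g | elems G g /\ forall n c, glue_mirror n c -> 0 < sdist n c x * sdist n c (act g (act w y))].
have [||g [Gg Ag] Hg] := @closest_orbit_point R W x (act w y) A WF.
- by move=> g [Gg _]; exact: GW.
- exists (aff1 R); split=> [|n c gm]; first exact: elems1.
  rewrite act1 lt_neqAle eq_sym mulf_neq0 ?offx ?offW//=; [|by case: gm|by case: gm].
  by rewrite leNgt; apply/negP => neg; apply: pos; exists n, c.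
set z := act g (act w y) in Ag Hg.
have Wgw : elems W (affM g w) by apply: elemsM => //; exact: GW.
have zE : z = act (affM g w) y by rewrite actM.
have pz n c : mirror W n c -> 0 <= sdist n c x * sdist n c z.
  move=> m; have [Gr|nr] := pselect (elems G (refl n c)); last first.
    by apply/ltW/Ag.
  rewrite leNgt; apply/negP => neg.
  have n1 : dotp n n = 1 by case: m.
  set s := refl n c in Gr.
  have : enorm (x - z) <= enorm (x - act (affM s g) (act w y)).
    apply: Hg; split; first exact: elemsM.
    move=> n2 c2 gm2; rewrite actM -/z.
    have [n3 [c3 [gm3 E3]]] := glue_conjV gm2 (GW Gr).
    set a := sdist n c x in neg; set b := sdist n c z in neg.
    have ab0 : a - b != 0.
      by rewrite subr_eq0; apply/eqP => ab; move: neg; rewrite ab -expr2 ltNge sqr_ge0.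
    pose t := a / (a - b).
    have t01 : 0 < t < 1.
      have [a0|a0] := ltP 0 a.
        have b0 : b < 0 by rewrite -(pmulr_rlt0 _ a0).
        by rewrite divr_gt0 ?ltr_pdivrMr ?mul1r//; lra.
      have a1 : a < 0 by rewrite lt_neqAle a0 andbT; apply/eqP => a1; move: neg; rewrite a1 mul0r ltxx.
      have b0 : 0 < b by rewrite -(nmulr_rlt0 _ a1).
      have -> : t = (- a) / (b - a) by rewrite /t -opprB invrN mulrN mulNr.
      by rewrite divr_gt0 ?ltr_pdivrMr ?mul1r//; lra.
    case/andP: t01 => t0 t1.
    (* The point where the segment from [x] to [z] meets the mirror of [s]. It is fixed by [s] and
       on the same side of every glue mirror as [x] and [z], so it carries the sign from [x] to
       [s z]. *)
    pose m0 := (1 - t) *: x + t *: z.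
    have m00 : sdist n c m0 = 0.
      rewrite /m0 sdist_conv -/a -/b /t; field.
      exact: ab0.
    have sm : act s m0 = m0 by rewrite act_refl m00 mulr0 scale0r subr0.
    have h1 : 0 < sdist n2 c2 x * sdist n2 c2 m0.
      rewrite /m0 sdist_conv; have := Ag _ _ gm2; have := sqr_ge0 (sdist n2 c2 x).
      move: (sdist n2 c2 x) (sdist n2 c2 z) => u v; nra.
    have h2 : 0 < sdist n3 c3 m0 * sdist n3 c3 z.
      rewrite /m0 sdist_conv; have := Ag _ _ gm3; have := sqr_ge0 (sdist n3 c3 z).
      move: (sdist n3 c3 x) (sdist n3 c3 z) => u v; nra.
    by rewrite !E3 sm in h2; exact: same_sign_lt h1 h2.
  have -> : act (affM s g) (act w y) = act s z by exact: actM.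
  have := refl_dist c x z n1; rewrite -/s => E le_xz.
  have : enorm (x - z) ^+ 2 <= enorm (x - act s z) ^+ 2 by rewrite ler_sqr ?nnegrE ?enorm_ge0.
  by rewrite E lerDl -mulrA pmulr_rge0// leNgt neg.
have iz : ichamber W x0 z.
  move=> n c m; rewrite lt_neqAle (same_sign (ix _ _ m) (pz _ _ m)) andbT eq_sym.
  by rewrite mulf_neq0 ?(sdist_x0 gen m)// zE offW.
have : chamber_stab W x0 (affM g w).
  split=> //; apply: (ichamber_act Wgw iy _ (ichamber_x0 gen)); by rewrite -zE.
move=> /stab_triv E; apply: (index2_cancel Ww Gg); rewrite E; exact: elems1.
Qed.

Lemma chamber_glue_cross x y w : chamber W x0 x -> chamber W x0 y -> elems W w -> ~ elems G w ->
  glue_dist x + glue_dist y <= enorm (x - act w y).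
Proof.
move=> cx cy Ww nw; apply/ler_addgt0Pr => e e0.
pose M := enorm (x - x0) + enorm (y - x0) + 1.
have M0 : 0 < M by rewrite ltr_wpDl// addr_ge0 ?enorm_ge0.
pose t := Num.min 1 (e / (2 * M)).
have t0 : 0 < t by rewrite lt_min ltr01 divr_gt0// mulr_gt0.
have t1 : t <= 1 by rewrite ge_min lexx.
have te : t * (2 * M) <= e.
  by rewrite -ler_pdivlMr ?mulr_gt0// ge_min lexx orbT.
pose xt := (1 - t) *: x + t *: x0; pose yt := (1 - t) *: y + t *: x0.
have := ichamber_glue_cross (ichamber_conv gen cx t0 t1) (ichamber_conv gen cy t0 t1) Ww nw.
rewrite -/xt -/yt.
have dx : enorm (x - xt) = t * enorm (x - x0).
  by rewrite (_ : x - xt = t *: (x - x0)) ?enormZ ?gtr0_norm//; apply: planeP; rewrite !planeE; ring.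
have dy : enorm (y - yt) = t * enorm (y - x0).
  by rewrite (_ : y - yt = t *: (y - x0)) ?enormZ ?gtr0_norm//; apply: planeP; rewrite !planeE; ring.
have := glue_dist_lip x xt; have := glue_dist_lip y yt.
have := enorm_triangle xt x (act w yt); have := enorm_triangle x (act w y) (act w yt).
rewrite enorm_act; last exact: elems_orth Ww.
rewrite (enormB xt x) dx dy; move: te; rewrite /M.
have := enorm_ge0 (x - x0); have := enorm_ge0 (y - x0); nra.
Qed.

Lemma chamber_closest x y g : chamber W x0 x -> chamber W x0 y -> elems W g ->
  enorm (x - y) <= enorm (x - act g y).
Proof.
move=> cx cy Wg; have [h /stab_triv -> ] := chamber_stab_closest_closed WF gen cx cy Wg.
by rewrite act1.
Qed.

(* The orbit space of [G] consists of two copies of the chamber of [W], glued along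
   the walls of [W] outside [G]; a signed distance to these walls separates the copies. *)
Lemma embeds_double : embeds G 2.
Proof.
pose gx x := s2val (cid2 (chamber_repr x0 WF x)).
have Wgx x : elems W (gx x) by rewrite /gx; case: cid2.
pose c x := act (gx x) x.
have cc x : chamber W x0 (c x) by rewrite /c /gx; case: cid2.
pose eps x : R := if `[< elems G (gx x) >] then 1 else -1.
have epsP x : (elems G (gx x) /\ eps x = 1) \/ (~ elems G (gx x) /\ eps x = -1).
  by rewrite /eps; case: asboolP => h; [left|right].
have gO g : elems W g -> orth g by exact: elems_orth.
(* Position and signed glue distance are both 1-Lipschitz for the orbit metric, so together with the
   factor [sqrt 2] the map is 2-Lipschitz. *)
pose f (i : 'I_3) x := Num.sqrt 2 * (if i == 0 then c x 0 0 else if i == 1 then c x 1 0 else eps x * glue_dist (c x)).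
have fE x y : \sum_i (f i x - f i y) ^+ 2 = 2 * (enorm (c x - c y) ^+ 2 + (eps x * glue_dist (c x) - eps y * glue_dist (c y)) ^+ 2).
  rewrite !big_ord_recl big_ord0 /f /= -!mulrBr !exprMn sqrt2_sqr enorm_sqr /dotp !planeE; ring.
apply: (@embeds_funcs _ G 2 3 f) => // [g x y Gg|x y]; rewrite fE.
  pose w := affM (gx x) (affM g (affV (gx y))).
  have Ww : elems W w by apply: elemsM => //; apply: elemsM; [exact: GW|exact: elemsV].
  have wE : enorm (x - act g y) = enorm (c x - act w (c y)).
    rewrite /w /c !actM actV; last exact: gO.
    by rewrite enorm_act//; exact: gO.
  have h1 := chamber_closest (cc x) (cc y) Ww.
  have p1 := glue_dist_ge0 (c x); have p2 := glue_dist_ge0 (c y).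
  have h2 : (eps x * glue_dist (c x) - eps y * glue_dist (c y)) ^+ 2 <= enorm (c x - act w (c y)) ^+ 2.
    have same : eps x = eps y -> eps x ^+ 2 = 1 -> (eps x * glue_dist (c x) - eps y * glue_dist (c y)) ^+ 2 <= enorm (c x - act w (c y)) ^+ 2.
      move=> <- e2; rewrite -mulrBr exprMn e2 mul1r.
      apply: (@le_trans _ _ (enorm (c x - c y) ^+ 2)); last by rewrite ler_sqr ?nnegrE ?enorm_ge0.
      rewrite -[leLHS]real_normK ?num_real// ler_sqr ?nnegrE ?enorm_ge0// ler_norml.
      by have := glue_dist_lip (c x) (c y); have := glue_dist_lip (c y) (c x);
        rewrite (enormB (c y)); move=> *; apply/andP; split; lra.
    have diff : ~ elems G w -> (glue_dist (c x) + glue_dist (c y)) ^+ 2 <= enorm (c x - act w (c y)) ^+ 2.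
      move=> nw; rewrite ler_sqr ?nnegrE ?enorm_ge0 ?addr_ge0//.
      exact: chamber_glue_cross.
    have gV := elemsV Gg.
    have [[Gx ex]|[nx ex]] := epsP x; have [[Gy ey]|[ny ey]] := epsP y.
    - by apply: same; rewrite ex ?ey ?expr1n.
    - rewrite ex ey mul1r mulN1r opprK; apply: diff => Gw; apply: ny.
      have := index2_cancel _ Gx Gw => /(_ (elemsM (GW Gg) (elemsV (Wgx y)))).
      move=> /(index2_cancel (elemsV (Wgx y)) Gg) /elemsV; rewrite affVK//; exact: gO.
    - have -> : (eps x * glue_dist (c x) - eps y * glue_dist (c y)) ^+ 2 = (glue_dist (c x) + glue_dist (c y)) ^+ 2.
        by rewrite ex ey; ring.
      apply: diff => Gw; apply: nx.
      by apply: (index2_cancelr (Wgx x) _ Gw); apply: elemsM => //; exact: elemsV.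
    - by apply: same; rewrite ex ?ey ?sqrrN ?expr1n.
  rewrite wE; have : enorm (c x - c y) ^+ 2 <= enorm (c x - act w (c y)) ^+ 2.
    by rewrite ler_sqr ?nnegrE ?enorm_ge0.
  lra.
have gVE s : elems W s -> enorm (x - act (affM (affV (gx x)) (affM s (gx y))) y) = enorm (c x - act s (c y)).
  move=> Ws; rewrite !actM -/(c y) -(enorm_act x _ (gO _ (Wgx x))) actVK//; exact: gO.
have sqpos := sqr_ge0 (eps x * glue_dist (c x) - eps y * glue_dist (c y)).
have Vx := elemsV (Wgx x).
have same : elems G (affM (affV (gx x)) (gx y)) -> exists2 g, elems G g &
    enorm (x - act g y) ^+ 2 <= 2 * (enorm (c x - c y) ^+ 2 + (eps x * glue_dist (c x) - eps y * glue_dist (c y)) ^+ 2).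
  move=> Gg; exists (affM (affV (gx x)) (gx y)) => //.
  have := gVE _ (elems1 W); rewrite aff1M act1 => ->.
  by have := sqr_ge0 (enorm (c x - c y)); lra.
have diff : eps x * eps y = -1 -> (forall n d, glue_mirror n d -> elems G (affM (affV (gx x)) (affM (refl n d) (gx y)))) ->
  exists2 g, elems G g &
    enorm (x - act g y) ^+ 2 <= 2 * (enorm (c x - c y) ^+ 2 + (eps x * glue_dist (c x) - eps y * glue_dist (c y)) ^+ 2).
  move=> exy HG.
  have e2 : eps x ^+ 2 = 1 /\ eps y ^+ 2 = 1.
    by have [[_ ->]|[_ ->]] := epsP x; have [[_ ->]|[_ ->]] := epsP y; rewrite ?sqrrN expr1n.
  have -> : (eps x * glue_dist (c x) - eps y * glue_dist (c y)) ^+ 2 = (glue_dist (c x) + glue_dist (c y)) ^+ 2.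
    transitivity (eps x ^+ 2 * glue_dist (c x) ^+ 2 + eps y ^+ 2 * glue_dist (c y) ^+ 2 - 2 * (eps x * eps y) * (glue_dist (c x) * glue_dist (c y))); first by ring.
    by rewrite exy e2.1 e2.2; ring.
  set D := enorm (c x - c y); set p := glue_dist (c x); set q := glue_dist (c y).
  have D0 : 0 <= D by exact: enorm_ge0.
  have p0 : 0 <= p by exact: glue_dist_ge0.
  have q0 : 0 <= q by exact: glue_dist_ge0.
  (* The mirror is the one nearest to the point with the smaller glue distance; the other point is
     at most [D] further away from it. *)
  have [n [d [gm np]]] : exists n d, glue_mirror n d /\
      `|sdist n d (c x)| * `|sdist n d (c y)| <= Num.min p q * (Num.min p q + D).
    have [pq|pq] := leP p q.
      have [n [d [gm E]]] := glue_distP (c x); exists n, d; split=> //.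
      have n1 : dotp n n = 1 by case: gm => -[].
      rewrite -/p in E; rewrite -E ler_wpM2l// E.
      have := sdist_lip d (c y) (c x) n1; rewrite enormB -/D => h.
      have := ler_normD (sdist n d (c x)) (sdist n d (c y) - sdist n d (c x)).
      by rewrite addrC subrK; lra.
    have [n [d [gm E]]] := glue_distP (c y); exists n, d; split=> //.
    have n1 : dotp n n = 1 by case: gm => -[].
    rewrite -/q in E; rewrite -E mulrC ler_wpM2l// E.
    have := sdist_lip d (c x) (c y) n1; rewrite -/D => h.
    have := ler_normD (sdist n d (c y)) (sdist n d (c x) - sdist n d (c y)).
    by rewrite addrC subrK; lra.
  have [[n1 Wr] _] := gm.
  exists (affM (affV (gx x)) (affM (refl n d) (gx y))); first exact: HG.
  rewrite gVE// refl_dist// -/D.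
  have := ler_norm (sdist n d (c x) * sdist n d (c y)); rewrite normrM -mulrA => h.
  have {}np := le_trans h np; move: np.
  set u := _ * sdist n d (c y).
  set m := Num.min p q => um.
  have mp : m <= p by rewrite ge_min lexx.
  have mq : m <= q by rewrite ge_min lexx orbT.
  have m0 : 0 <= m by rewrite le_min p0.
  have : (2 * m) ^+ 2 <= (p + q) ^+ 2 by rewrite ler_sqr ?nnegrE; lra.
  (* Reflecting gives the squared distance at most [D^2 + 4 m (m + D)], and [4 m D <= D^2 + 4 m^2]
     bounds this by [2 (D^2 + (2m)^2)]. *)
  by have := sqr_ge0 (D - 2 * m); lra.
have [[Gx ex]|[nx ex]] := epsP x; have [[Gy ey]|[ny ey]] := epsP y.
- by apply: same; apply: elemsM => //; exact: elemsV.
- apply: diff => [|n d [[_ Wr] nr]]; first by rewrite ex ey mul1r.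
  by apply: elemsM; [exact: elemsV|exact: index2].
- apply: diff => [|n d [[_ Wr] nr]]; first by rewrite ex ey mulr1.
  apply: index2 => //; first exact: elemsM.
    exact: index2_V.
  by move/(index2_cancelr Wr Gy).
- by apply: same; apply: index2 => //; exact: index2_V.
Qed.

End IndexTwoReflection.

(** * Adjoining a normalising involution *)

Section Extension.
Variables (R : realType) (G : subgroupE2 R) (s : affine R).
Hypothesis sO : orth s.
Hypothesis ss : affM s s = aff1 R.
Hypothesis sG : forall g, elems G g -> elems G (affM s (affM g s)).

Lemma ext_orthogonal g : elems G g \/ elems G (affM g s) -> g.1^T *m g.1 = 1%:M.
Proof.
case=> [|H]; first exact: elems_orth.
have -> : g = affM (affM g s) s by rewrite -affMA ss affM1.
by apply: affM_orth => //; exact: elems_orth H.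
Qed.

Lemma extM g h : elems G g \/ elems G (affM g s) -> elems G h \/ elems G (affM h s) ->
  elems G (affM g h) \/ elems G (affM (affM g h) s).
Proof.
move=> [Gg|Gg] [Gh|Gh].
- by left; exact: elemsM.
- by right; rewrite -affMA; exact: elemsM.
- right; have -> : affM (affM g h) s = affM (affM g s) (affM s (affM h s)).
    by rewrite !affMA -(affMA g s s) ss affM1.
  by apply: elemsM => //; exact: sG.
left; have -> : affM g h = affM (affM g s) (affM s (affM (affM h s) s)).
  by rewrite -(affMA h) ss affM1 affMA -(affMA g s s) ss affM1.
by apply: elemsM => //; exact: sG.
Qed.

Lemma extV g : elems G g \/ elems G (affM g s) -> elems G (affV g) \/ elems G (affM (affV g) s).
Proof.
move=> H; have gO := ext_orthogonal H; case: H => Gg; first by left; exact: elemsV.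
right; have := sG (elemsV Gg).
have -> : affV (affM g s) = affM s (affV g).
  have gsO := affM_orth gO sO.
  apply: aff_eq => x.
  have E : act (affM g s) (act (affM s (affV g)) x) = x.
    by rewrite !actM -(actM s s) ss act1 actVK.
  by rewrite -{1}E actV.
by rewrite !affMA ss aff1M.
Qed.

Definition extension : subgroupE2 R :=
  @SubgroupE2 R [set g | elems G g \/ elems G (affM g s)] ext_orthogonal
    (or_introl (elems1 G)) extM extV.

Lemma extension_sub : elems G `<=` elems extension.
Proof. by move=> g; left. Qed.

Lemma extension_gen : elems extension s.
Proof. by right; rewrite ss; exact: elems1. Qed.

Lemma extension_index2 v w : elems extension v -> elems extension w ->
  ~ elems G v -> ~ elems G w -> elems G (affM v w).
Proof.
move=> [|Gv] // [|Gw] // _ _.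
have -> : affM v w = affM (affM v s) (affM s (affM (affM w s) s)).
  by rewrite -(affMA w) ss affM1 affMA -(affMA v s s) ss affM1.
by apply: elemsM => //; exact: sG.
Qed.

Lemma extension_locally_finite : locally_finite G -> locally_finite extension.
Proof.
move=> GF r.
apply: (@sub_finite_set _ _ ([set g | elems G g /\ enorm (act g 0) <= r] `|`
   (fun g => affM g s) @` [set g | elems G g /\ enorm (act g 0) <= r + enorm (act s 0)])).
  move=> g [[Gg|Gg] gr]; first by left.
  right; exists (affM g s); last by rewrite -affMA ss affM1.
  split=> //; have gO : orth g by apply: ext_orthogonal; right.
  have -> : act (affM g s) 0 = act g 0 + (act g (act s 0) - act g 0).
    by rewrite actM addrC subrK.
  apply: le_trans (enormD _ _) _; apply: lerD => //.
  by rewrite enorm_act// subr0.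
by rewrite finite_setU; split; [exact: GF|exact/finite_image/GF].
Qed.
End Extension.

(** The hypothesis on rotation centres makes the chamber stabiliser trivial: a nontrivial element
    would rotate about an interior point of the chamber, which lies on no mirror. *)
Lemma embeds_of_index2_reflection (R : realType) (W G : subgroupE2 R) n1 c1 n2 c2 n3 c3 :
  locally_finite W -> spans W -> mirror W n1 c1 -> mirror W n2 c2 -> cross n1 n2 != 0 ->
  (forall g p, elems W g -> \det g.1 = 1 -> act g p = p -> g <> aff1 R -> on_mirror W p) ->
  elems G `<=` elems W ->
  (forall v w, elems W v -> elems W w -> ~ elems G v -> ~ elems G w -> elems G (affM v w)) ->
  mirror W n3 c3 -> ~ elems G (refl n3 c3) -> embeds G 2.
Proof.
move=> WF sp m1 m2 cr Hrot GW ind m3 n3G.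
have [x0 gen] := generic_point WF.
have bnd := chamber_bounded_of_mirrors sp m1 m2 cr (sdist_x0 gen).
apply: (embeds_double WF gen) => //; last by exists n3, c3.
move=> g Sg; apply: contrapT => g1.
have [p ip pfix] := chamber_stab_fix WF gen bnd.
have nom : ~ on_mirror W p.
  by move=> /on_mirrorP[n [d [m d0]]]; have := ip _ _ m; rewrite d0 mulr0 ltxx.
apply: nom; apply: (Hrot g) => //; [by case: Sg| |exact: pfix].
by apply: (no_mirror_det1 _ (proj1 Sg) (pfix _ Sg)) => /on_mirrorP[n [d [m d0]]];
  have := ip _ _ m; rewrite d0 mulr0 ltxx.
Qed.

Lemma sub_spans (R : realType) (G W : subgroupE2 R) : elems G `<=` elems W -> spans G -> spans W.
Proof. by move=> GW sp n /sp[t Gt nt]; exists t => //; exact: GW. Qed.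

(** * Groups preserving a rectangular frame *)

Section Frames.
Variable R : realType.
Implicit Types (U V : plane R -> R) (G : subgroupE2 R) (g h : affine R) (b : bool) (s t : R).

(* [U] and [V] are the coordinates in an orthonormal frame. *)
Definition frame U V : Prop :=
  (forall x y, enorm (x - y) ^+ 2 = (U x - U y) ^+ 2 + (V x - V y) ^+ 2) /\
  (forall a b : R, exists x, U x = a /\ V x = b).

Definition sg b : R := if b then -1 else 1.
Lemma sgM b b' : sg b * sg b' = sg (b (+) b').
Proof. by case: b; case: b'; rewrite /sg /= ?mul1r ?mulr1 ?mulrNN ?mulr1. Qed.

Lemma sg2 b : sg b * sg b = 1.
Proof. by rewrite sgM addbb. Qed.

(* In these coordinates [g] is the map (u, v) |-> (+-u + s, +-v + t). *)
Definition coord_form U V g b1 b2 s t : Prop :=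
  forall x, U (act g x) = sg b1 * U x + s /\ V (act g x) = sg b2 * V x + t.

(** [coord_form] speaks of values of [U] and [V] only; the determinant is recorded as well because
    mirrors and rotations are defined through it. *)
Definition rect U V G : Prop := forall g, elems G g ->
  exists b1 b2 s t, coord_form U V g b1 b2 s t /\ \det g.1 = sg (b1 (+) b2).

Definition elt U V G b1 b2 s t : Prop := exists2 g, elems G g & coord_form U V g b1 b2 s t.

Definition spanning U V G : Prop :=
  (exists s t, elt U V G false false s t /\ s != 0) /\
  (exists s t, elt U V G false false s t /\ t != 0).

Lemma frame_swap U V : frame U V -> frame V U.
Proof.
move=> [D E]; split=> [x y|a b']; first by rewrite D addrC.
by have [x [? ?]] := E b' a; exists x.
Qed.

Lemma form_swap U V g b1 b2 s t : coord_form U V g b1 b2 s t -> coord_form V U g b2 b1 t s.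
Proof. by move=> H x; have [? ?] := H x. Qed.

Lemma rect_swap U V G : rect U V G -> rect V U G.
Proof.
move=> H g /H[b1 [b2 [s [t [f d]]]]]; exists b2, b1, t, s; split; first exact: form_swap.
by rewrite addbC.
Qed.

Lemma elt_swap U V G b1 b2 s t : elt U V G b1 b2 s t -> elt V U G b2 b1 t s.
Proof. by move=> [g Gg /form_swap ?]; exists g. Qed.

Lemma spanning_swap U V G : spanning U V G -> spanning V U G.
Proof.
by move=> [[s [t [e n]]] [s' [t' [e' n']]]]; split;
  [exists t', s'|exists t, s]; split=> //; exact: elt_swap.
Qed.

Definition recentre (c : R) U : plane R -> R := fun x => U x - c.

Lemma frame_shift U V c d : frame U V -> frame (recentre c U) (recentre d V).
Proof.
move=> [D E]; split=> [x y|a b']; first by rewrite /recentre D; ring.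
have [x [xa xb]] := E (a + c) (b' + d); exists x.
by rewrite /recentre xa xb !addrK.
Qed.

Lemma form_shift U V g b1 b2 s t c d : coord_form U V g b1 b2 s t ->
  coord_form (recentre c U) (recentre d V) g b1 b2 (s + sg b1 * c - c) (t + sg b2 * d - d).
Proof. by move=> H x; have [h1 h2] := H x; rewrite /recentre h1 h2; split; ring. Qed.

Lemma rect_shift U V G c d : rect U V G -> rect (recentre c U) (recentre d V) G.
Proof.
move=> H g /H[b1 [b2 [s [t [f dt]]]]].
by exists b1, b2, (s + sg b1 * c - c), (t + sg b2 * d - d); split; first exact: form_shift.
Qed.

Lemma elt_shift U V G b1 b2 s t c d : elt U V G b1 b2 s t ->
  elt (recentre c U) (recentre d V) G b1 b2 (s + sg b1 * c - c) (t + sg b2 * d - d).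
Proof. by move=> [g Gg H]; exists g => //; exact: form_shift. Qed.

Lemma spanning_shift U V G c d : spanning U V G -> spanning (recentre c U) (recentre d V) G.
Proof.
move=> [[s [t [e n]]] [s' [t' [e' n']]]]; split; [exists s, t|exists s', t']; split=> //.
  by have := elt_shift c d e; rewrite !mul1r !addrK.
by have := elt_shift c d e'; rewrite !mul1r !addrK.
Qed.

Section Fixed.
Variables (U V : plane R -> R) (G : subgroupE2 R).
Hypothesis fr : frame U V.
Hypothesis rc : rect U V G.
Local Notation elt := (elt U V G).
Local Notation coord_form := (coord_form U V).

Lemma frame_inj x y : U x = U y -> V x = V y -> x = y.
Proof.
move=> hU hV; have [D _] := fr; apply/eqP; rewrite -subr_eq0; apply/eqP/enorm0_eq0/eqP.
by rewrite -sqrf_eq0 D hU hV !subrr expr0n /= addr0.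
Qed.

Lemma form_act_inj g h b1 b2 s t : coord_form g b1 b2 s t -> coord_form h b1 b2 s t -> g = h.
Proof.
move=> fg fh; apply: aff_eq => x; have [g1 g2] := fg x; have [h1 h2] := fh x.
by apply: frame_inj; rewrite ?g1 ?g2 ?h1 ?h2.
Qed.

Lemma form_uniq g b1 b2 s t b1' b2' s' t' : coord_form g b1 b2 s t -> coord_form g b1' b2' s' t' ->
  [/\ b1 = b1', b2 = b2', s = s' & t = t'].
Proof.
move=> f f'; have [_ E] := fr.
have [x [x0 y0]] := E 0 0; have [y [x1 y1]] := E 1 1.
have [fx1 fx2] := f x; have [fx1' fx2'] := f' x.
have [fy1 fy2] := f y; have [fy1' fy2'] := f' y.
rewrite x0 in fx1 fx1'; rewrite y0 in fx2 fx2'; rewrite x1 in fy1 fy1'; rewrite y1 in fy2 fy2'.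
have ss : s = s' by rewrite mulr0 add0r in fx1; rewrite mulr0 add0r in fx1'; rewrite -fx1 -fx1'.
have tt : t = t' by rewrite mulr0 add0r in fx2; rewrite mulr0 add0r in fx2'; rewrite -fx2 -fx2'.
rewrite -ss in fy1'; rewrite -tt in fy2'; split=> //.
  by case: b1 b1' fy1 fy1' {f f' fx1 fx1'} => -[] //; rewrite /sg; lra.
by case: b2 b2' fy2 fy2' {f f' fx2 fx2'} => -[] //; rewrite /sg; lra.
Qed.

Lemma form_det g b1 b2 s t : elems G g -> coord_form g b1 b2 s t -> \det g.1 = sg (b1 (+) b2).
Proof.
move=> Gg f; have [b1' [b2' [s' [t' [f' ->]]]]] := rc Gg.
by have [-> -> _ _] := form_uniq f f'.
Qed.

Lemma formM g h b1 b2 s t b1' b2' s' t' : coord_form g b1 b2 s t -> coord_form h b1' b2' s' t' ->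
  coord_form (affM g h) (b1 (+) b1') (b2 (+) b2') (sg b1 * s' + s) (sg b2 * t' + t).
Proof.
move=> f f' x; rewrite actM; have [-> ->] := f (act h x); have [-> ->] := f' x.
by rewrite -!sgM; split; ring.
Qed.

Lemma eltM b1 b2 s t b1' b2' s' t' : elt b1 b2 s t -> elt b1' b2' s' t' ->
  elt (b1 (+) b1') (b2 (+) b2') (sg b1 * s' + s) (sg b2 * t' + t).
Proof.
move=> [g Gg f] [h Gh f']; exists (affM g h); first exact: elemsM.
exact: formM.
Qed.

Lemma formV g b1 b2 s t : elems G g -> coord_form g b1 b2 s t -> coord_form (affV g) b1 b2 (- sg b1 * s) (- sg b2 * t).
Proof.
move=> Gg f x; have := f (act (affV g) x); rewrite actVK; last exact: elems_orth Gg.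
move=> [-> ->]; split; rewrite mulrDr mulrA ?mulNr sg2; ring.
Qed.

Lemma eltV b1 b2 s t : elt b1 b2 s t -> elt b1 b2 (- sg b1 * s) (- sg b2 * t).
Proof. by move=> [g Gg f]; exists (affV g); [exact: elemsV|exact: formV]. Qed.

Lemma elt1 : elt false false 0 0.
Proof.
by exists (aff1 R); [exact: elems1|move=> x; rewrite act1 !mul1r !addr0].
Qed.

Lemma eltT_B s t s' t' : elt false false s t -> elt false false s' t' -> elt false false (s - s') (t - t').
Proof. by move=> e /eltV e'; have := eltM e e'; rewrite /= !mul1r !mulN1r ![- _ + _]addrC. Qed.

Lemma eltT_D s t s' t' : elt false false s t -> elt false false s' t' -> elt false false (s + s') (t + t').
Proof. by move=> e e'; have := eltM e e'; rewrite /= !mul1r ![_ + s]addrC [_ + t]addrC. Qed.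

Lemma eltT_Z (k : int) s t : elt false false s t -> elt false false (k%:~R * s) (k%:~R * t).
Proof.
move=> e; have H (m : nat) : elt false false (m%:R * s) (m%:R * t).
  elim: m => [|m IH]; first by rewrite !mul0r; exact: elt1.
  by rewrite -natr1 !mulrDl !mul1r; exact: eltT_D.
case: k => m; first exact: H.
have := eltT_B elt1 (H m.+1); rewrite !sub0r NegzE mulrNz !mulNr; exact.
Qed.

Lemma elt_T b1 b2 s t s' t' : elt false false s' t' -> elt b1 b2 s t -> elt b1 b2 (s + s') (t + t').
Proof. by move=> e' e; have := eltM e' e; rewrite !mul1r. Qed.

Hypothesis GF : locally_finite G.

Lemma elt_finite r : finite_set [set s | elt false false s 0 /\ 0 < s <= r].
Proof.
apply: (@sub_finite_set _ _ ((fun g => U (act g 0) - U 0) @` [set g | elems G g /\ enorm (act g 0) <= r])).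
  move=> s [[g Gg f] /andP[s0 sr]]; exists g; last first.
    by have [-> _] := f 0; rewrite mul1r addrC addKr.
  split=> //; have [D _] := fr; have := D (act g 0) 0; have [-> ->] := f 0.
  rewrite subr0 !mul1r addr0 subrr expr0n addr0 [U 0 + _]addrC addrK => E.
  by rewrite -ler_sqr ?nnegrE ?enorm_ge0 ?E ?ler_sqr ?nnegrE; lra.
exact/finite_image/GF.
Qed.

Lemma horizontal_lattice s0 : elt false false s0 0 -> s0 != 0 -> exists2 a, 0 < a &
  forall s, elt false false s 0 <-> exists k : int, s = k%:~R * a.
Proof.
move=> e0 s00.
have [|a [a0 Sa Ha]] := @discrete_subgroup R [set s | elt false false s 0] s0 e0 s00 _ (elt_finite _).
  by move=> s s' es es'; have := eltT_B es es'; rewrite subrr.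
exists a => // s; split=> [|[k ->]]; first exact: Ha.
by have := eltT_Z k Sa; rewrite mulr0.
Qed.
End Fixed.

(** Conjugation by the reversing element changes the translation [(s, t)] into [(s, - t)]; sum and
    difference are the pure translations [(2s, 0)] and [(0, 2t)]. *)
Lemma rectangular_sublattice U V G s0 t0 : frame U V -> rect U V G -> locally_finite G ->
  spanning U V G -> elt U V G false true s0 t0 ->
  exists a b : R, [/\ 0 < a, 0 < b,
    (forall s, elt U V G false false s 0 <-> exists k : int, s = k%:~R * a),
    (forall t, elt U V G false false 0 t <-> exists l : int, t = l%:~R * b) &
    forall s t, elt U V G false false s t -> elt U V G false false (2 * s) 0 /\ elt U V G false false 0 (2 * t)].
Proof.
move=> fr rc GF [[s1 [t1 [e1 n1]]] [s2 [t2 [e2 n2]]]] e0.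
have dbl s t : elt U V G false false s t -> elt U V G false false (2 * s) 0 /\ elt U V G false false 0 (2 * t).
  move=> e; have := eltM (eltM e0 e) (eltV e0).
  rewrite /= !mul1r !mulN1r !opprK => e'.
  have {}e' : elt U V G false false s (- t).
    by move: e'; congr (elt _ _ _ _ _ _ _); rewrite /sg; ring.
  split.
    by have := eltT_D e e'; congr (elt _ _ _ _ _ _ _); ring.
  by have := eltT_B e e'; congr (elt _ _ _ _ _ _ _); ring.
have [a a0 Ha] : exists2 a, 0 < a & forall s, elt U V G false false s 0 <-> exists k : int, s = k%:~R * a.
  by apply: (horizontal_lattice fr GF (dbl _ _ e1).1); rewrite mulf_neq0.
have [b b0 Hb] : exists2 b, 0 < b & forall s, elt V U G false false s 0 <-> exists k : int, s = k%:~R * b.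
  by apply: (horizontal_lattice (frame_swap fr) GF (elt_swap (dbl _ _ e2).2)); rewrite mulf_neq0.
exists a, b; split=> // t; split=> [/elt_swap/Hb//|/Hb/elt_swap//].
Qed.

Lemma int_parity (k : int) : (exists j : int, k = 2 * j) \/ (exists j : int, k = 2 * j + 1).
Proof.
have := divz_eq k 2; have := ltz_pmod k (isT : 0 < 2 :> int); have := modz_ge0 k (isT : 2 != 0 :> int).
set q := (k %/ 2)%Z; set r := (k %% 2)%Z => r0 r2 E.
have [r1|r1] : r = 0 \/ r = 1 by lia.
  by left; exists q; lia.
by right; exists q; lia.
Qed.

(* pg *)
Lemma glide_structure U V G s0 t0 : frame U V -> rect U V G -> locally_finite G ->
  spanning U V G -> (forall t, ~ elt U V G false true 0 t) -> elt U V G false true s0 t0 ->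
  exists a b : R, [/\ 0 < a, 0 < b,
    (forall s t, elt U V G false false s t <-> exists k l : int, s = k%:~R * a /\ t = l%:~R * b) &
    (forall s t, elt U V G false true s t <-> exists k l : int, s = (k%:~R + 2^-1) * a /\ t = t0 + l%:~R * b)].
Proof.
move=> fr rc GF sp nomir e0.
have [a [b [a0 b0 Ha Hb dbl]]] := rectangular_sublattice fr rc GF sp e0.
(* The square of a glide reflection is the pure translation [2 s = k a]. If [k] were even, composing
   with a translation would cancel the glide and leave a mirror. *)
have odd s t : elt U V G false true s t -> exists k : int, s = (k%:~R + 2^-1) * a.
  move=> e; have e2 : elt U V G false false (2 * s) 0.
    by have := eltM e e; congr (elt _ _ _ _ _ _ _); rewrite /sg; ring.
  have /Ha[k kE] := e2.
  have [[j jE]|[j jE]] := int_parity k; last first.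
    by exists j; move: kE; rewrite jE intrD intrM; lra.
  case: (nomir t); have /(elt_T (eltT_Z (- j) ((Ha a).2 (ex_intro _ 1 (esym (mul1r a)))))) := e.
  congr (elt _ _ _ _ _ _ _); last by rewrite mulr0 addr0.
  by move: kE; rewrite jE intrM mulrNz; lra.
(* A translation times the given glide reflection is again one, so [s] is a difference of two
   half-odd multiples of [a]. *)
have lat s t : elt U V G false false s t -> exists k l : int, s = k%:~R * a /\ t = l%:~R * b.
  move=> e; have [k0 k0E] := odd _ _ e0; have [k1 k1E] := odd _ _ (elt_T e e0).
  have sE : s = (k1 - k0)%:~R * a by rewrite intrB; lra.
  have es : elt U V G false false s 0 by apply/Ha; exists (k1 - k0).
  have et : elt U V G false false 0 t by have := eltT_B e es; rewrite subrr subr0.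
  by have /Hb[l lE] := et; exists (k1 - k0), l.
have latV k l : elt U V G false false (k%:~R * a) (l%:~R * b).
  have ea : elt U V G false false (k%:~R * a) 0 by apply/Ha; exists k.
  have eb : elt U V G false false 0 (l%:~R * b) by apply/Hb; exists l.
  by have := eltT_D ea eb; rewrite addr0 add0r.
exists a, b; split=> // s t; split; [exact: lat|by move=> [k [l [-> ->]]]; exact: latV| |].
  move=> e; have := eltM e (eltV e0) => e'.
  have {}e' : elt U V G false false (s - s0) (t - t0).
    by move: e'; congr (elt _ _ _ _ _ _ _); rewrite /sg; ring.
  have [k [l [kE lE]]] := lat _ _ e'; have [k0 k0E] := odd _ _ e0.
  by exists (k + k0), l; rewrite intrD; split; lra.
move=> [k [l [-> ->]]]; have [k0 k0E] := odd _ _ e0.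
have := elt_T (latV (k - k0) l) e0; congr (elt _ _ _ _ _ _ _).
by rewrite intrB k0E; ring.
Qed.

(* The alternatives are pm and cm. *)
Lemma mirror_structure U V G : frame U V -> rect U V G -> locally_finite G ->
  spanning U V G -> elt U V G false true 0 0 ->
  exists a b : R, [/\ 0 < a, 0 < b,
    (forall s t, elt U V G false false s t <-> exists k l : int, s = k%:~R * a /\ t = l%:~R * b) \/
    (forall s t, elt U V G false false s t <-> exists k l : int,
       (s = k%:~R * a /\ t = l%:~R * b) \/ (s = (k%:~R + 2^-1) * a /\ t = (l%:~R + 2^-1) * b)) &
    (forall s t, elt U V G false true s t <-> elt U V G false false s t)].
Proof.
move=> fr rc GF sp e0.
have [a [b [a0 b0 Ha Hb dbl]]] := rectangular_sublattice fr rc GF sp e0.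
have latV k l : elt U V G false false (k%:~R * a) (l%:~R * b).
  have ea : elt U V G false false (k%:~R * a) 0 by apply/Ha; exists k.
  have eb : elt U V G false false 0 (l%:~R * b) by apply/Hb; exists l.
  by have := eltT_D ea eb; rewrite addr0 add0r.
have lat s t : elt U V G false false s t -> exists k l : int,
       (s = k%:~R * a /\ t = l%:~R * b) \/ (s = (k%:~R + 2^-1) * a /\ t = (l%:~R + 2^-1) * b).
  move=> e; have [/Ha[k kE] /Hb[l lE]] := dbl _ _ e.
  (* If one coordinate of the doubled vector is an even multiple, its half splits off as a pure
     translation and the other coordinate is pure too. Two odd multiples give the centred
     lattice. *)
  have [[j jE]|[j jE]] := int_parity k.
    have sE : s = j%:~R * a by move: kE; rewrite jE intrM; lra.
    have es : elt U V G false false s 0 by apply/Ha; exists j.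
    have et : elt U V G false false 0 t by have := eltT_B e es; rewrite subrr subr0.
    by have /Hb[i iE] := et; exists j, i; left.
  have [[i iE]|[i iE]] := int_parity l.
    have tE : t = i%:~R * b by move: lE; rewrite iE intrM; lra.
    have et : elt U V G false false 0 t by apply/Hb; exists i.
    have es : elt U V G false false s 0 by have := eltT_B e et; rewrite subrr subr0.
    by have /Ha[m mE] := es; exists m, i; left.
  by exists j, i; right; move: kE lE; rewrite jE iE !intrD !intrM; split; lra.
exists a, b; split=> //; last first.
  move=> s t; split=> e; first by have := eltM e e0; congr (elt _ _ _ _ _ _ _); rewrite /sg; ring.
  by have := eltM e e0; congr (elt _ _ _ _ _ _ _); rewrite /sg; ring.
have [half|nohalf] := pselect (elt U V G false false (2^-1 * a) (2^-1 * b)).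
  right=> s t; split; first exact: lat.
  move=> [k [l [[-> ->]|[-> ->]]]]; first exact: latV.
  by have := eltT_D half (latV k l); congr (elt _ _ _ _ _ _ _); ring.
left=> s t; split; last by move=> [k [l [-> ->]]].
move=> e; have [k [l [[kE lE]|[kE lE]]]] := lat _ _ e; first by exists k, l.
case: nohalf; have := eltT_B e (latV k l); congr (elt _ _ _ _ _ _ _); rewrite ?kE ?lE; ring.
Qed.

Lemma frame_of_normal (n : plane R) : dotp n n = 1 -> frame (fun x => cross x n) (fun x => dotp n x).
Proof.
move=> n1; split=> [x y|a b'].
  rewrite enorm_sqr -[LHS]mulr1 -[X in _ * X = _]n1 /dotp /cross !planeE; ring.
exists (pt (a * n 1 0 + b' * n 0 0) (b' * n 1 0 - a * n 0 0)).
rewrite /cross /dotp !ptE; split.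
  by rewrite -[RHS]mulr1 -[X in _ = _ * X]n1 /dotp; ring.
by rewrite -[RHS]mulr1 -[X in _ = _ * X]n1 /dotp; ring.
Qed.

Lemma rect_of_normal G (n : plane R) : dotp n n = 1 ->
  (forall g, elems G g -> [\/ g.1 = 1%:M, g.1 = - 1%:M, g.1 = (refl n 0).1 | g.1 = - (refl n 0).1]) ->
  rect (fun x => cross x n) (fun x => dotp n x) G.
Proof.
move=> n1 lin g Gg.
have actE x : act g x = g.1 *m x + g.2 by [].
have rE x : (refl n 0).1 *m x = x - (2 * dotp n x) *: n.
  by apply: planeP; rewrite mulmx2E !planeE /= !mx2E /dotp; ring.
have crD x y : cross (x + y) n = cross x n + cross y n by rewrite /cross !planeE; ring.
have crN x : cross (- x) n = - cross x n by rewrite /cross !planeE; ring.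
have crn a : cross (a *: n) n = 0 by rewrite /cross !planeE; ring.
have detN A : \det (- A : 'M[R]_2) = \det A by rewrite !det2 !mxE; ring.
case: (lin g Gg) => E.
- exists false, false, (cross g.2 n), (dotp n g.2); split; last by rewrite E det1.
  by move=> x; rewrite actE E mul1mx crD dotpDr !mul1r.
- exists true, true, (cross g.2 n), (dotp n g.2); split; last by rewrite E detN det1.
  by move=> x; rewrite actE E mulNmx mul1mx crD crN dotpDr dotpNr !mulN1r.
- exists false, true, (cross g.2 n), (dotp n g.2); split; last by rewrite E det_refl.
  move=> x; rewrite actE E rE !crD crN crn !dotpDr dotpNr dotpZr n1 /sg; split; ring.
- exists true, false, (cross g.2 n), (dotp n g.2); split; last by rewrite E detN det_refl.
  move=> x; rewrite actE E mulNmx rE crD crN crD crN crn !dotpDr dotpNr dotpDr dotpNr dotpZr n1 /sg; split; ring.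
Qed.

Lemma spanning_of_normal G (n : plane R) : dotp n n = 1 -> spans G ->
  spanning (fun x => cross x n) (fun x => dotp n x) G.
Proof.
move=> n1 sp.
have n0 : n != 0 by apply/eqP => n0; move: n1; rewrite n0 /dotp !plane0 mulr0 addr0; lra.
have crD x y : cross (x + y) n = cross x n + cross y n by rewrite /cross !planeE; ring.
have T (t : plane R) : elems G (trans t) -> elt (fun x => cross x n) (fun x => dotp n x) G false false (cross t n) (dotp n t).
  by move=> Gt; exists (trans t) => // x; rewrite act_trans crD dotpDr !mul1r.
split; last by have [t /T e nt] := sp _ n0; exists (cross t n), (dotp n t).
have e0 : pt (n 1 0) (- n 0 0) != 0.
  apply: contraNneq n0 => /matrixP E; apply/eqP; apply: planeP; rewrite plane0.
    by have := E 1 0; rewrite !planeE => /eqP; rewrite oppr_eq0 => /eqP.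
  by have := E 0 0; rewrite !planeE.
have [t /T e nt] := sp _ e0; exists (cross t n), (dotp n t); split=> //.
by move: nt; congr (_ != 0); rewrite /dotp /cross !ptE; ring.
Qed.

End Frames.

(** * Circles, folded lines and product embeddings *)

Section FrameEmbeddings.
Variable R : realType.
Implicit Types (U V : plane R -> R) (G N : subgroupE2 R) (g h : affine R) (s t u v : R).

Lemma nearest_int (x : R) : exists k : int, `|x - k%:~R| <= 2^-1.
Proof.
have [k hk] := @nearest_turn R 1 (2 * pi * x) isT; exists k.
have p0 : 0 < pi :> R := pi_gt0 R.
have hn : 0 < 2 * pi :> R by rewrite mulr_gt0.
rewrite -(ler_pM2l hn) -{1}(gtr0_norm hn) -normrM mulrBr.
have -> : 2 * pi * 2^-1 = pi :> R by move: pi => q; field.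
by move: hk; rewrite !divr1.
Qed.

(** The circle of radius [a / 4] wrapped once by a period [a]: the chord over an arc [w] is
    [(a / 2) sin (pi w / a)], which by Jordan's inequality is at least [w] for [w <= a / 2] and at
    most [(pi / 2) w]. *)
Definition circ (a : R) (i : 'I_2) u : R :=
  a / 4 * (if i == 0 then cos (2 * pi * u / a) else sin (2 * pi * u / a)).

Lemma circ_dist a u v (k : int) : 0 < a ->
  \sum_i (circ a i u - circ a i v) ^+ 2 = (a / 2 * sin (pi * (u - (v + k%:~R * a)) / a)) ^+ 2.
Proof.
move=> a0; have an : a != 0 by rewrite gt_eqF.
rewrite sum2 /circ /=.
have -> : pi * (u - (v + k%:~R * a)) / a = (2 * pi * (u - (v + k%:~R * a)) / a) / 2.
  by move: pi => q; field.
rewrite exprMn sin_half_sqr.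
have -> : 2 * pi * (u - (v + k%:~R * a)) / a = (2 * pi * u / a - 2 * pi * v / a) + 2 * pi * (- k)%:~R.
  by rewrite mulrNz; move: pi => q; field.
rewrite cos_periodZ cosB; have := cos2Dsin2 (2 * pi * u / a); have := cos2Dsin2 (2 * pi * v / a).
move: (cos _) (sin _) => c s; move: (cos _) (sin _) => c' s' h1 h2.
transitivity ((a / 4) ^+ 2 * ((c' ^+ 2 + s' ^+ 2) + (c ^+ 2 + s ^+ 2) - 2 * (c' * c + s' * s))); first by ring.
by rewrite h1 h2; field.
Qed.

Lemma circ_le a u v (k : int) : 0 < a ->
  \sum_i (circ a i u - circ a i v) ^+ 2 <= (pi / 2) ^+ 2 * (u - (v + k%:~R * a)) ^+ 2.
Proof.
move=> a0; rewrite (circ_dist u v k a0) -exprMn -ler_sqrt ?sqr_ge0// !sqrtr_sqr.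
rewrite !normrM; set w := u - _.
apply: (@le_trans _ _ (`|a / 2| * `|pi * w / a|)).
  by rewrite -normrM ler_wpM2l// normr_sin_le.
by rewrite -!normrM le_eqVlt; apply/orP; left; apply/eqP; congr (`|_|); move: pi => q; field; rewrite gt_eqF.
Qed.

Lemma circ_ge a u v : 0 < a ->
  exists k : int, (u - (v + k%:~R * a)) ^+ 2 <= \sum_i (circ a i u - circ a i v) ^+ 2.
Proof.
move=> a0; have [k hk] := nearest_int ((u - v) / a); exists k.
have an : a != 0 by rewrite gt_eqF.
have p0 : 0 < pi :> R := pi_gt0 R.
rewrite (circ_dist u v k a0); set w := u - _.
have wE : (u - v) / a - k%:~R = w / a by rewrite /w; field.
rewrite wE in hk.
rewrite -ler_sqrt ?sqr_ge0// !sqrtr_sqr normrM (gtr0_norm (divr_gt0 a0 _))//.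
have -> : `|sin (pi * w / a)| = `|sin (pi * `|w / a|)|.
  by case: (ger0P (w / a)) => _; rewrite ?mulrN ?sinN ?normrN mulrA.
have h : 0 <= pi * `|w / a| <= pi / 2.
  by rewrite mulr_ge0 ?(ltW p0)//= ler_pM2l.
have J := Jordan_inequality h.
apply: le_trans (ler_wpM2l _ (le_trans J (ler_norm _))); last by rewrite divr_ge0// ltW.
rewrite normrM normfV (gtr0_norm a0) le_eqVlt; apply/orP; left; apply/eqP.
by move: `|w| => z; move: pi p0 => q q0; field; rewrite an gt_eqF.
Qed.

Lemma fold_ex (b v : R) : 0 < b -> exists r : R, (exists (m : int) e, v = m%:~R * b + sg R e * r) /\
  0 <= r /\ forall m : int, r <= `|v - m%:~R * b|.
Proof.
move=> b0; have [m hm] := nearest_int (v / b); exists `|v - m%:~R * b|; split.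
  exists m; exists (v < m%:~R * b); rewrite /sg; case: (ltP v (m%:~R * b)) => h.
    by rewrite ltr0_norm ?subr_lt0//; ring.
  by rewrite ger0_norm ?subr_ge0//; ring.
split=> // n; have bn : b != 0 by rewrite gt_eqF.
have E (j : int) : `|v - j%:~R * b| = b * `|v / b - j%:~R|.
  by rewrite -{2}(gtr0_norm b0) -normrM; congr (`|_|); field.
rewrite !E ler_pM2l//.
have [->//|mn] := eqVneq n m.
have : 1 <= `|(m - n)%:~R : R|.
  by rewrite -intr_norm -[1]/(1%:~R) ler_int; move/eqP: mn => mn; lia.
rewrite intrB; have -> : m%:~R - n%:~R = (v / b - n%:~R) - (v / b - m%:~R) :> R by ring.
by have := ler_normB (v / b - n%:~R) (v / b - m%:~R); lra.
Qed.

(** The distance from [v] to the multiples of [b], which folds the line isometrically onto the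
    segment [[0, b / 2]]; for [b <= 0] it is the default 0. *)
Definition foldR (b v : R) : R := if 0 < b =P true is ReflectT b0 then sval (cid (fold_ex v b0)) else 0.

Lemma foldRP (b v : R) : 0 < b -> (exists (m : int) e, v = m%:~R * b + sg R e * foldR b v) /\
  0 <= foldR b v /\ forall m : int, foldR b v <= `|v - m%:~R * b|.
Proof. by move=> b0; rewrite /foldR; case: eqP => // p; case: (cid _). Qed.

Lemma fold_le b v w : 0 < b -> foldR b v <= foldR b w + `|v - w|.
Proof.
move=> b0; have [[m [e E]] [r0 _]] := foldRP w b0; have [_ [_ /(_ m) h]] := foldRP v b0.
apply: le_trans h _; have -> : v - m%:~R * b = sg R e * foldR b w + (v - w) by rewrite {2}E; ring.
apply: le_trans (ler_normD _ _) _; rewrite lerD2r normrM (ger0_norm r0).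
by case: (e); rewrite /sg ?normrN normr1 mul1r.
Qed.

Lemma fold_act b v (k : int) e : 0 < b -> foldR b (sg R e * v + k%:~R * b) = foldR b v.
Proof.
move=> b0; have H w j d : foldR b (sg R d * w + j%:~R * b) <= foldR b w.
  have [[m [d' E]] [r0 _]] := foldRP w b0.
  have [_ [_ /(_ ((if d then - m else m) + j)%R) h]] := foldRP (sg R d * w + j%:~R * b) b0.
  apply: le_trans h _; rewrite {1}E intrD.
  have -> : sg R d * (m%:~R * b + sg R d' * foldR b w) + j%:~R * b - ((if d then - m else m)%:~R + j%:~R) * b =
    sg R d * sg R d' * foldR b w by case: (d); rewrite /sg ?mulrNz; ring.
  by rewrite sgM normrM (ger0_norm r0); case: (_ (+) _); rewrite /sg ?normrN normr1 mul1r.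
apply/eqP; rewrite eq_le H /=.
have {1}-> : v = sg R e * (sg R e * v + k%:~R * b) + (if e then k else - k)%:~R * b.
  by rewrite mulrDr mulrA sg2; case: (e); rewrite /sg ?mulrNz; ring.
exact: H.
Qed.

Lemma fold_ge b v w : 0 < b -> exists (k : int) e, `|v - (sg R e * w + k%:~R * b)| <= `|foldR b v - foldR b w|.
Proof.
move=> b0; have [[m [e E]] _] := foldRP v b0; have [[m' [e' E']] _] := foldRP w b0.
exists (m - (if e (+) e' then - m' else m')), (e (+) e').
have -> : v - (sg R (e (+) e') * w + (m - (if e (+) e' then - m' else m'))%:~R * b) =
    sg R e * (foldR b v - foldR b w).
  rewrite {1}E {1}E' intrB; case: (e) (e') => -[]; rewrite /sg /= ?mulrNz; ring.
by rewrite normrM; case: (e); rewrite /sg ?normrN normr1 mul1r.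
Qed.

Lemma embeds_product U V G k (c d : 'I_2 -> R -> R) : frame U V -> 0 <= k ->
  (forall g x y, elems G g ->
    \sum_i (c i (U x) - c i (U y)) ^+ 2 <= k ^+ 2 * (U x - U (act g y)) ^+ 2) ->
  (forall g x y, elems G g ->
    \sum_i (d i (V x) - d i (V y)) ^+ 2 <= k ^+ 2 * (V x - V (act g y)) ^+ 2) ->
  (forall x y, exists2 g, elems G g &
    (U x - U (act g y)) ^+ 2 <= \sum_i (c i (U x) - c i (U y)) ^+ 2 /\
    (V x - V (act g y)) ^+ 2 <= \sum_i (d i (V x) - d i (V y)) ^+ 2) -> embeds G k.
Proof.
move=> [D _] k0 cu du lo.
pose f (i : 'I_(2 + 2)) (x : plane R) := match fintype.split i with inl j => c j (U x) | inr j => d j (V x) end.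
have fE x y : \sum_i (f i x - f i y) ^+ 2 =
    \sum_i (c i (U x) - c i (U y)) ^+ 2 + \sum_i (d i (V x) - d i (V y)) ^+ 2.
  rewrite big_split_ord /=; congr (_ + _); apply: eq_bigr => i _; rewrite /f.
    by rewrite (unsplitK (inl i)).
  by rewrite (unsplitK (inr i)).
apply: (embeds_funcs (f := f)) => // [g x y Gg|x y].
  by rewrite fE D mulrDr lerD ?cu ?du.
by have [g Gg [h1 h2]] := lo x y; exists g => //; rewrite fE D lerD.
Qed.

Lemma embeds_torus U V G a b : frame U V -> 0 < a -> 0 < b ->
  (forall k l : int, elt U V G false false (k%:~R * a) (l%:~R * b)) ->
  (forall g, elems G g -> exists k l : int, coord_form U V g false false (k%:~R * a) (l%:~R * b)) ->
  embeds G (pi / 2).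
Proof.
move=> fr a0 b0 lat all; have p0 : 0 < pi :> R := pi_gt0 R.
apply: (embeds_product (c := circ a) (d := circ b) fr); first by lra.
- by move=> g x y /all[k [l f]]; have [-> _] := f y; rewrite mul1r; exact: circ_le.
- by move=> g x y /all[k [l f]]; have [_ ->] := f y; rewrite mul1r; exact: circ_le.
move=> x y; have [k hk] := circ_ge (U x) (U y) a0; have [l hl] := circ_ge (V x) (V y) b0.
by have [g Gg f] := lat k l; exists g => //; have [-> ->] := f y; rewrite !mul1r.
Qed.

Lemma embeds_strip U V G a b : frame U V -> 0 < a -> 0 < b ->
  (forall e (k l : int), elt U V G false e (k%:~R * a) (l%:~R * b)) ->
  (forall g, elems G g -> exists e (k l : int), coord_form U V g false e (k%:~R * a) (l%:~R * b)) ->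
  embeds G (pi / 2).
Proof.
move=> fr a0 b0 lat all; have p2 : 2 <= pi :> R := pi_ge2 R.
pose d (i : 'I_2) v := if i == 0 then foldR b v else 0.
have dE v w : \sum_i (d i v - d i w) ^+ 2 = (foldR b v - foldR b w) ^+ 2.
  by rewrite sum2 /d /= subrr expr0n addr0.
apply: (embeds_product (c := circ a) (d := d) fr); first by lra.
- by move=> g x y /all[e [k [l f]]]; have [-> _] := f y; rewrite mul1r; exact: circ_le.
- move=> g x y /all[e [k [l f]]]; rewrite dE; have [_ ->] := f y.
  rewrite -(fold_act (V y) l e b0); set w := sg R e * V y + _.
  rewrite -exprMn -ler_sqrt ?sqr_ge0// !sqrtr_sqr normrM (@ger0_norm _ (pi / 2)); last by lra.
  apply: (@le_trans _ _ `|V x - w|); last first.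
    by have n0 := normr_ge0 (V x - w); nra.
  have h1 := fold_le (V x) w b0; have := fold_le w (V x) b0; rewrite distrC => h2.
  by rewrite ler_norml; apply/andP; split; lra.
move=> x y; have [k hk] := circ_ge (U x) (U y) a0; have [l [e hl]] := fold_ge (V x) (V y) b0.
have [g Gg f] := lat e k l; exists g => //; have [-> ->] := f y; rewrite mul1r; split=> //.
by rewrite dE -ler_sqrt ?sqr_ge0// !sqrtr_sqr.
Qed.

(** The curve is the line [V = v0], closed up by an element that shifts it by [P]. Points half a
    period apart stay [P / 2] apart: horizontally by an odd multiple of [P / 2] if the element
    shifts by a multiple of [P], vertically in the other case. *)
Lemma line_bound U V G k v0 P e t0 : frame U V -> 0 <= k -> embeds G k -> 0 < P ->
  elt U V G false e P t0 -> sg R e * v0 + t0 = v0 ->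
  (forall g, elems G g -> exists b1 b2 s t, coord_form U V g b1 b2 s t /\
     ((b1 = false /\ exists j : int, s = j%:~R * P) \/ P / 2 <= `|v0 - (sg R b2 * v0 + t)|)) ->
  pi / 2 <= k.
Proof.
move=> fr k0 Gk P0 [g0 Gg0 f0] v0E sep; have [D E] := fr.
have {E}E u : {x | U x = u /\ V x = v0} by apply: cid; exact: E.
pose p s := sval (E (P * s)).
have pU s : U (p s) = P * s by rewrite /p; case: (E _) => x [].
have pV s : V (p s) = v0 by rewrite /p; case: (E _) => x [].
have p0 : 0 < pi :> R := pi_gt0 R.
suff : pi * (P / 2) <= P * k.
  by rewrite mulrA -mulrA mulrCA ler_pM2l.
apply: (@curve_bound _ G k p (P / 2) P Gk k0); [by lra|exact: ltW| | |].
- move=> s t; rewrite -ler_sqr ?nnegrE ?enorm_ge0 ?mulr_ge0 ?(ltW P0)//.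
  by rewrite D !pU !pV subrr expr0n addr0 -mulrBr !exprMn real_normK ?num_real.
- move=> s; exists g0 => //; have [h1 h2] := f0 (p s).
  by apply: (frame_inj fr); rewrite ?h1 ?h2 !(pU, pV) ?v0E// mul1r mulrDr mulr1.
move=> s g Gg; have [b1 [b2 [s' [t [f H]]]]] := sep g Gg.
have Ph : 0 <= P / 2 by lra.
rewrite -ler_sqr ?nnegrE ?enorm_ge0 ?Ph// D.
have [-> ->] := f (p (s + 2^-1)); rewrite !pU !pV.
case: H => [[-> [j ->]]|H].
  rewrite -[leLHS]addr0; apply: lerD; last exact: sqr_ge0.
  have -> : P * s - (sg R false * (P * (s + 2^-1)) + j%:~R * P) = - (P / 2 * (2 * j + 1)%:~R).
    by rewrite intrD intrM /sg; field.
  rewrite sqrrN [leRHS]exprMn ler_peMr ?sqr_ge0// -rmorphXn /= -[1]/(1%:~R) ler_int.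
  have : (2 * j + 1 <= -1) || (1 <= 2 * j + 1) by lia.
  by case/orP => h; nia.
rewrite -[leLHS]add0r; apply: lerD; first exact: sqr_ge0.
by rewrite -[leRHS]real_normK ?num_real// ler_sqr ?nnegrE//; lra.
Qed.

Section Character.
Variables (G : subgroupE2 R) (chi : affine R -> bool).
Hypothesis chiM : forall g h, elems G g -> elems G h -> chi (affM g h) = chi g (+) chi h.

Lemma chi1 : chi (aff1 R) = false.
Proof. by have := chiM (elems1 G) (elems1 G); rewrite affM1; case: chi. Qed.

Lemma chiV g : elems G g -> chi (affV g) = chi g.
Proof.
move=> Gg; have := chiM Gg (elemsV Gg); rewrite affMV ?chi1; last exact: elems_orth Gg.
by case: (chi g); case: (chi (affV g)).
Qed.

Lemma char_kernel_orth g : elems G g /\ ~~ chi g -> g.1^T *m g.1 = 1%:M.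
Proof. by case=> /elems_orth. Qed.

Lemma char_kernel1 : elems G (aff1 R) /\ ~~ chi (aff1 R).
Proof. by split; [exact: elems1|rewrite chi1]. Qed.

Lemma char_kernelM g h : elems G g /\ ~~ chi g -> elems G h /\ ~~ chi h ->
  elems G (affM g h) /\ ~~ chi (affM g h).
Proof.
by move=> [Gg cg] [Gh ch]; split; [exact: elemsM|rewrite chiM// (negbTE cg) (negbTE ch)].
Qed.

Lemma char_kernelV g : elems G g /\ ~~ chi g -> elems G (affV g) /\ ~~ chi (affV g).
Proof. by move=> [Gg cg]; split; [exact: elemsV|rewrite chiV]. Qed.

Definition char_kernel : subgroupE2 R :=
  @SubgroupE2 R [set g | elems G g /\ ~~ chi g] char_kernel_orth char_kernel1 char_kernelM char_kernelV.

(** [N] is given by its elements, rather than as [char_kernel] itself, so that it can also be the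
    translation lattice. *)
Lemma embeds_char_kernel N (s : affine R) k : (forall g, elems N g <-> elems G g /\ ~~ chi g) ->
  elems G s -> chi s -> 0 <= k -> embeds N k -> embeds G (Num.sqrt 2 * k).
Proof.
move=> NE Gs cs; apply: (@embeds_index2 _ G N s) => //.
- by move=> g /NE[].
- move=> n /NE[Gn cn]; apply/NE; have GV := elemsV Gs; have nV := elemsM Gn GV.
  split; first exact: elemsM Gs nV.
  by rewrite chiM// chiM// chiV// cs (negbTE cn).
- by apply/NE; split; [exact: (elemsM Gs Gs)|rewrite chiM// cs].
move=> g Gg; have [cg|cg] := boolP (chi g); last by left; apply/NE.
right; exists (affM g (affV s)); last by rewrite -affMA affVM ?affM1//; exact: elems_orth Gs.
by apply/NE; have GV := elemsV Gs; split; [exact: elemsM Gg GV|rewrite chiM// chiV// cs cg].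
Qed.
End Character.

End FrameEmbeddings.

(** * Groups with rotations of order at most two; pm and cm *)

Section RectangularGroups.
Variable R : realType.
Implicit Types (U V : plane R -> R) (G N : subgroupE2 R) (g h : affine R) (s t u v : R) (p q : plane R).

(** A rotation has a centre, of order 2 by the hypotheses, so its linear part is that of a
    half-turn. *)
Lemma det1_linear G : locally_finite G -> (forall n p, cone_point G n p -> n = 2%N) ->
  (forall n p, corner_point G n p -> n = 2%N) ->
  forall g, elems G g -> \det g.1 = 1 -> g.1 = 1%:M \/ g.1 = - 1%:M.
Proof.
move=> GF hc hk g Gg gd; have [->|/eqP g1] := eqVneq g.1 1%:M; [by left|right].
have [p gp] := rotation_fixpoint (elems_orth Gg) gd g1.
have ng : g <> aff1 R by move=> E; apply: g1; rewrite E.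
have [n [_ cn H]] := rotation_center GF Gg gd gp ng.
have n2 : n = 2%N by case: H => [/hc|/hk].
have [_ _ /(_ g)[|k k2 gE]] := rotations_card cn; first by split.
rewrite n2 in k2 gE; case: k k2 gE => [|[|//]] _ gE.
  by case: ng; rewrite gE mulr0 rotp0.
rewrite gE /rotp /= mulr1 mulrAC divff ?mul1r ?pnatr_eq0//.
by apply: mx2P; rewrite !mx2E !mxE /= ?cospi ?sinpi ?oppr0.
Qed.

(** The linear part of [gam] is a reflection, whose normal defines the frame. All other linear parts
    agree with it or with 1 up to sign. Recentring [V] by half the translation part puts the axis of
    [gam] on [V = 0]. *)
Lemma rect_frame G gam : spans G ->
  (forall g, elems G g -> \det g.1 = 1 -> g.1 = 1%:M \/ g.1 = - 1%:M) ->
  elems G gam -> \det gam.1 = -1 ->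
  exists U V s, [/\ frame U V, rect U V G, spanning U V G & coord_form U V gam false true s 0].
Proof.
move=> sp lin Ggam dgam; have gO := elems_orth Ggam.
have [n [c [n1 gE _]]] : exists n c, [/\ dotp n n = 1, (gam.1, 0) = refl n c & dotp n 0 = c].
  by apply: reflP => //; rewrite /act /= mulmx0 addr0.
have {}gE : gam.1 = (refl n 0).1 by have := congr1 fst gE.
have rc : rect (fun x => cross x n) (fun x => dotp n x) G.
  apply: rect_of_normal => // g Gg; have [d|d] := orth_det (elems_orth Gg).
    by case: (lin g Gg d) => ->; [constructor 1|constructor 2].
  have := lin _ (elemsM Gg (elemsV Ggam)); rewrite det_affM det_affV d dgam mulrNN mulr1 => /(_ erefl) /= H.
  have E : g.1 = g.1 *m gam.1^T *m gam.1 by rewrite -mulmxA gO mulmx1.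
  by rewrite E; case: H => ->; [constructor 3|constructor 4]; rewrite ?mulNmx mul1mx gE.
have fr := frame_of_normal n1.
have [b1 [b2 [s [t [f d]]]]] := rc _ Ggam.
have [b1E b2E] : b1 = false /\ b2 = true.
  have f0 : coord_form (fun x => cross x n) (fun x => dotp n x) (refl n 0) false true 0 0.
    by move=> x; rewrite act_refl /sdist /cross /sg dotpDr dotpNr dotpZr n1 !planeE; split; ring.
  have [fr1 fr2] := fr; have fl0 x : act gam x = act (refl n 0) x + gam.2.
    by rewrite /act -gE /= mulr0 scale0r addr0.
  have H x y z : cross (x + y) z = cross x z + cross y z by rewrite /cross !planeE; ring.
  have f' : coord_form (fun x => cross x n) (fun x => dotp n x) gam false true (cross gam.2 n) (dotp n gam.2).
    by move=> x; rewrite fl0 H dotpDr; have [-> ->] := f0 x; rewrite !addr0.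
  by have [-> ->] := form_uniq fr f f'.
rewrite b1E b2E in f.
exists (recentre 0 (fun x => cross x n)), (recentre (t / 2) (fun x => dotp n x)), (s + sg R false * 0 - 0).
split; [exact: frame_shift|exact: rect_shift|exact/spanning_shift/spanning_of_normal|].
by have := form_shift 0 (t / 2) f; congr (coord_form _ _ _ _ _ _ _); rewrite /sg; field.
Qed.

Section Frame.
Variables (U V : plane R -> R) (G : subgroupE2 R).
Hypothesis fr : frame U V.
Hypothesis rc : rect U V G.
Local Notation elt := (elt U V G).

Lemma frame_lip x y : V x <= V y + enorm (x - y).
Proof.
have [D _] := fr; have : `|V x - V y| <= enorm (x - y).
  by rewrite -ler_sqr ?nnegrE ?enorm_ge0// D real_normK ?num_real// lerDr sqr_ge0.
by rewrite ler_norml => /andP[_]; lra.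
Qed.

Lemma elt_mirror t p : elt false true 0 t -> V p = t / 2 -> on_mirror G p.
Proof.
move=> [g Gg f] Vp; exists g; split=> //; first by rewrite (form_det fr rc Gg f).
by have [h1 h2] := f p; apply: (frame_inj fr); rewrite ?h1 ?h2 ?Vp /sg; lra.
Qed.

Lemma elt_rotation s t p : elt true true s t -> U p = s / 2 -> V p = t / 2 ->
  exists g, [/\ elems G g, \det g.1 = 1, act g p = p & g <> aff1 R].
Proof.
move=> [g Gg f] Up Vp; exists g; split=> //; first by rewrite (form_det fr rc Gg f).
  by have [h1 h2] := f p; apply: (frame_inj fr); rewrite ?h1 ?h2 ?Vp ?Up /sg; lra.
move=> E; have f1 : coord_form U V g false false 0 0 by move=> x; rewrite E act1 !mul1r !addr0.
by have [] := form_uniq fr f f1.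
Qed.

Lemma no_rotation s t : locally_finite G -> (forall n p, ~ cone_point G n p) ->
  (forall n p, ~ corner_point G n p) -> ~ elt true true s t.
Proof.
move=> GF nc nk e; have [p [Up Vp]] := fr.2 (s / 2) (t / 2).
have [g [Gg gd gp g1]] := elt_rotation e Up Vp.
by have [n [_ _ [/nc|/nk]]] := rotation_center GF Gg gd gp g1.
Qed.

Lemma mirror_form p : on_mirror G p -> (exists t, elt false true 0 t /\ V p = t / 2) \/
  (exists s, elt true false s 0 /\ U p = s / 2).
Proof.
move=> [g [Gg gd gp]]; have [b1 [b2 [s [t [f d]]]]] := rc Gg.
have [h1 h2] := f p; rewrite gp in h1 h2; rewrite d in gd.
case: b1 b2 f d gd h1 h2 => -[] f _; rewrite /sg /=; try lra; move=> _ h1 h2.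
  right; exists s; split; last by lra.
  by exists g => //; have -> : 0 = t :> R by lra.
left; exists t; split; last by lra.
by exists g => //; have -> : 0 = s :> R by lra.
Qed.
End Frame.

(* pm *)
Definition full_strip U V G a b : Prop :=
  (forall e (k l : int), elt U V G false e (k%:~R * a) (l%:~R * b)) /\
  (forall g, elems G g -> exists e (k l : int), coord_form U V g false e (k%:~R * a) (l%:~R * b)).

(* cm *)
Definition centred_strip U V G a b : Prop :=
  (forall e (k l : int), elt U V G false e (k%:~R * a) (l%:~R * b) /\
     elt U V G false e ((k%:~R + 2^-1) * a) ((l%:~R + 2^-1) * b)) /\
  (forall g, elems G g -> exists e (k l : int), coord_form U V g false e (k%:~R * a) (l%:~R * b) \/
     coord_form U V g false e ((k%:~R + 2^-1) * a) ((l%:~R + 2^-1) * b)).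

Lemma strip_structure G p : locally_finite G -> spans G -> (forall n p, ~ cone_point G n p) ->
  (forall n p, ~ corner_point G n p) -> on_mirror G p ->
  exists U V a b, [/\ frame U V, rect U V G, 0 < a, 0 < b & full_strip U V G a b \/ centred_strip U V G a b].
Proof.
move=> GF sp nc nk [gam [Ggam dgam gp]].
have lin := det1_linear GF (fun n p c => False_ind _ (nc n p c)) (fun n p c => False_ind _ (nk n p c)).
have [U [V [s [fr rc spn f]]]] := rect_frame sp lin Ggam dgam.
have s0 : s = 0 by have [h _] := f p; rewrite gp mul1r in h; lra.
rewrite s0 in f; have e0 : elt U V G false true 0 0 by exists gam.
have [a [b [a0 b0 lat mir]]] := mirror_structure fr rc GF spn e0.
have all g : elems G g -> exists e s t, coord_form U V g false e s t /\ elt U V G false false s t.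
  move=> Gg; have [b1 [b2 [s' [t [f' d]]]]] := rc _ Gg.
  have e' : elt U V G b1 b2 s' t by exists g.
  case: b1 b2 f' {d} e' => -[] f' e'.
  - by case: (no_rotation fr rc GF nc nk e').
  - by case: (no_rotation fr rc GF nc nk (eltM e' e0)).
  - by exists true, s', t; split=> //; apply/mir.
  - by exists false, s', t.
exists U, V, a, b; split=> //; case: lat => lat; [left|right].
  split=> [e k l|g /all[e [s' [t [f' /lat[k [l [sE tE]]]]]]]].
    have el : elt U V G false false (k%:~R * a) (l%:~R * b) by apply/lat; exists k, l.
    by case: e => //; apply/mir.
  by exists e, k, l; rewrite -sE -tE.
split=> [e k l|g /all[e [s' [t [f' /lat[k [l H]]]]]]].
  have e1 : elt U V G false false (k%:~R * a) (l%:~R * b) by apply/lat; exists k, l; left.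
  have e2 : elt U V G false false ((k%:~R + 2^-1) * a) ((l%:~R + 2^-1) * b).
    by apply/lat; exists k, l; right.
  by case: e => //; split; apply/mir.
by exists e, k, l; case: H => [[<- <-]|[<- <-]]; [left|right].
Qed.

Lemma full_strip_bounds U V G a b : frame U V -> 0 < a -> 0 < b -> full_strip U V G a b ->
  embeds G (pi / 2) /\ forall k, 0 <= k -> embeds G k -> pi / 2 <= k.
Proof.
move=> fr a0 b0 [lat all]; split; first exact: (embeds_strip fr a0 b0).
move=> k k0 Gk; apply: (@line_bound R U V G k 0 a false 0) => //.
- by have := lat false 1 0; rewrite mul1r mul0r.
- by rewrite mulr0 addr0.
move=> g /all[e [j [l f]]]; exists false, e, (j%:~R * a), (l%:~R * b); split=> //.
by left; split=> //; exists j.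
Qed.

Lemma half_int_neq (j k : int) (a : R) : 0 < a -> (j%:~R + 2^-1) * a <> k%:~R * a.
Proof.
move=> a0 /(mulIf (lt0r_neq0 a0)) H.
have : (2 * j + 1)%:~R = (2 * k)%:~R :> R by rewrite intrD !intrM -H; field.
by move/intr_inj; lia.
Qed.

Lemma centred_strip_bounds U V G a b : frame U V -> 0 < a -> 0 < b -> centred_strip U V G a b ->
  embeds G (Num.sqrt 2 * (pi / 2)) /\ forall k, 0 <= k -> embeds G k -> pi / 2 <= k.
Proof.
move=> fr a0 b0 [lat all]; split; last first.
  (* The line [V = b / 4] is the axis of the glide reflection with shift [(a / 2, b / 2)], so its
     period is only [a / 2]. *)
  move=> k k0 Gk; apply: (@line_bound R U V G k (b / 4) (a / 2) true (b / 2)) => //.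
  - by rewrite divr_gt0.
  - by have [_] := lat true 0 0; congr (elt _ _ _ _ _ _ _); field.
  - by rewrite /sg; field.
  move=> g /all[e [j [l [f|f]]]].
    exists false, e, (j%:~R * a), (l%:~R * b); split=> //; left; split=> //.
    by exists (2 * j); rewrite intrM; field.
  exists false, e, ((j%:~R + 2^-1) * a), ((l%:~R + 2^-1) * b); split=> //; left; split=> //.
  by exists (2 * j + 1); rewrite intrD intrM; field.
(* For the upper bound, the elements with integral shift along [U] form a pm group of index two. *)
pose half g := exists e (k : int) t, coord_form U V g false e ((k%:~R + 2^-1) * a) t.
pose chi g := `[< half g >].
have chiF g e (k : int) t : coord_form U V g false e (k%:~R * a) t -> chi g = false.
  move=> f; apply/asboolP => -[e' [k' [t' f']]].
  by have [_ _ E _] := form_uniq fr f f'; apply: (half_int_neq a0 (esym E)).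
have chiT g e (k : int) t : coord_form U V g false e ((k%:~R + 2^-1) * a) t -> chi g.
  by move=> f; apply/asboolP; exists e, k, t.
have chiM g h : elems G g -> elems G h -> chi (affM g h) = chi g (+) chi h.
  move=> /all[e [k [l f]]] /all[e' [k' [l' f']]].
  case: f f' => f [] f'; have := formM f f'; rewrite mul1r => F.
  - rewrite (chiF _ _ _ _ f) (chiF _ _ _ _ f') /=; apply: (chiF _ _ (k' + k)).
    by rewrite intrD mulrDl; exact: F.
  - rewrite (chiF _ _ _ _ f) (chiT _ _ _ _ f') /=; apply: (chiT _ _ (k' + k)).
    by rewrite intrD addrAC mulrDl; exact: F.
  - rewrite (chiT _ _ _ _ f) (chiF _ _ _ _ f') /=; apply: (chiT _ _ (k' + k)).
    by rewrite intrD -addrA mulrDl; exact: F.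
  rewrite (chiT _ _ _ _ f) (chiT _ _ _ _ f') /=; apply: (chiF _ _ (k' + k + 1)).
  have -> : (k' + k + 1)%:~R * a = (k'%:~R + 2^-1) * a + (k%:~R + 2^-1) * a :> R.
    by rewrite !intrD; field.
  exact: F.
have [s Gs fs] := (lat false 0 0).2.
apply: (@embeds_char_kernel R G chi chiM (char_kernel chiM) s) => //.
- exact: chiT fs.
- by rewrite divr_ge0 ?pi_ge0.
apply: (embeds_strip fr a0 b0) => [e k l|g [/all[e [k [l [f|f]]]] cg]].
  by have [[g Gg f] _] := lat e k l; exists g => //; split=> //; rewrite (chiF _ _ _ _ f).
  by exists e, k, l.
by rewrite (chiT _ _ _ _ f) in cg.
Qed.

End RectangularGroups.

(** * Glide reflections *)

Section RectangularTypes.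
Variable R : realType.
Implicit Types (U V : plane R -> R) (G N : subgroupE2 R) (g h : affine R) (s t u v : R) (p q : plane R).

Lemma line_connected G U V : frame U V -> connected (orb G @` [set p | V p = 0]).
Proof.
move=> fr; have [D E] := fr.
have {}E u : {x | U x = u /\ V x = 0} by apply: cid; exact: E.
pose q u := sval (E u).
have qU u : U (q u) = u by rewrite /q; case: (E u) => x [].
have qV u : V (q u) = 0 by rewrite /q; case: (E u) => x [].
have qc : continuous q.
  move=> u; apply/cvg_ballP => e e0; near=> w.
  have uw : `|u - w| < e by near: w; apply: (@nbhsx_ballx _ _ u _ e0).
  have quw : enorm (q u - q w) < e.
    have -> : enorm (q u - q w) = `|u - w|; last by [].
    apply/eqP; rewrite -(eqrXn2 (n := 2)) ?enorm_ge0// D !qU !qV subrr expr0n addr0.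
    by rewrite real_normK ?num_real.
  split=> // i j; rewrite (ord1 j); have [->|->] := I2P i; rewrite /ball /=.
    by apply: le_lt_trans quw; have := coord0_le (q u - q w); rewrite !planeE.
  by apply: le_lt_trans quw; have := coord1_le (q u - q w); rewrite !planeE.
have -> : orb G @` [set p | V p = 0] = (orb G \o q) @` [set: R].
  apply/seteqP; split=> [_ [p Vp <-]|_ [u _ <-]].
    exists (U p) => //=; congr (orb G); apply: (frame_inj fr); rewrite ?qU ?qV //.
  by exists (q u) => //=; exact: qV.
apply: connected_continuous_connected; first exact/connected_intervalP.
apply: continuous_subspaceT => u; apply: continuous_comp; first exact: qc.
exact: pi_continuous.
Unshelve. all: by end_near. Qed.

(** Mirrors are the lines [V = l b / 2]. Even [l] is carried to [V = 0] by the translations along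
    [V], odd [l] by the centring ones, so the mirror locus is the image of one line and connected.
    This excludes cm when two boundary components are listed. *)
Lemma centred_strip_one_boundary U V G a b bs : frame U V -> rect U V G -> 0 < a -> 0 < b ->
  centred_strip U V G a b -> lists_boundaries G bs -> (size bs <= 1)%N.
Proof.
move=> fr rc a0 b0 [lat all] [Cs [Cu <- HC _]].
have locE : @mirror_locus R G = orb G @` [set p | V p = 0].
  apply/seteqP; split=> [_ [p mp <-]|_ [p /= Vp <-]]; last first.
    exists p => //; apply: (elt_mirror fr rc (t := 0)); last by rewrite Vp mul0r.
    by have [] := lat true 0 0; rewrite !mul0r.
  suff [g Gg h] : exists2 g, elems G g & V (act g p) = 0.
    by exists (act g p) => //; exact: orbit_act.
  have H t s : elt U V G false false s t -> V p = - t -> exists2 g, elems G g & V (act g p) = 0.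
    by move=> [g Gg f] Vp; exists g => //; have [_ ->] := f p; rewrite Vp mul1r addNr.
  case: (mirror_form rc mp) => [[t [[g Gg f] Vp]]|[s [[g Gg f] _]]]; last first.
    by have [e [k [l [f'|f']]]] := all _ Gg; have [] := form_uniq fr f f'.
  have [e [k [l [f'|f']]]] := all _ Gg; have [_ _ kE tE] := form_uniq fr f f'; last first.
    by case: (@half_int_neq R k 0 a a0); rewrite -kE mul0r.
  have [[j jE]|[j jE]] := int_parity l.
    apply: (H _ _ (lat false 0 (- j)%R).1); by rewrite Vp tE jE mulrNz intrM; field.
  apply: (H _ _ (lat false 0 (- j - 1)%R).2).
  by rewrite Vp tE jE intrB mulrNz intrD intrM; field.
have conn : connected (@mirror_locus R G) by rewrite locE; exact: line_connected fr.
have one C : C \in Cs -> C = @mirror_locus R G.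
  by move=> /HC[x lx ->]; exact: connected_component_id.
case: Cs Cu {HC} one => [//|C1 [//|C2 Cs]] /= /andP[C1n _] one.
by move: C1n; rewrite (one C1) ?mem_head// (one C2) ?inE ?eqxx ?orbT.
Qed.

(** An orientation-reversing element maps [V] to [- V + l b], so a path from a point to its image
    meets [V = l b / 2]. In pm this line is a mirror, whereas a one-sided loop avoids all fixed
    points. *)
Lemma full_strip_no_crosscap U V G a b : frame U V -> rect U V G -> 0 < a -> 0 < b ->
  full_strip U V G a b -> forall gam, ~ one_sided_loop G gam.
Proof.
move=> fr rc a0 b0 [lat all] gam [gc free [g Gg [gd g1]] _].
have [e [k [l f]]] := all _ Gg.
have eT : e = true.
  by move: gd; rewrite (form_det fr rc Gg f) /sg; case: e {f} => //=; lra.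
rewrite eT in f; have Vc := lip_continuous (frame_lip fr).
have h1 : V (gam 1) = - V (gam 0) + l%:~R * b by rewrite g1; have [_ ->] := f (gam 0); rewrite mulN1r.
have [c c01 Vcl] : exists2 c, c \in `[0%R, 1%R] & (V \o gam) c = l%:~R * b / 2.
  apply: IVT => //.
    by move=> x; exact: (continuous_comp (gc x) (Vc _)).
  by rewrite /= h1 ge_min le_max; case: (leP (V (gam 0)) (l%:~R * b / 2)) => h;
    apply/andP; split; apply/orP; (left + right); lra.
have [|m [Gm md mp]] := elt_mirror fr rc (t := l%:~R * b) (p := gam c) _ Vcl.
  by have := lat true 0 l; rewrite mul0r.
by have := free c c01 m Gm mp => E; move: md; rewrite E det1; lra.
Qed.

Lemma embeds_glide U V G a b s0 t0 : frame U V -> 0 < a -> 0 < b ->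
  (forall k l : int, elt U V G false false (k%:~R * a) (l%:~R * b)) -> elt U V G false true s0 t0 ->
  (forall g, elems G g -> (exists k l : int, coord_form U V g false false (k%:~R * a) (l%:~R * b)) \/
     exists s t, coord_form U V g false true s t) ->
  embeds G (Num.sqrt 2 * (pi / 2)).
Proof.
move=> fr a0 b0 lat [gam Ggam fgam] all.
pose glide g := exists s t, coord_form U V g false true s t.
pose chi g := `[< glide g >].
have chiT g s t : coord_form U V g false true s t -> chi g by move=> f; apply/asboolP; exists s, t.
have chiF g s t : coord_form U V g false false s t -> chi g = false.
  by move=> f; apply/asboolP => -[s' [t' f']]; have [] := form_uniq fr f f'.
have chiM g h : elems G g -> elems G h -> chi (affM g h) = chi g (+) chi h.
  move=> /all[[k [l f]]|[s [t f]]] /all[[k' [l' f']]|[s' [t' f']]]; have F := formM f f'.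
  - by rewrite (chiF _ _ _ f) (chiF _ _ _ f') (chiF _ _ _ F).
  - by rewrite (chiF _ _ _ f) (chiT _ _ _ f') (chiT _ _ _ F).
  - by rewrite (chiT _ _ _ f) (chiF _ _ _ f') (chiT _ _ _ F).
  - by rewrite (chiT _ _ _ f) (chiT _ _ _ f') (chiF _ _ _ F).
apply: (@embeds_char_kernel R G chi chiM (char_kernel chiM) gam) => //.
- exact: chiT fgam.
- by rewrite divr_ge0 ?pi_ge0.
apply: (embeds_torus fr a0 b0) => [k l|g [Gg cg]].
  by have [g Gg f] := lat k l; exists g => //; split=> //; rewrite (chiF _ _ _ f).
by case: (all g Gg) => // -[s [t f]]; rewrite (chiT _ _ _ f) in cg.
Qed.

(** The translations are a rectangular torus group of index two; for the lower bound the curve is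
    the glide axis [V = 0], of period [a / 2]. *)
Lemma glide_group_bounds G gam : locally_finite G -> spans G -> (forall n p, ~ cone_point G n p) ->
  (forall p, ~ on_mirror G p) -> elems G gam -> \det gam.1 = -1 ->
  embeds G (Num.sqrt 2 * (pi / 2)) /\ forall k, 0 <= k -> embeds G k -> pi / 2 <= k.
Proof.
move=> GF sp nc nm Ggam dgam.
have nk n p : ~ corner_point G n p.
  by move=> /corner_two_mirrors[n1 [c1 [_ [_ [m _ _]]]]]; apply: (nm (c1 *: n1)); apply/on_mirrorP;
    exists n1, c1; split=> //; rewrite /sdist dotpZr (proj1 m) mulr1 subrr.
have lin := det1_linear GF (fun n p c => False_ind _ (nc n p c)) (fun n p c => False_ind _ (nk n p c)).
have [U [V [s0 [fr rc spn f]]]] := rect_frame sp lin Ggam dgam.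
have e0 : elt U V G false true s0 0 by exists gam.
have nmir t : ~ elt U V G false true 0 t.
  by move=> e; have [p [_ Vp]] := fr.2 0 (t / 2); apply: (nm p); exact: elt_mirror e Vp.
have [a [b [a0 b0 lat gl]]] := glide_structure fr rc GF spn nmir e0.
have all g : elems G g -> (exists k l : int, coord_form U V g false false (k%:~R * a) (l%:~R * b)) \/
    exists k l : int, coord_form U V g false true ((k%:~R + 2^-1) * a) (l%:~R * b).
  move=> Gg; have [b1 [b2 [s [t [f' d]]]]] := rc _ Gg.
  have e' : elt U V G b1 b2 s t by exists g.
  case: b1 b2 f' {d} e' => -[] f' e'.
  - by case: (no_rotation fr rc GF nc nk e').
  - by case: (no_rotation fr rc GF nc nk (eltM e' e0)).
  - right; have /gl[k [l [sE tE]]] := e'; exists k, l.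
    by move: f'; rewrite sE tE add0r.
  - by left; have /lat[k [l [sE tE]]] := e'; exists k, l; rewrite -sE -tE.
have e1 : elt U V G false true (a / 2) 0.
  by apply/gl; exists 0, 0; split; field.
split; last first.
  move=> k k0 Gk; apply: (@line_bound R U V G k 0 (a / 2) true 0) => //.
  - by rewrite divr_gt0.
  - by rewrite mulr0 addr0.
  move=> g /all[[j [l f']]|[j [l f']]].
    exists false, false, (j%:~R * a), (l%:~R * b); split=> //; left; split=> //.
    by exists (2 * j); rewrite intrM; field.
  exists false, true, ((j%:~R + 2^-1) * a), (l%:~R * b); split=> //; left; split=> //.
  by exists (2 * j + 1); rewrite intrD intrM; field.
apply: (embeds_glide fr a0 b0 _ e0) => [k l|g /all[|[k [l f']]]]; first by apply/lat; exists k, l.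
  by left.
by right; exists ((k%:~R + 2^-1) * a), (l%:~R * b).
Qed.

Definition pgg_elements U V G a b : Prop :=
  (forall k l : int,
    [/\ elt U V G false false (k%:~R * a) (l%:~R * b),
        elt U V G false true ((k%:~R + 2^-1) * a) (l%:~R * b),
        elt U V G true false (k%:~R * a) ((l%:~R + 2^-1) * b) &
        elt U V G true true ((k%:~R + 2^-1) * a) ((l%:~R + 2^-1) * b)]) /\
  (forall g, elems G g -> exists k l : int,
    [\/ coord_form U V g false false (k%:~R * a) (l%:~R * b),
        coord_form U V g false true ((k%:~R + 2^-1) * a) (l%:~R * b),
        coord_form U V g true false (k%:~R * a) ((l%:~R + 2^-1) * b) |
        coord_form U V g true true ((k%:~R + 2^-1) * a) ((l%:~R + 2^-1) * b)]).

Lemma rotation_elt U V G rho p : frame U V -> rect U V G ->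
  elems G rho -> \det rho.1 = 1 -> act rho p = p -> rho <> aff1 R ->
  exists s t, coord_form U V rho true true s t.
Proof.
move=> fr rc Grho drho rhop rho1.
have [b1 [b2 [s [t [f d]]]]] := rc _ Grho; exists s, t.
have [h1 h2] := f p; rewrite rhop in h1 h2; rewrite drho in d.
case: b1 b2 f d h1 h2 => -[] f; rewrite /sg /=; try lra; first by [].
move=> _ h1 h2; case: rho1; apply: (form_act_inj fr f).
have -> : s = 0 by lra. have -> : t = 0 by lra.
by move=> x; rewrite act1 !mul1r !addr0.
Qed.

(** The given glide reflection and its product with the half-turn have perpendicular axes.
    [glide_structure] applies along both, and the two resulting lattices are the same lattice. *)
Lemma pgg_structure G gam rho p : locally_finite G -> spans G ->
  (forall n p, cone_point G n p -> n = 2%N) ->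
  (forall p, ~ on_mirror G p) -> elems G gam -> \det gam.1 = -1 ->
  elems G rho -> \det rho.1 = 1 -> act rho p = p -> rho <> aff1 R ->
  exists U V a b, [/\ frame U V, rect U V G, 0 < a, 0 < b & pgg_elements U V G a b].
Proof.
move=> GF sp c2 nm Ggam dgam Grho drho rhop rho1.
have nk n q : ~ corner_point G n q.
  by move=> /corner_two_mirrors[n1 [c1 [_ [_ [m _ _]]]]]; apply: (nm (c1 *: n1)); apply/on_mirrorP;
    exists n1, c1; split=> //; rewrite /sdist dotpZr (proj1 m) mulr1 subrr.
have lin := det1_linear GF c2 (fun n q c => False_ind _ (nk n q c)).
have [U0 [V [s0 [fr0 rc0 spn0 f0]]]] := rect_frame sp lin Ggam dgam.
have [sr [tr er]] : exists s t, elt U0 V G true true s t.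
  by have [s [t f]] := rotation_elt fr0 rc0 Grho drho rhop rho1; exists s, t, rho.
(* The product of [rho] and [gam] acts as [u |-> - u + (sr - s0)]; its axis becomes [U = 0]. *)
pose U := recentre ((sr - s0) / 2) U0.
have VE : V = recentre 0 V by apply/funext => x; rewrite /recentre subr0.
have fr : frame U V by rewrite VE; exact: frame_shift.
have rc : rect U V G by rewrite VE; exact: rect_shift.
have spn : spanning U V G by rewrite VE; exact: spanning_shift.
have e0 : elt U V G false true s0 0.
  have : elt U0 V G false true s0 0 by exists gam.
  by rewrite {2}VE; move/(elt_shift ((sr - s0) / 2) 0); congr (elt _ _ _ _ _ _ _); rewrite /sg; field.
have e1 : elt U V G true false 0 tr.
  have : elt U0 V G false true s0 0 by exists gam.
  move=> /(eltM er); rewrite /= {2}VE; move/(elt_shift ((sr - s0) / 2) 0).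
  by congr (elt _ _ _ _ _ _ _); rewrite /sg; field.
have nmir t : ~ elt U V G false true 0 t.
  by move=> e; have [q [_ Vq]] := fr.2 0 (t / 2); apply: (nm q); exact: elt_mirror e Vq.
have nmir' t : ~ elt V U G false true 0 t.
  move=> e; have [q [Uq _]] := fr.2 (t / 2) 0; apply: (nm q).
  exact: (elt_mirror (frame_swap fr) (rect_swap rc) e Uq).
have [a [b [a0 b0 lat gl]]] := glide_structure fr rc GF spn nmir e0.
have [b' [a' [b0' a0' lat' gl']]] :=
  glide_structure (frame_swap fr) (rect_swap rc) GF (spanning_swap spn) nmir' (elt_swap e1).
(* The positive generator of an infinite cyclic subgroup of the reals is unique. *)
have same (x y : R) (P : R -> Prop) : 0 < x -> 0 < y -> (forall s, P s <-> exists k : int, s = k%:~R * x) ->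
    (forall s, P s <-> exists k : int, s = k%:~R * y) -> x = y.
  move=> x0 y0 Hx Hy.
  have /Hx[k kE] : P y by apply/Hy; exists 1; rewrite mul1r.
  have /Hy[l lE] : P x by apply/Hx; exists 1; rewrite mul1r.
  have kl : (k * l)%:~R = 1%:~R :> R.
    by apply: (mulIf (lt0r_neq0 x0)); rewrite intrM mul1r {2}lE kE; ring.
  have k0 : (0 < k%:~R :> R) by rewrite -(pmulr_lgt0 _ x0) -kE.
  rewrite ltr0z in k0; move/intr_inj in kl; rewrite kE.
  have -> : k = 1.
    have [?|?] : (l <= 0 \/ 1 <= l)%R by lia.
      by nia.
    by nia.
  by rewrite mul1r.
have ab s : elt U V G false false s 0 <-> exists k : int, s = k%:~R * a.
  split=> [/lat[k [l [-> _]]]|[k ->]]; first by exists k.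
  by apply/lat; exists k, 0; rewrite mul0r.
have ab' s : elt U V G false false s 0 <-> exists k : int, s = k%:~R * a'.
  split=> [/elt_swap/lat'[k [l [_ ->]]]|[k ->]]; first by exists l.
  by apply/elt_swap/lat'; exists 0, k; rewrite mul0r.
have ba t : elt U V G false false 0 t <-> exists k : int, t = k%:~R * b.
  split=> [/lat[k [l [_ ->]]]|[k ->]]; first by exists l.
  by apply/lat; exists 0, k; rewrite mul0r.
have ba' t : elt U V G false false 0 t <-> exists k : int, t = k%:~R * b'.
  split=> [/elt_swap/lat'[k [l [-> _]]]|[k ->]]; first by exists k.
  by apply/elt_swap/lat'; exists k, 0; rewrite mul0r.
have aE := same _ _ _ a0 a0' ab ab'; have bE := same _ _ _ b0 b0' ba ba'.
rewrite -aE -bE in gl'.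
have eff (k l : int) : elt U V G false false (k%:~R * a) (l%:~R * b) by apply/lat; exists k, l.
have eft (k l : int) : elt U V G false true ((k%:~R + 2^-1) * a) (l%:~R * b).
  by apply/gl; exists k, l; rewrite add0r.
have etf (k l : int) : elt U V G true false (k%:~R * a) ((l%:~R + 2^-1) * b).
  by apply/elt_swap/gl'; exists l, k; rewrite add0r.
have ett (k l : int) : elt U V G true true ((k%:~R + 2^-1) * a) ((l%:~R + 2^-1) * b).
  have := eltM (eft k 0) (etf 0 (- l - 1)); congr (elt _ _ _ _ _ _ _).
    by rewrite /sg; ring.
  by rewrite intrB mulrNz /sg; field.
exists U, V, a, b; split=> //; split=> // g Gg.
have [b1 [b2 [s [t [f d]]]]] := rc _ Gg.
have e' : elt U V G b1 b2 s t by exists g.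
case: b1 b2 f {d} e' => -[] f e'.
- have := eltM (eft 0 0) e' => /= e''.
  have /elt_swap/gl'[l [k [E1 E2]]] := e''.
  exists (k - 1), (- l - 1); constructor 4; move: f; congr (coord_form _ _ _ _ _ _ _).
    by move: E2; rewrite intrB /sg; lra.
  by move: E1; rewrite intrB mulrNz /sg; lra.
- have /elt_swap/gl'[l [k [E1 E2]]] := e'; exists k, l; constructor 3.
  by rewrite -E1; move: f; rewrite E2 add0r.
- have /gl[k [l [E1 E2]]] := e'; exists k, l; constructor 2.
  by rewrite -E1; move: f; rewrite E2 add0r.
have /lat[k [l [E1 E2]]] := e'; exists k, l; constructor 1.
by rewrite -E1 -E2.
Qed.

End RectangularTypes.

(** * Bounds for pgg and pmg *)

Section RectangularTypes2.
Variable R : realType.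
Implicit Types (U V : plane R -> R) (G N : subgroupE2 R) (g h : affine R) (s t u v : R) (p q : plane R).

Lemma pgg_swap U V G a b : pgg_elements U V G a b -> pgg_elements V U G b a.
Proof.
move=> [lat all]; split=> [k l|g /all[k [l [f|f|f|f]]]].
- by have [? ? ? ?] := lat l k; split; exact: elt_swap.
- by exists l, k; constructor 1; exact: form_swap.
- by exists l, k; constructor 3; exact: form_swap.
- by exists l, k; constructor 2; exact: form_swap.
- by exists l, k; constructor 4; exact: form_swap.
Qed.

Lemma half_int_norm (l : int) (b : R) : 0 < b -> b / 2 <= `|(l%:~R + 2^-1) * b|.
Proof.
move=> b0; rewrite normrM (gtr0_norm b0) [leRHS]mulrC ler_pM2l//.
have [h|h] : l%:~R <= (-1)%:~R :> R \/ 0%:~R <= l%:~R :> R.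
  by rewrite !ler_int; lia.
  by rewrite ler0_norm; move: h; rewrite mulrNz; lra.
by rewrite ger0_norm; move: h; rewrite mulr0z; lra.
Qed.

(** Along the glide axis [V = 0] the period is [a / 2]. Half-turns and the perpendicular glide
    reflections move this line by at least [b / 2], which is enough when [a <= 2 b]; exchanging the
    coordinates covers the remaining shapes. *)
Lemma pgg_lower U V G a b k : frame U V -> 0 < a -> 0 < b -> pgg_elements U V G a b -> a <= 2 * b ->
  0 <= k -> embeds G k -> pi / 2 <= k.
Proof.
move=> fr a0 b0 [lat all] ab k0 Gk.
apply: (@line_bound R U V G k 0 (a / 2) true 0) => //; first by rewrite divr_gt0.
- by have [_ e _ _] := lat 0 0; move: e; congr (elt _ _ _ _ _ _ _); field.
- by rewrite mulr0 addr0.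
move=> g /all[j [l [f|f|f|f]]].
- exists false, false, (j%:~R * a), (l%:~R * b); split=> //; left; split=> //.
  by exists (2 * j); rewrite intrM; field.
- exists false, true, ((j%:~R + 2^-1) * a), (l%:~R * b); split=> //; left; split=> //.
  by exists (2 * j + 1); rewrite intrD intrM; field.
- exists true, false, (j%:~R * a), ((l%:~R + 2^-1) * b); split=> //; right.
  by rewrite sub0r mulr0 add0r normrN; apply: le_trans (half_int_norm l b0); lra.
exists true, true, ((j%:~R + 2^-1) * a), ((l%:~R + 2^-1) * b); split=> //; right.
by rewrite sub0r mulr0 add0r normrN; apply: le_trans (half_int_norm l b0); lra.
Qed.

Lemma pgg_bounds U V G a b : frame U V -> 0 < a -> 0 < b -> pgg_elements U V G a b ->
  embeds G pi /\ forall k, 0 <= k -> embeds G k -> pi / 2 <= k.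
Proof.
move=> fr a0 b0 H; split; last first.
  move=> k k0 Gk; have [ab|ab] : a <= 2 * b \/ b <= 2 * a by lra.
    exact: (pgg_lower fr a0 b0 H ab k0 Gk).
  exact: (pgg_lower (frame_swap fr) b0 a0 (pgg_swap H) ab k0 Gk).
have [lat all] := H.
pose turn g := exists e s t, coord_form U V g true e s t.
pose chi g := `[< turn g >].
have chiT g e s t : coord_form U V g true e s t -> chi g by move=> f; apply/asboolP; exists e, s, t.
have chiF g e s t : coord_form U V g false e s t -> chi g = false.
  by move=> f; apply/asboolP => -[e' [s' [t' f']]]; have [] := form_uniq fr f f'.
have chiE g b1 b2 s t : coord_form U V g b1 b2 s t -> chi g = b1.
  by case: b1 => f; [exact: chiT f|exact: chiF f].
have ex g : elems G g -> exists b1 b2 s t, coord_form U V g b1 b2 s t.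
  by move=> /all[k [l [f|f|f|f]]]; do 4 eexists; exact: f.
have chiM g h : elems G g -> elems G h -> chi (affM g h) = chi g (+) chi h.
  move=> /ex[b1 [b2 [s [t f]]]] /ex[b1' [b2' [s' [t' f']]]].
  by rewrite (chiE _ _ _ _ _ f) (chiE _ _ _ _ _ f') (chiE _ _ _ _ _ (formM f f')).
have [_ [gl Ggl fgl] _ [rho Grho frho]] := lat 0 0.
(* One factor [sqrt 2] for each step of the chain pgg, pg, p1 of index-two subgroups, and [pi / 2]
   for the torus. *)
have -> : pi = Num.sqrt 2 * (Num.sqrt 2 * (pi / 2)) :> R.
  by rewrite mulrA -expr2 sqrt2_sqr; field.
apply: (@embeds_char_kernel R G chi chiM (char_kernel chiM) rho) => //.
- exact: chiT frho.
- by rewrite mulr_ge0 ?sqrtr_ge0 ?divr_ge0 ?pi_ge0.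
apply: (embeds_glide fr a0 b0 (s0 := (0%:~R + 2^-1) * a) (t0 := 0%:~R * b)).
- by move=> k l; have [[g Gg f] _ _ _] := lat k l; exists g => //; split=> //; rewrite (chiE _ _ _ _ _ f).
- by exists gl => //; split=> //; rewrite (chiE _ _ _ _ _ fgl).
move=> g [/all[k [l [f|f|f|f]]] cg].
- by left; exists k, l.
- by right; exists ((k%:~R + 2^-1) * a), (l%:~R * b).
- by rewrite (chiT _ _ _ _ f) in cg.
- by rewrite (chiT _ _ _ _ f) in cg.
Qed.

Lemma cone_rotation G n p : cone_point G n p ->
  exists g, [/\ elems G g, \det g.1 = 1, act g p = p & g <> aff1 R].
Proof.
move=> [n2 card_n _]; have [n0 Gr _] := rotations_card card_n.
exists (rotp p (2 * pi / n%:R)); split=> //; [exact: det_rotmx|exact: rotp_fix|].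
move=> E; have : rotmx (2 * pi / n%:R : R) = 1%:M by have := congr1 fst E.
have p0 : 0 < pi :> R := pi_gt0 R.
have n2R : 2 <= n%:R :> R by rewrite ler_nat.
have h0 : 0 < 2 * pi / n%:R :> R by rewrite divr_gt0 ?mulr_gt0//; lra.
have h1 : 2 * pi / n%:R <= pi :> R by rewrite ler_pdivrMr; [rewrite [leRHS]mulrC ler_pM2r|lra].
by move=> /rotmx_eq1 E0; have := h0; rewrite E0 ?ltxx//; apply/andP; split; lra.
Qed.

(* Each centre has coordinates (+-a/4 + k a, +-b/4 + l b), and glide reflections identify
   these four points in pairs. *)
Lemma pgg_cone_orbits U V G a b : frame U V -> rect U V G -> 0 < a -> 0 < b -> pgg_elements U V G a b ->
  exists q1 q2, forall n p, cone_point G n p -> orb G p = orb G q1 \/ orb G p = orb G q2.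
Proof.
move=> fr rc a0 b0 [lat all].
have [q1 [U1 V1]] := fr.2 (a / 4) (b / 4); have [q2 [U2 V2]] := fr.2 (a / 4) (- b / 4).
exists q1, q2 => n p /cone_rotation[g [Gg gd gp g1]].
have [s [t f]] := rotation_elt fr rc Gg gd gp g1.
have [k [l [f'|f'|f'|f']]] := all g Gg; have [//= _ _ sE tE] := form_uniq fr f f'.
have [Up Vp] := f p; rewrite gp in Up Vp.
have {}Up : U p = (k%:~R + 2^-1) * a / 2 by move: Up; rewrite sE /sg; lra.
have {}Vp : V p = (l%:~R + 2^-1) * b / 2 by move: Vp; rewrite tE /sg; lra.
have to1 h : elems G h -> U (act h p) = a / 4 -> V (act h p) = b / 4 -> orb G p = orb G q1 \/ orb G p = orb G q2.
  move=> Gh hU hV; left; rewrite -(orbit_act p Gh); congr (orb G).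
  by apply: (frame_inj fr); rewrite ?hU ?hV.
have to2 h : elems G h -> U (act h p) = a / 4 -> V (act h p) = - b / 4 -> orb G p = orb G q1 \/ orb G p = orb G q2.
  move=> Gh hU hV; right; rewrite -(orbit_act p Gh); congr (orb G).
  by apply: (frame_inj fr); rewrite ?hU ?hV.
have [[j jE]|[j jE]] := int_parity k; have [[i iE]|[i iE]] := int_parity l;
    rewrite jE ?intrD intrM in Up; rewrite iE ?intrD intrM in Vp.
- have [[h Gh fh] _ _ _] := lat (- j) (- i); have [hU hV] := fh p; apply: (to1 _ Gh).
    by rewrite hU Up mulrNz /sg; field.
  by rewrite hV Vp mulrNz /sg; field.
- have [[h Gh fh] _ _ _] := lat (- j) (- i - 1); have [hU hV] := fh p; apply: (to2 _ Gh).
    by rewrite hU Up mulrNz /sg; field.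
  by rewrite hV Vp intrB mulrNz /sg; field.
- have [_ [h Gh fh] _ _] := lat (- j - 1) i; have [hU hV] := fh p; apply: (to2 _ Gh).
    by rewrite hU Up intrB mulrNz /sg; field.
  by rewrite hV Vp /sg; field.
have [_ [h Gh fh] _ _] := lat (- j - 1) (i + 1); have [hU hV] := fh p; apply: (to1 _ Gh).
  by rewrite hU Up intrB mulrNz /sg; field.
by rewrite hV Vp intrD /sg; field.
Qed.

(** This is what distinguishes pgg from p2, which has four orbits of cone points of the same
    order. *)
Lemma pgg_cone_count U V G a b ks : frame U V -> rect U V G -> 0 < a -> 0 < b -> pgg_elements U V G a b ->
  (forall n p, cone_point G n p -> n = 2%N) -> lists_orders G (cone_point G) ks -> (size ks <= 2)%N.
Proof.
move=> fr rc a0 b0 H c2 [s [su <- sE]]; rewrite size_map.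
have [q1 [q2 Hq]] := pgg_cone_orbits fr rc a0 b0 H.
apply: (@uniq_leq_size _ s [:: (orb G q1, 2%N); (orb G q2, 2%N)]) => //; case=> o n /sE[p <- cp].
by rewrite (c2 _ _ cp) !inE; case: (Hq _ _ cp) => ->; rewrite eqxx ?orbT.
Qed.

Lemma corner_of_reflections G p g h : locally_finite G -> reflections_at G p g -> reflections_at G p h ->
  g <> h -> exists k, corner_point G k p.
Proof.
move=> GF [Gg gd gp] [Gh hd hp] gh; have hO := elems_orth Gh.
have [|||n [_ _ [[_ _ nm]|ck]]] := @rotation_center R G p (affM g (affV h)) GF (elemsM Gg (elemsV Gh)).
- by rewrite det_affM det_affV gd hd mulrNN mulr1.
- by rewrite actM -{1}hp actV.
- move=> E; apply: gh; have := congr1 (fun z => affM z h) E.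
  by rewrite -affMA affVM// affM1 aff1M.
- by case: nm; exists g.
by exists n.
Qed.

(** [U] and [V] are known through distances only. From [|z - q| = |x - q|] and [|z - x| = 2 |x - q|]
    the parallelogram law in coordinates forces [q] to be the midpoint. *)
Lemma form_point_reflection U V q : frame U V -> exists iota : affine R,
  [/\ orth iota, \det iota.1 = 1 & coord_form U V iota true true (2 * U q) (2 * V q)].
Proof.
move=> [D _]; exists (- 1%:M, 2 *: q); split.
- by rewrite /orth /=; apply: mx2P; rewrite !mulmx2E !mxE /=; ring.
- by rewrite [LHS]det2 !mxE /=; ring.
move=> x; set z := act _ x.
have zE : z = 2 *: q - x by rewrite /z /act /= mulNmx mul1mx addrC.
have E1 : enorm (z - q) ^+ 2 = enorm (x - q) ^+ 2.
  by rewrite !enorm_sqr zE /dotp !planeE; ring.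
have E2 : enorm (z - x) ^+ 2 = 4 * enorm (x - q) ^+ 2.
  by rewrite !enorm_sqr zE /dotp !planeE; ring.
rewrite !D in E1 E2; rewrite /sg.
have E3 : (U z + U x - 2 * U q) ^+ 2 + (V z + V x - 2 * V q) ^+ 2 = 0 by nra.
have [] : U z + U x - 2 * U q = 0 /\ V z + V x - 2 * V q = 0.
  by have := sqr_ge0 (U z + U x - 2 * U q); have := sqr_ge0 (V z + V x - 2 * V q);
    split; apply/eqP; rewrite -sqrf_eq0; apply/eqP; lra.
by split; lra.
Qed.

(** Adjoining the reflection [sig] in [U = 0], perpendicular to the mirrors of [G], produces a pmm
    group. It contains [G] with index two, and its rotation centres lie on mirrors, so [R^2 / G] is
    a double of a rectangle. *)
Lemma pmg_embeds G p rho q : locally_finite G -> spans G ->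
  (forall n p, cone_point G n p -> n = 2%N) -> (forall n p, ~ corner_point G n p) ->
  on_mirror G p ->
  elems G rho -> \det rho.1 = 1 -> act rho q = q -> rho <> aff1 R -> embeds G 2.
Proof.
move=> GF sp c2 nk [gam [Ggam dgam gamp]] Grho drho rhoq rho1.
have lin := det1_linear GF c2 (fun n q c => False_ind _ (nk n q c)).
have [U0 [V [s0 [fr0 rc0 spn0 f0]]]] := rect_frame sp lin Ggam dgam.
have s00 : s0 = 0 by have [h _] := f0 p; rewrite gamp mul1r in h; lra.
rewrite s00 in f0.
have [sr [tr fr']] := rotation_elt fr0 rc0 Grho drho rhoq rho1.
have er : elt U0 V G true true sr tr by exists rho.
(* The centre of [rho] is moved to [U = 0], which thus becomes the axis of the glide reflection
   obtained from [rho] and [gam]. *)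
pose U := recentre (sr / 2) U0.
have VE : V = recentre 0 V by apply/funext => x; rewrite /recentre subr0.
have fr : frame U V by rewrite VE; exact: frame_shift.
have rc : rect U V G by rewrite VE; exact: rect_shift.
have spn : spanning U V G by rewrite VE; exact: spanning_shift.
have fgam : coord_form U V gam false true 0 0.
  by rewrite VE; move: (form_shift (sr / 2) 0 f0); congr (coord_form _ _ _ _ _ _ _); rewrite /sg; field.
have e0 : elt U V G false true 0 0 by exists gam.
have e1 : elt U V G true false 0 tr.
  have : elt U0 V G false true 0 0 by exists gam.
  move=> /(eltM er); rewrite /= {2}VE; move/(elt_shift (sr / 2) 0).
  by congr (elt _ _ _ _ _ _ _); rewrite /sg; field.
have nmir t : ~ elt V U G false true 0 t.
  move=> [g Gg /form_swap f]; have [z [Uz Vz]] := fr.2 (t / 2) 0.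
  have gamz : act gam z = z.
    by have [h1 h2] := fgam z; apply: (frame_inj fr); rewrite ?h1 ?h2 ?Vz /sg; lra.
  have gz : act g z = z.
    by have [h1 h2] := f z; apply: (frame_inj fr); rewrite ?h1 ?h2 ?Uz /sg; lra.
  have gd : \det g.1 = -1 by rewrite (form_det fr rc Gg f).
  have [k ck] : exists k, corner_point G k z.
    apply: (corner_of_reflections GF (g := g) (h := gam)) => // E.
    by rewrite E in f; have [] := form_uniq fr f fgam.
  exact: nk ck.
have [b [a [b0 a0 lat gl]]] :=
  glide_structure (frame_swap fr) (rect_swap rc) GF (spanning_swap spn) nmir (elt_swap e1).
have all b1 b2 s t : elt U V G b1 b2 s t -> exists k : int, s = k%:~R * a.
  have tt s' t' : elt U V G false false s' t' -> exists k : int, s' = k%:~R * a.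
    by move=> /elt_swap/lat[l [k [_ ->]]]; exists k.
  have tf s' t' : elt U V G true false s' t' -> exists k : int, s' = k%:~R * a.
    by move=> /elt_swap/gl[l [k [_ ->]]]; exists k; rewrite add0r.
  case: b1 b2 => -[] e.
  - by have := eltM e0 e; rewrite mul1r addr0 => /tf.
  - exact: tf e.
  - by have := eltM e0 e; rewrite mul1r addr0 => /tt.
  - exact: tt e.
have [z0 [Uo Vo]] := fr.2 0 0.
have [iota [iO di fi]] := form_point_reflection z0 fr; rewrite Uo Vo !mulr0 in fi.
have gO := elems_orth Ggam.
pose sig := affM iota gam.
have sO : orth sig by exact: affM_orth.
have fs : coord_form U V sig true false 0 0 by have := formM fi fgam; rewrite !mulr0 !addr0.
have ss : affM sig sig = aff1 R.
  have f1 : coord_form U V (aff1 R) false false 0 0 by move=> x; rewrite act1 !mul1r !addr0.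
  by apply: (form_act_inj fr _ f1); have := formM fs fs; rewrite !mulr0 !addr0.
have inG g b1 b2 s t : coord_form U V g b1 b2 s t -> elt U V G b1 b2 s t -> elems G g.
  by move=> f [h Gh f']; rewrite (form_act_inj fr f f').
have trE (k l : int) : elt U V G false false (k%:~R * a) (l%:~R * b).
  by apply/elt_swap/lat; exists l, k.
have sG g : elems G g -> elems G (affM sig (affM g sig)).
  move=> Gg; have [b1 [b2 [s [t [f _]]]]] := rc _ Gg.
  have [k sE] : exists k : int, s = k%:~R * a by apply: (all b1 b2 s t); exists g.
  have F := formM fs (formM f fs); rewrite /= !mulr0 !add0r !addr0 addbT /= in F.
  apply: (inG _ _ _ _ _ F).
  (* Conjugation by [sig] replaces [s = k a] by [- s], which the translation by [- 2 k a] achieves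
     inside [G]. *)
  have : elt U V G b1 b2 s t by exists g.
  move=> /(elt_T (trE (- 2 * k) 0)); congr (elt _ _ _ _ _ _ _); rewrite ?sE ?intrM /sg.
  - by case: b1 {f F}.
  - by case: b2 {f F}.
  - by rewrite mulrNz; ring.
  - by ring.
have WF := extension_locally_finite sO ss sG GF.
set W := extension sO ss sG in WF.
have GW : elems G `<=` elems W by exact: extension_sub.
have sW : elems W sig by exact: extension_gen.
have dsig : \det sig.1 = -1 by rewrite det_affM di dgam mul1r.
have Wform w : elems W w -> exists b1 b2 s t (k : int),
    [/\ coord_form U V w b1 b2 s t, \det w.1 = sg R (b1 (+) b2) & s = k%:~R * a].
  have Gform g : elems G g -> exists b1 b2 s t (k : int),
      [/\ coord_form U V g b1 b2 s t, \det g.1 = sg R (b1 (+) b2) & s = k%:~R * a].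
    move=> Gg; have [b1 [b2 [s [t [f d]]]]] := rc _ Gg.
    have [k sE] : exists k : int, s = k%:~R * a by apply: (all b1 b2 s t); exists g.
    by exists b1, b2, s, t, k.
  case=> [/Gform//|/Gform[b1 [b2 [s [t [k [f d sE]]]]]]].
  have F := formM f fs; rewrite -affMA ss affM1 !mulr0 !add0r addbF addbT in F.
  exists (~~ b1), b2, s, t, k; split=> //.
  move: d; rewrite det_affM dsig mulrN1 => /(canRL (@opprK _)) ->.
  by case: (b1) (b2) => -[]; rewrite /sg /= ?opprK.
have rcW : rect U V W.
  by move=> w /Wform[b1 [b2 [s [t [k [f d _]]]]]]; exists b1, b2, s, t.
have zf g b1 b2 : coord_form U V g b1 b2 0 0 -> act g z0 = z0.
  by move=> f; have [h1 h2] := f z0; apply: (frame_inj fr); rewrite ?h1 ?h2 ?Uo ?Vo mulr0 addr0.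
have [n1 [c1 [u1 gE np1]]] := reflP gO dgam (zf _ _ _ fgam).
have [n2 [c2' [u2 sE np2]]] := reflP sO dsig (zf _ _ _ fs).
apply: (@embeds_of_index2_reflection R W G n1 c1 n2 c2' n2 c2') => //.
- exact: sub_spans sp.
- by split=> //; rewrite -gE; exact: GW.
- by split=> //; rewrite -sE.
- apply: (cross_reflections (p := z0)) => //; rewrite np1 np2 -gE -sE => E.
  by rewrite -E in fs; have [] := form_uniq fr fgam fs.
- move=> g z Wg gd gz g1; have [b1 [b2 [s [t [k [f d skE]]]]]] := Wform g Wg.
  have [h1 h2] := f z; rewrite gz in h1 h2; rewrite gd in d.
  case: b1 b2 f d h1 h2 => -[] f; rewrite /sg /=; try lra; move=> _ h1 h2.
    (* A half-turn of [W] with shift [k a] has its centre on [U = k a / 2], the mirror of [sig]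
       followed by the translation by [k a]. *)
    apply: (elt_mirror (frame_swap fr) (rect_swap rcW) (t := k%:~R * a)); last by rewrite -skE; lra.
    have [tau Gtau ftau] := trE k 0; exists (affM tau sig); first by apply: elemsM => //; exact: GW.
    apply: form_swap; have := formM ftau fs; congr (coord_form _ _ _ _ _ _ _).
      by rewrite mulr0 add0r.
    by rewrite mul0r mulr0 add0r.
  case: g1; apply: (form_act_inj fr f).
  have -> : s = 0 by lra. have -> : t = 0 by lra.
  by move=> x; rewrite act1 !mul1r !addr0.
- exact: extension_index2.
- by split=> //; rewrite -sE.
(* In [G] an element reversing [U] alone glides along [V] by a half-odd multiple of [b], so [sig] is
   not one of them. *)
rewrite -sE => Gs.
have /elt_swap/gl[l [k [lE _]]] : elt U V G true false 0 0 by exists sig.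
by case: (@half_int_neq R l 0 b b0); rewrite -lE mul0r.
Qed.

End RectangularTypes2.

(** * Bounds by type *)

Section Types.
Variable R : realType.
Implicit Types (G : subgroupE2 R) (p q : plane R).

Lemma wallpaper_finite G : is_wallpaper G -> locally_finite G.
Proof. by case=> iG _; exact: locally_finite_of_isolated. Qed.

Lemma wallpaper_spans G : is_wallpaper G -> spans G.
Proof.
move=> hG; apply: spans_of_cobounded; apply: cobounded_of_compact; last by case: hG.
exact: wallpaper_finite.
Qed.

Lemma c2_bounds G (lo hi : R) : locally_finite G -> 0 <= hi -> embeds G hi ->
  (forall k, 0 <= k -> embeds G k -> lo <= k) -> (lo%:E <= c2 G <= hi%:E)%E.
Proof.
move=> GF hi0 Ghi Hlo; apply/andP; split; last exact: embeds_c2_le.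
by apply: c2_ge => // k k0 Gk; rewrite lee_fin; exact: Hlo.
Qed.

Lemma c2_eq G (c : R) : locally_finite G -> 0 <= c -> embeds G c ->
  (forall k, 0 <= k -> embeds G k -> c <= k) -> c2 G = c%:E.
Proof.
by move=> GF c0 Gc H; apply/eqP; rewrite eq_le andbC; exact: c2_bounds.
Qed.

(** Two points at positive orbit distance suffice. Let [d] be the least displacement of a generic
    point [x0] and [y] a point at distance [d / 2]; no element brings [y] closer to [x0], so the
    bounds at this pair give [d / 2 <= k d / 2]. *)
Lemma embeds_ge1 G k : locally_finite G -> spans G -> 0 <= k -> embeds G k -> 1 <= k.
Proof.
move=> GF sp k0 [H [F [up low]]].
have [x0 gen] := generic_point GF.
have e1 : pt 1 0 != 0 :> plane R.
  by apply/eqP => /matrixP/(_ 0 0); rewrite ptE plane0 => /eqP; rewrite oner_eq0.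
have [t Gt nt] := sp _ e1.
have [|g [Gg g1] Hg] := @closest_orbit_point R G x0 x0 [set g | elems G g /\ g <> aff1 R] GF (fun g H => proj1 H).
  exists (trans t); split=> // E; move: nt.
  by have := congr1 snd E => /= ->; rewrite /dotp !plane0 !mulr0 addr0 eqxx.
set d := enorm (x0 - act g x0) in Hg.
have d0 : 0 < d.
  by rewrite enorm_gt0 subr_eq0; apply/eqP => E; apply: g1; apply: gen.
pose y := x0 + (d / 2) *: pt 1 0.
have yx : enorm (x0 - y) = d / 2.
  rewrite /y opprD addrA subrr sub0r enormN enormZ gtr0_norm ?divr_gt0//.
  by rewrite enormE /dotp !ptE mulr0 addr0 mulr1 sqrtr1 mulr1.
have near h : elems G h -> d / 2 <= enorm (x0 - act h y).
  move=> Gh; have [->|/eqP h1] := eqVneq h (aff1 R); first by rewrite act1 yx.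
  have := enorm_triangle x0 (act h y) (act h x0).
  rewrite (enorm_act _ _ (elems_orth Gh)) (enormB y) yx.
  by have := Hg h (conj Gh h1); lra.
have [h Gh h2] := low x0 y; have := up _ x0 y (elems1 G).
rewrite act1 yx => h3; have := near h Gh => h4.
have : d / 2 * 1 <= d / 2 * k by rewrite mulr1 [leRHS]mulrC; lra.
by rewrite ler_pM2l// divr_gt0.
Qed.

Lemma cone_order_mem G cs bs x n p : has_type G (Signature cs bs x) -> cone_point G n p -> n \in cs.
Proof. by move=> [h _ _]; exact: (lists_orders_mem h). Qed.

Lemma corner_order_mem G cs bs x n p : has_type G (Signature cs bs x) -> corner_point G n p ->
  n \in flatten bs.
Proof.
move=> [_ h _] /(boundaries_corner h)[b bbs nb]; apply/flattenP; by exists b.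
Qed.

Lemma cone_ex G cs bs x n : has_type G (Signature cs bs x) -> n \in cs -> exists p, cone_point G n p.
Proof. by move=> [h _ _]; exact: (lists_orders_ex h). Qed.

Lemma cone_lower G cs bs x n k : locally_finite G -> has_type G (Signature cs bs x) -> n \in cs ->
  0 <= k -> embeds G k -> n%:R * sin (pi / (2 * n%:R)) <= k.
Proof.
by move=> GF ty /(cone_ex ty)[p cp] k0 Gk; exact: cone_point_bound cp k0 Gk.
Qed.

Lemma c2_reflection_group G k b bs x : is_wallpaper G -> has_type G (Signature [::] (b :: bs) x) ->
  k \in b -> c2 G = 1%:E.
Proof.
move=> hG ty kb; have GF := wallpaper_finite hG; have sp := wallpaper_spans hG.
have [q cq] : exists q, corner_point G k q.
  by case: ty => _ h _; apply: boundaries_corner_ex h _ kb; exact: mem_head.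
apply: c2_eq => //; last by move=> k' k0 Gk; exact: embeds_ge1 Gk.
by apply: embeds_corner cq _ _ => // n p /(cone_order_mem ty).
Qed.

Lemma embeds_one_cone G n k b bs x kap : is_wallpaper G -> has_type G (Signature [:: n] (b :: bs) x) ->
  k \in b -> cone_table n kap -> embeds G kap.
Proof.
move=> hG ty kb tab; have GF := wallpaper_finite hG; have sp := wallpaper_spans hG.
have [q cq] : exists q, corner_point G k q.
  by case: ty => _ h _; apply: boundaries_corner_ex h _ kb; exact: mem_head.
have kap1 : 1 <= kap by case: tab => ? [].
apply: embeds_corner cq _ _ => // m p /(cone_order_mem ty).
by rewrite inE => /eqP ->.
Qed.

Lemma c2_one_cone G n k b bs x kap : is_wallpaper G -> has_type G (Signature [:: n] (b :: bs) x) ->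
  k \in b -> cone_table n kap -> n%:R * sin (pi / (2 * n%:R)) = kap -> c2 G = kap%:E.
Proof.
move=> hG ty kb tab cE; have GF := wallpaper_finite hG.
have kap1 : 1 <= kap by case: tab => ? [].
apply: c2_eq => //; [lra|exact: embeds_one_cone ty kb tab|].
by move=> k' k0 Gk; rewrite -cE; apply: (cone_lower GF ty _ k0 Gk); exact: mem_head.
Qed.

Lemma pi_div_sqrt2 : pi / Num.sqrt 2 = Num.sqrt 2 * (pi / 2) :> R.
Proof.
have s0 : Num.sqrt 2 != 0 :> R by rewrite gt_eqF// sqrtr_gt0.
apply: (mulIf s0); rewrite mulfVK// mulrAC -expr2 sqrt2_sqr.
by move: pi => q; field.
Qed.

Lemma has_no_corner G cs bs x n p : has_type G (Signature cs bs x) -> flatten bs = [::] -> ~ corner_point G n p.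
Proof. by move=> ty E /(corner_order_mem ty); rewrite E. Qed.

Lemma c2_annulus G : is_wallpaper G -> has_type G (Signature [::] [:: [::]; [::]] 0) ->
  c2 G = (pi / 2)%:E.
Proof.
move=> hG ty; have GF := wallpaper_finite hG; have sp := wallpaper_spans hG.
have nc n p : ~ cone_point G n p by move=> /(cone_order_mem ty).
have nk n p : ~ corner_point G n p by exact: (has_no_corner ty).
have lb : lists_boundaries G [:: [::]; [::]] by case: ty.
have [p mp] := boundaries_mirror_ex lb.
(* The centred case has at most one boundary component, against the two in the signature. *)
have [U [V [a [b [fr rc a0 b0 [st|st]]]]]] := strip_structure GF sp nc nk mp; last first.
  by have := centred_strip_one_boundary fr rc a0 b0 st lb.
have [up lo] := full_strip_bounds fr a0 b0 st.
by apply: c2_eq => //; rewrite divr_ge0 ?pi_ge0.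
Qed.

Lemma c2_moebius G : is_wallpaper G -> has_type G (Signature [::] [:: [::]] 1) ->
  ((pi / 2)%:E <= c2 G <= (pi / Num.sqrt 2)%:E)%E.
Proof.
move=> hG ty; have GF := wallpaper_finite hG; have sp := wallpaper_spans hG.
have nc n p : ~ cone_point G n p by move=> /(cone_order_mem ty).
have nk n p : ~ corner_point G n p by exact: (has_no_corner ty).
have [_ lb [[gam [Hg _]] _]] := ty.
have [p mp] := boundaries_mirror_ex lb.
(* The rectangular case admits no one-sided loop, against the crosscap in the signature. *)
have [U [V [a [b [fr rc a0 b0 [st|st]]]]]] := strip_structure GF sp nc nk mp.
  by case: (full_strip_no_crosscap fr rc a0 b0 st (Hg ord0)).
have [up lo] := centred_strip_bounds fr a0 b0 st.
by rewrite pi_div_sqrt2; apply: c2_bounds => //; rewrite mulr_ge0 ?sqrtr_ge0 ?divr_ge0 ?pi_ge0.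
Qed.

Lemma c2_klein G : is_wallpaper G -> has_type G (Signature [::] [::] 2) ->
  ((pi / 2)%:E <= c2 G <= (pi / Num.sqrt 2)%:E)%E.
Proof.
move=> hG ty; have GF := wallpaper_finite hG; have sp := wallpaper_spans hG.
have nc n p : ~ cone_point G n p by move=> /(cone_order_mem ty).
have [_ lb /crosscap_det[gam Ggam dgam]] := ty.
have nm p : ~ on_mirror G p by exact: boundaries_nil_mirror.
have [up lo] := glide_group_bounds GF sp nc nm Ggam dgam.
by rewrite pi_div_sqrt2; apply: c2_bounds => //; rewrite mulr_ge0 ?sqrtr_ge0 ?divr_ge0 ?pi_ge0.
Qed.

Lemma c2_pgg G : is_wallpaper G -> has_type G (Signature [:: 2; 2]%N [::] 1) ->
  ((pi / 2)%:E <= c2 G <= pi%:E)%E.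
Proof.
move=> hG ty; have GF := wallpaper_finite hG; have sp := wallpaper_spans hG.
have c2 n p : cone_point G n p -> n = 2%N.
  by move=> /(cone_order_mem ty); rewrite !inE orbb => /eqP.
have [_ lb /crosscap_det[gam Ggam dgam]] := ty.
have nm p : ~ on_mirror G p by exact: boundaries_nil_mirror.
have [p /cone_rotation[rho [Gr dr rp r1]]] := cone_ex ty (mem_head 2%N _).
have [U [V [a [b [fr rc a0 b0 st]]]]] := pgg_structure GF sp c2 nm Ggam dgam Gr dr rp r1.
have [up lo] := pgg_bounds fr a0 b0 st.
by apply: c2_bounds => //; exact: pi_ge0.
Qed.

Lemma c2_pmg G : is_wallpaper G -> has_type G (Signature [:: 2; 2]%N [:: [::]] 0) ->
  ((Num.sqrt 2)%:E <= c2 G <= 2%:E)%E.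
Proof.
move=> hG ty; have GF := wallpaper_finite hG; have sp := wallpaper_spans hG.
have c2 n p : cone_point G n p -> n = 2%N.
  by move=> /(cone_order_mem ty); rewrite !inE orbb => /eqP.
have nk n p : ~ corner_point G n p by exact: (has_no_corner ty).
have lb : lists_boundaries G [:: [::]] by case: ty.
have [p mp] := boundaries_mirror_ex lb.
have [q /cone_rotation[rho [Gr dr rp r1]]] := cone_ex ty (mem_head 2%N _).
apply: c2_bounds => //; first exact: (pmg_embeds GF sp c2 nk mp Gr dr rp r1).
by move=> k k0 Gk; rewrite -cone_const2; apply: (cone_lower GF ty _ k0 Gk); exact: mem_head.
Qed.

End Types.

(** * Translation lattices *)

Section Lattices.
Variable R : realType.
Implicit Types (G N : subgroupE2 R) (p q t w tau : plane R).

Lemma shortest_translation G : locally_finite G -> spans G -> exists tau,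
  [/\ elems G (trans tau), tau != 0 & forall t, elems G (trans t) -> t != 0 -> enorm tau <= enorm t].
Proof.
move=> GF sp.
have e1 : pt 1 0 != 0 :> plane R.
  by apply/eqP => /matrixP/(_ 0 0); rewrite ptE plane0 => /eqP; rewrite oner_eq0.
have [t Gt nt] := sp _ e1.
have t0 : t != 0 by apply: contraNneq nt => ->; rewrite /dotp !plane0 !mulr0 addr0.
pose A : set (affine R) := [set g | elems G g /\ exists2 t, g = trans t & t != 0].
have [|||g [Gg [tau gE tau0]] Hg] := @locally_finite_argmin R G A (fun g => enorm (act g 0)) 0 GF.
- by move=> g [].
- by exists (trans t); split=> //; exists t.
- by move=> g _; rewrite addr0.
exists tau; rewrite -gE; split=> // s Gs s0.
have := Hg (trans s); rewrite gE !act_trans !add0r; apply.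
by split=> //; exists s.
Qed.

Lemma enorm_frame (e x : plane R) : dotp e e = 1 ->
  enorm x ^+ 2 = dotp e x ^+ 2 + dotp (pt (- e 1 0) (e 0 0)) x ^+ 2.
Proof.
move=> u; rewrite enorm_sqr -[LHS]mul1r -[X in X * _]u /dotp !ptE; ring.
Qed.

(** Lagrange-Gauss reduction. With [tau] shortest of length [a] and [w] reduced along it,
    [|m| <= a / 2] and [m^2 + h^2 >= a^2] combine to [3 m^2 <= h^2]. *)
Lemma reduced_basis G : locally_finite G -> spans G -> exists (e tau w : plane R) (a m h : R),
  [/\ dotp e e = 1, 0 < a /\ 0 < h, tau = a *: e,
      elems G (trans tau) /\ elems G (trans w) &
      [/\ dotp e w = m, dotp (pt (- e 1 0) (e 0 0)) w = h, 3 * m ^+ 2 <= h ^+ 2 &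
      forall t, elems G (trans t) -> exists k l : int, t = k%:~R *: tau + l%:~R *: w]].
Proof.
move=> GF sp; have [tau [Gtau tau0 Hmin]] := shortest_translation GF sp.
have [a aE] : exists a, a = enorm tau by exists (enorm tau).
rewrite -aE in Hmin.
have a0 : 0 < a by rewrite aE enorm_gt0.
pose e := a^-1 *: tau.
have tauE : tau = a *: e by rewrite scalerA divff ?scale1r// gt_eqF.
have ee : dotp e e = 1.
  by rewrite /e dotpZl dotpZr -enorm_sqr -aE; field; rewrite gt_eqF.
move: e tauE ee => e tauE ee.
pose n := pt (- e 1 0) (e 0 0).
have ne : dotp n e = 0 by rewrite /n /dotp !ptE; ring.
have n0 : n != 0.
  apply/eqP => n0; move: ee; rewrite /dotp; have := congr1 (fun z : plane R => z 0 0) n0.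
  have := congr1 (fun z : plane R => z 1 0) n0; rewrite !ptE !plane0 => -> /eqP.
  by rewrite oppr_eq0 => /eqP ->; rewrite !mul0r addr0 => /esym/eqP; rewrite oner_eq0.
have nE x : dotp (pt (- e 1 0) (e 0 0)) x = dotp n x by [].
have red t : elems G (trans t) -> exists k : int,
    [/\ elems G (trans (t - k%:~R *: tau)), dotp n (t - k%:~R *: tau) = dotp n t &
      `|dotp e (t - k%:~R *: tau)| <= a / 2].
  move=> Gt; have [k hk] := nearest_int (dotp e t / a); exists k.
  split; first by apply: elems_transB => //; exact: elems_transMz.
    by rewrite dotpDr dotpNr dotpZr tauE dotpZr ne !mulr0 subr0.
  rewrite dotpDr dotpNr dotpZr tauE dotpZr ee mulr1.
  have -> : dotp e t - k%:~R * a = a * (dotp e t / a - k%:~R) by field; rewrite gt_eqF.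
  by rewrite normrM gtr0_norm// ler_pM2l.
have bnd t : enorm t <= `|dotp e t| + `|dotp n t|.
  rewrite -ler_sqr ?nnegrE ?enorm_ge0 ?addr_ge0 ?normr_ge0// (enorm_frame t ee) nE.
  rewrite [leRHS]sqrrD !real_normK ?num_real//.
  have : 0 <= `|dotp e t| * `|dotp n t| by rewrite mulr_ge0.
  by rewrite -mulr_natr; lra.
have [t0 Gt0 nt0] := sp _ n0.
pose S : set R := [set x | exists2 t, elems G (trans t) & dotp n t = x].
have [||h [h0 [w0 Gw0 w0h] Hh]] := @discrete_subgroup R S (dotp n t0) (ex_intro2 _ _ t0 Gt0 erefl) nt0.
- move=> x y [t Gt <-] [s Gs <-]; exists (t - s); first exact: elems_transB.
  by rewrite dotpDr dotpNr.
- apply: (@sub_finite_set _ _ ((fun g : affine R => dotp n g.2) @`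
     [set g | elems G g /\ enorm (act g 0) <= a / 2 + `|dotp n t0|])).
    move=> x [[t Gt <-] /andP[x0 xt]]; have [k [Gk nk ek]] := red t Gt.
    exists (trans (t - k%:~R *: tau)) => //; split=> //.
    rewrite act_trans add0r; apply: le_trans (bnd _) _; rewrite nk lerD//.
    by rewrite gtr0_norm.
  exact/finite_image/GF.
have [k [Gw nw ew]] := red w0 Gw0; rewrite w0h in nw.
move: (w0 - _) Gw nw ew => w Gw nw ew.
have wn0 : w != 0 by apply: contraTneq h0 => E; rewrite -nw E /dotp !plane0 !mulr0 addr0 ltxx.
exists e, tau, w, a, (dotp e w), h; split=> //; split=> //.
  have := Hmin w Gw wn0; rewrite -ler_sqr ?nnegrE ?enorm_ge0 ?(ltW a0)// (enorm_frame w ee) nE nw.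
  have : dotp e w ^+ 2 <= (a / 2) ^+ 2.
    by rewrite -[leLHS]real_normK ?num_real// ler_sqr ?nnegrE ?normr_ge0//; lra.
  by rewrite expr_div_n; lra.
move=> t Gt; have [l lE] := Hh _ (ex_intro2 _ _ t Gt erefl).
have [k' [Gk' nk' ek']] := red _ (elems_transB Gt (elems_transMz l Gw)).
(* The remainder is parallel to [tau] and of length at most [a / 2], hence zero. *)
exists k', l; apply/eqP; rewrite -subr_eq0 opprD addrA addrAC; apply: contraT => ne0.
have := Hmin _ Gk' ne0; have := bnd (t - l%:~R *: w - k'%:~R *: tau).
have -> : dotp n (t - l%:~R *: w - k'%:~R *: tau) = 0.
  by rewrite nk' dotpDr dotpNr dotpZr nw lE subrr.
rewrite normr0 addr0.
by move=> h1 h2; exfalso; move: (le_trans h2 (le_trans h1 ek')); lra.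
Qed.

(* A reduced lattice is sheared to a rectangular one by a map that changes lengths by a
   factor of at most [Num.sqrt 2]. *)
Lemma embeds_lattice G : locally_finite G -> spans G -> (forall g, elems G g -> g.1 = 1%:M) ->
  embeds G pi.
Proof.
move=> GF sp tr; have [e [tau [w [a [m [h [ee [a0 h0] tauE [Gtau Gw] [em nh mh all]]]]]]]] := reduced_basis GF sp.
pose n := pt (- e 1 0) (e 0 0).
have ne : dotp n e = 0 by rewrite /n /dotp !ptE; ring.
pose c := m / h; pose U x := dotp e x - c * dotp n x.
have hn : h != 0 by rewrite gt_eqF.
(* The shear maps [(A + c B, B)] to [(A, B)]. Squared lengths change by at most 2 in either
   direction when [c^2 <= 1 / 2]: the defects are [(A + 2 c B)^2 + (1 - 2 c^2) B^2] and
   [(A - c B)^2 + (1 - 2 c^2) B^2]. *)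
have c2 : c ^+ 2 <= 1 / 2.
  rewrite /c expr_div_n ler_pdivrMr ?exprn_gt0//.
  by have := sqr_ge0 h; lra.
pose s2 : R := Num.sqrt 2.
pose f (i : 'I_(2 + 2)) x := match fintype.split i with
  inl j => s2 * circ a j (U x) | inr j => s2 * circ h j (dotp n x) end.
have fE x y : \sum_i (f i x - f i y) ^+ 2 = 2 * (\sum_i (circ a i (U x) - circ a i (U y)) ^+ 2 +
    \sum_i (circ h i (dotp n x) - circ h i (dotp n y)) ^+ 2).
  rewrite big_split_ord /= mulrDr !mulr_sumr; congr (_ + _); apply: eq_bigr => i _; rewrite /f.
    by rewrite (unsplitK (inl i)) -mulrBr exprMn /s2 sqrt2_sqr.
  by rewrite (unsplitK (inr i)) -mulrBr exprMn /s2 sqrt2_sqr.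
have coords x (k l : int) : U (x + (k%:~R *: tau + l%:~R *: w)) = U x + k%:~R * a /\
    dotp n (x + (k%:~R *: tau + l%:~R *: w)) = dotp n x + l%:~R * h.
  rewrite /U !dotpDr !dotpZr em -/n tauE !dotpZr ee ne nh; split; last by ring.
  by rewrite /c; field.
have D x y : enorm (x - y) ^+ 2 = (U x - U y + c * (dotp n x - dotp n y)) ^+ 2 + (dotp n x - dotp n y) ^+ 2.
  by rewrite (enorm_frame _ ee) -/n !dotpDr !dotpNr /U; ring.
have p0 : 0 <= pi :> R := pi_ge0 R.
apply: (embeds_funcs (f := f)) => // [g x y Gg|x y].
  have gE : act g y = y + g.2 by rewrite /act (tr g Gg) mul1mx.
  have [k [l kl]] := all _ (elems_trans_of_lin Gg (tr g Gg)).
  rewrite fE D gE kl; have [-> ->] := coords y k l.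
  have := circ_le (U x) (U y) k a0; have := circ_le (dotp n x) (dotp n y) l h0.
  move: (U x - (U y + _)) (dotp n x - (dotp n y + _)) => A B.
  move: (\sum_i _) (\sum_i _) => S1 S2 h1 h2.
  have h3 : A ^+ 2 + B ^+ 2 <= 2 * ((A + c * B) ^+ 2 + B ^+ 2).
    have q1 := sqr_ge0 (A + 2 * (c * B)).
    have : c ^+ 2 * B ^+ 2 <= 1 / 2 * B ^+ 2 by rewrite ler_wpM2r ?sqr_ge0.
    by rewrite -exprMn; nra.
  have h4 := ler_wpM2l (sqr_ge0 (pi / 2)) h3.
  by move: h1 h2 h4; rewrite expr_div_n; lra.
have [k hk] := circ_ge (U x) (U y) a0; have [l hl] := circ_ge (dotp n x) (dotp n y) h0.
exists (trans (k%:~R *: tau + l%:~R *: w)).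
  by apply: elems_transD; exact: elems_transMz.
rewrite act_trans D fE; have [-> ->] := coords y k l.
move: hk hl; move: (U x - (U y + _)) (dotp n x - (dotp n y + _)) => A B.
move: (\sum_i _) (\sum_i _) => S1 S2 h1 h2.
have q1 := sqr_ge0 (A - c * B).
have : c ^+ 2 * B ^+ 2 <= 1 / 2 * B ^+ 2 by rewrite ler_wpM2r ?sqr_ge0.
by rewrite -exprMn; nra.
Qed.

Lemma translation_lattice_spans G : spans G -> spans (translation_lattice G).
Proof. by move=> sp n /sp[t Gt nt]; exists t. Qed.

Lemma c2_p2 G : is_wallpaper G -> has_type G (Signature [:: 2; 2; 2; 2]%N [::] 0) ->
   ((Num.sqrt 2)%:E <= c2 G)%E /\
   (c2 G <= (Num.sqrt 2)%:E * c2 (translation_lattice G))%E /\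
   ((Num.sqrt 2)%:E * c2 (translation_lattice G) < (8 * Num.sqrt 2)%:E)%E.
Proof.
move=> hG ty; have GF := wallpaper_finite hG; have sp := wallpaper_spans hG.
have ord2 n p : cone_point G n p -> n = 2%N.
  by move=> /(cone_order_mem ty); rewrite !inE !orbb => /eqP.
have nk n p : ~ corner_point G n p by exact: (has_no_corner ty).
have [lc lb _] := ty.
have nm p : ~ on_mirror G p by exact: boundaries_nil_mirror.
have [p /cone_rotation[rho [Gr dr rp r1]]] := cone_ex ty (mem_head 2%N _).
(* An orientation-reversing element would make [G] a pgg group, with at most two orbits of cone
   points instead of four. *)
have det1 g : elems G g -> \det g.1 = 1.
  move=> Gg; have [//|dg] := orth_det (elems_orth Gg).
  have [U [V [a [b [fr rc a0 b0 st]]]]] := pgg_structure GF sp ord2 nm Gg dg Gr dr rp r1.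
  by have := pgg_cone_count fr rc a0 b0 st ord2 lc.
have lin g : elems G g -> g.1 = 1%:M \/ g.1 = - 1%:M.
  by move=> Gg; apply: (det1_linear GF ord2 (fun n q c => False_ind _ (nk n q c))) => //; exact: det1.
have n1 : (- 1%:M : 'M[R]_2) != 1%:M.
  by apply/eqP => /matrixP/(_ 0 0); rewrite !mxE /=; lra.
pose chi (g : affine R) := g.1 != 1%:M.
have chiM g h : elems G g -> elems G h -> chi (affM g h) = chi g (+) chi h.
  move=> /lin gl /lin hl; rewrite /chi /=.
  by case: gl hl => -> [] ->; rewrite ?mulNmx ?mulmxN ?mul1mx ?opprK ?eqxx ?n1.
have NE g : elems (translation_lattice G) g <-> elems G g /\ ~~ chi g.
  by rewrite /chi negbK; split=> -[Gg] /eqP.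
have chir : chi rho.
  apply/eqP => r; apply: r1; apply: aff_eq => x; rewrite act1.
  have : rho.2 = 0.
    by move: rp; rewrite /act r mul1mx => /eqP; rewrite -subr_eq0 addrC addKr => /eqP.
  by rewrite /act r mul1mx => ->; rewrite addr0.
have NF : locally_finite (translation_lattice G) by apply: locally_finite_sub GF => g [].
split; [|split].
- apply: c2_ge => // k k0 Gk; rewrite lee_fin -cone_const2.
  by apply: (cone_lower GF ty _ k0 Gk); exact: mem_head.
- have s0 : 0 < Num.sqrt 2 :> R by rewrite sqrtr_gt0.
  by apply: (c2_scale NF s0) => k k0 Nk; exact: (embeds_char_kernel chiM NE Gr chir k0 Nk).
have : (c2 (translation_lattice G) <= pi%:E)%E.
  apply: embeds_c2_le; first exact: pi_ge0.
  by apply: embeds_lattice => //; [exact: translation_lattice_spans|move=> g []].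
move=> h.
have s0 : (0 <= (Num.sqrt 2 : R)%:E)%E by rewrite lee_fin sqrtr_ge0.
apply: le_lt_trans (lee_wpmul2l s0 h) _.
have s1 : 0 < Num.sqrt 2 :> R by rewrite sqrtr_gt0.
rewrite -EFinM lte_fin mulrC ltr_pM2r//.
(* The lattice has distortion at most [pi], and [pi < 4] is more than is asked. *)
by have := @pihalf_lt2 R; lra.
Qed.

End Lattices.

(** * Rotations of order 3, 4 and 6 *)

Section RotationLattices.
Variable R : realType.
Implicit Types (G : subgroupE2 R) (g h : affine R) (p t u v w tau : plane R).

Lemma elems_trans_same_lin G g h p : elems G g -> elems G h -> g.1 = h.1 ->
  elems G (trans (act g p - act h p)).
Proof.
move=> Gg Gh E; have := elems_same_lin Gg Gh E; congr (elems G (trans _)).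
have H (f : affine R) : act f p = f.1 *m p + act f 0 by rewrite /act mulmx0 add0r.
rewrite (H g) (H h) E; move: (act g 0) (act h 0) (h.1 *m p) => a b c.
by apply: planeP; rewrite !planeE; ring.
Qed.

Lemma rotmx_conj (B : 'M[R]_2) th : B^T *m B = 1%:M -> \det B = -1 -> B *m rotmx th = rotmx (- th) *m B.
Proof.
move=> BO Bd; have [h1 h2 _] := @orth_detN1 R (B, 0) BO Bd; rewrite /= in h1 h2.
by apply: mx2P; rewrite !mulmx2E !mx2E cosN sinN ?h1 ?h2; ring.
Qed.

(** Cayley-Hamilton for a matrix of trace [2 cos th] and determinant 1; for crystallographic angles
    the trace is an integer. *)
Lemma rotmx_char th : rotmx th *m rotmx th = (2 * cos th) *: rotmx th - 1%:M :> 'M[R]_2.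
Proof.
have := cos2Dsin2 th => E.
by apply: mx2P; rewrite !mulmx2E !mxE /= ?mulr1n ?mulr0n; nra.
Qed.

Lemma cross_rotmx th tau : cross tau (rotmx th *m tau) = sin th * enorm tau ^+ 2.
Proof. by rewrite enorm_sqr /cross /dotp !mulmx2E !mx2E; ring. Qed.

Lemma basis_exists (u v x : plane R) : cross u v != 0 -> exists a b, x = a *: u + b *: v.
Proof.
move=> D; exists (cross x v / cross u v), (cross u x / cross u v).
by apply: planeP; rewrite !planeE; move: D; rewrite /cross => D; field.
Qed.

Lemma basis_uniq (u v : plane R) (a b a' b' : R) : cross u v != 0 ->
  a *: u + b *: v = a' *: u + b' *: v -> a = a' /\ b = b'.
Proof.
move=> D E.
have E1 := congr1 (fun z => cross z v) E; have E2 := congr1 (cross u) E.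
have h1 (q r : R) : cross (q *: u + r *: v) v = q * cross u v by rewrite /cross !planeE; ring.
have h2 (q r : R) : cross u (q *: u + r *: v) = r * cross u v by rewrite /cross !planeE; ring.
by rewrite !h1 in E1; rewrite !h2 in E2; split; apply: (mulIf D).
Qed.

Lemma rotation_lattice G p th : locally_finite G -> spans G -> elems G (rotp p th) ->
  `|cos th| <= 2^-1 -> sin th != 0 ->
  exists2 tau, tau != 0 & forall t, elems G (trans t) <->
    exists k l : int, t = k%:~R *: tau + l%:~R *: (rotmx th *m tau).
Proof.
move=> GF sp Gr hc hs; have [tau [Gtau tau0 Hmin]] := shortest_translation GF sp.
have a0 : 0 < enorm tau by rewrite enorm_gt0.
have D : cross tau (rotmx th *m tau) != 0.
  by rewrite cross_rotmx mulf_neq0// expf_neq0// gt_eqF.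
have GRtau : elems G (trans (rotmx th *m tau)) by exact: (trans_conj Gr Gtau).
exists tau => // t; split; last first.
  by move=> [k [l ->]]; apply: elems_transD; exact: elems_transMz.
move=> Gt; have [x [y xy]] := basis_exists t D.
have [k hk] := nearest_int x; have [l hl] := nearest_int y.
exists k, l; apply/eqP; rewrite -subr_eq0; apply: contraT => ne.
have := Hmin _ (elems_transB Gt (elems_transD (elems_transMz k Gtau) (elems_transMz l GRtau))) ne.
rewrite -ler_sqr ?nnegrE ?enorm_ge0//.
have -> : t - (k%:~R *: tau + l%:~R *: (rotmx th *m tau)) = (x - k%:~R) *: tau + (y - l%:~R) *: (rotmx th *m tau).
  by rewrite xy; apply: planeP; rewrite !planeE; ring.
move: (x - _) (y - _) hk hl => X Y hX hY.
have -> : enorm (X *: tau + Y *: (rotmx th *m tau)) ^+ 2 = (X ^+ 2 + Y ^+ 2 + 2 * (X * Y) * cos th) * enorm tau ^+ 2.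
  have E := cos2Dsin2 th.
  transitivity ((X ^+ 2 + Y ^+ 2 * (cos th ^+ 2 + sin th ^+ 2) + 2 * (X * Y) * cos th) * enorm tau ^+ 2); last by rewrite E mulr1.
  by rewrite !enorm_sqr /dotp !planeE !mulmx2E !mx2E; ring.
have sq (Z : R) : `|Z| <= 2^-1 -> Z ^+ 2 <= 4^-1.
  move=> h; have -> : 4^-1 = 2^-1 ^+ 2 :> R by field.
  by rewrite -[leLHS]real_normK ?num_real// ler_sqr ?nnegrE ?normr_ge0//; lra.
have XY : 2 * (X * Y) * cos th <= 4^-1.
  apply: le_trans (ler_norm _) _; rewrite !normrM (ger0_norm (ler0n _ _)).
  have h1 : `|X| * `|Y| <= 4^-1.
    have -> : 4^-1 = 2^-1 * 2^-1 :> R by field.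
    exact: ler_pM.
  have -> : 4^-1 = 2 * 4^-1 * 2^-1 :> R by field.
  by apply: ler_pM => //; rewrite ler_pM2l.
have := sq _ hX; have := sq _ hY; have := exprn_gt0 2 a0.
move: (enorm tau ^+ 2) XY => e; move: (_ * cos th) => z; move: (X ^+ 2) (Y ^+ 2) => x2 y2 *.
by exfalso; nra.
Qed.

(* The rotation [rotmx th] in the basis [tau], [rotmx th *m tau], with [c = 2 cos th]. *)
Definition turn (c : R) (z : R * R) : R * R := (- z.2, z.1 + c * z.2).

Section Extension.
Variables (G : subgroupE2 R) (p tau : plane R) (th : R) (c : int) (n : nat) (eps : bool).
Hypothesis GF : locally_finite G.
Hypothesis sp : spans G.
Hypothesis cE : 2 * cos th = c%:~R.
Hypothesis s0 : sin th != 0.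
Hypothesis tau0 : tau != 0.
Hypothesis Gr : elems G (rotp p th).
Hypothesis lin : forall g, elems G g -> exists2 j, (j < n)%N & g.1 = rotmx (th * j%:R).
Hypothesis lat : forall t, elems G (trans t) <->
  exists k l : int, t = k%:~R *: tau + l%:~R *: (rotmx th *m tau).
Hypothesis arith : forall (x y : R) (k l : int) j, (0 < j < n)%N ->
  iter j (turn c%:~R) (x, y) = (x + k%:~R, y + l%:~R) ->
  exists i (k' l' : int), (sg R eps * (x + c%:~R * y), - sg R eps * y) =
    ((iter i (turn c%:~R) (x, y)).1 + k'%:~R, (iter i (turn c%:~R) (x, y)).2 + l'%:~R).

Let co (z : R * R) : plane R := p + (z.1 *: tau + z.2 *: (rotmx th *m tau)).

Let D : cross tau (rotmx th *m tau) != 0.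
Proof. by rewrite cross_rotmx mulf_neq0// expf_neq0// gt_eqF// enorm_gt0. Qed.

Lemma co_ex q : exists z, q = co z.
Proof.
have [a [b E]] := basis_exists (q - p) D; exists (a, b).
by rewrite /co /= -E addrC subrK.
Qed.

Lemma co_inj z z' : co z = co z' -> z = z'.
Proof.
by move=> /addrI /(basis_uniq D)[]; case: z z' => [a b] [a' b'] /= -> ->.
Qed.

Lemma co_turn z : act (rotp p th) (co z) = co (turn c%:~R z).
Proof.
rewrite act_rotp /co [p + _]addrC addrK addrC; congr (_ + _).
rewrite mulmxDr -!scalemxAr mulmxA rotmx_char mulmxBl mul1mx -scalemxAl cE /=.
by apply: planeP; rewrite !planeE; ring.
Qed.

Lemma co_turns j z : act (rotp p (th * j%:R)) (co z) = co (iter j (turn c%:~R) z).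
Proof.
elim: j => [|j IH]; first by rewrite mulr0 rotp0 act1.
by rewrite -natr1 mulrDr mulr1 addrC rotpD actM IH co_turn.
Qed.

Lemma Grj j : elems G (rotp p (th * j%:R)).
Proof.
elim: j => [|j IH]; first by rewrite mulr0 rotp0; exact: elems1.
by rewrite -natr1 mulrDr mulr1 rotpD; exact: elemsM.
Qed.

Lemma co_trans k l z : act (trans (k *: tau + l *: (rotmx th *m tau))) (co z) = co (z.1 + k, z.2 + l).
Proof. by rewrite act_trans /co /=; apply: planeP; rewrite !planeE; ring. Qed.

(** An element differs from a power of the rotation about [p] by a lattice translation; in lattice
    coordinates it becomes an iterate of [turn] plus an integral shift. *)
Lemma elem_decomp g : elems G g -> exists j (k l : int), [/\ (j < n)%N, g.1 = rotmx (th * j%:R) &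
  forall z, act g (co z) = co ((iter j (turn c%:~R) z).1 + k%:~R, (iter j (turn c%:~R) z).2 + l%:~R)].
Proof.
move=> Gg; have [j jn gE] := lin Gg; exists j.
have rE : (rotp p (th * j%:R)).1 = g.1 by rewrite gE.
have /lat[k [l kl]] := elems_trans_same_lin p Gg (Grj j) (esym rE).
exists k, l; split=> // z; rewrite -co_trans -co_turns -kl act_trans.
rewrite -[LHS](subrK (act g p)) actB -rE -actB.
move: (act (rotp p _) (co z)) (act g p) (act (rotp p _) p) => a b d.
by rewrite addrA addrAC.
Qed.

(* [G] has index two in the group generated by [G] and the reflection through [p] that
   maps [tau] to [+-tau]; by [arith] its rotation centres are on mirrors. *)
Lemma embeds_rotation_lattice : embeds G 2.
Proof.
have a0 : enorm tau != 0 by rewrite gt_eqF// enorm_gt0.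
(* The unit normal of the new mirror is parallel to [tau] if [tau] is to be negated, perpendicular
   to it if [tau] is to be fixed. *)
have [m [um mt]] : exists m, dotp m m = 1 /\ tau - (2 * dotp m tau) *: m = sg R eps *: tau.
  case: eps; rewrite /sg.
    exists ((enorm tau)^-1 *: tau); rewrite !dotpZl dotpZr -enorm_sqr; split; first by field.
    by rewrite scalerA; apply: planeP; rewrite !planeE; field.
  exists ((enorm tau)^-1 *: pt (- tau 1 0) (tau 0 0)); rewrite !dotpZl dotpZr; split.
    have -> : dotp (pt (- tau 1 0) (tau 0 0)) (pt (- tau 1 0) (tau 0 0)) = enorm tau ^+ 2.
      by rewrite enorm_sqr /dotp !ptE; ring.
    by field.
  have -> : dotp (pt (- tau 1 0) (tau 0 0)) tau = 0 by rewrite /dotp !ptE; ring.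
  by rewrite !mulr0 scale0r subr0 scale1r.
pose sig := refl m (dotp m p).
have sO : orth sig by exact: refl_orth.
have sd : \det sig.1 = -1 by exact: det_refl.
have sp0 : act sig p = p by rewrite act_refl /sdist subrr mulr0 scale0r subr0.
have slin x : act sig (p + x) = p + sig.1 *m x.
  by rewrite -{2}sp0 -[LHS](subrK (act sig p)) actB [p + x]addrC addrK addrC.
have st : sig.1 *m tau = sg R eps *: tau.
  have := slin tau; rewrite act_refl /sdist dotpDr [_ + dotp m tau]addrC addrK -addrA mt.
  by move/addrI.
have sRt : sig.1 *m (rotmx th *m tau) = (sg R eps * c%:~R) *: tau - sg R eps *: (rotmx th *m tau).
  rewrite mulmxA rotmx_conj// -mulmxA st -scalemxAr -scalerA -scalerBr; congr (_ *: _).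
  by rewrite -cE; apply: planeP; rewrite !planeE !mulmx2E !mx2E cosN sinN; ring.
have sco z : act sig (co z) = co (sg R eps * (z.1 + c%:~R * z.2), - sg R eps * z.2).
  rewrite slin mulmxDr -!scalemxAr st sRt /co /=; congr (p + _).
  by apply: planeP; rewrite !planeE; ring.
have ss : affM sig sig = aff1 R.
  by apply: aff_eq => x; rewrite actM act1 reflK.
have det1 g : elems G g -> \det g.1 = 1.
  by move=> /lin[j _ ->]; exact: det_rotmx.
have srot al : affM sig (affM (rotp p al) sig) = rotp p (- al).
  apply: aff_eq => x; rewrite !actM -[x](subrK p) addrC slin !act_rotp.
  rewrite ![p + _]addrC !addrK ![_ + p]addrC slin mulmxA rotmx_conj// -mulmxA.
  rewrite (mulmxA sig.1); have -> : sig.1 *m sig.1 = 1%:M by have := congr1 fst ss.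
  by rewrite mul1mx.
have sgi (z : int) : exists z' : int, sg R eps * z%:~R = z'%:~R.
  by case: (eps); rewrite /sg; [exists (- z); rewrite mulN1r mulrNz|exists z; rewrite mul1r].
have strans t : elems G (trans t) -> elems G (affM sig (affM (trans t) sig)).
  move=> /lat[k [l tE]].
  have -> : affM sig (affM (trans t) sig) = trans (sig.1 *m t).
    apply: aff_eq => x; rewrite !actM !act_trans -[RHS](subrK (act sig (act sig x))).
    rewrite -[in X in _ - X + _](actM sig sig) ss act1 [x + _]addrC addrK.
    rewrite -[LHS](subrK (act sig (act sig x))) actB.
    by rewrite [act sig x + t]addrC addrK.
  have [k' kE] := sgi k; have [l' lE] := sgi l.
  apply/lat; exists (k' + c * l')%R, (- l'); rewrite intrD intrM mulrNz -kE -lE tE.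
  rewrite mulmxDr -!scalemxAr st sRt; apply: planeP; rewrite !planeE; ring.
(* Writing [g] as a translation times a rotation about [p], conjugation by [sig] maps the lattice to
   itself and inverts the rotation. *)
have sG g : elems G g -> elems G (affM sig (affM g sig)).
  move=> Gg; have [j [k [l [jn gE H]]]] := elem_decomp Gg.
  have Gt : elems G (trans (act g p - act (rotp p (th * j%:R)) p)).
    by apply: elems_trans_same_lin => //; exact: Grj.
  have -> : affM sig (affM g sig) = affM (affM sig (affM (trans (act g p - act (rotp p (th * j%:R)) p)) sig))
      (affM sig (affM (rotp p (th * j%:R)) sig)).
    apply: aff_eq => x; rewrite !actM -(actM sig sig) ss act1 act_trans; congr (act sig _).
    move: (act sig x) => y; rewrite -[LHS](subrK (act g p)) actB.
    have -> : g.1 *m (y - p) = act (rotp p (th * j%:R)) y - act (rotp p (th * j%:R)) p.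
      by rewrite actB gE.
    move: (act (rotp p _) y) (act g p) (act (rotp p _) p) => u v w.
    by rewrite addrA addrAC.
  apply: elemsM; first exact: strans.
  by rewrite srot rotpN; apply: elemsV; exact: Grj.
have WF := extension_locally_finite sO ss sG GF.
set W := extension sO ss sG in WF.
have GW : elems G `<=` elems W by exact: extension_sub.
have sW : elems W sig by exact: extension_gen.
have rs : \det (affM (rotp p th) sig).1 = -1 by rewrite det_affM sd det_rotmx mul1r.
have rsp : act (affM (rotp p th) sig) p = p by rewrite actM sp0 rotp_fix.
have [n2 [c2' [u2 rE np2]]] := reflP (affM_orth (rotp_orth p th) sO) rs rsp.
apply: (@embeds_of_index2_reflection R W G m (dotp m p) n2 c2' m (dotp m p)) => //.
- exact: sub_spans sp.
- by split=> //; rewrite -rE; apply: elemsM => //; exact: GW.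
- apply: (cross_reflections (p := p)) => //; rewrite np2 -rE -/sig => E.
  have : act (affM (rotp p th) sig) (co (1, 0)) = act sig (co (1, 0)) by rewrite -E.
  rewrite actM sco co_turn => /co_inj; rewrite /turn /= !mulr0 !addr0 mulr1 oppr0 => -[+ _].
  by case: (eps); rewrite /sg; lra.
- move=> g z Wg gd gz g1.
  have Gg : elems G g.
    case: Wg => // /det1; rewrite det_affM gd sd; lra.
  have [[x y] zE] := co_ex z; have [j [k [l [jn gE H]]]] := elem_decomp Gg.
  have j0 : (0 < j)%N.
    rewrite lt0n; apply/eqP => j0; apply: g1; apply: aff_eq => q.
    have [w ->] := co_ex q; rewrite act1 H j0 /=.
    move: gz; rewrite zE H j0 /= => /co_inj[/(canRL (addKr _)) k0 /(canRL (addKr _)) l0].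
    by rewrite k0 l0 !addNr !addr0; case: (w).
  have E : iter j (turn c%:~R) (x, y) = (x + (- k)%:~R, y + (- l)%:~R).
    move: gz; rewrite zE H => /co_inj[ex ey].
    have -> : x + (- k)%:~R = (iter j (turn c%:~R) (x, y)).1 by rewrite mulrNz -{1}ex addrK.
    have -> : y + (- l)%:~R = (iter j (turn c%:~R) (x, y)).2 by rewrite mulrNz -{1}ey addrK.
    by case: (iter _ _ _).
  have [|i [k' [l' ar]]] := arith _ E; first by rewrite j0.
  (* By [arith] some [h] in [G] sends the centre [z] to [sig z]; then [h^-1 sig] is a reflection
     fixing [z]. *)
  pose h := affM (trans (k'%:~R *: tau + l'%:~R *: (rotmx th *m tau))) (rotp p (th * i%:R)).
  have Gh : elems G h by apply: elemsM; [apply/lat; exists k', l'|exact: Grj].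
  exists (affM (affV h) sig); split.
  + by apply: elemsM => //; apply: GW; exact: elemsV.
  + by rewrite det_affM det_affV sd det1// mul1r.
  have hz : act h (co (x, y)) = act sig (co (x, y)) by rewrite sco /= ar /h actM co_turns co_trans.
  by rewrite actM zE -hz actV//; exact: elems_orth Gh.
- exact: extension_index2.
by move=> /det1; rewrite sd; lra.
Qed.
End Extension.
End RotationLattices.

(** * Pairing of centres and exclusion of reversing elements *)

Section RotationTypes.
Variable R : realType.
Implicit Types (G : subgroupE2 R) (g h : affine R) (p t u v w tau : plane R).

(* The left-hand side is the image of the rotation centre (x, y) under the added
   reflection. *)
Definition centres_paired (c : int) (n : nat) (eps : bool) : Prop :=
  forall (x y : R) (k l : int) j, (0 < j < n)%N ->
  iter j (turn c%:~R) (x, y) = (x + k%:~R, y + l%:~R) ->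
  exists i (k' l' : int), (sg R eps * (x + c%:~R * y), - sg R eps * y) =
    ((iter i (turn c%:~R) (x, y)).1 + k'%:~R, (iter i (turn c%:~R) (x, y)).2 + l'%:~R).

(** The reflection must negate [tau], which leads to p3m1. The one that fixes [tau] would lead to
    p31m, which has rotation centres off the mirrors. *)
Lemma centres_paired3 : centres_paired (-1) 3 true.
Proof.
move=> x y k l [|[|[|j]]] // _; rewrite /turn /= mulrN1z => -[ex ey]; rewrite /sg.
  by exists 0%N, (k - l), 0; rewrite /= intrB mulr0z; congr (_, _); lra.
by exists 0%N, k, 0; rewrite /= mulr0z; congr (_, _); lra.
Qed.

Lemma centres_paired4 : centres_paired 0 4 false.
Proof.
move=> x y k l [|[|[|[|j]]]] // _; rewrite /turn /= mulr0z => -[ex ey]; rewrite /sg.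
- by exists 0%N, 0, (k + l); rewrite /= intrD mulr0z; congr (_, _); lra.
- by exists 0%N, 0, l; rewrite /= mulr0z; congr (_, _); lra.
by exists 0%N, 0, (l - k); rewrite /= intrB mulr0z; congr (_, _); lra.
Qed.

Lemma centres_paired6 : centres_paired 1 6 false.
Proof.
have c1 : 1%:~R = 1 :> R by [].
move=> x y k l [|[|[|[|[|[|j]]]]]] // _; rewrite /turn /= c1 => -[ex ey]; rewrite /sg.
- exists 0%N, (- l - k), (2 * l + 2 * k).
  by rewrite /= intrB intrD !intrM mulrNz; congr (_, _); lra.
- exists 1%N, (- k - l), (k + l).
  by rewrite /= intrB intrD mulrNz; congr (_, _); lra.
(* Centres of half-turns are halves of lattice vectors; the parities of the coordinates decide which
   rotation brings the centre back to its reflection. *)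
- have [[i lE]|[i lE]] := int_parity l.
    exists 0%N, (- i), l; rewrite lE intrM in ey *.
    by rewrite /= mulrNz; congr (_, _); lra.
  have [[i' kE]|[i' kE]] := int_parity k.
    exists 1%N, (- i' - l), (i' + l); rewrite kE intrM in ex.
    by rewrite /= intrB intrD mulrNz; congr (_, _); lra.
  exists 2%N, (- k - l), (i + i' + 1); move: ex ey; rewrite lE kE => ex ey.
  rewrite !(intrD, intrM) in ex ey; rewrite /= !(intrB, mulrNz, intrD, intrM).
  by congr (_, _); lra.
- exists 1%N, (- l), l.
  by rewrite /= mulrNz; congr (_, _); lra.
exists 0%N, k, (- 2 * k).
by rewrite /= intrM mulrNz; congr (_, _); lra.
Qed.

(** As [B R = R^-1 B], the products [R gam] and [gam R^-1] have equal linear parts, and so have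
    [gam gam] and the identity; each pair differs by a translation, read off at [p]. *)
Lemma glide_vectors G p th gam : elems G (rotp p th) -> elems G gam -> \det gam.1 = -1 ->
  elems G (trans (rotmx th *m (act gam p - p) - (act gam p - p))) /\
  elems G (trans (gam.1 *m (act gam p - p) + (act gam p - p))).
Proof.
move=> Gr Ggam dg; have gO := elems_orth Ggam.
have BR := rotmx_conj th gO dg.
set v := act gam p - p; have gp : act gam p = p + v by rewrite /v addrC subrK.
have rV : act (affV (rotp p th)) p = p by rewrite -{2}(rotp_fix p th) actV//; exact: rotp_orth.
have gx x : act gam (p + x) = p + v + gam.1 *m x.
  by rewrite -gp /act mulmxDr addrAC.
split.
  have E : (affM (rotp p th) gam).1 = (affM gam (affV (rotp p th))).1.
    by rewrite /= rotmxN rotmx_conj// opprK.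
  have := elems_trans_same_lin p (elemsM Gr Ggam) (elemsM Ggam (elemsV Gr)) E.
  congr (elems G (trans _)); rewrite !actM rV gp act_rotp [p + v]addrC addrK [v + p]addrC.
  by move: (rotmx th *m v) => w; apply: planeP; rewrite !planeE; ring.
have E : (affM gam gam).1 = (aff1 R).1.
  have [h1 h2 h3] := orth_detN1 gO dg.
  by apply: mx2P; rewrite /= !mulmx2E !mxE /= ?h1 ?h2; move: h3; lra.
have := elems_trans_same_lin p (elemsM Ggam Ggam) (elems1 G) E.
congr (elems G (trans _)); rewrite actM act1 gp gx.
by move: (gam.1 *m v) => w; apply: planeP; rewrite !planeE; ring.
Qed.

Lemma reversing_mirror G gam t q : elems G gam -> \det gam.1 = -1 -> elems G (trans t) ->
  act gam q + t = q -> on_mirror G q.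
Proof.
move=> Ggam dg Gt E; exists (affM (trans t) gam); split.
- exact: elemsM.
- by rewrite det_affM det1 mul1r.
- by rewrite actM act_trans.
Qed.

(* If [v] is the displacement of [p] under [gam] and [B] is the linear part of [gam],
   then [(R - 1) v] and [(B + 1) v] are translations, where [R] is the rotation; hence
   some element with linear part in [R^j B] fixes a point. *)
Lemma no_reversing3 G p th gam : 2 * cos th = (-1)%:~R -> elems G (rotp p th) ->
  (forall q, ~ on_mirror G q) -> elems G gam -> \det gam.1 <> -1.
Proof.
move=> cE Gr nm Ggam dg; have [F1 F2] := glide_vectors Gr Ggam dg.
set v := act gam p - p in F1 F2; have gp : act gam p = p + v by rewrite /v addrC subrK.
(* For order 3, [R^2 = - R - 1], so [- (R + 2) (R - 1) = 3]. *)
have F3 : elems G (trans (3 *: v)).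
  have := elems_transN (elems_transD (trans_conj Gr F1) (elems_transD F1 F1)).
  congr (elems G (trans _)); rewrite mulmxBr mulmxA rotmx_char cE mulmxBl mul1mx -scalemxAl mulrN1z.
  by move: (rotmx th *m v) => w; apply: planeP; rewrite !planeE; ring.
apply: (nm (p - v)); apply: (reversing_mirror Ggam dg (elems_transB F2 F3)).
have -> : act gam (p - v) = act gam p - gam.1 *m v by rewrite /act mulmxBr addrAC.
rewrite gp; move: (gam.1 *m v) => w; apply: planeP; rewrite !planeE; ring.
Qed.

(** Here [R^2 = R - 1], so [R (R - 1) v = - v] is itself a translation vector; it brings [gam p]
    back to [p], which would lie on a mirror. *)
Lemma no_reversing6 G p th gam : 2 * cos th = 1%:~R -> elems G (rotp p th) ->
  (forall q, ~ on_mirror G q) -> elems G gam -> \det gam.1 <> -1.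
Proof.
move=> cE Gr nm Ggam dg; have [F1 _] := glide_vectors Gr Ggam dg.
set v := act gam p - p in F1; have gp : act gam p = p + v by rewrite /v addrC subrK.
apply: (nm p); apply: (reversing_mirror Ggam dg (trans_conj Gr F1)).
rewrite gp /= mulmxBr mulmxA rotmx_char cE mulmxBl mul1mx -scalemxAl mulr1z scale1r.
by move: (rotmx th *m v) => w; apply: planeP; rewrite !planeE; ring.
Qed.

Lemma sum_two_squares1 (k l : int) : k ^+ 2 + l ^+ 2 = 1 ->
  [\/ k = 1 /\ l = 0, k = -1 /\ l = 0, k = 0 /\ l = 1 | k = 0 /\ l = -1].
Proof.
move=> E; have hk : (-1 <= k)%R && (k <= 1)%R by nia.
have hl : (-1 <= l)%R && (l <= 1)%R by nia.
have [k0|[k0|k0]] : k = -1 \/ (k = 0 \/ k = 1) by lia.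
- by constructor 2; split=> //; rewrite k0 in E; nia.
- have [l0|l0] : l = 1 \/ l = -1 by rewrite k0 in E; nia.
    by constructor 3.
  by constructor 4.
by constructor 1; split=> //; rewrite k0 in E; nia.
Qed.

(** From [(R - 1) v] in the lattice, [v] is a lattice vector or congruent to [u], half of
    [tau + R tau]. In the first case [p] lies on a mirror. In the second, a rotated copy of [gam]
    negates [u] and moves [p] by [u] up to a translation, so it can be made to fix [p + u / 2]. *)
Lemma no_reversing4 G p th tau gam : 2 * cos th = 0%:~R -> tau != 0 -> elems G (rotp p th) ->
  (forall t, elems G (trans t) <-> exists k l : int, t = k%:~R *: tau + l%:~R *: (rotmx th *m tau)) ->
  (forall q, ~ on_mirror G q) -> elems G gam -> \det gam.1 <> -1.
Proof.
move=> cE tau0 Gr lat nm Ggam dg; have [F1 F2] := glide_vectors Gr Ggam dg.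
have c0 : cos th = 0 by move: cE; rewrite mulr0z; lra.
have RR (x : plane R) : rotmx th *m (rotmx th *m x) = - x.
  by rewrite mulmxA rotmx_char c0 mulr0 scale0r sub0r mulNmx mul1mx.
have sn : sin th ^+ 2 = 1 by have := cos2Dsin2 th; rewrite c0 expr0n add0r.
have a0 : enorm tau ^+ 2 != 0 by rewrite expf_neq0// gt_eqF// enorm_gt0.
have D : cross tau (rotmx th *m tau) != 0.
  by rewrite cross_rotmx mulf_neq0// -sqrf_eq0 sn oner_eq0.
set v := act gam p - p in F1 F2; have gp : act gam p = p + v by rewrite /v addrC subrK.
have gO := elems_orth Ggam; have BR := rotmx_conj th gO dg.
have RN : rotmx (- th) = - rotmx th :> 'M[R]_2.
  by apply: mx2P; rewrite [RHS]mxE !mx2E ?cosN ?sinN ?c0 ?oppr0 ?opprK.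
have T0 w : elems G (trans w) -> act gam p + (- w) = p -> False.
  by move=> Gw E; apply: (nm p); exact: (reversing_mirror Ggam dg (elems_transN Gw) E).
have [k1 [l1 E1]] := (lat _).1 F1.
have vE : 2 *: v = (- k1 + l1)%:~R *: tau + (- k1 - l1)%:~R *: (rotmx th *m tau).
  have E2 : rotmx th *m (rotmx th *m v - v) = - v - rotmx th *m v by rewrite mulmxBr RR.
  rewrite E1 mulmxDr -!scalemxAr RR in E2.
  have -> : 2 *: v = - (rotmx th *m v - v) - (- v - rotmx th *m v).
    by move: (rotmx th *m v) => w; apply: planeP; rewrite !planeE; ring.
  rewrite E1 -E2 intrD intrB mulrNz; move: (rotmx th *m tau) => w.
  by apply: planeP; rewrite !planeE; ring.
pose u : plane R := 2^-1 *: (tau + rotmx th *m tau).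
(* An even coefficient would make [v] a lattice vector; the other coefficient has the same
   parity. *)
have [j jE] : exists j : int, - k1 + l1 = 2 * j + 1.
  have [[j jE]|//] := int_parity (- k1 + l1).
  case: (T0 v); last by rewrite gp addrK.
  apply/lat; exists j, (j - l1); apply: (scalerI (a := 2 : R)); rewrite ?pnatr_eq0// vE.
  have -> : (- k1 - l1 = 2 * (j - l1))%R by lia.
  by rewrite jE !intrM; apply: planeP; rewrite !planeE; ring.
have uv : elems G (trans (u - v)).
  apply/lat; exists (- j), (- j + l1); apply: (scalerI (a := 2 : R)); rewrite ?pnatr_eq0//.
  rewrite scalerBr vE /u scalerA divff ?pnatr_eq0// scale1r.
  have -> : (- k1 - l1 = 2 * (j - l1) + 1)%R by lia.
  rewrite jE !(intrD, intrM, mulrNz, intrB); move: (rotmx th *m tau) => w.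
  by apply: planeP; rewrite !planeE; ring.
have Gtau : elems G (trans tau) by apply/lat; exists 1, 0; rewrite mulr0z scale0r addr0 scale1r.
have [k [l kl]] := (lat _).1 (trans_conj Ggam Gtau).
have k2l2 : k ^+ 2 + l ^+ 2 = 1.
  have : enorm (gam.1 *m tau) ^+ 2 = enorm tau ^+ 2 by rewrite enorm_orth.
  have -> : enorm (gam.1 *m tau) ^+ 2 = (k%:~R ^+ 2 + l%:~R ^+ 2) * enorm tau ^+ 2.
    transitivity ((k%:~R ^+ 2 + l%:~R ^+ 2 * sin th ^+ 2) * enorm tau ^+ 2); last by rewrite sn mulr1.
    by rewrite kl !enorm_sqr /dotp !planeE !mulmx2E !mx2E c0; ring.
  rewrite -[RHS]mul1r => /(mulIf a0); rewrite -!rmorphXn /= -intrD => H.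
  exact: (@intr_inj R).
have Bu : gam.1 *m u = 2^-1 *: ((k + l)%:~R *: tau + (l - k)%:~R *: (rotmx th *m tau)).
  rewrite -scalemxAr; congr (_ *: _); rewrite mulmxDr mulmxA BR RN !mulNmx -mulmxA kl mulmxDr -!scalemxAr RR.
  rewrite intrD intrB; move: (rotmx th *m tau) => w.
  by apply: planeP; rewrite !planeE; ring.
(* [S] is a power of the rotation times [gam.1]: it is chosen so that [S u = - u]. *)
have key h (S : 'M[R]_2) : elems G h -> h.1 = S -> \det S = -1 -> S *m u = - u -> elems G (trans (act h p - p - u)) -> False.
  move=> Gh hS dS Su Gt; apply: (nm (p + 2^-1 *: u)).
  apply: (reversing_mirror Gh _ (elems_transN Gt)); first by rewrite hS.
  have -> : act h (p + 2^-1 *: u) = act h p - 2^-1 *: u.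
    by rewrite /act mulmxDr -scalemxAr hS Su scalerN addrAC.
  by move: (act h p) => w; apply: planeP; rewrite !planeE; field.
have [tu1 tu2] : elems G (trans (rotmx th *m u - u)) /\ elems G (trans (- u - u)).
  split; apply/lat; rewrite /u.
    exists (-1), 0; rewrite -scalemxAr mulmxDr RR mulr0z scale0r addr0 mulrN1z.
    by move: (rotmx th *m tau) => w; apply: planeP; rewrite !planeE; field.
  exists (-1), (-1); rewrite !mulrN1z.
  by move: (rotmx th *m tau) => w; apply: planeP; rewrite !planeE; field.
have rp x : act (rotp p th) (p + x) = p + rotmx th *m x.
  by rewrite act_rotp [p + x]addrC addrK addrC.
have vu : elems G (trans (v - u)).
  by have := elems_transN uv; rewrite opprB.
have GG := elemsM Gr Ggam; have GGG := elemsM Gr GG.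
have [[k1' l1']|[k1' l1']|[k1' l1']|[k1' l1']] := sum_two_squares1 k2l2; rewrite k1' l1' in Bu.
- apply: (key _ _ (elemsM Gr GGG) erefl); rewrite ?det_affM ?det_rotmx ?dg ?mul1r//.
    rewrite /= -!mulmxA Bu /u -!scalemxAr -scalerN; congr (_ *: _).
    rewrite RR mulmxDr -!scalemxAr RR; move: (rotmx th *m tau) => w.
    by apply: planeP; rewrite !planeE; ring.
  rewrite !actM gp !rp; have := elems_transD (trans_conj Gr (trans_conj Gr (trans_conj Gr vu))) (trans_conj Gr tu1).
  congr (elems G (trans _)); rewrite /= !mulmxBr !RR; move: (rotmx th *m v) (rotmx th *m u) => w w'.
  by apply: planeP; rewrite !planeE; ring.
- apply: (key _ _ GG erefl); rewrite ?det_affM ?det_rotmx ?dg ?mul1r//.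
    rewrite /= -!mulmxA Bu /u -!scalemxAr -scalerN; congr (_ *: _).
    by rewrite mulmxDr -!scalemxAr RR; apply: planeP; rewrite !planeE; ring.
  rewrite !actM gp !rp; have := elems_transD (trans_conj Gr vu) tu1.
  congr (elems G (trans _)); rewrite /= !mulmxBr; move: (rotmx th *m v) (rotmx th *m u) => w w'.
  by apply: planeP; rewrite !planeE; ring.
- apply: (key _ _ GGG erefl); rewrite ?det_affM ?det_rotmx ?dg ?mul1r//.
    rewrite /= -!mulmxA Bu /u -!scalemxAr RR -scalerN; congr (_ *: _).
    by apply: planeP; rewrite !planeE; ring.
  rewrite !actM gp !rp; have := elems_transD (trans_conj Gr (trans_conj Gr vu)) tu2.
  congr (elems G (trans _)); rewrite /= !mulmxBr !RR.
  by apply: planeP; rewrite !planeE; ring.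
apply: (key _ _ Ggam erefl dg).
  by rewrite Bu /u -scalerN; congr (_ *: _); apply: planeP; rewrite !planeE; ring.
by move: vu; congr (elems G (trans _)); rewrite gp [p + v]addrC addrK.
Qed.

End RotationTypes.

Section CyclicTypes.
Variable R : realType.
Implicit Types (G : subgroupE2 R) (g h : affine R) (p q t u v w tau : plane R).

(** Without mirrors every rotation centre is a cone point, whose order divides [n], so its angles
    are multiples of [2 pi / n]. *)
Lemma rotation_angles G n g : (0 < n)%N -> locally_finite G -> (forall m p, cone_point G m p -> (m %| n)%N) ->
  (forall p, ~ on_mirror G p) -> elems G g -> \det g.1 = 1 ->
  exists2 j, (j < n)%N & g.1 = rotmx (2 * pi / n%:R * j%:R).
Proof.
move=> n0 GF hc nm Gg gd; have [->|/eqP g1] := eqVneq g.1 1%:M.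
  by exists 0%N; rewrite ?mulr0 ?rotmx0.
have [p gp] := rotation_fixpoint (elems_orth Gg) gd g1.
have ng : g <> aff1 R by move=> E; apply: g1; rewrite E.
have [m [m2 cm H]] := rotation_center GF Gg gd gp ng.
have cp : cone_point G m p by split=> //; exact: nm.
have [_ _ /(_ g)[|k km gE]] := rotations_card cm; first by split.
have /dvdnP[d dE] := hc _ _ cp.
have m0 : m%:R != 0 :> R by rewrite pnatr_eq0; case: m m2 {cm cp H km gE dE}.
have d0 : (0 < d)%N by move: n0; rewrite dE muln_gt0 => /andP[].
exists (d * k)%N; first by rewrite dE ltn_pmul2l.
rewrite gE /rotp /= dE !natrM; congr rotmx.
by move: pi => q; field; rewrite m0 pnatr_eq0 -lt0n d0.
Qed.

(** The common part of 333, 442 and 632; [norev] is the order-specific exclusion of reversing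
    elements and [pair] the order-specific pairing of centres. *)
Lemma embeds_cyclic G n c eps cs x : is_wallpaper G -> has_type G (Signature cs [::] x) ->
  (2 < n)%N -> n \in cs -> all (fun m => m %| n)%N cs -> 2 * cos (2 * pi / n%:R) = c%:~R :> R ->
  (-1 <= c <= 1)%R -> centres_paired R c n eps ->
  (forall p tau gam, tau != 0 -> elems G (rotp p (2 * pi / n%:R)) ->
    (forall t, elems G (trans t) <-> exists k l : int, t = k%:~R *: tau + l%:~R *: (rotmx (2 * pi / n%:R) *m tau)) ->
    (forall q, ~ on_mirror G q) -> elems G gam -> \det gam.1 <> -1) ->
  embeds G 2.
Proof.
move=> hG ty n2 ncs dvd cE c1 pair norev.
have GF := wallpaper_finite hG; have sp := wallpaper_spans hG.
have nm p : ~ on_mirror G p by case: ty => _ lb _; exact: boundaries_nil_mirror.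
have [p [_ card_n _]] := cone_ex ty ncs.
have [n0 Gr _] := rotations_card card_n.
have p0 : 0 < pi :> R := pi_gt0 R.
have n0R : 0 < n%:R :> R by rewrite ltr0n.
have sn : sin (2 * pi / n%:R) != 0 :> R.
  rewrite gt_eqF// sin_gt0_pi//; apply/andP; split; first by rewrite divr_gt0 ?mulr_gt0.
  by rewrite ltr_pdivrMr// mulrC ltr_pM2l// ltr_nat.
have cabs : `|cos (2 * pi / n%:R)| <= 2^-1 :> R.
  have /andP[h1 h2] := c1; have : c%:~R <= 1%:~R :> R by rewrite ler_int.
  have : (-1)%:~R <= c%:~R :> R by rewrite ler_int.
  by rewrite -cE mulrN1z => h3 h4; rewrite ler_norml; apply/andP; split; lra.
have [tau tau0 lat] := rotation_lattice GF sp Gr cabs sn.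
have det1 g : elems G g -> \det g.1 = 1.
  by move=> Gg; have [//|/(norev p tau g tau0 Gr lat nm Gg)] := orth_det (elems_orth Gg).
apply: (embeds_rotation_lattice GF sp cE sn tau0 Gr (n := n) (eps := eps)) => // g Gg.
apply: (rotation_angles n0 GF _ nm Gg (det1 g Gg)) => m q /(cone_order_mem ty) mcs.
exact: (allP dvd).
Qed.

Lemma embeds_333 G x : is_wallpaper G -> has_type G (Signature [:: 3; 3; 3]%N [::] x) -> embeds G 2.
Proof.
move=> hG ty.
have cE : 2 * cos (2 * pi / 3%:R) = (-1)%:~R :> R.
  by rewrite -mulrA cos_double cos_pi3 mulrN1z; field.
apply: (embeds_cyclic hG ty _ _ _ cE _ (@centres_paired3 R)) => // p tau gam _ Gr _ nm.
exact: (no_reversing3 cE Gr nm).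
Qed.

Lemma embeds_442 G x : is_wallpaper G -> has_type G (Signature [:: 4; 4; 2]%N [::] x) -> embeds G 2.
Proof.
move=> hG ty.
have cE : 2 * cos (2 * pi / 4%:R) = 0%:~R :> R.
  have -> : 2 * pi / 4%:R = pi / 2 :> R by move: pi => q; field.
  by rewrite cos_pihalf mulr0 mulr0z.
apply: (embeds_cyclic hG ty _ _ _ cE _ (@centres_paired4 R)) => // p tau gam tau0 Gr lat nm.
exact: (no_reversing4 cE tau0 Gr lat nm).
Qed.

Lemma embeds_632 G x : is_wallpaper G -> has_type G (Signature [:: 6; 3; 2]%N [::] x) -> embeds G 2.
Proof.
move=> hG ty.
have cE : 2 * cos (2 * pi / 6%:R) = 1%:~R :> R.
  have -> : 2 * pi / 6%:R = pi / 3 :> R by move: pi => q; field.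
  by rewrite cos_pi3 mulr1z divff// pnatr_eq0.
apply: (embeds_cyclic hG ty _ _ _ cE _ (@centres_paired6 R)) => // p tau gam _ Gr _ nm.
exact: (no_reversing6 cE Gr nm).
Qed.

Lemma c2_cone_bounds G n cs bs x : is_wallpaper G -> has_type G (Signature cs bs x) -> n \in cs ->
  embeds G 2 -> ((n%:R * sin (pi / (2 * n%:R)))%:E <= c2 G <= 2%:E)%E.
Proof.
move=> hG ty ncs G2; have GF := wallpaper_finite hG.
by apply: c2_bounds => // k k0 Gk; exact: (cone_lower GF ty ncs k0 Gk).
Qed.

End CyclicTypes.

Unset Implicit Arguments.
Set Strict Implicit.
Set Printing Implicit Defensive.
Local Close Scope quotient_scope.
Local Close Scope card_scope.
Local Close Scope classical_set_scope.

Theorem theorem26 (R : realType) (G : subgroupE2 R) (hG : is_wallpaper G) :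
  (* (a)  *333, *442, *632, *2222 *)
  (has_type G (Signature [::] [:: [:: 3; 3; 3]%N] 0) \/
   has_type G (Signature [::] [:: [:: 4; 4; 2]%N] 0) \/
   has_type G (Signature [::] [:: [:: 6; 3; 2]%N] 0) \/
   has_type G (Signature [::] [:: [:: 2; 2; 2; 2]%N] 0) ->
   c2 G = 1%:E) /\
  (* (b)  ** *)
  (has_type G (Signature [::] [:: [::]; [::]] 0) ->
   c2 G = (pi / 2)%:E) /\
  (* (c)  2*22 *)
  (has_type G (Signature [:: 2%N] [:: [:: 2; 2]%N] 0) ->
   c2 G = (Num.sqrt 2)%:E) /\
  (* (d)  4*2 *)
  (has_type G (Signature [:: 4%N] [:: [:: 2%N]] 0) ->
   c2 G = (2 * Num.sqrt (2 - Num.sqrt 2))%:E) /\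
  (* (e)  xx *)
  (has_type G (Signature [::] [::] 2) ->
   ((pi / 2)%:E <= c2 G <= (pi / Num.sqrt 2)%:E)%E) /\
  (* (f)  22x *)
  (has_type G (Signature [:: 2; 2]%N [::] 1) ->
   ((pi / 2)%:E <= c2 G <= pi%:E)%E) /\
  (* (g)  2222 *)
  (has_type G (Signature [:: 2; 2; 2; 2]%N [::] 0) ->
   ((Num.sqrt 2)%:E <= c2 G)%E /\
   (c2 G <= (Num.sqrt 2)%:E * c2 (translation_lattice G))%E /\
   ((Num.sqrt 2)%:E * c2 (translation_lattice G) < (8 * Num.sqrt 2)%:E)%E) /\
  (* (h)  *x *)
  (has_type G (Signature [::] [:: [::]] 1) ->
   ((pi / 2)%:E <= c2 G <= (pi / Num.sqrt 2)%:E)%E) /\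
  (* (i)  22* *)
  (has_type G (Signature [:: 2; 2]%N [:: [::]] 0) ->
   ((Num.sqrt 2)%:E <= c2 G <= 2%:E)%E) /\
  (* (j)  333, 3*3 *)
  (has_type G (Signature [:: 3; 3; 3]%N [::] 0) \/
   has_type G (Signature [:: 3%N] [:: [:: 3%N]] 0) ->
   ((3 / 2)%:E <= c2 G <= 2%:E)%E) /\
  (* (k)  442 *)
  (has_type G (Signature [:: 4; 4; 2]%N [::] 0) ->
   ((2 * Num.sqrt (2 - Num.sqrt 2))%:E <= c2 G <= 2%:E)%E) /\
  (* (l)  632 *)
  (has_type G (Signature [:: 6; 3; 2]%N [::] 0) ->
   ((3 * Num.sqrt (2 - Num.sqrt 3))%:E <= c2 G <= 2%:E)%E).
Proof.
split; first by move=> [|[|[|]]] ty; apply: (c2_reflection_group hG ty (mem_head _ _)).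
split; first exact: c2_annulus.
split.
  by move=> ty; apply: (c2_one_cone hG ty (mem_head _ _) (@cone_table2 R)); exact: cone_const2.
split.
  by move=> ty; apply: (c2_one_cone hG ty (mem_head _ _) (@cone_table4 R)); exact: cone_const4.
split; first exact: c2_klein.
split; first exact: c2_pgg.
split; first exact: c2_p2.
split; first exact: c2_moebius.
split; first exact: c2_pmg.
split.
  rewrite -cone_const3 => -[] ty; apply: (c2_cone_bounds hG ty (mem_head _ _)).
    exact: embeds_333 ty.
  (* For [3*3] the cone map reaches [3 / 2], weakened here to the bound shared with [333]. *)
  by apply: embeds_mono (embeds_one_cone hG ty (mem_head _ _) (@cone_table3 R)); lra.
split; move=> ty.
  rewrite -cone_const4; apply: (c2_cone_bounds hG ty (mem_head _ _)); exact: embeds_442 ty.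
rewrite -cone_const6; apply: (c2_cone_bounds hG ty (mem_head _ _)); exact: embeds_632 ty.
Qed.
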